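(* Let $f:\overline{\Omega}\times\mathbb{R}^{m\times n}\to\mathbb{R}_{\ge 0}$ be continuous in the joint variable, convex in the second variable, and assume there are constants $c_0,C_0>0$ with $c_0|Ay|\le f(x,y)\le C_0(1+|Ay|)$ for all $(x,y)$. Assume moreover that the limit $f^\infty(x,y):=\lim_{x'\to x,\,t\to+\infty}\frac1t f(x',ty)$ exists for all $(x,y)\in\overline\Omega\times\mathbb{R}^{m\times n}$. Then for all $u,r\in L^2(\Omega,\mathbb{R}^m)$ the following are equivalent: (a) $r\in\partial F_{dual}(u)$ (subdifferential in $L^2(\Omega,\mathbb{R}^m)$). (b) $u\in\mathrm{BV}^{\mathbb{A}}(\Omega)$ and there is $z\in\mathcal{Z}$ such that $$r=-\operatorname{div}z\ \text{ in }\Omega,\qquad \langle z,\nu\rangle=0\ \text{ on }\partial\Omega,$$ $$z(x)\in\partial_yf(x,(\mathbb{A}u)^a(x))\ \text{ for }\mathcal{L}^n\text{-a.e. }x\in\Omega,\qquad \theta(z,\mathbb{A}u)(x)=f^\infty\Big(x,\tfrac{(\mathbb{A}u)^s}{|\mathbb{A}u|^s}(x)\Big)\ \text{ for }|\mathbb{A}u|^s\text{-a.e. }x\in\Omega.$$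
   Context: Setting: $\Omega\subset\mathbb{R}^n$ is a bounded open set with Lipschitz boundary and outer unit normal $\nu$. $A:\mathbb{R}^{m\times n}\to\mathbb{R}^{m\times n}$ is a fixed linear map, symmetric with respect to the Frobenius product $y:y'=\sum_{i,j}y_{ij}y'_{ij}$, with $A^2=A$. For $u:\Omega\to\mathbb{R}^m$ set $\mathbb{A}u:=A\,\mathrm{D}u$ (distributional). $\mathrm{BV}^{\mathbb{A}}(\Omega)$ is the space of $u\in L^1(\Omega,\mathbb{R}^m)$ for which $\mathbb{A}u$ is a bounded $\mathbb{R}^{m\times n}$-valued Radon measure on $\Omega$. $\mu^a,\mu^s$ are the absolutely continuous (identified with its density) and singular parts of a measure $\mu$ w.r.t. Lebesgue measure $\mathcal{L}^n$; $\frac{(\mathbb{A}u)^s}{|\mathbb{A}u|^s}$ is the Radon–Nikodym density of $(\mathbb{A}u)^s$ w.r.t. its total variation. The divergence of matrix fields is row-wise, $(\operatorname{div}z)_i=\sum_j\partial_jz_{ij}$, distributional. $X_2(\Omega):=\{z\in L^\infty(\Omega,\mathbb{R}^{m\times n}): Az=z,\ \operatorname{div}z\in L^2(\Omega,\mathbb{R}^m)\}$. For $u\in\mathrm{BV}^{\mathbb{A}}(\Omega)\cap L^2(\Omega,\mathbb{R}^m)$ and $z\in X_2(\Omega)$ the pairing $(z,\mathbb{A}u)$ is the distribution $\langle (z,\mathbb{A}u),\phi\rangle:=-\int_\Omega\sum_{i,j}(\phi\,\partial_jz_{ij}u_i+\partial_j\phi\, z_{ij}u_i)\,dx$, $\phi\in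 C_c^\infty(\Omega)$, which is a bounded Radon measure on $\Omega$, absolutely continuous w.r.t. $|\mathbb{A}u|$; $\theta(z,\mathbb{A}u):=\frac{d(z,\mathbb{A}u)}{d|\mathbb{A}u|}$. For $z\in X_2(\Omega)$, the normal trace $\langle z,\nu\rangle\in L^\infty(\partial\Omega,\mathbb{R}^m)$ is the unique function with $\int_\Omega\langle\operatorname{div}z,\phi\rangle+z:\mathrm{D}\phi\,dx=\int_{\partial\Omega}\langle\phi,\langle z,\nu\rangle\rangle\,d\mathcal{H}^{n-1}$ for all $\phi\in (W^{1,1}\cap L^{2})(\Omega,\mathbb{R}^m)$. $f^*(x,z)=\sup_{y}(z:y-f(x,y))$. $\mathcal{Z}:=\{z\in X_2(\Omega): f^*(x,z(x))\in L^1(\Omega)\}$. For $u\in L^2(\Omega,\mathbb{R}^m)$, $F_{dual}(u):=\sup_{z\in\mathcal{Z}}\big(\int_\Omega -f^*(x,z(x))\,dx+\int_\Omega (z,\mathbb{A}u)\big)$ if $u\in\mathrm{BV}^{\mathbb{A}}(\Omega)$ and $+\infty$ otherwise. For convex $\mathcal{G}:H\to\mathbb{R}\cup\{+\infty\}$ on a Hilbert space: $v\in\partial\mathcal{G}(u)$ iff $\langle v,w-u\rangle\le\mathcal{G}(w)-\mathcal{G}(u)$ for all $w\in H$; $\partial_yf(x,y)$ is the subdifferential of $f(x,\cdot)$ at $y$. *)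

(* Defs.v *)
From HB Require Import structures.
From mathcomp Require Import all_boot all_order all_algebra.
From mathcomp Require Import all_classical all_reals all_analysis.
From mathcomp Require Import measurable_realfun.
From mathcomp Require Import ring lra.

Set Implicit Arguments.
Unset Strict Implicit.
Unset Printing Implicit Defensive.

Import Order.TTheory GRing.Theory Num.Theory.
Import numFieldNormedType.Exports.

Local Open Scope classical_set_scope.
Local Open Scope ring_scope.

Definition mx_display : measure_display -> measure_display.
Proof. exact. Qed.

Section mx_measurable.
Context {d} {T : measurableType d} (m n : nat).

(* The product sigma-algebra on matrices, generated by the entries; over R it
   is the Borel sigma-algebra, since open sets are measurable
   (open_measurable_mx) and entries are continuous. *)
Definition mx_cylinders : set (set 'M[T]_(m, n)) :=
  [set B | exists i j (S : set T),
    measurable S /\ B = (fun M : 'M[T]_(m, n) => M i j) @^-1` S].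

Let mx_set0 : <<s mx_cylinders >> set0.
Proof. exact: sigma_algebra0. Qed.

Let mx_setC A : <<s mx_cylinders >> A -> <<s mx_cylinders >> (~` A).
Proof. exact: sigma_algebraC. Qed.

Let mx_bigcup (F : _^nat) : (forall i, <<s mx_cylinders >> (F i)) ->
  <<s mx_cylinders >> (\bigcup_i (F i)).
Proof. exact: sigma_algebra_bigcup. Qed.

HB.instance Definition _ := @isMeasurable.Build (mx_display d)
  'M[T]_(m, n) <<s mx_cylinders >> mx_set0 mx_setC mx_bigcup.
End mx_measurable.

Lemma measurable_mx_coord d (T : measurableType d) m n i j :
  measurable_fun setT (fun M : 'M[T]_(m, n) => M i j).
Proof.
move=> _ S mS; rewrite setTI; apply: sub_sigma_algebra.
by exists i, j, S.
Qed.

Lemma measurable_fun_mx d1 d2 (S : measurableType d1) (T : measurableType d2)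
    m n (f : S -> 'M[T]_(m, n)) :
  (forall i j, measurable_fun setT (fun x => f x i j)) -> measurable_fun setT f.
Proof.
move=> mf; apply: (measurability (@mx_cylinders _ T m n) erefl).
move=> _ [_ [i [j [B [mB ->]]]] <-].
by have := mf i j measurableT B mB; rewrite !setTI.
Qed.

Lemma open_measurable_mx (R : realType) m n (U : set 'M[R]_(m, n)) :
  open U -> measurable U.
Proof.
move=> oU.
pose c (k : nat) : 'M[R]_(m, n) * R :=
  if unpickle k is Some (M, r) then (map_mx ratr (M : 'M[rat]_(m, n)), ratr (r : rat))
  else (0, 0).
have -> : U = \bigcup_(k in [set k | ball (c k).1 (c k).2 `<=` U])
    ball (c k).1 (c k).2.
  apply/seteqP; split=> [x Ux|x [k /= kU]]; last exact: kU.
  have /nbhs_ballP[e /= e0 eU] : nbhs x U by apply: open_nbhs_nbhs.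
  have [r /andP[r0 re]] : exists r : rat, 0 < (ratr r : R) < e / 2.
    have /rat_in_itvoo[r] : 0 < e / 2 by rewrite divr_gt0.
    by rewrite in_itv/= => ?; exists r.
  have /choice[M HM] : forall ij : 'I_m * 'I_n, exists q : rat,
      `|x ij.1 ij.2 - ratr q| < ratr r.
    move=> [i j]/=.
    have : x i j - ratr r < x i j + ratr r by rewrite ltrD2l gtrN.
    move=> /rat_in_itvoo[q]; rewrite in_itv/= => qr; exists q.
    by rewrite distrC ltr_distl.
  pose MM := \matrix_(i < m, j < n) M (i, j).
  have ck : c (pickle (MM, r)) = (map_mx ratr MM, ratr r) by rewrite /c pickleK.
  exists (pickle (MM, r)) => /=; rewrite ck/=.
    move=> y [_ yb]; apply: eU; split=> // i j.
    have := yb i j; rewrite !mxE /ball/= => h1.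
    have /= h2 := HM (i, j).
    rewrite (splitr e) -(subrK (ratr (M (i, j))) (x i j)) -addrA.
    by rewrite (le_lt_trans (ler_normD _ _))// ltrD// (lt_trans _ re).
  split=> // i j; rewrite !mxE /ball/= distrC; exact: (HM (i, j)).
apply: bigcup_measurable => k _.
have [e0|e0] := ltP 0 (c k).2; last first.
  rewrite (_ : ball _ _ = set0)//; apply/seteqP; split=> // y [].
  by rewrite ltNge e0.
rewrite (_ : ball _ _ = \bigcap_(ij in [set: 'I_m * 'I_n])
    ((fun M : 'M[R]_(m, n) => M ij.1 ij.2) @^-1`
      ball ((c k).1 ij.1 ij.2) (c k).2)).
  apply: fin_bigcap_measurable => // -[i j] _ /=.
  rewrite -[X in measurable X]setTI; apply: measurable_mx_coord => //.
  exact: measurable_ball.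
apply/seteqP; split=> [y [_ yb] [i j] _ /=|y yb]; first exact: yb.
by split=> // i j; exact: (yb (i, j)).
Qed.

Section lebesgue_measure_rV.
Variable R : realType.

Definition rV_cons n (p : measurableTypeR R * 'rV[R]_n) : 'rV[R]_n.+1 :=
  row_mx (const_mx p.1 : 'rV_1) p.2.

Definition rV_uncons n (v : 'rV[R]_n.+1) : measurableTypeR R * 'rV[R]_n :=
  (v 0 0, rsubmx (v : 'rV_(1 + n))).

Lemma rV_consK n : cancel (@rV_cons n) (@rV_uncons n).
Proof.
case=> x v; rewrite /rV_cons /rV_uncons/= row_mxKr; congr (_, _).
have E (w : 'rV[R]_(1 + n)) : w 0 0 = lsubmx w 0 0.
  by rewrite mxE; congr (w _ _); exact/val_inj.
by rewrite (E (row_mx _ _)) row_mxKl mxE.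
Qed.

Lemma rV_unconsK n : cancel (@rV_uncons n) (@rV_cons n).
Proof.
move=> v; rewrite /rV_cons /rV_uncons/=.
rewrite (_ : const_mx _ = lsubmx (v : 'rV_(1 + n))) ?(@hsubmxK _ 1 1 n)//.
apply/rowP => i; rewrite !mxE ord1; congr (v _ _); exact/val_inj.
Qed.

Lemma measurable_rV_cons n : measurable_fun setT (@rV_cons n).
Proof.
apply: measurable_fun_mx => i j; rewrite ord1 /rV_cons/=.
case: (split_ordP (j : 'I_(1 + n))) => k ->.
  rewrite (_ : (fun _ => _) = fst); first exact: measurable_fst.
  by apply/funext => -[x v]; apply: etrans (row_mxEl _ _ _ _) _; rewrite mxE.
rewrite (_ : (fun _ => _) = (fun M : 'rV[R]_n => M 0 k) \o snd).
  apply: measurableT_comp; last exact: measurable_snd.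
  exact: measurable_mx_coord.
by apply/funext => -[x v]; apply: etrans (row_mxEr _ _ _ _) _.
Qed.

Lemma measurable_rV_uncons n : measurable_fun setT (@rV_uncons n).
Proof.
apply: measurable_fun_pair; first exact: measurable_mx_coord.
apply: measurable_fun_mx => i j.
under eq_fun do rewrite mxE.
exact: measurable_mx_coord.
Qed.

Section step.
Variables (n : nat) (mu : {sigma_finite_measure set 'rV[R]_n -> \bar R}).

Definition lebesgue_rV_step : set 'rV[R]_n.+1 -> \bar R :=
  pushforward (lebesgue_measure \x mu)%E (@rV_cons n).

Let lebesgue_rV_step0 : lebesgue_rV_step set0 = 0%E.
Proof. by rewrite /lebesgue_rV_step /pushforward preimage_set0 measure0. Qed.

Let lebesgue_rV_step_ge0 B : (0 <= lebesgue_rV_step B)%E.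
Proof. by rewrite /lebesgue_rV_step /pushforward; apply: measure_ge0. Qed.

Let lebesgue_rV_step_sigma_additive : semi_sigma_additive lebesgue_rV_step.
Proof.
move=> F mF tF mUF; rewrite /lebesgue_rV_step /pushforward preimage_bigcup.
apply: measure_semi_sigma_additive.
- by move=> k; rewrite -[X in measurable X]setTI; exact: measurable_rV_cons.
- apply/trivIsetP => /= i j _ _ ij; rewrite -preimage_setI.
  by move/trivIsetP : tF => /(_ _ _ _ _ ij) ->//; rewrite preimage_set0.
- rewrite -preimage_bigcup -[X in measurable X]setTI.
  exact: measurable_rV_cons.
Qed.

HB.instance Definition _ := isMeasure.Build _ _ _ lebesgue_rV_step
  lebesgue_rV_step0 lebesgue_rV_step_ge0 lebesgue_rV_step_sigma_additive.

Let lebesgue_rV_step_sigma_finite : sigma_finite setT lebesgue_rV_step.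
Proof.
have /sigma_finiteP[F [TF ndF Foo]] := sigma_finiteT (@lebesgue_measure R).
have /sigma_finiteP[G [TG ndG Goo]] := sigma_finiteT mu.
exists (fun k => @rV_uncons n @^-1` (F k `*` G k)).
  rewrite -preimage_bigcup (_ : \bigcup_k _ = setT) ?preimage_setT//.
  apply/seteqP; split=> // -[x v] _.
  have [k _ Fx] : (\bigcup_k F k) x by rewrite -TF.
  have [l _ Gv] : (\bigcup_k G k) v by rewrite -TG.
  exists (maxn k l) => //; split.
    by move: x Fx; exact/subsetPset/ndF/leq_maxl.
  by move: v Gv; exact/subsetPset/ndG/leq_maxr.
move=> k; have [mF Fk] := Foo k; have [mG Gk] := Goo k; split.
  rewrite -[X in measurable X]setTI; apply: measurable_rV_uncons => //.
  exact: measurableX.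
rewrite /lebesgue_rV_step /pushforward -comp_preimage (_ : _ \o _ = id); last first.
  by apply/funext => x; exact: rV_consK.
by rewrite preimage_id product_measure1E// lte_mul_pinfty// ge0_fin_numE.
Qed.

HB.instance Definition _ := Measure_isSigmaFinite.Build _ _ _ lebesgue_rV_step
  lebesgue_rV_step_sigma_finite.
End step.

(* Lebesgue measure on R^n, on Borel sets, as iterated product measure. *)
Fixpoint lebesgue_rV n : {sigma_finite_measure set 'rV[R]_n -> \bar R} :=
  match n with
  | 0 => \d_(0 : 'rV[R]_0)
  | n'.+1 => lebesgue_rV_step (lebesgue_rV n')
  end.
End lebesgue_measure_rV.

Section frobenius.
Variables (R : realType) (m n : nat).
Implicit Types y : 'M[R]_(m, n).

(* On row vectors ('M_(1, n)) these are the Euclidean inner product and norm;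
   the library norm of a matrix is the sup norm. *)
Definition frob_ip y y' : R := \sum_i \sum_j y i j * y' i j.

Definition frob y : R := Num.sqrt (frob_ip y y).

Lemma frob_ge0 y : 0 <= frob y. Proof. exact: sqrtr_ge0. Qed.

Lemma frob_ip_ge0 y : 0 <= frob_ip y y.
Proof. by do 2![apply: sumr_ge0 => ? _]; rewrite -expr2 sqr_ge0. Qed.

Lemma frob_ipC y y' : frob_ip y y' = frob_ip y' y.
Proof. by do 2![apply: eq_bigr => ? _]; rewrite mulrC. Qed.

Lemma frob_ipDZ (a b : R) y y' y'' :
  frob_ip (a *: y + b *: y') y'' = a * frob_ip y y'' + b * frob_ip y' y''.
Proof.
rewrite /frob_ip !mulr_sumr -big_split; apply: eq_bigr => i _ /=.
rewrite !mulr_sumr -big_split; apply: eq_bigr => j _ /=.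
by rewrite !mxE mulrDl !mulrA.
Qed.

Lemma frob_sqr y : frob y ^+ 2 = frob_ip y y.
Proof. by rewrite sqr_sqrtr// frob_ip_ge0. Qed.

Lemma frob_cauchy_schwarz y y' : frob_ip y y' <= frob y * frob y'.
Proof.
set a := frob y; set b := frob y'.
have a0 : 0 <= a by exact: frob_ge0.
have b0 : 0 <= b by exact: frob_ge0.
have sq s t : 0 <= s ^+ 2 * a ^+ 2 + s * t * frob_ip y y' *+ 2 + t ^+ 2 * b ^+ 2.
  have := frob_ip_ge0 (s *: y + t *: y').
  rewrite frob_ipDZ [frob_ip y _]frob_ipC [frob_ip y' _]frob_ipC !frob_ipDZ.
  rewrite [frob_ip y' y]frob_ipC -!frob_sqr -/a -/b; move/le_trans; apply.
  rewrite le_eqVlt; apply/orP; left; apply/eqP; ring.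
have [ab0|ab0] := ltP 0 (a * b).
  have := sq b (- a).
  have -> : b ^+ 2 * a ^+ 2 + b * - a * frob_ip y y' *+ 2 + (- a) ^+ 2 * b ^+ 2
     = (a * b * (a * b - frob_ip y y')) *+ 2 by ring.
  by rewrite pmulrn_lge0// pmulr_rge0// subr_ge0.
have ab : a * b = 0 by apply/eqP; rewrite eq_le ab0 mulr_ge0.
have z (w w' : 'M[R]_(m, n)) : frob w = 0 -> frob_ip w w' = 0.
  move=> /eqP; rewrite -sqrf_eq0 frob_sqr /frob_ip psumr_eq0; last first.
    by move=> i _; apply: sumr_ge0 => j _; rewrite -expr2 sqr_ge0.
  move=> /allP w0; apply: big1 => i _; apply: big1 => j _.
  have := w0 i (mem_index_enum _); rewrite psumr_eq0/=; last first.
    by move=> k _; rewrite -expr2 sqr_ge0.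
  move=> /allP/(_ j (mem_index_enum _)); rewrite /= mulf_eq0 orbb => /eqP->.
  by rewrite mul0r.
rewrite ab; move/eqP : ab; rewrite mulf_eq0 => /orP[]/eqP ab.
  by rewrite (z _ _ ab).
by rewrite frob_ipC (z _ _ ab).
Qed.

Lemma ler_frobD y y' : frob (y + y') <= frob y + frob y'.
Proof.
rewrite -(ler_pXn2r (ltn0Sn 1)) ?nnegrE ?addr_ge0 ?frob_ge0//.
rewrite frob_sqr -[y]scale1r -[y']scale1r.
rewrite frob_ipDZ [frob_ip y _]frob_ipC [frob_ip y' _]frob_ipC !frob_ipDZ.
rewrite !scale1r !mul1r sqrrD !frob_sqr [frob_ip y' y]frob_ipC.
rewrite addrA -[leLHS]addrA -[_ + frob_ip _ _]addrC.
have := frob_cauchy_schwarz y y'; lra.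
Qed.

Lemma frob_le_sum y : frob y <= \sum_i \sum_j `|y i j|.
Proof.
rewrite -(ler_pXn2r (ltn0Sn 1)) ?nnegrE ?frob_ge0//; last first.
  by do 2![apply: sumr_ge0 => ? _].
rewrite frob_sqr expr2 mulr_suml; apply: ler_sum => i _.
rewrite mulr_suml; apply: ler_sum => j _.
rewrite -expr2 -normr_id -real_normK ?num_real// expr2 normr_id ler_wpM2l//.
rewrite (bigD1 i)//= (bigD1 j)//= -addrA lerDl addr_ge0//.
  by apply: sumr_ge0.
by do 2![apply: sumr_ge0 => ? _].
Qed.

Lemma frob0 : frob 0 = 0.
Proof.
apply/eqP; rewrite eq_le frob_ge0 andbT (le_trans (frob_le_sum _))//.
by rewrite big1// => i _; rewrite big1// => j _; rewrite mxE normr0.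
Qed.

Lemma frobN y : frob (- y) = frob y.
Proof.
rewrite /frob; congr Num.sqrt.
by do 2![apply: eq_bigr => ? _]; rewrite !mxE mulrNN.
Qed.

End frobenius.

Section mx_variation.
Context d (X : measurableType d) (R : realType) (m n : nat).

(* A bounded R^(m x n)-valued measure, given by its entries. *)
Definition mx_charge := 'I_m -> 'I_n -> {charge set X -> \bar R}.

Variable mu : mx_charge.

Definition charge_mx (E : set X) : 'M[R]_(m, n) :=
  \matrix_(i, j) fine (mu i j E).

(* Competitors are only required to be contained in E, instead of covering it:
   for measurable E the supremum is the same (adjoin the complement). *)
Definition disjoint_family (E : set X) : set ((set X)^nat) :=
  [set F | [/\ forall k, measurable (F k), trivIset setT F &
    \bigcup_k F k `<=` E]].

Definition mx_variation (E : set X) : \bar R :=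
  ereal_sup [set (\sum_(k <oo) (frob (charge_mx (F k)))%:E)%E
    | F in disjoint_family E].

Local Open Scope ereal_scope.
Local Notation tv := mx_variation.
Local Notation nrm E := (frob (charge_mx E))%:E.

Let nrm_ge0 E : 0 <= nrm E.
Proof. by rewrite lee_fin frob_ge0. Qed.

Let val0 : charge_mx set0 = 0%R.
Proof. by apply/matrixP => i j; rewrite !mxE charge0. Qed.

Let nrm0 : nrm set0 = 0.
Proof. by rewrite val0 frob0. Qed.

Let tv_ub E F : disjoint_family E F -> \sum_(k <oo) nrm (F k) <= tv E.
Proof. by move=> FE; apply: ereal_sup_ubound; exists F. Qed.

Let tv_ge0 E : 0 <= tv E.
Proof.
apply: (le_trans _ (@tv_ub E (fun=> set0) _)); first exact: nneseries_ge0.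
split=> //; last by rewrite bigcup0.
by apply/trivIsetP => i j _ _ _; rewrite setI0.
Qed.

Let tv0 : tv set0 = 0.
Proof.
apply/eqP; rewrite eq_le tv_ge0 andbT; apply: ge_ereal_sup => _ [F [_ _ F0] <-].
rewrite eseries0// => k _ _; rewrite (_ : F k = set0) ?nrm0//.
by apply/seteqP; split=> // x Fx; apply: F0; exists k.
Qed.

Let le_tv A B : A `<=` B -> tv A <= tv B.
Proof.
move=> AB; apply: ge_ereal_sup => _ [F [mF tF FA] <-]; apply: tv_ub.
by split=> //; exact: subset_trans AB.
Qed.

Let tv_superadd A B : A `&` B = set0 -> tv A + tv B <= tv (A `|` B).
Proof.
move=> AB0.
have key F G : disjoint_family A F -> disjoint_family B G ->
    \sum_(k <oo) nrm (F k) + \sum_(k <oo) nrm (G k) <= tv (A `|` B).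
  move=> [mF tF FA] [mG tG GB].
  pose H k := if odd k then G k./2 else F k./2.
  have HAB : disjoint_family (A `|` B) H.
    split=> [k||x [k _]]; rewrite /H; first by case: ifP.
    - have FG k l : F k `&` G l = set0.
        rewrite -subset0 -AB0 => x [Fx Gx].
        by split; [apply: FA; exists k|apply: GB; exists l].
      apply/trivIsetP => k l _ _ kl.
      case: ifPn => ok; case: ifPn => ol.
      + move/trivIsetP : tG; apply => //; apply: contra kl => /eqP kl.
        by rewrite -(odd_double_half k) -(odd_double_half l) ok ol kl.
      + by rewrite setIC.
      + by [].
      + move/trivIsetP : tF; apply => //; apply: contra kl => /eqP kl.
        rewrite -(odd_double_half k) -(odd_double_half l).
        by rewrite (negbTE ok) (negbTE ol) kl.
    - case: ifP => _ ?; first by right; apply: GB; exists k./2.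
      by left; apply: FA; exists k./2.
  rewrite -nneseriesD//; apply: lime_le.
    by apply: is_cvg_nneseries => k _ _; rewrite adde_ge0.
  apply: nearW => N; apply: le_trans (tv_ub HAB).
  apply: le_trans (@nneseries_lim_ge _ _ xpredT 0%N N.*2 _); last by [].
  elim: N => [|N IH]; first by rewrite !big_nil.
  rewrite doubleS !big_nat_recr//= /H/= odd_double/= uphalf_double half_double.
  rewrite -addeA; exact: leeD.
have [->|coo] := eqVneq (tv (A `|` B)) +oo; first by rewrite leey.
have cfin : tv (A `|` B) \is a fin_num by rewrite ge0_fin_numE ?ltey.
have tvBfin : tv B \is a fin_num.
  by rewrite ge0_fin_numE// (@le_lt_trans _ _ (tv (A `|` B))) ?ltey// le_tv.
rewrite -leeBrDr//; apply: ge_ereal_sup => _ [F FA <-].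
have Ffin : \sum_(k <oo) nrm (F k) \is a fin_num.
  rewrite ge0_fin_numE; last exact: nneseries_ge0.
  rewrite (@le_lt_trans _ _ (tv (A `|` B))) ?ltey//.
  by rewrite (le_trans (tv_ub FA))// le_tv.
rewrite leeBrDr// -leeBrDl//; apply: ge_ereal_sup => _ [G GB <-].
by rewrite leeBrDl//; exact: key.
Qed.

Let cvg_rsum (I : Type) (r : seq I) (f : I -> nat -> R) (l : I -> R) :
  (forall i, f i N @[N --> \oo] --> l i) ->
  (\sum_(i <- r) f i N)%R @[N --> \oo] --> (\sum_(i <- r) l i)%R.
Proof.
move=> fl; elim: r => [|i r IH].
  rewrite big_nil (_ : (fun _ => _) = fun=> 0%R); first exact: cvg_cst.
  by apply/funext => N; rewrite big_nil.
rewrite big_cons (_ : (fun _ => _) = (fun N => f i N + \sum_(j <- r) f j N)%R).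
  by apply: cvgD.
by apply/funext => N; rewrite big_cons.
Qed.

Let nrm_bigcup G : (forall k, measurable (G k)) -> trivIset setT G ->
  nrm (\bigcup_k G k) <= \sum_(k <oo) nrm (G k).
Proof.
move=> mG tG; set B := \bigcup_k G k; set S := \sum_(k <oo) _.
have mB : measurable B by exact: bigcup_measurable.
have S0 : 0 <= S by exact: nneseries_ge0.
have [->|Soo] := eqVneq S +oo; first by rewrite leey.
have Sfin : S \is a fin_num by rewrite ge0_fin_numE ?ltey.
pose a i j N : R := (\sum_(0 <= k < N) fine (mu i j (G k)))%R.
have acvg i j : a i j N @[N --> \oo] --> fine (mu i j B).
  have := @charge_semi_sigma_additive _ _ _ (mu i j) G mG tG mB.
  rewrite -/B -(fineK (fin_num_measure (mu i j) _ mB)) => /fine_cvg.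
  rewrite (_ : fine \o _ = a i j)//.
  by apply/funext => N; rewrite /= /a sum_fine// => k _; exact: fin_num_measure.
pose h N : R := (\sum_i \sum_j `|fine (mu i j B) - a i j N|)%R.
have hcvg : h N @[N --> \oo] --> (0 : R)%R.
  rewrite [X in _ --> X](_ : _ = \sum_(i < m) \sum_(j < n) (0 : R))%R; last first.
    by rewrite big1// => i _; rewrite big1.
  apply: cvg_rsum => i; apply: cvg_rsum => j.
  rewrite -(@normr0 _ R) -(subrr (fine (mu i j B))).
  apply: cvg_norm; apply: cvgB => //; exact: cvg_cst.
have hle N : (frob (charge_mx B) - fine S <= h N)%R.
  pose v : 'M[R]_(m, n) := (\sum_(0 <= k < N) charge_mx (G k))%R.
  have vE i j : v i j = a i j N.
    by rewrite /v summxE; apply: eq_bigr => k _; rewrite mxE.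
  have vS : (frob v <= fine S)%R.
    rewrite -lee_fin fineK//; apply: le_trans (@nneseries_lim_ge _ _ xpredT 0%N N _); last by [].
    rewrite sumEFin lee_fin /v.
    elim: N {vE v hcvg h} => [|N IH]; first by rewrite !big_nil frob0.
    by rewrite !big_nat_recr//= (le_trans (ler_frobD _ _))// lerD.
  rewrite -[charge_mx B](subrK v) lerBlDr (le_trans (ler_frobD _ _))//.
  apply: lerD => //; apply: le_trans (frob_le_sum _) _.
  by apply: ler_sum => i _; apply: ler_sum => j _; rewrite !mxE vE.
rewrite -[S]fineK// lee_fin -subr_le0 -(cvg_lim (@Rhausdorff R) hcvg).
by apply: limr_ge; [apply/cvg_ex; exists 0%R|exact: nearW].
Qed.

Let tv_sigma_additive : semi_sigma_additive tv.
Proof.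
move=> E mE tE mUE.
suff -> : tv (\bigcup_k E k) = \sum_(k <oo) tv (E k).
  by apply: is_cvg_nneseries => k _ _; exact: tv_ge0.
apply/eqP; rewrite eq_le; apply/andP; split; last first.
  apply: lime_le; first by apply: is_cvg_nneseries => k _ _; exact: tv_ge0.
  apply: nearW => N.
  apply: (@le_trans _ _ (tv (\big[setU/set0]_(0 <= k < N) E k))); last first.
    by apply: le_tv; rewrite big_mkord; exact: bigsetU_bigcup.
  elim: N => [|N IH]; first by rewrite !big_nil tv0.
  rewrite !big_nat_recr//=; apply: (le_trans (leeD2r _ IH)).
  apply: tv_superadd; rewrite big_mkord.
  rewrite (@trivIset_bigsetUI _ xpredT)//.
  by rewrite [X in trivIset X E](_ : _ = [set: nat])//; exact/seteqP.
apply: ge_ereal_sup => _ [F [mF tF FE] <-].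
apply: (@le_trans _ _ (\sum_(k <oo) \sum_(l <oo) nrm (F k `&` E l))).
  apply: lee_nneseries => // k _.
  rewrite [X in nrm X](_ : _ = \bigcup_l (F k `&` E l)); last first.
    by rewrite -setI_bigcupr setIidl// => x Fx; apply: FE; exists k.
  apply: nrm_bigcup; first by move=> l; exact: measurableI.
  exact: trivIset_setIl.
rewrite nneseries_interchange//; apply: lee_nneseries.
  by move=> l _ _; exact: nneseries_ge0.
move=> l _; apply: tv_ub; split.
- by move=> k; exact: measurableI.
- exact: trivIset_setIr.
- by move=> x [k _ []].
Qed.

HB.instance Definition _ := isMeasure.Build _ _ _ mx_variation
  tv0 tv_ge0 tv_sigma_additive.

Let tv_fin : fin_num_fun mx_variation.
Proof.
apply: lty_fin_num_fun.
have /choice[nu' Hnu'] : forall ij : 'I_m * 'I_n,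
    exists nu : {measure set X -> \bar R}, nu setT < +oo /\
    forall E, measurable E -> `|mu ij.1 ij.2 E| <= nu E.
  move=> [i j]; have [P [N PN]] := Hahn_decomposition (mu i j).
  exists (charge_variation PN); split; last first.
    by move=> E; exact: abse_charge_variation.
  rewrite /charge_variation/= lte_add_pinfty// -ge0_fin_numE//.
    exact: fin_num_measure.
  exact: fin_num_measure.
pose nu i j := nu' (i, j).
have nuE i j E : measurable E -> `|mu i j E| <= nu i j E.
  exact: (Hnu' (i, j)).2.
apply: (@le_lt_trans _ _ (\sum_i \sum_j nu i j setT)); last first.
  apply/lte_sum_pinfty => i _; apply/lte_sum_pinfty => j _.
  exact: (Hnu' (i, j)).1.
apply: ge_ereal_sup => _ [F [mF tF _] <-].
apply: lime_le; first exact: is_cvg_nneseries.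
apply: nearW => N.
apply: (@le_trans _ _ (\sum_i \sum_j \sum_(0 <= k < N) nu i j (F k))).
  under [leRHS]eq_bigr do rewrite exchange_big/=.
  rewrite [leRHS]exchange_big/=; apply: lee_sum => k _.
  apply: (@le_trans _ _ (\sum_i \sum_j `|charge_mx (F k) i j|%:E)).
    under eq_bigr do rewrite sumEFin.
    by rewrite sumEFin lee_fin frob_le_sum.
  apply: lee_sum => i _; apply: lee_sum => j _.
  rewrite mxE -abse_EFin fineK ?fin_num_measure//.
  exact: nuE.
apply: lee_sum => i _; apply: lee_sum => j _.
apply: le_trans (@nneseries_lim_ge _ _ xpredT 0%N N _) _; first by [].
have mUF : measurable (\bigcup_k F k) by exact: bigcup_measurable.
have /cvg_lim -> // :=
  @measure_semi_sigma_additive _ _ _ (nu i j) F mF tF mUF.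
by rewrite le_measure ?inE.
Qed.

HB.instance Definition _ := Measure_isFinite.Build _ _ _ mx_variation tv_fin.

End mx_variation.

Section hausdorff.
Variables (R : realType) (n s : nat).
Local Open Scope ereal_scope.
Implicit Types A : set 'rV[R]_n.

Definition diam A : \bar R :=
  ereal_sup [set (frob (x - y))%:E | x in A & y in A].

Definition unit_ball_volume (k : nat) : R :=
  fine (lebesgue_rV R k [set x | (frob x <= 1)%R]).

(* With the convention 0 ^ 0 = 1 for nonempty sets, so that the 0-dimensional
   Hausdorff measure is the counting measure. *)
Definition hausdorff_weight A : \bar R :=
  if A == set0 then 0
  else (unit_ball_volume s * (fine (diam A) / 2) ^+ s)%:E.

Definition hausdorff_pre (e : R) A : \bar R :=
  ereal_inf [set \sum_(k <oo) hausdorff_weight (C k)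
    | C in [set C : (set 'rV[R]_n)^nat |
        (forall k, diam (C k) <= e%:E) /\ A `<=` \bigcup_k C k]].

Definition hausdorff A : \bar R :=
  ereal_sup [set hausdorff_pre e A | e in [set e | (0 < e)%R]].

Let diam0 : diam set0 = -oo.
Proof.
rewrite /diam (_ : image2 _ _ _ = set0) ?ereal_sup0//.
by apply/seteqP; split=> // z [].
Qed.

Let weight_ge0 A : 0 <= hausdorff_weight A.
Proof.
rewrite /hausdorff_weight; case: ifPn => [//|/set0P[x Ax]].
rewrite lee_fin mulr_ge0//; first exact/fine_ge0/measure_ge0.
rewrite exprn_ge0// divr_ge0// fine_ge0//.
apply: ereal_sup_ubound => /=; exists x => //; exists x => //.
by rewrite subrr frob0.
Qed.

Let T : semiRingOfSetsType _ := g_sigma_algebraType [set: set 'rV[R]_n].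

Let ext (v : set T -> \bar R) : set T -> \bar R := @mu_ext _ T R v.

Let w (e : R) (A : set T) : \bar R :=
  if diam A <= e%:E then hausdorff_weight A else +oo.

Let w0 e : w e set0 = 0.
Proof. by rewrite /w diam0 leNye /hausdorff_weight eqxx. Qed.

Let w_ge0 e A : 0 <= w e A.
Proof. by rewrite /w; case: ifP. Qed.

Let preE e A : hausdorff_pre e A = ext (w e) A.
Proof.
apply/eqP; rewrite eq_le; apply/andP; split.
  apply: le_ereal_inf_tmp => _ [C [_ AC] <-].
  have [[k Ck]|] := pselect (exists k, ~ (diam (C k) <= e%:E)).
    rewrite (_ : \sum_(k <oo) _ = +oo) ?leey//.
    apply: (@eseries_pinfty _ _ xpredT k) => //.
      by move=> i _; rewrite -ltNye (lt_le_trans _ (w_ge0 _ _)).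
    by rewrite /w; case: ifP.
  move=> /forallNP Ce; apply: ereal_inf_lbound; exists C => //=.
    by split=> // k; apply: contrapT.
  apply: eq_eseriesr => k _; rewrite /w; case: ifP => // /negP; have := Ce k.
  by [].
apply: le_ereal_inf_tmp => _ [C [Ce AC] <-]; apply: ereal_inf_lbound.
exists C.
  by split=> // k; exact: sub_sigma_algebra.
by apply: eq_eseriesr => k _; rewrite /w Ce.
Qed.

Let hausdorff0 : hausdorff set0 = 0.
Proof.
rewrite /hausdorff (_ : [set _ | _ in _] = [set 0]) ?ereal_sup1//.
apply/seteqP; split=> [_ [e /= _ <-]|_ ->].
  by rewrite preE; exact: mu_ext0.
exists 1%R => //=.
by rewrite preE; exact: mu_ext0.
Qed.

Let hausdorff_ge0 A : 0 <= hausdorff A.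
Proof.
apply: (@le_trans _ _ (hausdorff_pre 1 A)).
  by rewrite preE; exact: mu_ext_ge0.
by apply: ereal_sup_ubound; exists 1%R; first exact: ltr01.
Qed.

Let le_hausdorff : {homo hausdorff : A B / A `<=` B >-> A <= B}.
Proof.
move=> A B AB; apply: ge_ereal_sup => _ [e /= e0 <-].
apply: (@le_trans _ _ (hausdorff_pre e B)).
  by rewrite !preE; exact: le_mu_ext.
by apply: ereal_sup_ubound; exists e.
Qed.

Let hausdorff_sigma_subadditive : sigma_subadditive hausdorff.
Proof.
move=> F; apply: ge_ereal_sup => _ [e /= e0 <-].
rewrite preE.
apply: (@le_trans _ _ (\sum_(k <oo) ext (w e) (F k))).
  exact: (@mu_ext_sigma_subadditive _ T R (w e) (w_ge0 e) F).
apply: lee_nneseries => [k _ _|k _]; first exact: mu_ext_ge0.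
by rewrite -preE; apply: ereal_sup_ubound; exists e.
Qed.

HB.instance Definition _ := isOuterMeasure.Build R _ hausdorff
  hausdorff0 hausdorff_ge0 le_hausdorff hausdorff_sigma_subadditive.

Definition hausdorff_outer : {outer_measure set 'rV[R]_n -> \bar R} := hausdorff.

(* The sigma-algebra is that of Caratheodory-measurable sets. *)
Definition hausdorff_measure :
  {measure set (caratheodory_type hausdorff_outer) -> \bar R} := hausdorff_outer.
End hausdorff.

Local Open Scope charge_scope.

(* Names an object characterized by P; x0 is only a default value when no such
   object exists. *)
Definition choose_or (T : Type) (x0 : T) (P : set T) : T :=
  if pselect (exists x, P x) is left exP then sval (cid exP) else x0.

Section charge_integral.
Context d (X : measurableType d) (R : realType).
Variable nu : {charge set X -> \bar R}.

Definition hahn_pos : set X := sval (cid (Hahn_decomposition nu)).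

Definition hahn_neg : set X := sval (cid (svalP (cid (Hahn_decomposition nu)))).

Definition hahn_pos_neg : hahn_decomposition nu hahn_pos hahn_neg :=
  svalP (cid (svalP (cid (Hahn_decomposition nu)))).

(* Integration of g against a signed measure, by Jordan decomposition. *)
Definition charge_integral (g : X -> R) : R :=
  (\int[jordan_pos hahn_pos_neg]_x g x -
   \int[jordan_neg hahn_pos_neg]_x g x)%R.
End charge_integral.

Section lebesgue_spaces.
Context d (X : measurableType d) (R : realType) (m n : nat).
Variables (mu : {measure set X -> \bar R}) (D : set X).
Implicit Types g : X -> 'M[R]_(m, n).

(* The L^p sets consist of functions; a.e. equality is not quotiented out. *)
Definition L1 : set (X -> 'M[R]_(m, n)) := [set g | measurable_fun D g /\
  mu.-integrable D (fun x => (frob (g x))%:E)].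

Definition L2 : set (X -> 'M[R]_(m, n)) := [set g | measurable_fun D g /\
  mu.-integrable D (fun x => (frob (g x) ^+ 2)%:E)].

Definition Loo : set (X -> 'M[R]_(m, n)) := [set g | measurable_fun D g /\
  exists M : R, {ae mu, forall x, D x -> frob (g x) <= M}].
End lebesgue_spaces.

Section lebesgue_decomposition.
Context d (X : measurableType d) (R : realType) (m n : nat).
Variables (la : {sigma_finite_measure set X -> \bar R}) (mu : mx_charge X R m n).

Definition mx_singular (nu : mx_charge X R m n) := exists N : set X,
  [/\ measurable N, la N = 0%E & forall i j E,
    measurable E -> E `&` N = set0 -> nu i j E = 0%E].

Definition is_lebesgue_decomposition
    (p : (X -> 'M[R]_(m, n)) * mx_charge X R m n) :=
  [/\ L1 la setT p.1, mx_singular p.2 &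
    forall i j E, measurable E ->
      mu i j E = (\int[la]_(x in E) (p.1 x i j)%:E + p.2 i j E)%E].

Definition lebesgue_decomposition : (X -> 'M[R]_(m, n)) * mx_charge X R m n :=
  choose_or (cst 0, fun _ _ => czero : {charge set X -> \bar R})
    is_lebesgue_decomposition.

Definition ac_density : X -> 'M[R]_(m, n) := lebesgue_decomposition.1.

Definition singular_part : mx_charge X R m n := lebesgue_decomposition.2.
End lebesgue_decomposition.

(* Radon-Nikodym density of mu with respect to its total variation. *)
Definition polar_density d (X : measurableType d) (R : realType) (m n : nat)
    (mu : mx_charge X R m n) (x : X) : 'M[R]_(m, n) :=
  \matrix_(i, j) fine (('d (mu i j) '/d (mx_variation mu)) x).

Section distributions.
Variables (R : realType) (n : nat) (Om : set 'rV[R]_n).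

Definition pderive (j : 'I_n) (phi : 'rV[R]_n -> R) : 'rV[R]_n -> R :=
  fun x => 'D_(delta_mx 0 j) phi x.

(* C^infinity: all iterated partial derivatives are differentiable. *)
Definition smooth (phi : 'rV[R]_n -> R) :=
  forall (s : seq 'I_n) x, differentiable (foldr pderive phi s) x.

Definition test_function : set ('rV[R]_n -> R) := [set phi |
  [/\ smooth phi, compact (closure [set x | phi x != 0]) &
      closure [set x | phi x != 0] `<=` Om]].

(* A measure on Om is identified with its extension by 0 to R^n. *)
Definition concentrated (nu : {charge set 'rV[R]_n -> \bar R}) :=
  forall E, measurable E -> E `&` Om = set0 -> nu E = 0%E.

Section fields.
Variable m : nat.

(* Distributional gradient G and row-wise distributional divergence w on Om. *)
Definition is_wgrad (u : 'rV[R]_n -> 'rV[R]_m) (G : 'rV[R]_n -> 'M[R]_(m, n)) :=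
  forall phi, test_function phi -> forall i j,
    \int[lebesgue_rV R n]_(x in Om) (u x 0 i * pderive j phi x) =
    - \int[lebesgue_rV R n]_(x in Om) (G x i j * phi x).

Definition is_wdiv (z : 'rV[R]_n -> 'M[R]_(m, n)) (w : 'rV[R]_n -> 'rV[R]_m) :=
  forall phi, test_function phi -> forall i,
    \int[lebesgue_rV R n]_(x in Om) (\sum_j z x i j * pderive j phi x) =
    - \int[lebesgue_rV R n]_(x in Om) (w x 0 i * phi x).

Definition wdiv (z : 'rV[R]_n -> 'M[R]_(m, n)) : 'rV[R]_n -> 'rV[R]_m :=
  choose_or (cst 0) (L2 (lebesgue_rV R n) Om `&` is_wdiv z).


Variable A : 'M[R]_(m, n) -> 'M[R]_(m, n).

(* mu = A Du in the sense of distributions on Om: the matrix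
   (- \int u_i d_j phi)_ij is the value at phi of the distribution Du, and A acts
   on these values. *)
Definition is_Agrad (u : 'rV[R]_n -> 'rV[R]_m) (mu : mx_charge 'rV[R]_n R m n) :=
  (forall i j, concentrated (mu i j)) /\
  forall phi, test_function phi ->
    \matrix_(i, j) charge_integral (mu i j) phi =
    A (\matrix_(i, j) - \int[lebesgue_rV R n]_(x in Om) (u x 0 i * pderive j phi x)).

Definition BVA : set ('rV[R]_n -> 'rV[R]_m) :=
  [set u | L1 (lebesgue_rV R n) Om u /\ exists mu, is_Agrad u mu].

Definition Agrad (u : 'rV[R]_n -> 'rV[R]_m) : mx_charge 'rV[R]_n R m n :=
  choose_or (fun _ _ => czero : {charge set 'rV[R]_n -> \bar R}) (is_Agrad u).

Definition X2 : set ('rV[R]_n -> 'M[R]_(m, n)) := [set z |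
  [/\ Loo (lebesgue_rV R n) Om z, {ae lebesgue_rV R n, forall x, Om x -> A (z x) = z x} &
      exists2 w, L2 (lebesgue_rV R n) Om w & is_wdiv z w]].

(* Since only the row sums (div z)_i = sum_j d_j z_ij are functions, the term
   phi d_j z_ij u_i of the pairing appears summed over j. *)
Definition is_pairing (z : 'rV[R]_n -> 'M[R]_(m, n)) (u : 'rV[R]_n -> 'rV[R]_m)
    (nu : {charge set 'rV[R]_n -> \bar R}) :=
  concentrated nu /\
  forall phi, test_function phi -> charge_integral nu phi =
    - \int[lebesgue_rV R n]_(x in Om)
        (phi x * \sum_i wdiv z x 0 i * u x 0 i +
         \sum_i \sum_j pderive j phi x * z x i j * u x 0 i).

Definition pairing (z : 'rV[R]_n -> 'M[R]_(m, n)) (u : 'rV[R]_n -> 'rV[R]_m) :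
    {charge set 'rV[R]_n -> \bar R} :=
  choose_or (czero : {charge set 'rV[R]_n -> \bar R}) (is_pairing z u).

Definition theta (z : 'rV[R]_n -> 'M[R]_(m, n)) (u : 'rV[R]_n -> 'rV[R]_m) :
    'rV[R]_n -> \bar R :=
  ('d (pairing z u) '/d (mx_variation (Agrad u))).

End fields.

End distributions.

Definition boundary (T : topologicalType) (D : set T) := closure D `\` D°.

Section traces.
Variables (R : realType) (n m : nat) (Om : set 'rV[R]_n.+1).

(* a is the boundary value of phi at x in the sense of L^1 means over
   Om `&` B(x, r), r -> 0+. *)
Definition is_trace_at (phi : 'rV[R]_n.+1 -> 'rV[R]_m) (x : 'rV[R]_n.+1)
    (a : 'rV[R]_m) :=
  let B r := Om `&` [set y | frob (y - x) < r] in
  (fine (lebesgue_rV R n.+1 (B r)))^-1 * \int[lebesgue_rV R n.+1]_(y in B r) frob (phi y - a)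
    @[r --> 0^'+] --> 0.

Definition btrace (phi : 'rV[R]_n.+1 -> 'rV[R]_m) (x : 'rV[R]_n.+1) : 'rV[R]_m :=
  choose_or 0 (is_trace_at phi x).

Definition is_normal_trace (z : 'rV[R]_n.+1 -> 'M[R]_(m, n.+1))
    (w : 'rV[R]_n.+1 -> 'rV[R]_m) :=
  Loo (hausdorff_measure R n.+1 n) (boundary Om) w /\
  forall phi G,
    L1 (lebesgue_rV R n.+1) Om phi -> L2 (lebesgue_rV R n.+1) Om phi ->
    L1 (lebesgue_rV R n.+1) Om G -> is_wgrad Om phi G ->
    \int[lebesgue_rV R n.+1]_(x in Om) (frob_ip (wdiv Om z x) (phi x) + frob_ip (z x) (G x)) =
    \int[hausdorff_measure R n.+1 n]_(x in boundary Om) frob_ip (btrace phi x) (w x).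

(* Near each boundary point, and after the orthogonal change of coordinates
   y |-> y Q, the set Om is the strict epigraph of a Lipschitz function of the
   first n coordinates. *)
Definition lipschitz_boundary := forall x, boundary Om x ->
  exists (Q : 'M[R]_n.+1) (r k : R) (gamma : 'rV[R]_n -> R),
    [/\ Q *m Q^T = 1%:M, 0 < r, k.-lipschitz gamma &
      forall y, frob (y - x) < r ->
        Om y <-> gamma (col' ord_max (y *m Q)) < (y *m Q) 0 ord_max].
End traces.

Section functional.
Variables (R : realType) (m n : nat) (Om : set 'rV[R]_n).
Variable A : 'M[R]_(m, n) -> 'M[R]_(m, n).
Variable f : 'rV[R]_n -> 'M[R]_(m, n) -> R.

Definition fconjugate (x : 'rV[R]_n) (z : 'M[R]_(m, n)) : \bar R :=
  ereal_sup [set (frob_ip z y - f x y)%:E | y in [set: 'M[R]_(m, n)]].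

(* (x', t) with x' -> x inside closure Om and t -> +oo. *)
Definition recession_filter (x : 'rV[R]_n) : set_system ('rV[R]_n * R) :=
  filter_prod (within (closure Om) (nbhs x)) (pinfty_nbhs R).

Definition recession_quotient (y : 'M[R]_(m, n)) (p : 'rV[R]_n * R) : R :=
  p.2^-1 * f p.1 (p.2 *: y).

Definition finfty (x : 'rV[R]_n) (y : 'M[R]_(m, n)) : R :=
  lim (recession_quotient y @ recession_filter x).

Definition Zset : set ('rV[R]_n -> 'M[R]_(m, n)) := [set z | X2 Om A z /\
  (lebesgue_rV R n).-integrable Om (fun x => fconjugate x (z x))].

Definition Fdual (u : 'rV[R]_n -> 'rV[R]_m) : \bar R :=
  if `[< BVA Om A u >] then
    ereal_sup [set (\int[lebesgue_rV R n]_(x in Om) (- fconjugate x (z x)) +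
                    pairing Om z u Om)%E | z in Zset]
  else +oo%E.
End functional.

(* Subdifferential at u of G, defined on the subspace D of H carrying the inner
   product ip. *)
Definition subdiff (R : realType) (H : zmodType) (D : set H) (ip : H -> H -> R)
    (G : H -> \bar R) (u : H) : set H :=
  [set v | D v /\ forall w, D w -> ((ip v (w - u))%:E <= G w - G u)%E].

Definition L2_ip (R : realType) (m n : nat) (Om : set 'rV[R]_n)
    (v w : 'rV[R]_n -> 'rV[R]_m) : R :=
  \int[lebesgue_rV R n]_(x in Om) frob_ip (v x) (w x).

(* Main.v *)
(* Mollifying z makes the pairing (z, A u) an integral against A u; passing to the limit
   gives a bounded density th with respect to V = |A u|, equal to z : (A u)^a dx off a Lebesgue-null
   set N, and th <= finfty(x, s) V-a.e. where s is the polar density. Pushing inwards along the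
   Lipschitz boundary, the same argument yields (z, A u)(Om) = - int div z . u as soon as z has zero
   normal trace.

   (b) => (a): the pointwise conditions make z a maximizer in the definition of Fdual u, and the
   corresponding term is affine in u with slope r.

   (a) => (b): on Sobolev functions w, Fdual w <= int f(x, D w), so D w |-> int r . w lies below a
   convex functional on L^1 up to a constant. Its Hahn-Banach extension is the integral against a
   bounded field z; testing with Sobolev functions shows div z = - r and that the normal trace
   vanishes, and testing with simple functions that int f^*(x, z) is small enough for z to be a
   maximizer. Comparing z with z + phi (z0 - z), for constant z0 and a cutoff phi supported where
   f^*(x, z0) is bounded, gives z : a - f^*(z) >= z0 : a - f^*(z0) a.e. and th >= z0 : s on N;
   countably many z0 suffice, and the suprema over z0 are f(x, a) and finfty(x, s). *)

(* No approximation of [u] by smooth functions and no relaxation formula enters: in (a) => (b) the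
   subgradient inequality is tested with Sobolev functions only, and [u] survives just in the
   constant [c = int r . u - Fdual u]. As these functions need not vanish on the boundary, the zero
   normal trace comes out together with the divergence. Conversely, no trace theory is needed: a
   zero normal trace is tested with [phi e_i], [phi] smooth on the whole space, and then says that
   the extension of [z] by zero has the extension of [div z] by zero as its divergence.
   Mollification may therefore cross the boundary, provided that the kernel is moved off centre so
   that the mollified field stays supported in [Om]. The obstacle on the convex side is that the
   conjugate of [f] may be infinite at points arbitrarily close to one where it is finite. Since
   [wdiv], [Agrad] and [pairing] are chosen objects with default values, existence is proved first,
   and explicit representatives are identified with the chosen ones by testing. *)
Require Import Defs.
From HB Require Import structures.
From mathcomp Require Import all_boot all_order all_algebra.
From mathcomp Require Import all_classical all_reals all_analysis.
From mathcomp Require Import measurable_realfun.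
From mathcomp Require Import ring lra.

Set Implicit Arguments.
Unset Strict Implicit.
Unset Printing Implicit Defensive.

Import Order.TTheory GRing.Theory Num.Theory.
Import numFieldNormedType.Exports.

Local Open Scope classical_set_scope.
Local Open Scope ring_scope.

(** * Hahn-Banach extension below a convex function *)

Section hahn_banach.
Variables (R : realType) (V : lmodType R) (D : set V) (p : V -> R).
Hypothesis D_lin : forall (a : R) u v, D u -> D v -> D (a *: u + v).
Hypothesis p_conv : forall u v (t : R), D u -> D v -> 0 < t -> t < 1 ->
  p (t *: u + (1 - t) *: v) <= t * p u + (1 - t) * p v.

(** A partial linear functional is kept as a set of pairs, so that the union of a chain of
    extensions is a plain union of sets. *)
Let graph (G : set (V * R)) :=
  [/\ G (0, 0), (forall (a : R) u s v t, G (u, s) -> G (v, t) ->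
    G (a *: u + v, a * s + t)) & forall u s, G (u, s) -> D u /\ s <= p u].

(** A pair [(0, c)] with [c > 0] has the multiple [(0, p 0 + 1)], which violates domination at 0.
    Differences of two values at one point are of this form. *)
Lemma dominated_graph_fun G : graph G -> forall u s t, G (u, s) -> G (u, t) -> s = t.
Proof.
move=> [G0 GL Gp].
have H c : G (0, c) -> c <= 0.
  move=> Gc; rewrite leNgt; apply/negP => c0.
  have := GL ((p 0 + 1) / c) _ _ _ _ Gc G0.
  rewrite scaler0 !addr0 -mulrA mulVf ?gt_eqF// mulr1 => /Gp[_].
  by rewrite leNgt ltrDl ltr01.
move=> u s t us ut.
have K c : G (0, c) -> c = 0.
  move=> Gc; apply/eqP; rewrite eq_le H//= -oppr_le0; apply: H.
  by have := GL (- 1) _ _ _ _ Gc G0; rewrite scaler0 !addr0 mulN1r.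
have := GL (- 1) _ _ _ _ us ut; rewrite scaleN1r addNr => /K.
by rewrite mulN1r => /eqP; rewrite addrC subr_eq0 => /eqP.
Qed.

(** The value at [v0] has to lie above all slopes coming from [w - t v0] and below all those coming
    from [w' + t' v0]. Convexity of [p] orders the two families, so the supremum of the lower ones
    is admissible. *)
Lemma dominated_graph_extend G v0 : graph G -> D v0 -> exists c,
  graph [set x | exists w s (t : R), G (w, s) /\ x = (w + t *: v0, s + t * c)].
Proof.
move=> gG Dv0; have [G0 GL Gp] := gG.
have key w s t w' s' t' : 0 < t -> 0 < t' -> G (w, s) -> G (w', s') ->
    (s - p (w - t *: v0)) / t <= (p (w' + t' *: v0) - s') / t'.
  move=> t0 t'0 Gw Gw'.
  rewrite ler_pdivrMr// mulrAC ler_pdivlMr//.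
  have tt0 : 0 < t + t' by rewrite addr_gt0.
  have e1 : 1 - t' / (t + t') = t / (t + t') by field; rewrite gt_eqF.
  have [Dw _] := Gp _ _ Gw; have [Dw' _] := Gp _ _ Gw'.
  have D0 : D 0 by case: (Gp _ _ G0).
  have Dm : D (w - t *: v0).
    by rewrite addrC -scaleNr; exact: D_lin.
  have Dp : D (w' + t' *: v0) by rewrite addrC; exact: D_lin.
  (* With the weights [t' / (t + t')] and [t / (t + t')] the multiples of [v0] cancel, and the point
     lies in the domain of the graph. *)
  have := p_conv Dm Dp (divr_gt0 t'0 tt0).
  rewrite e1 ltr_pdivrMr// mul1r ltrDr => /(_ t0).
  rewrite (_ : _ + _ = (t' / (t + t')) *: w + (t / (t + t')) *: w'); last first.
    rewrite scalerDr scalerN !scalerA scalerDr scalerA.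
    rewrite (_ : t' / _ * t = t / (t + t') * t'); last by rewrite mulrAC [t' * t]mulrC mulrAC.
    by rewrite addrACA addNr addr0.
  have := GL (t' / (t + t')) _ _ _ _ Gw (GL (t / (t + t')) _ _ _ _ Gw' G0).
  rewrite !addr0 => /Gp[_]/le_trans/[apply].
  have e x y : t' / (t + t') * x + t / (t + t') * y = (t' * x + t * y) / (t + t').
    by ring.
  rewrite !e ler_pM2r ?invr_gt0//; lra.
pose S := [set x | exists w s t, [/\ 0 < t, G (w, s) & x = (s - p (w - t *: v0)) / t]].
have S0 : S !=set0 by exists ((0 - p (0 - 1 *: v0)) / 1), 0, 0, 1; split.
have Sub w' s' t' : 0 < t' -> G (w', s') -> ubound S ((p (w' + t' *: v0) - s') / t').
  by move=> t'0 G' x [w [s [t [t0 Gw ->]]]]; exact: key.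
have hS : has_ubound S by exists ((p (0 + 1 *: v0) - 0) / 1); exact: Sub.
exists (sup S); split.
- by exists 0, 0, 0; split => //; rewrite scale0r mul0r !addr0.
- move=> a _ _ _ _ [w [s [t [Gw [-> ->]]]]] [w' [s' [t' [Gw' [-> ->]]]]].
  exists (a *: w + w'), (a * s + s'), (a * t + t'); split; first exact: GL.
  by rewrite scalerDr scalerA scalerDl addrACA; congr (_, _); ring.
- move=> _ _ [w [s [t [Gw [-> ->]]]]].
  have [Dw sp] := Gp _ _ Gw; split; first by rewrite addrC; exact: D_lin.
  have [t0|t0|->] := ltgtP t 0; last by rewrite scale0r mul0r !addr0.
    have nt0 : 0 < - t by rewrite oppr_gt0.
    have : S ((s - p (w - (- t) *: v0)) / (- t)) by exists w, s, (- t).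
    move/(ub_le_sup hS); rewrite ler_pdivrMr// scaleNr opprK; lra.
  have := ge_sup S0 (Sub _ _ _ t0 Gw); rewrite ler_pdivlMr//; lra.
Qed.

(* The functional to be extended is given by its graph, single-valued by domination. *)
Theorem hahn_banach_graph (G : set (V * R)) : G (0, 0) ->
  (forall (a : R) u s v t, G (u, s) -> G (v, t) -> G (a *: u + v, a * s + t)) ->
  (forall u s, G (u, s) -> D u /\ s <= p u) ->
  exists L : V -> R, [/\ (forall (a : R) u v, D u -> D v -> L (a *: u + v) = a * L u + L v),
    (forall u, D u -> L u <= p u) & (forall u s, G (u, s) -> L u = s)].
Proof.
move=> G0 GL Gp; have gG : graph G by split.
have [|M [[MG|MG] maxM]] := @Zorn_bigcup _ (fun H : set (V * R) => H = set0 \/ (graph H /\ G `<=` H)).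
- move=> F FP Ftot.
  have [[X [FX X0]]|] := pselect (exists X, F X /\ X !=set0); last first.
    move=> Fe; left; apply/seteqP; split=> // x [X FX Xx].
    by apply: Fe; exists X; split => //; exists x.
  have P' Y : F Y -> Y !=set0 -> graph Y /\ G `<=` Y.
    by move=> FY [y Yy]; case: (FP _ FY) => // Y0; rewrite Y0 in Yy.
  right; have [[X00 XL Xp] GX] := P' _ FX X0; split.
    split; first by exists X.
    - move=> a u s v t [Y FY Yu] [Z FZ Zv].
      have [gY _] := P' _ FY (ex_intro _ _ Yu).
      have [gZ _] := P' _ FZ (ex_intro _ _ Zv).
      have [YZ|ZY] := Ftot _ _ FY FZ.
        by exists Z => //; case: gZ => _ + _; apply => //; exact: YZ.
      by exists Y => //; case: gY => _ + _; apply => //; exact: ZY.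
    - move=> u s [Y FY Yu].
      by have [[_ _ +] _] := P' _ FY (ex_intro _ _ Yu); apply.
  by move=> x Gx; exists X => //; exact: GX.
- exfalso; apply: (maxM G); last by right; split => //; exact: subset_refl.
  by rewrite MG; split=> // /(_ _ G0).
have [gM GM] := MG; have Mfun := dominated_graph_fun gM.
have MD u : D u -> exists s, M (u, s).
  move=> Du; apply: contrapT => nM.
  have [c gc] := dominated_graph_extend gM Du.
  have [M00 ML Mp] := gM.
  have sub : M `<=` [set x | exists w s (t : R), M (w, s) /\ x = (w + t *: u, s + t * c)].
    by move=> [w s] Mw; exists w, s, 0; split; rewrite // scale0r mul0r !addr0.
  apply: (maxM _ _ (or_intror (conj gc (subset_trans GM sub)))).
  split => // /(_ (u, c)) H; apply: nM; exists c; apply: H.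
  by exists 0, 0, 1; split; rewrite // scale1r mul1r !add0r.
have /choice[L HL] : forall u, exists s, D u -> M (u, s).
  move=> u; have [Du|nD] := pselect (D u); last by exists 0.
  by have [s Ms] := MD u Du; exists s.
have [M00 ML Mp] := gM.
exists L; split.
- move=> a u v Du Dv; apply: (Mfun (a *: u + v)).
    by apply: HL; exact: D_lin.
  by apply: ML; exact: HL.
- by move=> u Du; have [] := Mp _ _ (HL _ Du).
- move=> u s Gu; have [Du _] := Gp _ _ Gu.
  by apply: (Mfun u); [exact: HL|exact: GM].
Qed.

End hahn_banach.

Lemma linear_mx_frob_ip (R : realType) (m n : nat) (L : 'M[R]_(m, n) -> R) :
  (forall (a : R) u v, L (a *: u + v) = a * L u + L v) ->
  forall y, L y = frob_ip (\matrix_(i, j) L (delta_mx i j)) y.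
Proof.
move=> Llin y.
have L0 : L 0 = 0 by have := Llin 1 0 0; rewrite scaler0 addr0 mul1r; lra.
have LZ a u : L (a *: u) = a * L u by have := Llin a u 0; rewrite !addr0 L0 addr0.
have LD u v : L (u + v) = L u + L v by have := Llin 1 u v; rewrite scale1r mul1r.
rewrite {1}(matrix_sum_delta y) /frob_ip.
rewrite (big_morph L LD L0); apply: eq_bigr => i _.
rewrite (big_morph L LD L0); apply: eq_bigr => j _.
by rewrite LZ mxE mulrC.
Qed.

(** Hahn-Banach from the zero subspace, below [h |-> g (y + h) - g y]: the resulting linear
    functional is the subgradient. *)
Lemma convex_subgradient (R : realType) (m n : nat) (g : 'M[R]_(m, n) -> R) :
  (forall u v (t : R), 0 < t -> t < 1 ->
    g (t *: u + (1 - t) *: v) <= t * g u + (1 - t) * g v) ->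
  forall y, exists p, forall y', g y + frob_ip p (y' - y) <= g y'.
Proof.
move=> gconv y.
have [||||u s [-> ->]|L [Llin Lp _]] := @hahn_banach_graph R 'M[R]_(m, n) setT
    (fun h => g (y + h) - g y) _ _ [set (0, 0)].
- by [].
- move=> u v t _ _ t0 t1 /=.
  have := gconv (y + u) (y + v) t t0 t1.
  rewrite (_ : t *: (y + u) + (1 - t) *: (y + v) = y + (t *: u + (1 - t) *: v)); first lra.
  by rewrite !scalerDr addrACA -scalerDl subrKC scale1r.
- by [].
- by move=> a u s v t /= [-> ->] [-> ->]; rewrite scaler0 mulr0 !addr0.
- by split => //; rewrite addr0 subrr.
exists (\matrix_(i, j) L (delta_mx i j)) => y'.
rewrite -linear_mx_frob_ip; last by move=> a u v; exact: Llin.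
by have := Lp (y' - y) I; rewrite subrKC; lra.
Qed.

(** * Smooth functions and bumps *)

Section smooth_functions.
Variables (R : realType) (n : nat).
Implicit Types f g phi : 'rV[R]_n -> R.

(** Coinduction for [smooth]: differentiability of one function propagates to all iterated
    derivatives once the class is stable under them. *)
Lemma smooth_class (C : set ('rV[R]_n -> R)) :
  (forall f, C f -> forall x, differentiable f x) ->
  (forall f j, C f -> C (pderive j f)) -> C `<=` @smooth R n.
Proof.
move=> Cd CD f Cf s; suff : C (foldr (@pderive R n) f s) by exact: Cd.
by elim: s => //= j s; exact: CD.
Qed.

Lemma smooth_differentiable f x : smooth f -> differentiable f x.
Proof. by move=> /(_ [::] x). Qed.

Lemma smooth_pderive f j : smooth f -> smooth (pderive j f).
Proof. by move=> sf s x; have := sf (rcons s j) x; rewrite foldr_rcons. Qed.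

(** The derivative of a product is a sum of products. The algebra generated by smooth functions is
    therefore a class to which [smooth_class] applies, whereas the set of products alone is not. *)
Inductive smooth_alg : ('rV[R]_n -> R) -> Prop :=
| SmoothBase f of smooth f : smooth_alg f
| SmoothAdd f g of smooth_alg f & smooth_alg g : smooth_alg (f + g)
| SmoothMul f g of smooth_alg f & smooth_alg g : smooth_alg (f * g).

Let smooth_alg_diff f : smooth_alg f -> forall x, differentiable f x.
Proof.
by elim=> [g sg x|g h _ dg _ dh x|g h _ dg _ dh x];
  [exact: smooth_differentiable|exact: differentiableD|exact: differentiableM].
Qed.

Lemma pderiveD f g j : (forall x, differentiable f x) -> (forall x, differentiable g x) ->
  pderive j (f + g) = pderive j f + pderive j g.
Proof. by move=> df dg; apply/funext => x; rewrite /pderive deriveD; [|exact: diff_derivable..]. Qed.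

Lemma pderiveM f g j : (forall x, differentiable f x) -> (forall x, differentiable g x) ->
  pderive j (f * g) = f * pderive j g + g * pderive j f.
Proof. by move=> df dg; apply/funext => x; rewrite /pderive deriveM; [|exact: diff_derivable..]. Qed.

Let smooth_alg_sub : smooth_alg `<=` @smooth R n.
Proof.
apply: smooth_class => // f j; elim=> [g sg|g h sg dg sh dh|g h sg dg sh dh].
- exact/SmoothBase/smooth_pderive.
- by rewrite pderiveD; [exact: SmoothAdd|exact: smooth_alg_diff..].
- rewrite pderiveM; [|exact: smooth_alg_diff..].
  by apply: SmoothAdd; exact: SmoothMul.
Qed.

Lemma smoothD f g : smooth f -> smooth g -> smooth (f + g).
Proof. by move=> sf sg; apply: smooth_alg_sub; exact/SmoothAdd/SmoothBase/sg/SmoothBase. Qed.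

Lemma smoothM f g : smooth f -> smooth g -> smooth (f * g).
Proof. by move=> sf sg; apply: smooth_alg_sub; exact/SmoothMul/SmoothBase/sg/SmoothBase. Qed.

Lemma pderive_cst (c : R) j : pderive j (cst c : 'rV[R]_n -> R) = cst 0.
Proof. by apply/funext => x; rewrite /pderive derive_cst. Qed.

Lemma smooth_cst (c : R) : smooth (cst c : 'rV[R]_n -> R).
Proof.
apply: (@smooth_class [set f | exists c, f = cst c]); last by exists c.
  by move=> _ [k ->] x; exact: differentiable_cst.
by move=> _ j [k ->]; rewrite pderive_cst; exists 0.
Qed.

Lemma smooth_prod (I : Type) (r : seq I) (P : pred I) (F : I -> 'rV[R]_n -> R) :
  (forall i, P i -> smooth (F i)) -> smooth (\prod_(i <- r | P i) F i).
Proof.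
by move=> sF; elim/big_ind : _ => //; [exact: smooth_cst|exact: smoothM].
Qed.

End smooth_functions.

(** * A function that is flat at the origin *)

Section flat_function.
Variable R : realType.
Implicit Types P : {poly R}.

(** This is P(1/x) exp(-1/x) on the positive axis. The polynomial factor makes the family stable
    under derivation. *)
Definition flat P (x : R) := if 0 < x then P.[x^-1] * expR (- x^-1) else 0.

Lemma flat_neg P x : x <= 0 -> flat P x = 0.
Proof. by rewrite /flat leNgt => /negbTE ->. Qed.

(** With y = 1/x >= 1, the polynomial is at most the sum of its absolute coefficients times y^d, and
    the exponential series gives exp(-y) <= (d+2)! / y^(d+2). The remaining factor x^2 is what makes
    the derivative at 0 vanish. *)
Lemma flat_bound P : exists2 C : R, 0 < C & forall x, 0 <= x -> x < 1 ->
  `|flat P x| <= C * x ^+ 2.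
Proof.
pose d := size P.
exists ((\sum_(i < d) `|P`_i|) * (d + 2)`!%:R + 1).
  rewrite ltr_wpDl// mulr_ge0//; exact: sumr_ge0.
move=> x x0 x1; have [x_gt0|xle] := ltP 0 x; last first.
  rewrite flat_neg// normr0 mulr_ge0 ?sqr_ge0//.
  rewrite addr_ge0// mulr_ge0//; exact: sumr_ge0.
have y1 : 1 <= x^-1 by rewrite invr_ge1 ?ltW// unitfE gt_eqF.
set y := x^-1 in y1 *.
have y0 : 0 < y by exact: lt_le_trans y1.
rewrite /flat x_gt0 -/y normrM [`|expR _|]ger0_norm ?expR_ge0//.
have Pb : `|P.[y]| <= (\sum_(i < d) `|P`_i|) * y ^+ d.
  rewrite horner_coef (le_trans (ler_norm_sum _ _ _))// mulr_suml.
  apply: ler_sum => i _; rewrite normrM ler_wpM2l// ger0_norm ?exprn_ge0 ?(ltW y0)//.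
  by rewrite ler_weXn2l// ltnW.
have eb : expR (- y) <= (d + 2)`!%:R / y ^+ (d + 2).
  rewrite expRN -[leRHS]invf_div lef_pV2 ?posrE ?expR_gt0//; last first.
    by rewrite divr_gt0 ?exprn_gt0// ltr0n fact_gt0.
  rewrite !addn2; apply: le_trans (expR_ge1Dxn d.+1 (ltW y0)).
  by rewrite lerDr.
apply: (@le_trans _ _ (((\sum_(i < d) `|P`_i|) * (d + 2)`!%:R) * x ^+ 2)); last first.
  by rewrite ler_wpM2r ?sqr_ge0// lerDl.
apply: (le_trans (ler_pM _ _ Pb eb)); rewrite ?expR_ge0//.
have -> : x ^+ 2 = (y ^+ 2)^-1 by rewrite /y exprVn invrK.
rewrite exprD le_eqVlt; apply/orP; left; apply/eqP.
by clearbody y; field; rewrite expf_neq0 gt_eqF.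
Qed.

(** For x > 0 the chain rule brings out the factor x^-2, which becomes ['X^2] in the variable 1/x.
    At 0 the quotient is controlled by [flat_bound]. *)
Lemma is_derive_flat P (x : R) : is_derive x (1 : R) (flat P) (flat ('X^2 * (P - P^`())) x).
Proof.
have [x0|x0|->] := ltgtP x 0.
- rewrite (flat_neg _ (ltW x0)).
  apply: (@near_eq_is_derive _ _ _ (cst 0) _ x (1 : R)).
  near=> y; rewrite flat_neg//; near: y; exact: lt_le_nbhsl.
- have xn0 : x != 0 by rewrite gt_eqF.
  have -> : flat ('X^2 * (P - P^`())) x =
      P.[x^-1] * (expR (- x^-1) * (- - x ^- 2)) + expR (- x^-1) * (P^`().[x^-1] * (- x ^- 2)).
    by rewrite /flat x0 hornerM hornerD hornerN hornerXn exprVn; ring.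
  apply: (@near_eq_is_derive _ _ _ (fun y : R => P.[y^-1] * expR (- y^-1)) _ x (1 : R)).
  + near=> y; rewrite /flat; case: ifPn => // /negP[]; near: y; exact: lt_nbhsr.
  + have dV : is_derive x 1 (fun y : R => y^-1) (- x ^- 2).
      have := @realfun.is_deriveV _ id x 1 1 xn0 (is_derive_id x 1).
      by rewrite /GRing.scale/= mulr1.
    have dN : is_derive x 1 (fun y : R => - y^-1) (- - x ^- 2) by exact: is_deriveN.
    have d1 := @is_derive1_comp _ (horner P) (fun y => y^-1) x _ _ (is_derive_poly P x^-1) dV.
    have d2 := @is_derive1_comp _ expR (fun y => - y^-1) x _ _ (is_derive_expR (- x^-1)) dN.
    exact: (is_deriveM d1 d2).
- rewrite flat_neg//; have [C C0 HC] := flat_bound P.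
  suff H : (fun h : R => h^-1 *: (flat P (h *: 1 + 0) - flat P 0)) @ 0^' --> (0 : R).
    by apply: DeriveDef; [apply/cvg_ex; exists 0|exact: cvg_lim].
  apply/cvgrPdist_le => e e0; near=> h.
  rewrite sub0r normrN addr0 (flat_neg _ (lexx 0)) subr0 /GRing.scale/= mulr1.
  have h0 : h != 0 by near: h; exact: nbhs_dnbhs_neq.
  have h1 : `|h| < 1.
    by near: h; apply: dnbhs0_lt.
  have he : `|h| < e / C by near: h; apply: dnbhs0_lt; rewrite divr_gt0.
  have [hle|hgt] := leP h 0; first by rewrite flat_neg// mulr0 normr0 ltW.
  have := HC h (ltW hgt); rewrite -{1}(gtr0_norm hgt) => /(_ h1) Hh.
  rewrite normrM normfV (gtr0_norm hgt) mulrC ler_pdivrMr//.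
  apply: (le_trans Hh); rewrite expr2 mulrA ler_wpM2r ?(ltW hgt)//.
  by rewrite mulrC -ler_pdivlMr// -(gtr0_norm hgt) ltW.
Unshelve. all: by end_near. Qed.

Lemma flat1_gt0 x : (0 < flat 1 x) = (0 < x).
Proof.
rewrite /flat; case: ifPn => x0; first by rewrite hornerC mul1r expR_gt0.
by rewrite ltxx.
Qed.

Lemma flat1_ge0 x : 0 <= flat 1 x.
Proof. by have [x0|/flat_neg->//] := ltP 0 x; rewrite ltW// flat1_gt0. Qed.

Lemma flat1_le1 x : flat 1 x <= 1.
Proof.
rewrite /flat; case: ifPn => // x0.
by rewrite hornerC mul1r expR_le1 oppr_le0 invr_ge0 ltW.
Qed.

End flat_function.

(** * Bump functions on cubes *)

Section bumps.
Variables (R : realType) (n : nat).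
Implicit Types (a x y : 'rV[R]_n) (s : R).

Lemma pderive_comp1 (g dg : R -> R) (c e : R) (i j : 'I_n) :
  (forall x : R, is_derive x (1 : R) g (dg x)) ->
  (forall x : 'rV[R]_n, differentiable (fun x : 'rV[R]_n => g (c + e * x 0 i)) x) /\
  pderive j (fun x : 'rV[R]_n => g (c + e * x 0 i)) =
    (fun x => (if i == j then e else 0) * dg (c + e * x 0 i)).
Proof.
move=> Hg; pose l (x : 'rV[R]_n) := c + e * x 0 i.
have dgx (x : R) : differentiable g x by apply/derivable1_diffP; case: (Hg x).
have dl x : differentiable l x.
  by apply: differentiableD => //; apply: differentiableM => //; exact: differentiable_coord.
have dgl x : differentiable (g \o l) x by exact: differentiable_comp.
split=> [//|]; apply/funext => x; rewrite /pderive -[fun _ => _]/(g \o l).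
rewrite deriveE//= diff_comp//=.
have -> : 'd l x (delta_mx 0 j) = (if i == j then e else 0).
  rewrite -deriveE//; apply: cvg_lim => //; apply: cvg_near_cst.
  near=> h; rewrite /= /shift/= /l !mxE eqxx/= /GRing.scale/=.
  have h0 : h != 0 by near: h; exact: nbhs_dnbhs_neq.
  by case: eqP => _ /=; field.
have -> : 'd g (l x) (if i == j then e else 0) = (if i == j then e else 0) * 'd g (l x) (1 : R).
  by rewrite -[in LHS](mulr1 (if i == j then e else 0)) -linearZ.
by rewrite -deriveE//; case: (Hg (l x)) => _ ->.
Unshelve. all: by end_near. Qed.

Lemma smooth_flat_coord P (c e : R) (i : 'I_n) :
  smooth (fun x : 'rV[R]_n => flat P (c + e * x 0 i)).
Proof.
apply: (@smooth_class _ _ [set f | exists P, f = fun x : 'rV[R]_n => flat P (c + e * x 0 i)]);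
  last by exists P.
- move=> _ [Q ->]; exact: (pderive_comp1 c e i i (@is_derive_flat R Q)).1.
- move=> _ j [Q ->]; rewrite (pderive_comp1 c e i j (@is_derive_flat R Q)).2.
  exists ((if i == j then e else 0) *: ('X^2 * (Q - Q^`()))); apply/funext => x.
  rewrite /flat; case: ltP => _; last by rewrite mulr0.
  by rewrite [in RHS]hornerZ mulrA.
Qed.

(** Positive exactly on the open cube of half side [s] about [a], which for [s > 0] is a ball of the
    sup norm. Each factor is affine in one coordinate, the form required by [smooth_flat_coord]. *)
Definition bump (a : 'rV[R]_n) (s : R) : 'rV[R]_n -> R :=
  \prod_(j < n) ((fun x : 'rV[R]_n => flat 1 (s - a 0 j + 1 * x 0 j)) *
                 (fun x : 'rV[R]_n => flat 1 (s + a 0 j + (- 1) * x 0 j))).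

Lemma bumpE a s x : bump a s x =
  \prod_(j < n) (flat 1 (s + (x 0 j - a 0 j)) * flat 1 (s - (x 0 j - a 0 j))).
Proof.
rewrite /bump (big_morph (fun f : 'rV[R]_n -> R => f x) (id1 := 1) (op1 := *%R))//.
by apply: eq_bigr => j _; congr (flat 1 _ * flat 1 _); ring.
Qed.

Lemma smooth_bump a s : smooth (bump a s).
Proof. by apply: smooth_prod => i _; apply: smoothM; exact: smooth_flat_coord. Qed.

Lemma bump_ge0 a s x : 0 <= bump a s x.
Proof. by rewrite bumpE; apply: prodr_ge0 => j _; rewrite mulr_ge0// flat1_ge0. Qed.

Lemma bump_le1 a s x : bump a s x <= 1.
Proof.
rewrite bumpE.
suff /andP[] : 0 <= \prod_(j < n) (flat 1 (s + (x 0 j - a 0 j)) * flat 1 (s - (x 0 j - a 0 j))) <= 1 by [].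
elim/big_ind : _ => [|u v /andP[u0 u1] /andP[v0 v1]|j _]; first by rewrite ler01 lexx.
  by rewrite mulr_ge0// mulr_ile1.
by rewrite mulr_ge0 ?flat1_ge0// mulr_ile1 ?flat1_ge0 ?flat1_le1.
Qed.

Lemma bump_gt0 a s x : (forall j, `|x 0 j - a 0 j| < s) -> 0 < bump a s x.
Proof.
move=> H; rewrite bumpE; apply: prodr_gt0 => j _.
by have := H j; rewrite ltr_norml => /andP[? ?]; rewrite mulr_gt0// flat1_gt0; lra.
Qed.

Lemma bump_eq0 a s x j : s <= `|x 0 j - a 0 j| -> bump a s x = 0.
Proof.
move=> H; rewrite bumpE (bigD1 j)//=.
suff -> : flat 1 (s + (x 0 j - a 0 j)) * flat 1 (s - (x 0 j - a 0 j)) = 0 by rewrite mul0r.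
move: H; rewrite ler_normr => /orP[|] H; first by rewrite (@flat_neg _ _ (s - _)) ?mulr0//; lra.
by rewrite flat_neg ?mul0r//; lra.
Qed.

Lemma bump_sym a s x y : bump a s (x - y) = bump (x - a) s y.
Proof.
rewrite !bumpE; apply: eq_bigr => j _; rewrite !mxE mulrC.
by congr (flat 1 _ * flat 1 _); ring.
Qed.

Lemma bump_shift a s x y : bump a s (x + y) = bump (a - y) s x.
Proof.
rewrite !bumpE; apply: eq_bigr => j _; rewrite !mxE.
by congr (flat 1 _ * flat 1 _); ring.
Qed.

End bumps.

(** * Translation invariance of Lebesgue measure *)

Section lebesgue_shift.
Variable R : realType.

Lemma measurable_rV_shift n (h : 'rV[R]_n) :
  measurable_fun setT (fun x : 'rV[R]_n => x + h).
Proof.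
apply: measurable_fun_mx => i j; under eq_fun do rewrite mxE.
by apply: measurable_funD => //; exact: measurable_mx_coord.
Qed.

Lemma lebesgue_measure_shift (h : R) (A : set R) : measurable A ->
  lebesgue_measure ((fun x : measurableTypeR R => x + h) @^-1` A) = lebesgue_measure A.
Proof.
move=> mA.
have mf : @measurable_fun _ _ (measurableTypeR R) (measurableTypeR R) setT (fun x : R => x + h).
  exact: (@measurable_funD _ (measurableTypeR R) R setT id (cst h)).
pose f : {mfun measurableTypeR R >-> measurableTypeR R} :=
    @mfun_Sub _ _ (measurableTypeR R) (measurableTypeR R) _ (mem_set mf).
rewrite [RHS](@lebesgue_measure_unique _ (pushforward lebesgue_measure f))//.
move=> _ [[a b] _ <-]; rewrite /pushforward.
transitivity (lebesgue_measure (`]a - h, b - h]%classic : set R)); last first.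
  congr (_ _); apply/seteqP; split=> x; rewrite /= !in_itv/= ltrBlDr lerBrDr//.
by rewrite !lebesgue_measure_itv/= !lte_fin ltrD2r; case: ifP => // _; congr (_%:E); ring.
Qed.

Lemma rV_consD n (p q : measurableTypeR R * 'rV[R]_n) :
  rV_cons p + rV_cons q = rV_cons (p.1 + q.1 : measurableTypeR R, p.2 + q.2).
Proof.
rewrite /rV_cons; apply: etrans (@add_row_mx _ 1 1 n _ _ _ _) _.
by congr (row_mx _ _); apply/rowP => i; rewrite !mxE.
Qed.

Lemma rV_cons_rshift n (p : measurableTypeR R * 'rV[R]_n) (k : 'I_n) :
  rV_cons p 0 (rshift 1 k) = p.2 0 k.
Proof. exact: etrans (row_mxEr _ _ _ _) _. Qed.

(** By induction on the dimension: the translated measure agrees with the product measure on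
    rectangles, and product measures are determined there. *)
Lemma lebesgue_rV_shift n (h : 'rV[R]_n) (E : set 'rV[R]_n) : measurable E ->
  lebesgue_rV R n ((fun x => x + h) @^-1` E) = lebesgue_rV R n E.
Proof.
elim: n h E => [|n IH] h E mE.
  congr (_ _); apply/seteqP; split=> x /=; rewrite (_ : x + h = x)//;
    by apply/rowP => -[].
pose h' : measurableTypeR R * 'rV[R]_n := rV_uncons h.
pose sh (p : measurableTypeR R * 'rV[R]_n) : measurableTypeR R * 'rV[R]_n :=
  (p.1 + h'.1, p.2 + h'.2).
have msh : measurable_fun setT sh.
  apply: measurable_fun_pair; last first.
    by apply: measurableT_comp (measurable_rV_shift _) _; exact: measurable_snd.
  apply: (measurableT_comp (f := fun x : measurableTypeR R => x + h'.1 : measurableTypeR R)).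
    exact: (@measurable_funD _ (measurableTypeR R) R setT id (cst h'.1)).
  exact: measurable_fst.
pose f : {mfun (measurableTypeR R * 'rV[R]_n)%type >-> (measurableTypeR R * 'rV[R]_n)%type} :=
  mfun_Sub (mem_set msh).
have -> : lebesgue_rV R n.+1 E = (lebesgue_measure \x lebesgue_rV R n)%E (@rV_cons R n @^-1` E) by [].
have -> : lebesgue_rV R n.+1 ((fun x => x + h) @^-1` E) =
    pushforward (lebesgue_measure \x lebesgue_rV R n)%E f (@rV_cons R n @^-1` E).
  rewrite /= /lebesgue_rV_step /pushforward; congr (_ _).
  by apply/seteqP; split=> -[x v]; rewrite /preimage/= /sh/= -(rV_consD (x, v) h') rV_unconsK.
have mE' : measurable (@rV_cons R n @^-1` E).
  by rewrite -[X in measurable X]setTI; apply: measurable_rV_cons.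
apply/esym; apply: product_measure_unique => // A B mA mB.
transitivity ((lebesgue_measure \x lebesgue_rV R n)%E
  (((fun x : measurableTypeR R => x + h'.1) @^-1` A) `*` ((fun x => x + h'.2) @^-1` B))) => //.
rewrite product_measure1E; first by rewrite IH//; congr (_ * _)%E; exact: lebesgue_measure_shift.
  rewrite -[X in measurable X]setTI.
  exact: (@measurable_funD _ (measurableTypeR R) R setT id (cst h'.1)).
by rewrite -[X in measurable X]setTI; exact: measurable_rV_shift.
Qed.

(** Balls are those of the sup norm, hence cubes of side [2 r]. *)
Lemma lebesgue_rV_ball n (a : 'rV[R]_n) (r : R) : 0 < r ->
  lebesgue_rV R n (ball a r) = ((r *+ 2) ^+ n)%:E.
Proof.
move=> r0; elim: n a => [|n IH] a.
  by rewrite /= diracE mem_set//; split=> // i [].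
have := lebesgue_measure_ball (rV_uncons a).1 (ltW r0).
have mb : measurable (ball (rV_uncons a).2 r) by apply: open_measurable_mx; exact: ball_open.
rewrite exprS EFinM -(IH (rV_uncons a).2) => <-.
rewrite -product_measure1E//; last exact: measurable_ball.
rewrite /= /lebesgue_rV_step /pushforward; congr (_ _).
apply/seteqP; split=> -[x v]; rewrite /= /ball/=.
  case=> _ H; split.
    by have := H 0 0; rewrite (congr1 fst (rV_consK (x, v)) : rV_cons (x, v) 0 0 = x).
  split=> // i j; have := H i (rshift 1 j).
  by rewrite !ord1 rV_cons_rshift mxE.
case=> H0 [_ H]; split=> // i j; rewrite ord1.
case: (split_ordP (j : 'I_(1 + n))) => k ->.
  have -> : lshift n k = 0 by apply/val_inj; rewrite ord1.
  by rewrite (congr1 fst (rV_consK (x, v)) : rV_cons (x, v) 0 0 = x).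
by rewrite rV_cons_rshift; have := H 0 k; rewrite mxE.
Qed.

End lebesgue_shift.

(** * Test functions and density *)

Section real_integrals.
Context d (T : measurableType d) (R : realType).
Variables (mu : {measure set T -> \bar R}) (D : set T).
Hypothesis mD : measurable D.
Implicit Types f g h : T -> R.
Local Notation rint f := (mu.-integrable D (EFin \o f)).

Lemma rint_measurable f : rint f -> measurable_fun D f.
Proof. by move=> fi; apply/measurable_EFinP; exact: (measurable_int mu). Qed.

Lemma rintD f g : rint f -> rint g -> rint (fun x => f x + g x).
Proof. exact: integrableD. Qed.

Lemma rintN f : rint f -> rint (fun x => - f x).
Proof. exact: integrableN. Qed.

Lemma rintB f g : rint f -> rint g -> rint (fun x => f x - g x).
Proof. exact: integrableB. Qed.

Lemma rintZ k f : rint f -> rint (fun x => k * f x).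
Proof. exact: integrableZl. Qed.

Lemma rint_norm f : rint f -> rint (fun x => `|f x|).
Proof. exact: integrable_norm. Qed.

Lemma rint0 : rint (fun=> 0).
Proof. exact: integrable0. Qed.

Lemma rint_le f g : measurable_fun D f -> (forall x, D x -> `|f x| <= g x) ->
  rint g -> rint f.
Proof.
move=> mf fg ig; apply: (le_integrable mD _ _ ig); first exact/measurable_EFinP.
move=> x Dx; rewrite lee_fin (le_trans (fg _ Dx))//; exact: ler_norm.
Qed.

Lemma rint_bddM f h M : rint f -> measurable_fun D h ->
  (forall x, D x -> `|h x| <= M) -> rint (fun x => h x * f x).
Proof.
move=> fi mh hM; apply: (@rint_le _ (fun x => M * `|f x|)).
- by apply: measurable_funM => //; exact: rint_measurable.
- by move=> x Dx; rewrite normrM ler_wpM2r// hM.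
- exact/rintZ/rint_norm.
Qed.

Lemma rint_bdd h M : (mu D < +oo)%E -> measurable_fun D h ->
  (forall x, D x -> `|h x| <= M) -> rint h.
Proof.
move=> Doo mh hM; apply: measurable_bounded_integrable => //.
exists M; split; first exact: num_real.
by move=> N MN x Dx; exact: le_trans (hM _ Dx) (ltW MN).
Qed.

Lemma eq_rint f g : (forall x, D x -> f x = g x) -> rint f -> rint g.
Proof.
move=> fg; apply: eq_integrable => // x; rewrite inE => Dx /=.
by rewrite fg.
Qed.

Lemma rint_sum (I : Type) (s : seq I) (P : pred I) (F : I -> T -> R) :
  (forall i, P i -> rint (F i)) -> rint (fun x => \sum_(i <- s | P i) F i x).
Proof.
move=> Fi; elim: s => [|i s IH].
  by apply: eq_rint rint0 => x _; rewrite big_nil.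
case Pi : (P i); last by apply: eq_rint IH => x _; rewrite big_cons Pi.
by apply: eq_rint (rintD (Fi _ Pi) IH) => x _; rewrite big_cons Pi.
Qed.

Lemma Rintegral_sum (I : Type) (s : seq I) (P : pred I) (F : I -> T -> R) :
  (forall i, P i -> rint (F i)) ->
  \int[mu]_(x in D) (\sum_(i <- s | P i) F i x) =
  \sum_(i <- s | P i) \int[mu]_(x in D) F i x.
Proof.
move=> Fi; elim: s => [|i s IH].
  rewrite big_nil; under eq_Rintegral do rewrite big_nil.
  by rewrite Rintegral_cst// mul0r.
rewrite big_cons -IH; case Pi : (P i).
  rewrite -RintegralD//; [|exact: Fi|exact: rint_sum].
  by apply: eq_Rintegral => x _; rewrite big_cons Pi.
by apply: eq_Rintegral => x _; rewrite big_cons Pi.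
Qed.

Lemma RintegralN f : rint f -> \int[mu]_(x in D) (- f x) = - \int[mu]_(x in D) f x.
Proof.
move=> fi; under eq_Rintegral do rewrite -mulN1r.
by rewrite RintegralZl// mulN1r.
Qed.

Lemma le_norm_Rintegral f g : rint f -> rint g -> (forall x, D x -> `|f x| <= g x) ->
  `|\int[mu]_(x in D) f x| <= \int[mu]_(x in D) g x.
Proof.
move=> fi gi fg; rewrite (le_trans (le_normr_Rintegral _ _))//.
by apply: le_Rintegral => //; exact: rint_norm.
Qed.

Lemma RintegralE f : rint f -> ((\int[mu]_(x in D) f x)%:E = \int[mu]_(x in D) (f x)%:E)%E.
Proof. by move=> fi; rewrite /Rintegral fineK//; exact: integrable_fin_num. Qed.

End real_integrals.

Section test_functions.
Variables (R : realType) (n : nat).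
Implicit Types (phi eta psi : 'rV[R]_n -> R) (Om U : set 'rV[R]_n).

Lemma smooth_continuous phi : smooth phi -> continuous phi.
Proof. by move=> sp x; apply/differentiable_continuous/smooth_differentiable. Qed.

Lemma continuous_rV_measurable phi : continuous phi -> measurable_fun setT phi.
Proof.
move=> cphi; apply: (measurability _ (RGenOpens.measurableE R)).
move=> _ [_ [a [b ->]] <-]; rewrite setTI; apply: open_measurable_mx.
by move: cphi => /continuousP; apply; exact: interval_open.
Qed.

Lemma smooth_measurable phi (D : set 'rV[R]_n) : smooth phi -> measurable_fun D phi.
Proof. by move=> sp; apply: measurable_funTS; apply: continuous_rV_measurable; exact: smooth_continuous. Qed.

Lemma test_functionS Om U : Om `<=` U -> @test_function R n Om `<=` test_function U.
Proof. by move=> OU phi [? ? ?]; split => //; exact: subset_trans OU. Qed.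

Lemma test_function_supp Om phi eta : smooth eta -> test_function Om phi ->
  (forall x, phi x = 0 -> eta x = 0) -> test_function Om eta.
Proof.
move=> se [sp cp pO] pe; have S : closure [set x | eta x != 0] `<=` closure [set x | phi x != 0].
  by apply: closure_subset => x /=; apply: contra => /eqP /pe ->.
split => //; last exact: subset_trans pO.
by apply: subclosed_compact cp S; exact: closed_closure.
Qed.

Lemma test_functionM Om phi eta : test_function Om phi -> smooth eta ->
  test_function Om (phi * eta).
Proof.
move=> tp se; apply: (test_function_supp _ tp); first by case: tp => sp _ _; exact: smoothM.
by move=> x /= px; rewrite /GRing.mul/= px mul0r.
Qed.

Lemma test_functionZ Om k phi : test_function Om phi -> test_function Om (fun x => k * phi x).
Proof.
move=> tp; rewrite (_ : (fun x => _) = phi * cst k).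
  by apply: test_functionM => //; exact: smooth_cst.
by apply/funext => x; rewrite /GRing.mul/= mulrC.
Qed.

Lemma test_functionD Om phi eta : test_function Om phi -> test_function Om eta ->
  test_function Om (phi + eta).
Proof.
move=> [sp cp pO] [se ce eO].
have S : closure [set x | (phi + eta) x != 0] `<=`
    closure [set x | phi x != 0] `|` closure [set x | eta x != 0].
  rewrite -closureU; apply: closure_subset => x /=; rewrite /GRing.add/= => H.
  have [p0|] := eqVneq (phi x) 0; last by left.
  by right; move: H; rewrite p0 add0r.
split; first exact: smoothD.
  by apply: subclosed_compact (compactU cp ce) S; exact: closed_closure.
by apply: subset_trans S _; rewrite subUset.
Qed.

Lemma test_functionN Om phi : test_function Om phi -> test_function Om (fun x => - phi x).
Proof.
move=> tp; rewrite (_ : (fun x => - phi x) = (fun x => -1 * phi x)); first exact: test_functionZ.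
by apply/funext => x; rewrite mulN1r.
Qed.

Lemma test_function0 Om : test_function Om (cst 0 : 'rV[R]_n -> R).
Proof.
have E : [set x : 'rV[R]_n | (cst 0 : 'rV[R]_n -> R) x != 0] = set0.
  by apply/seteqP; split => x //=; rewrite eqxx.
by split; [exact: smooth_cst|rewrite E closure0; exact: compact0|rewrite E closure0].
Qed.

Lemma test_function_pderive Om phi j : test_function Om phi -> test_function Om (pderive j phi).
Proof.
move=> [sp cp pO].
have S : closure [set x | pderive j phi x != 0] `<=` closure [set x | phi x != 0].
  set S := closure [set x | phi x != 0].
  apply: (@subset_trans _ (closure S)); last by rewrite -(closure_id S).1//; exact: closed_closure.
  apply: closure_subset => x /=; apply: contra_neqP => nx.
  have : \forall y \near x, (cst 0 : 'rV[R]_n -> R) y = phi y.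
    have : nbhs x (~` closure [set x | phi x != 0]).
      by apply: open_nbhs_nbhs; split => //; exact/closed_openC/closed_closure.
    apply: filterS => y /= ny; apply/esym/eqP; apply: contra_notT ny => ?.
    exact: subset_closure.
  by move=> /near_eq_derive; rewrite /pderive => /(_ (delta_mx 0 j)) <-; rewrite derive_cst.
split; [exact: smooth_pderive| |exact: subset_trans pO].
by apply: subclosed_compact cp S; exact: closed_closure.
Qed.

Lemma test_function_bounded Om phi : test_function Om phi ->
  exists2 M, 0 < M & forall x, `|phi x| <= M.
Proof.
move=> [sp cp _].
have : compact (phi @` closure [set x | phi x != 0]).
  by apply: continuous_compact => //; apply: continuous_subspaceT; exact: smooth_continuous.
move=> /compact_bounded [M [Mr HM]]; exists (Num.max 1 (M + 1)); first by rewrite lt_max ltr01.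
move=> x; have [->|px] := eqVneq (phi x) 0; first by rewrite normr0 le_max ler01.
rewrite le_max; apply/orP; right; apply: HM; first by rewrite ltrDl.
by exists x => //; apply: subset_closure; exact: px.
Qed.

Lemma test_bump Om (a : 'rV[R]_n) (s : R) :
  [set x : 'rV[R]_n | forall j, `|x 0 j - a 0 j| <= s] `<=` Om -> test_function Om (bump a s).
Proof.
move=> aO; set C := [set x : 'rV[R]_n | _] in aO.
have cC : compact C.
  have -> : C = [set v : 'rV[R]_n | forall i, `[a 0 i - s, a 0 i + s]%classic (v ord0 i)].
    by apply/seteqP; split=> x /= H j; have := H j; rewrite /= in_itv/= ler_distl.
  by apply: (@rV_compact _ _ (fun i => `[a 0 i - s, a 0 i + s]%classic)) => i; exact: segment_compact.
have S : closure [set x | bump a s x != 0] `<=` C.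
  have clC : closed C by apply: compact_closed cC; exact: norm_hausdorff.
  rewrite [C](closure_id C).1//; apply: closure_subset => x /= bx j.
  by rewrite leNgt; apply: contra bx => /ltW /bump_eq0 ->.
split; [exact: smooth_bump| |exact: subset_trans aO].
by apply: subclosed_compact cC S; exact: closed_closure.
Qed.

End test_functions.

Lemma Rdominated_cvg d (T : measurableType d) (R : realType)
    (mu : {measure set T -> \bar R}) (D : set T) (f_ : nat -> T -> R) (f g : T -> R) :
  measurable D -> (forall k, measurable_fun D (f_ k)) ->
  (forall x, D x -> f_ ^~ x @ \oo --> f x) ->
  mu.-integrable D (EFin \o g) -> (forall k x, D x -> `|f_ k x| <= g x) ->
  mu.-integrable D (EFin \o f) /\
  \int[mu]_(x in D) f_ k x @[k --> \oo] --> \int[mu]_(x in D) f x.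
Proof.
move=> mD mf ff ig fg.
have mf0 : measurable_fun D f by apply: measurable_fun_cvg mf ff.
have [|||||i1 _ i2] := @dominated_convergence _ _ _ mu D mD (fun k x => (f_ k x)%:E)
    (EFin \o f) (EFin \o g).
- by move=> k; apply/measurable_EFinP.
- exact/measurable_EFinP.
- by apply: aeW => x Dx; apply: cvg_EFin; [exact: nearW|exact: ff].
- exact: ig.
- by apply: aeW => x k Dx; rewrite lee_fin; exact: fg.
- split => //; apply: fine_cvg.
  by rewrite /Rintegral fineK; [exact: i2|exact: integrable_fin_num].
Qed.

(** * Rational cubes as a countable base *)

Section rational_cubes.
Variables (R : realType) (m n : nat).

Definition cube (a : 'M[R]_(m, n)) (s : R) : set 'M[R]_(m, n) :=
  [set x | forall i j, `|x i j - a i j| < s].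
Definition ccube (a : 'M[R]_(m, n)) (s : R) : set 'M[R]_(m, n) :=
  [set x | forall i j, `|x i j - a i j| <= s].

Lemma cube_ball (a : 'M[R]_(m, n)) (s : R) : 0 < s -> cube a s = ball a s.
Proof.
move=> s0; apply/seteqP; split=> x H.
  by split=> // i j; rewrite /ball/= distrC; exact: H.
by case: H => _ H i j; have := H i j; rewrite /ball/= distrC.
Qed.

Lemma open_cube (a : 'M[R]_(m, n)) (s : R) : open (cube a s).
Proof.
have [s0|s0] := ltP 0 s; first by rewrite cube_ball//; exact: ball_open.
(* For [s <= 0] the cube is empty, except that a matrix without entries satisfies the condition
   vacuously. *)
case: (pselect (exists ij : 'I_m * 'I_n, True)) => [[[i j] _]|nij].
  rewrite (_ : cube a s = set0); first exact: open0.
  by apply/seteqP; split => // x /(_ i j); rewrite ltNge (le_trans s0).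
rewrite (_ : cube a s = setT); first exact: openT.
by apply/seteqP; split => // x _ i j; exfalso; apply: nij; exists (i, j).
Qed.

Definition rat_mx (q : 'M[rat]_(m, n)) : 'M[R]_(m, n) := map_mx ratr q.

Lemma rat_mx_dense (x : 'M[R]_(m, n)) (e : R) : 0 < e -> exists q, cube (rat_mx q) e x.
Proof.
move=> e0.
have /choice[M HM] : forall ij : 'I_m * 'I_n, exists q : rat, `|x ij.1 ij.2 - ratr q| < e.
  move=> [i j]/=.
  have : x i j - e < x i j + e by rewrite ltrD2l gtrN.
  move=> /rat_in_itvoo[q]; rewrite in_itv/= => qr; exists q.
  by rewrite distrC ltr_distl.
by exists (\matrix_(i, j) M (i, j)) => i j; rewrite !mxE; exact: (HM (i, j)).
Qed.

(** The closed cube is required to lie in [U] so that a bump on it has compact support inside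
    [U]. *)
Lemma rat_cube_nbhs (U : set 'M[R]_(m, n)) (x : 'M[R]_(m, n)) : open U -> U x ->
  exists (q : 'M[rat]_(m, n)) (r : rat), [/\ 0 < (ratr r : R),
    cube (rat_mx q) (ratr r) x & ccube (rat_mx q) (ratr r) `<=` U].
Proof.
move=> oU Ux.
have /nbhs_ballP[e /= e0 eU] : nbhs x U by apply: open_nbhs_nbhs.
have [r /andP[r0 re]] : exists r : rat, 0 < (ratr r : R) < e / 2.
  have /rat_in_itvoo[r] : 0 < e / 2 by rewrite divr_gt0.
  by rewrite in_itv/= => ?; exists r.
have [q xq] := rat_mx_dense x r0; exists q, r; split => // y yq; apply: eU.
split=> // i j; rewrite /ball/=.
rewrite (splitr e) -(subrK (rat_mx q i j) (x i j)) -addrA.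
rewrite (le_lt_trans (ler_normD _ _))// ltrD//; first exact: lt_trans (xq i j) re.
by rewrite distrC (le_lt_trans _ re)// yq.
Qed.

End rational_cubes.

(** * Approximation of indicators by test functions with values in [0, 1] *)

Section density.
Variables (R : realType) (n : nat) (Om : set 'rV[R]_n) (mu : {measure set 'rV[R]_n -> \bar R}).
Hypotheses (oOm : open Om) (mufin : (mu Om < +oo)%E).
Implicit Types (E F : set 'rV[R]_n) (phi psi : 'rV[R]_n -> R).

Let mOm : measurable Om. Proof. exact: open_measurable_mx. Qed.

Definition test01 phi := test_function Om phi /\ forall x, 0 <= phi x <= 1.

Lemma test01M phi psi : test01 phi -> test01 psi -> test01 (fun x => phi x * psi x).
Proof.
move=> [tp p01] [tq q01]; split; first by apply: test_functionM => //; case: tq.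
by move=> x; have /andP[? ?] := p01 x; have /andP[? ?] := q01 x; rewrite mulr_ge0// mulr_ile1.
Qed.

Lemma test01U phi psi : test01 phi -> test01 psi ->
  test01 (fun x => phi x + psi x - phi x * psi x).
Proof.
move=> tp tq; have [tpq _] := test01M tp tq; move: tp tq => [tp p01] [tq q01]; split.
  by apply: test_functionD; [exact: test_functionD|exact: test_functionN].
by move=> x; have /andP[? ?] := p01 x; have /andP[? ?] := q01 x; apply/andP; split; nra.
Qed.

Lemma test01_compl phi psi : test01 phi -> test01 psi ->
  test01 (fun x => phi x * (1 - psi x)).
Proof.
move=> [tp p01] [tq q01]; split.
  apply: test_functionM => //; case: tq => sq _ _.
  rewrite (_ : (fun x => 1 - psi x) = cst 1 + cst (-1) * psi).
    by apply: smoothD; [exact: smooth_cst|apply: smoothM => //; exact: smooth_cst].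
  by apply/funext => x; rewrite /GRing.add/GRing.mul/= mulN1r.
by move=> x; have /andP[? ?] := p01 x; have /andP[? ?] := q01 x; apply/andP; split; nra.
Qed.

Lemma rint_indic_test E phi : measurable E -> test01 phi ->
  mu.-integrable Om (EFin \o (fun x => `|\1_E x - phi x|)).
Proof.
move=> mE [[sp _ _] p01]; apply: (@rint_bdd _ _ _ _ _ mOm _ 1) => //.
  apply: measurableT_comp => //; apply: measurable_funB; first exact: measurable_indic.
  exact: smooth_measurable.
move=> x _; rewrite normr_id indicE; have /andP[? ?] := p01 x.
by case: (_ \in _) => /=; rewrite ler_norml; apply/andP; split; lra.
Qed.

Definition approximable E := forall e, 0 < e ->
  exists2 phi, test01 phi & \int[mu]_(x in Om) `|\1_E x - phi x| < e.

Lemma approximable_setI E F : E `&` Om = F `&` Om -> approximable E -> approximable F.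
Proof.
move=> EF aE e e0; have [phi tp pe] := aE e e0; exists phi => //.
rewrite (_ : \int[mu]_(x in Om) _ = \int[mu]_(x in Om) `|\1_E x - phi x|)//.
apply: eq_Rintegral => x; rewrite inE => Ox; rewrite !indicE.
suff -> : (x \in E) = (x \in F) by [].
apply/idP/idP; rewrite !inE => H.
  by have [] : (F `&` Om) x by rewrite -EF.
by have [] : (E `&` Om) x by rewrite EF.
Qed.

Lemma approximableU E F : measurable E -> measurable F ->
  approximable E -> approximable F -> approximable (E `|` F).
Proof.
move=> mE mF aE aF e e0; have e20 : 0 < e / 2 by rewrite divr_gt0.
have [phi tp pe] := aE _ e20; have [psi tq qe] := aF _ e20.
exists (fun x => phi x + psi x - phi x * psi x); first exact: test01U.
rewrite (splitr e); apply: le_lt_trans (ltrD pe qe).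
rewrite -RintegralD//; [|exact: rint_indic_test..].
apply: le_Rintegral => //.
- by apply: rint_indic_test; [exact: measurableU|exact: test01U].
- by apply: rintD => //; exact: rint_indic_test.
- move=> x _; rewrite !indicE in_setU.
  have /andP[p0 p1] := tp.2 x; have /andP[q0 q1] := tq.2 x.
  move: (phi x) (psi x) p0 p1 q0 q1 => p q p0 p1 q0 q1.
  case: (_ \in _); case: (_ \in _) => /=.
  + by rewrite (ger0_norm (x := 1 - p)) ?(ger0_norm (x := 1 - q)) ?ger0_norm; nra.
  + by rewrite (ger0_norm (x := 1 - p)) ?(ler0_norm (x := 0 - q)) ?ger0_norm; nra.
  + by rewrite (ler0_norm (x := 0 - p)) ?(ger0_norm (x := 1 - q)) ?ger0_norm; nra.
  + by rewrite (ler0_norm (x := 0 - p)) ?(ler0_norm (x := 0 - q)) ?ler0_norm; nra.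
Qed.

(** Since [1 - psi] has no compact support, it is multiplied by a function approximating the
    constant 1. *)
Lemma approximableC E : measurable E -> approximable setT -> approximable E ->
  approximable (~` E).
Proof.
move=> mE aT aE e e0; have e20 : 0 < e / 2 by rewrite divr_gt0.
have [phi tp pe] := aT _ e20; have [psi tq qe] := aE _ e20.
exists (fun x => phi x * (1 - psi x)); first exact: test01_compl.
rewrite (splitr e); apply: le_lt_trans (ltrD pe qe).
rewrite -RintegralD//; [|exact: rint_indic_test..].
apply: le_Rintegral => //.
- by apply: rint_indic_test; [exact: measurableC|exact: test01_compl].
- by apply: rintD => //; exact: rint_indic_test.
- move=> x _; rewrite !indicE in_setC in_setT.
  have /andP[p0 p1] := tp.2 x; have /andP[q0 q1] := tq.2 x.
  move: (phi x) (psi x) p0 p1 q0 q1 => p q p0 p1 q0 q1.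
  case: (_ \in _) => /=.
  + by rewrite (ger0_norm (x := 1 - p)) ?(ger0_norm (x := 1 - q)) ?ler0_norm; nra.
  + by rewrite (ger0_norm (x := 1 - p)) ?(ler0_norm (x := 0 - q)) ?ger0_norm; nra.
Qed.

Lemma approximable_bigcup (E : nat -> set 'rV[R]_n) : (forall k, measurable (E k)) ->
  (forall k, approximable (E k)) -> approximable (\bigcup_k E k).
Proof.
move=> mE aE e e0; have e20 : 0 < e / 2 by rewrite divr_gt0.
pose F k := \big[setU/set0]_(i < k) E i.
have mF k : measurable (F k) by exact: bigsetU_measurable.
have aF k : approximable (F k).
  elim: k => [|k IH].
    move=> r r0; exists (cst 0); first by split; [exact: test_function0|by move=> x /=; rewrite lexx ler01].
    rewrite /F big_ord0; under eq_Rintegral do rewrite indic0 /= subr0 normr0.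
    by rewrite Rintegral_cst// mul0r.
  by rewrite /F big_ord_recr/=; apply: approximableU => //; exact: mF.
have mUE : measurable (\bigcup_k E k) by exact: bigcup_measurable.
have [||||_] := @Rdominated_cvg _ _ _ mu Om
    (fun k x => `|\1_(\bigcup_k E k) x - \1_(F k) x|) (fun=> 0) (cst 1) mOm.
  - move=> k; apply: measurableT_comp => //; apply: measurable_funB; exact: measurable_indic.
  - move=> x _; apply: cvg_near_cst; rewrite indicE.
    have [/set_mem[k _ Ek]|nE] := boolP (x \in \bigcup_k E k).
      near=> j; rewrite indicE mem_set ?subrr ?normr0//.
      rewrite /F -(bigcup_mkord); exists k => //=; near: j; exact: nbhs_infty_gt.
    apply: nearW => k; rewrite indicE memNset ?subrr ?normr0//.
    move: nE; rewrite notin_setE; apply: contra_not; rewrite /F -(bigcup_mkord) => -[i _ Ei].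
    by exists i.
  - by apply: (@rint_bdd _ _ _ _ _ mOm _ 1) => // x _; rewrite normr1.
  - by move=> k x _; rewrite !indicE normr_id; do 2!case: (_ \in _) => /=; rewrite ler_norml; apply/andP; split; lra.
rewrite Rintegral_cst// mul0r => /cvgrPdist_lt/(_ _ e20)[K _ /(_ K (leqnn K))].
rewrite sub0r normrN ger0_norm; last by apply: Rintegral_ge0.
move=> FK; have [phi tp pe] := aF K _ e20; exists phi => //.
rewrite (splitr e); apply: le_lt_trans (ltrD FK pe).
have I1 : mu.-integrable Om (EFin \o (fun x => `|\1_(\bigcup_k E k) x - \1_(F K) x| : R)).
  apply: (@rint_bdd _ _ _ _ _ mOm _ 1) => //.
    apply: measurableT_comp => //; apply: measurable_funB; exact: measurable_indic.
  by move=> x _; rewrite !indicE normr_id; do 2!case: (_ \in _) => /=; rewrite ler_norml; apply/andP; split; lra.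
rewrite -RintegralD//; last exact: rint_indic_test.
apply: le_Rintegral => //.
- exact: rint_indic_test.
- by apply: rintD => //; exact: rint_indic_test.
- by move=> x _; exact: ler_distD.
Unshelve. all: by end_near. Qed.

(** The powers of [1 - bump] decrease to 0 inside the cube and stay equal to 1 outside it, so
    [1 - (1 - bump)^k] converges to the indicator. *)
Lemma approximable_cube a s : 0 < s -> ccube a s `<=` Om -> approximable (cube a s).
Proof.
move=> s0 aO e e0.
have tb : test01 (bump a s).
  split; last by move=> x; rewrite bump_ge0 bump_le1.
  by apply: test_bump => x H; apply: aO => i j; rewrite ord1; exact: H.
pose phi k := fun x => 1 - (1 - bump a s x) ^+ k.
have tphi k : test01 (phi k).
  elim: k => [|k IH].
    rewrite (_ : phi 0%N = cst 0); last by apply/funext => x; rewrite /phi expr0 subrr.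
    by split; [exact: test_function0|by move=> x /=; rewrite lexx ler01].
  (* The recursion phi_(k+1) = b + phi_k - b phi_k keeps the functions among compactly supported
     ones with values in [0, 1]. *)
  have := test01U tb IH; congr (test01 _); apply/funext => x.
  by rewrite /phi exprS; ring.
have [||||_] := @Rdominated_cvg _ _ _ mu Om
    (fun k x => `|\1_(cube a s) x - phi k x|) (fun=> 0) (cst 1) mOm.
  - move=> k; apply: measurableT_comp => //; apply: measurable_funB.
      by apply: measurable_indic; apply: open_measurable_mx; exact: open_cube.
    by apply: smooth_measurable; case: (tphi k) => -[].
  - move=> x _; rewrite indicE; have [/set_mem H|nE] := boolP (x \in cube a s).
      rewrite (_ : (fun k => _) = (fun k => (1 - bump a s x) ^+ k)); last first.
        apply/funext => k; rewrite /phi subKr ger0_norm// exprn_ge0// subr_ge0; exact: bump_le1.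
      apply: cvg_expr; rewrite ger0_norm ?subr_ge0 ?bump_le1//.
      by rewrite ltrBlDr ltrDl; apply: bump_gt0 => j; exact: H.
    apply: cvg_near_cst; apply: nearW => k.
    have [j H] : exists j, s <= `|x 0 j - a 0 j|.
      apply: contrapT => /forallNP H; move: nE; rewrite notin_setE; apply => i j.
      by rewrite ord1 ltNge; apply/negP/H.
    by rewrite /phi (bump_eq0 H) subr0 expr1n !subrr normr0.
  - by apply: (@rint_bdd _ _ _ _ _ mOm _ 1) => // x _; rewrite normr1.
  - move=> k x _; rewrite normr_id indicE; have /andP[? ?] := (tphi k).2 x.
    by case: (_ \in _) => /=; rewrite ler_norml; apply/andP; split; lra.
rewrite Rintegral_cst// mul0r => /cvgrPdist_lt/(_ _ e0)[K _ /(_ K (leqnn K))].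
rewrite sub0r normrN ger0_norm; last by apply: Rintegral_ge0.
by move=> H; exists (phi K).
Qed.

Lemma approximable_open U : open U -> approximable U.
Proof.
move=> oU; pose V := U `&` Om.
have oV : open V by exact: openI.
pose c (k : nat) : 'rV[R]_n * R :=
  if unpickle k is Some (M, r) then (rat_mx R (M : 'rV[rat]_n), ratr (r : rat)) else (0, 0).
pose E k := if `[< 0 < (c k).2 /\ ccube (c k).1 (c k).2 `<=` V >] then cube (c k).1 (c k).2
  else set0.
have mE k : measurable (E k).
  rewrite /E; case: ifP => // _; apply: open_measurable_mx; exact: open_cube.
apply: (@approximable_setI (\bigcup_k E k)).
  have VE : \bigcup_k E k = V.
    apply/seteqP; split=> [x [k _]|x Vx].
      rewrite /E; case: ifP => // /asboolP[_ kV] xk; apply: kV => i j; exact/ltW/xk.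
    have [q [r [r0 xq qV]]] := rat_cube_nbhs oV Vx.
    exists (pickle (q, r)) => //; rewrite /E /c pickleK/= asboolT//.
  by rewrite VE /V -setIA setIid.
apply: approximable_bigcup => // k; rewrite /E; case: asboolP => [[s0 kV]|_].
  by apply: approximable_cube => //; apply: subset_trans kV _; exact: subIsetr.
move=> r r0; exists (cst 0); first by split; [exact: test_function0|by move=> x /=; rewrite lexx ler01].
under eq_Rintegral do rewrite indic0 /= subr0 normr0.
by rewrite Rintegral_cst// mul0r.
Qed.

(** The approximable measurable sets form a sigma-algebra containing the open sets. The generators
    of the matrix sigma-algebra are preimages of Borel sets under coordinates, hence the second
    induction, over the Borel sets of the line. *)
Theorem measurable_approximable E : measurable E -> approximable E.
Proof.
move=> mE; suff : measurable E /\ approximable E by case.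
have aT : approximable setT by apply: approximable_open; exact: openT.
move: E mE; apply: smallest_sub.
  split=> [|A [mA aA]|F HF].
  - by split => //; apply: approximable_open; exact: open0.
  - by rewrite setTD; split; [exact: measurableC|exact: approximableC].
  - split; first by apply: bigcup_measurable => k _; case: (HF k).
    by apply: approximable_bigcup => k; case: (HF k).
move=> _ [i [j [S [mS ->]]]].
pose P (S : set R) := measurable ((fun M : 'rV[R]_n => M i j) @^-1` S) /\
  approximable ((fun M : 'rV[R]_n => M i j) @^-1` S).
have {mS} : <<s @RGenOpens.G R >> S.
  exact: (eq_ind _ (fun X : set (set R) => X S) mS _ (RGenOpens.measurableE R)).
rewrite -/(P S); move: S; apply: smallest_sub.
  split=> [|A [mA aA]|F HF].
  - by rewrite /P preimage_set0; split => //; apply: approximable_open; exact: open0.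
  - by rewrite setTD /P -preimage_setC; split; [exact: measurableC|exact: approximableC].
  - rewrite /P preimage_bigcup; split; first by apply: bigcup_measurable => k _; case: (HF k).
    by apply: approximable_bigcup => k; case: (HF k).
move=> _ [a [b ->]].
have oP : open ((fun M : 'rV[R]_n => M i j) @^-1` `]a, b[%classic).
  have /continuousP : continuous (fun M : 'rV[R]_n => M i j) by move=> x; exact: coord_continuous.
  by apply; exact: interval_open.
by split; [exact: open_measurable_mx|exact: approximable_open].
Qed.

End density.

Import HBSimple.

(** * Approximation for two weighted measures at once *)

Section weighted_density.
Variables (R : realType) (n : nat) (Om : set 'rV[R]_n).
Hypothesis oOm : open Om.

Let mOm : measurable Om. Proof. exact: open_measurable_mx. Qed.

Lemma tail_integral_small (mu : {measure set 'rV[R]_n -> \bar R}) (h : 'rV[R]_n -> R) (e : R) :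
  mu.-integrable Om (EFin \o h) -> 0 < e ->
  \forall N \near \oo, \int[mu]_(x in Om) Num.max (`|h x| - N%:R) 0 < e.
Proof.
move=> ih e0; have mh := rint_measurable ih.
have mk k : measurable_fun Om (fun x => Num.max (`|h x| - k%:R) 0).
  apply: measurable_maxr => //; apply: measurable_funB => //.
  exact: measurableT_comp.
have [|||_] := @Rdominated_cvg _ _ _ mu Om
    (fun k x => Num.max (`|h x| - k%:R) 0) (fun=> 0) (fun x => `|h x|) mOm mk.
- move=> x _; apply: cvg_near_cst; near=> k; apply/max_idPr.
  rewrite subr_le0; near: k; exact: nbhs_infty_ger.
- exact: rint_norm.
- move=> k x _; rewrite ger0_norm ?le_max ?lexx ?orbT// ge_max normr_ge0 andbT.
  by rewrite gerBl.
rewrite Rintegral_cst// mul0r => /cvgrPdist_lt/(_ _ e0).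
apply: filterS => k; rewrite sub0r normrN ger0_norm//.
by apply: Rintegral_ge0 => x _; rewrite le_max lexx orbT.
Unshelve. all: by end_near. Qed.

(** The weight is split as |h| <= N + (|h| - N)^+, and the second part meets a factor at most 1. *)
Lemma weighted_approx_le (mu : {measure set 'rV[R]_n -> \bar R}) (h phi : 'rV[R]_n -> R)
    (E : set 'rV[R]_n) (N : nat) : (mu Om < +oo)%E ->
  mu.-integrable Om (EFin \o h) -> measurable E -> test01 Om phi ->
  mu.-integrable Om (EFin \o (fun x => `|h x| * `|\1_E x - phi x|)) /\
  \int[mu]_(x in Om) (`|h x| * `|\1_E x - phi x|) <=
  N%:R * \int[mu]_(x in Om) `|\1_E x - phi x| +
  \int[mu]_(x in Om) Num.max (`|h x| - N%:R) 0.
Proof.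
move=> mufin ih mE tp; have mh := rint_measurable ih.
have i1 := rint_indic_test oOm mufin mE tp.
have b1 x : `|\1_E x - phi x| <= 1.
  rewrite indicE; have /andP[? ?] := tp.2 x.
  by case: (_ \in _) => /=; rewrite ler_norml; apply/andP; split; lra.
have mk : measurable_fun Om (fun x => Num.max (`|h x| - N%:R) 0).
  apply: measurable_maxr => //; apply: measurable_funB => //.
  exact: measurableT_comp.
have i2 : mu.-integrable Om (EFin \o (fun x => Num.max (`|h x| - N%:R) 0)).
  apply: (rint_le mOm mk _ (rint_norm ih)) => x _.

  by rewrite ger0_norm ?le_max ?lexx ?orbT// ge_max normr_ge0 andbT gerBl.
have i3 : mu.-integrable Om (EFin \o (fun x => `|h x| * `|\1_E x - phi x|)).
  apply: (rint_le mOm _ _ (rint_norm ih)).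
    apply: measurable_funM; first exact: measurableT_comp.
    exact: (rint_measurable i1).
  by move=> x _; rewrite normrM !normr_id ler_piMr.
split => //; rewrite -RintegralZl// -RintegralD//; last exact: rintZ.
apply: le_Rintegral => //; first by apply: rintD => //; exact: rintZ.
move=> x _; have := b1 x; have := normr_ge0 (\1_E x - phi x); have := normr_ge0 (h x).
move: `|h x| `|_ - _| => a b a0 b0 b1'.
by have [h1|h1] := leP (a - N%:R) 0; nra.
Qed.

Lemma Rintegral_measure_add_ge (mu1 mu2 : {measure set 'rV[R]_n -> \bar R}) (g : 'rV[R]_n -> R) :
  (forall x, 0 <= g x) ->
  mu1.-integrable Om (EFin \o g) -> mu2.-integrable Om (EFin \o g) ->
  \int[measure_add mu1 mu2]_(x in Om) g x =
  \int[mu1]_(x in Om) g x + \int[mu2]_(x in Om) g x.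
Proof.
move=> g0 i1 i2; rewrite /Rintegral ge0_integral_measure_add//; last 2 first.
- by move=> x _; rewrite lee_fin.
- exact: (measurable_int mu1 i1).
by rewrite fineD//; exact: integrable_fin_num.
Qed.

(** The same test function has to serve Lebesgue measure and the variation of A u, which are in
    general mutually unrelated. It is obtained by approximating for the sum of the two measures. *)
Theorem weighted_test_dense (mu1 mu2 : {measure set 'rV[R]_n -> \bar R}) (h1 h2 : 'rV[R]_n -> R)
    (E : set 'rV[R]_n) (e : R) : (mu1 Om < +oo)%E -> (mu2 Om < +oo)%E ->
  mu1.-integrable Om (EFin \o h1) -> mu2.-integrable Om (EFin \o h2) ->
  measurable E -> 0 < e ->
  exists phi, [/\ test01 Om phi,
    \int[mu1]_(x in Om) (`|h1 x| * `|\1_E x - phi x|) < e &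
    \int[mu2]_(x in Om) (`|h2 x| * `|\1_E x - phi x|) < e].
Proof.
move=> f1 f2 i1 i2 mE e0; have e20 : 0 < e / 2 by rewrite divr_gt0.
have [N [t1 t2]] : exists N : nat,
    \int[mu1]_(x in Om) Num.max (`|h1 x| - N%:R) 0 < e / 2 /\
    \int[mu2]_(x in Om) Num.max (`|h2 x| - N%:R) 0 < e / 2.
  have : \forall N \near \oo,
      \int[mu1]_(x in Om) Num.max (`|h1 x| - N%:R) 0 < e / 2 /\
      \int[mu2]_(x in Om) Num.max (`|h2 x| - N%:R) 0 < e / 2.
    near=> N; split; near: N; exact: tail_integral_small.
  by case=> N _ /(_ N (leqnn N)); exists N.
have N0 : 0 < N%:R + 1 :> R by rewrite ltr_wpDl.
have fadd : (measure_add mu1 mu2 Om < +oo)%E by rewrite measure_addE lte_add_pinfty.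
have eN : 0 < e / 2 / (N%:R + 1) by rewrite divr_gt0.
have [phi tp] := measurable_approximable oOm fadd mE eN.
have j1 := rint_indic_test oOm f1 mE tp.
have j2 := rint_indic_test oOm f2 mE tp.
rewrite Rintegral_measure_add_ge// => H.
have p1 : 0 <= \int[mu1]_(x in Om) `|\1_E x - phi x| by exact: Rintegral_ge0.
have p2 : 0 <= \int[mu2]_(x in Om) `|\1_E x - phi x| by exact: Rintegral_ge0.
have aux I : 0 <= I -> I < e / 2 / (N%:R + 1) -> N%:R * I <= e / 2.
  move=> I0; rewrite ltr_pdivlMr// => /ltW; apply: le_trans.
  by rewrite mulrC ler_wpM2l// lerDl.
exists phi; split => //.
  rewrite (le_lt_trans (weighted_approx_le N f1 i1 mE tp).2)// (splitr e) ler_ltD// aux//.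
  by apply: le_lt_trans H; rewrite lerDl.
rewrite (le_lt_trans (weighted_approx_le N f2 i2 mE tp).2)// (splitr e) ler_ltD// aux//.
by apply: le_lt_trans H; rewrite lerDr.
Unshelve. all: by end_near. Qed.

(** Turns an inequality known for cutoffs into one for Borel sets, on which the absolutely
    continuous and the singular parts can be separated. *)
Theorem test_le_set (mu1 mu2 : {measure set 'rV[R]_n -> \bar R}) (h1 h2 : 'rV[R]_n -> R) :
  (mu1 Om < +oo)%E -> (mu2 Om < +oo)%E ->
  mu1.-integrable Om (EFin \o h1) -> mu2.-integrable Om (EFin \o h2) ->
  (forall phi, test01 Om phi ->
    0 <= \int[mu1]_(x in Om) (h1 x * phi x) + \int[mu2]_(x in Om) (h2 x * phi x)) ->
  forall E, measurable E ->
    0 <= \int[mu1]_(x in Om) (h1 x * \1_E x) + \int[mu2]_(x in Om) (h2 x * \1_E x).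
Proof.
move=> f1 f2 i1 i2 H E mE; apply/ler_addgt0Pl => e e0.
have e20 : 0 < e / 2 by rewrite divr_gt0.
have [phi [tp a1 a2]] := weighted_test_dense f1 f2 i1 i2 mE e20.
have aux (mu : {measure set 'rV[R]_n -> \bar R}) (h : 'rV[R]_n -> R) :
    (mu Om < +oo)%E -> mu.-integrable Om (EFin \o h) ->
    \int[mu]_(x in Om) (h x * phi x) - \int[mu]_(x in Om) (h x * \1_E x) <=
    \int[mu]_(x in Om) (`|h x| * `|\1_E x - phi x|).
  move=> f ih; have k1 : mu.-integrable Om (EFin \o (fun x => h x * phi x)).
    apply: (@eq_rint _ _ _ _ _ mOm (fun x => phi x * h x)) => [x _|]; first by rewrite mulrC.
    apply: (@rint_bddM _ _ _ _ _ mOm _ _ 1) => //; first by apply: smooth_measurable; case: tp => -[].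
    by move=> x _; have /andP[? ?] := tp.2 x; rewrite ger0_norm.
  have k2 : mu.-integrable Om (EFin \o (fun x => h x * \1_E x)).
    apply: (@eq_rint _ _ _ _ _ mOm (fun x => \1_E x * h x)) => [x _|]; first by rewrite mulrC.
    apply: (@rint_bddM _ _ _ _ _ mOm _ _ 1) => //.
    by move=> x _; rewrite indicE; case: (_ \in _); rewrite ?normr1 ?normr0.
  rewrite -RintegralB//; apply: le_Rintegral => //; first exact: rintB.
    by case: (weighted_approx_le 0 f ih mE tp).
  move=> x _; rewrite -mulrBr -normrM; apply: le_trans (ler_norm _) _.
  by rewrite !normrM distrC.
have := H _ tp; have := aux _ _ f1 i1; have := aux _ _ f2 i2; lra.
Qed.

Lemma test_dense_L1 (mu : {measure set 'rV[R]_n -> \bar R}) (f : 'rV[R]_n -> R) (e : R) :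
  (mu Om < +oo)%E -> mu.-integrable Om (EFin \o f) -> 0 < e ->
  exists2 phi, test_function Om phi & \int[mu]_(x in Om) `|f x - phi x| < e.
Proof.
move=> mufin.
have itest phi : test_function Om phi -> mu.-integrable Om (EFin \o phi).
  move=> tp; have [M M0 pM] := test_function_bounded tp.
  apply: (@rint_bdd _ _ _ _ _ mOm _ M) => //; apply: smooth_measurable; by case: tp.
pose P f := mu.-integrable Om (EFin \o f) /\ forall e, 0 < e ->
  exists2 phi, test_function Om phi & \int[mu]_(x in Om) `|f x - phi x| < e.
have Psum g h : P g -> P h -> P (fun x => g x + h x).
  move=> [ig Pg] [ih Ph]; split; first exact: rintD.
  move=> {}e e0; have e20 : 0 < e / 2 by rewrite divr_gt0.
  have [phi tp pe] := Pg _ e20; have [psi tq qe] := Ph _ e20.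
  exists (phi + psi); first exact: test_functionD.
  rewrite (splitr e); apply: le_lt_trans (ltrD pe qe).
  have ip := itest _ tp; have iq := itest _ tq.
  rewrite -RintegralD//; [|by apply: rint_norm => //; exact: rintB..].
  apply: le_Rintegral => //.
  - by apply: rint_norm => //; apply: rintB => //; exact: rintD.
  - by apply: rintD => //; apply: rint_norm => //; exact: rintB.
  - move=> x _; rewrite [(phi + psi) x](_ : _ = phi x + psi x)// opprD addrACA.
    exact: ler_normD.
have Pind c E : measurable E -> P (fun x => c * \1_E x).
  move=> mE; have iE : mu.-integrable Om (EFin \o \1_E).
    apply: (@rint_bdd _ _ _ _ _ mOm _ 1) => //.
    by move=> x _; rewrite indicE; case: (_ \in _); rewrite ?normr1 ?normr0.
  split=> [|{}e e0]; first exact: rintZ.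
  have c0 : 0 < `|c| + 1 by rewrite ltr_wpDl.
  have [phi tp pe] := measurable_approximable oOm mufin mE (divr_gt0 e0 c0).
  exists (fun x => c * phi x); first by apply: test_functionZ; case: tp.
  have ii := rint_indic_test oOm mufin mE tp.
  under eq_Rintegral do rewrite -mulrBr normrM.
  rewrite RintegralZl//; move: pe; rewrite ltr_pdivlMr//; apply: le_lt_trans.
  by rewrite mulrC ler_wpM2l ?lerDl//; exact: Rintegral_ge0.
have Pbig (I : Type) (r : seq I) (F : I -> 'rV[R]_n -> R) : (forall i, P (F i)) ->
    P (fun x => \sum_(i <- r) F i x).
  move=> PF; elim: r => [|i r IH].
    by have := Pind 0 setT measurableT; congr P; apply/funext => x; rewrite big_nil mul0r.
  by under eq_fun do rewrite big_cons; exact: Psum.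
move=> fi e0; have e20 : 0 < e / 2 by rewrite divr_gt0.
have [g [gi gf]] := approximation_sfun_integrable mOm fi.
move=> /fine_cvgP[_ /cvgrPdist_lt/(_ _ e20)[K _ /(_ K (leqnn K))]] /=.
rewrite sub0r normrN => gK.
have /(_ _ e20)[phi tp pe] : forall e, 0 < e ->
    exists2 phi, test_function Om phi & \int[mu]_(x in Om) `|g K x - phi x| < e.
  suff [] : P (g K) by [].
  rewrite (funext (fimfunEord (g K))).
  by apply: Pbig => i; apply: Pind; exact: measurable_sfunP.
exists phi => //; have ip := itest _ tp.
rewrite (splitr e); apply: le_lt_trans (ltrD gK pe).
have gKi := gi K.
rewrite ger0_norm; last by apply: fine_ge0; exact: integral_ge0.
rewrite -/(Rintegral mu Om (fun z => `|f z - g K z|)) -RintegralD//;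
  [|by apply: rint_norm => //; exact: rintB..].
apply: le_Rintegral => //.
- by apply: rint_norm => //; exact: rintB.
- by apply: rintD => //; apply: rint_norm => //; exact: rintB.
- by move=> x _; exact: ler_distD.
Qed.

End weighted_density.

(** * Mollification *)

Lemma cvg_Rsum (R : realType) (T : Type) (F : set_system T) {FF : Filter F} (I : Type)
    (r : seq I) (f : I -> T -> R) (l : I -> R) :
  (forall i, f i x @[x --> F] --> l i) ->
  \sum_(i <- r) f i x @[x --> F] --> \sum_(i <- r) l i.
Proof.
move=> fl; elim: r => [|i r IH].
  by rewrite big_nil; under eq_fun do rewrite big_nil; exact: cvg_cst.
by rewrite big_cons; under eq_fun do rewrite big_cons; exact: cvgD.
Qed.

(** * Smoothness of convolutions *)

Section convolution_smooth.
Variables (R : realType) (n : nat).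
Implicit Types (rho : 'rV[R]_n -> R) (x y h : 'rV[R]_n).

Lemma ler_coord_norm m k (x : 'M[R]_(m, k)) i j : `|x i j| <= `|x|.
Proof.
rewrite [leRHS]/Num.norm /= mx_normrE; apply/bigmax_geP; right => /=.
by exists (i, j).
Qed.

Lemma ler_norm_coord m k (x : 'M[R]_(m, k)) (c : R) : 0 <= c ->
  (forall i j, `|x i j| <= c) -> `|x| <= c.
Proof.
move=> c0 H; rewrite [leLHS]/Num.norm /= mx_normrE; by apply/bigmax_leP; split => // -[i j] _.
Qed.

(** Compactness gives uniformity for [x] in the support. If only [x + h] lies there, the estimate at
    [x + h] with the increment [- h] is used, which is why both signs of [h] are treated. *)
Lemma compact_support_unif rho : continuous rho -> compact (closure [set x | rho x != 0]) ->
  forall e, 0 < e -> \forall h \near (0 : 'rV[R]_n), forall x, `|rho (x + h) - rho x| <= e.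
Proof.
move=> crho cK e e0; set K := closure _ in cK.
have H : \forall h \near (0 : 'rV[R]_n), K `<=` [set x | `|rho (x + h) - rho x| <= e].
  move/compact_near_coveringP : cK => cK.
  apply: (cK _ (nbhs (0 : 'rV[R]_n)) (fun h x => `|rho (x + h) - rho x| <= e)) => x Kx.
  have e20 : 0 < e / 2 by rewrite divr_gt0.
  have c1 : \forall x' \near x & h \near (0 : 'rV[R]_n), `|rho x - rho x'| < e / 2.
    have : (fun p : 'rV[R]_n * 'rV[R]_n => rho p.1) p @[p --> (x, 0 : 'rV[R]_n)] --> rho x.
      by apply: (cvg_comp fst rho); [exact: cvg_fst|exact: crho].
    by move=> /cvgrPdist_lt; apply.
  have c2 : \forall x' \near x & h \near (0 : 'rV[R]_n), `|rho x - rho (x' + h)| < e / 2.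
    have : (fun p : 'rV[R]_n * 'rV[R]_n => rho (p.1 + p.2)) p @[p --> (x, 0 : 'rV[R]_n)] --> rho (x + 0).
      apply: (cvg_comp (fun p : 'rV[R]_n * 'rV[R]_n => p.1 + p.2) rho); last exact: crho.
      by apply: cvgD; [exact: cvg_fst|exact: cvg_snd].
    by rewrite addr0 => /cvgrPdist_lt; apply.
  apply: filterS (filterI c1 c2) => -[x' h] /= [a b].
  rewrite -(subrKA (rho x)) (le_trans (ler_normD _ _))// (splitr e) lerD//; last exact: ltW.
  by rewrite distrC ltW.
have HN : \forall h \near (0 : 'rV[R]_n), K `<=` [set x | `|rho (x - h) - rho x| <= e].
  have : (fun h => - h) @ (0 : 'rV[R]_n) --> (0 : 'rV[R]_n).
    by rewrite -[X in _ --> X]oppr0; exact: opp_continuous.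
  by move=> /(_ _ H).
apply: filterS (filterI H HN) => h [Hh HNh] x; have [/Hh//|nKx] := pselect (K x).
have rx : rho x = 0.
  by apply/eqP; apply: contra_notT nKx => ?; exact: subset_closure.
have [rxh|rxh] := eqVneq (rho (x + h)) 0; first by rewrite rx rxh subrr normr0 ltW.
have /HNh /= : K (x + h) by exact: subset_closure.
by rewrite addrK distrC.
Qed.

Lemma derive_pderive rho x h : smooth rho -> 'D_h rho x = \sum_j h 0 j * pderive j rho x.
Proof.
move=> sr; have dr := smooth_differentiable x sr.
rewrite deriveE// {1}(row_sum_delta h) linear_sum; apply: eq_bigr => j _.
by rewrite linearZ/= -deriveE.
Qed.

Lemma smooth_mvt rho x h : smooth rho -> exists2 c, 0 < c < 1 &
  rho (x + h) - rho x = \sum_j h 0 j * pderive j rho (x + c *: h).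
Proof.
move=> sr; pose g (t : R) := rho (x + t *: h).
have dg (t : R) : is_derive t (1 : R) g (\sum_j h 0 j * pderive j rho (x + t *: h)).
  rewrite -derive_pderive//.
  have dr := smooth_differentiable (x + t *: h) sr.
  have E : (fun s : R => s^-1 *: ((g \o shift t) (s *: (1 : R)) - g t)) =
      (fun s : R => s^-1 *: ((rho \o shift (x + t *: h)) (s *: h) - rho (x + t *: h))).
    apply/funext => s; rewrite /g /= /shift/= /GRing.scale/= mulr1.
    by congr (_ * (rho _ - _)); rewrite [RHS]addrC -addrA -scalerDl [t + s]addrC.
  have := @diff_derivable _ _ _ _ _ h dr; rewrite /derivable -E => cv.
  by apply: DeriveDef => //; rewrite /derive E.
have cg : {within `[0, 1], continuous g}.
  apply: continuous_subspaceT => t; apply/differentiable_continuous/derivable1_diffP.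
  by case: (dg t).
have [c c01 H] := MVT ltr01 (fun t _ => dg t) cg.
exists c; first by move: c01; rewrite in_itv.
by move: H; rewrite /g scale1r scale0r addr0 subr0 mulr1.
Qed.

(** The mean value theorem along the segment, with derivatives that are uniformly continuous because
    they have compact support. Uniformity in [x] allows the expansion to pass under an integral. *)
Lemma smooth_taylor rho : test_function setT rho -> forall e, 0 < e ->
  \forall h \near (0 : 'rV[R]_n), forall x,
  `|rho (x + h) - rho x - \sum_j h 0 j * pderive j rho x| <= e * `|h|.
Proof.
move=> tr e e0; have sr : smooth rho by case: tr.
have n0 : 0 < n%:R + 1 :> R by rewrite ltr_wpDl.
have U : \forall h \near (0 : 'rV[R]_n), forall x (j : 'I_n),
    `|pderive j rho (x + h) - pderive j rho x| <= e / (n%:R + 1).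
  have : forall j : 'I_n, \forall h \near (0 : 'rV[R]_n), forall x,
      `|pderive j rho (x + h) - pderive j rho x| <= e / (n%:R + 1).
    move=> j; have [sp cp _] := test_function_pderive j tr.
    by apply: compact_support_unif => //; [exact: smooth_continuous|rewrite divr_gt0].
  move=> /filter_forall.
  by apply: filterS => h + x j; apply.
have [d /= d0 dU] := (nbhs_ballP _ _).1 U.
apply/nbhs_ballP; exists d => // h dh x.
have [c /andP[c0 c1] ->] := smooth_mvt x h sr.
have bch : ball (0 : 'rV[R]_n) d (c *: h).
  move: dh; rewrite -ball_normE /ball_ /= !sub0r !normrN normrZ (gtr0_norm c0).
  by apply: le_lt_trans; rewrite ler_piMl// ltW.
rewrite -sumrB (le_trans (ler_norm_sum _ _ _))//.
apply: (@le_trans _ _ (\sum_(j < n) (`|h| * (e / (n%:R + 1))))).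
  apply: ler_sum => j _; rewrite -mulrBr normrM ler_pM//; first exact: ler_coord_norm.
  exact: dU.
rewrite sumr_const card_ord.
suff : `|h| * (e / (n%:R + 1)) *+ n = (n%:R / (n%:R + 1)) * (e * `|h|).
  by move=> ->; rewrite ler_piMl ?mulr_ge0 ?(ltW e0)// ler_pdivrMr// mul1r lerDl.
by rewrite -mulr_natl; move: `|h| => k; field; rewrite gt_eqF.
Qed.

Local Notation la := (lebesgue_rV R n).

Definition conv (Z rho : 'rV[R]_n -> R) x := \int[la]_y (Z y * rho (x - y)).

Lemma measurable_reflect rho x : continuous rho -> measurable_fun setT (fun y => rho (x - y)).
Proof.
move=> cr; apply: continuous_rV_measurable => y; apply: continuous_comp; last exact: cr.
by apply: continuousB => //; exact: cst_continuous.
Qed.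

Lemma rint_conv Z rho x : la.-integrable setT (EFin \o Z) -> test_function setT rho ->
  la.-integrable setT (EFin \o (fun y => Z y * rho (x - y))).
Proof.
move=> iZ tr; have [M M0 rM] := test_function_bounded tr.
apply: (@eq_rint _ _ _ _ _ measurableT (fun y => rho (x - y) * Z y)) => [y _|]; first by rewrite mulrC.
apply: (@rint_bddM _ _ _ _ _ measurableT _ _ M) => //.
by apply: measurable_reflect; apply: smooth_continuous; case: tr.
Qed.

(** The remainder of the uniform Taylor expansion, integrated against [|Z|], is still [o(h)]; this
    exhibits the differential directly. *)
Lemma conv_derivative Z rho x : la.-integrable setT (EFin \o Z) -> test_function setT rho ->
  differentiable (conv Z rho) x /\
  (forall j, pderive j (conv Z rho) x = conv Z (pderive j rho) x).
Proof.
move=> iZ tr.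
have tp j : test_function setT (pderive j rho) by exact: test_function_pderive.
pose df h : R := \sum_j h 0 j * conv Z (pderive j rho) x.
have df_lin : linear df.
  move=> a u v; rewrite /df scaler_sumr -big_split/=; apply: eq_bigr => j _.
  by rewrite !mxE mulrDl -mulrA.
pose dfl := HB.pack df (GRing.isLinear.Build _ _ _ _ df df_lin) : {linear 'rV[R]_n -> R}.
have cdf : continuous dfl.
  move=> h; rewrite /dfl/= /df; apply: (@cvg_Rsum R _ (nbhs h) (nbhs_filter h)) => j; apply: cvgM; last exact: cvg_cst.
  exact: coord_continuous.
have expand : conv Z rho \o shift x = cst (conv Z rho x) + dfl +o_ (0 : 'rV[R]_n) id.
  apply/eqaddoP => e e0.
  pose I := \int[la]_y `|Z y|.
  have I0 : 0 <= I by exact: Rintegral_ge0.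
  have I1 : 0 < I + 1 by rewrite ltr_wpDl.
  have := smooth_taylor tr (divr_gt0 e0 I1).
  apply: filterS => h Hh /=.
  have -> : (conv Z rho \o shift x - (cst (conv Z rho x) + dfl)) h =
      \int[la]_y (Z y * (rho (x - y + h) - rho (x - y) - \sum_j h 0 j * pderive j rho (x - y))).
    rewrite [LHS](_ : _ = conv Z rho (h + x) - (conv Z rho x + df h))// /df opprD addrA.
    have -> : \sum_j h 0 j * conv Z (pderive j rho) x =
        \int[la]_y (\sum_j (h 0 j * (Z y * pderive j rho (x - y)))).
      rewrite Rintegral_sum//; last by move=> j _; apply: rintZ => //; exact: rint_conv.
      by apply: eq_bigr => j _; rewrite RintegralZl//; exact: rint_conv.
    have -> : conv Z rho (h + x) - conv Z rho x =
        \int[la]_y (Z y * rho (h + x - y) - Z y * rho (x - y)).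
      by rewrite /conv RintegralB//; exact: rint_conv.
    rewrite -RintegralB//; last 2 first.
      - by apply: rintB => //; exact: rint_conv.
      - by apply: rint_sum => // j _; apply: rintZ => //; exact: rint_conv.
    apply: eq_Rintegral => y _; rewrite !mulrBr mulr_sumr; congr (_ * rho _ - _ - _).
      by rewrite [h + x]addrC addrAC.
    by apply: eq_bigr => j _; rewrite mulrCA.
  have iR : la.-integrable setT (EFin \o (fun y => Z y * (rho (x - y + h) - rho (x - y) - \sum_j h 0 j * pderive j rho (x - y)))).
    apply: (@eq_rint _ _ _ _ _ measurableT (fun y => Z y * rho (x + h - y) - Z y * rho (x - y) -
        \sum_j h 0 j * (Z y * pderive j rho (x - y)))).
      move=> y _; rewrite !mulrBr mulr_sumr; congr (_ * rho _ - _ - _); first by rewrite addrAC.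
      by apply: eq_bigr => j _; rewrite mulrCA.
    apply: rintB => //; first by apply: rintB => //; exact: rint_conv.
    by apply: rint_sum => // j _; apply: rintZ => //; exact: rint_conv.
  apply: (@le_trans _ _ (\int[la]_y (e / (I + 1) * `|h| * `|Z y|))).
    apply: le_norm_Rintegral => //; first by apply: rintZ => //; exact: rint_norm.
    by move=> y _; rewrite normrM mulrC ler_wpM2r.
  rewrite RintegralZl//; last exact: rint_norm.
  rewrite -/I mulrAC ler_wpM2r// mulrAC -mulrA ler_piMr ?(ltW e0)//.
  by rewrite ler_pdivrMr// mul1r lerDl.
have dE := diff_unique cdf expand.
have dif : differentiable (conv Z rho) x.
  by apply/diff_locallyP; rewrite dE.
split => // j; rewrite /pderive deriveE// dE /dfl/= /df (bigD1 j)//= big1.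
  by rewrite addr0 !mxE !eqxx mul1r.
by move=> i ij; rewrite !mxE (negbTE ij) mul0r.
Qed.

Lemma pderive_conv Z rho j : la.-integrable setT (EFin \o Z) -> test_function setT rho ->
  pderive j (conv Z rho) = conv Z (pderive j rho).
Proof. by move=> iZ tr; apply/funext => x; exact: (conv_derivative x iZ tr).2. Qed.

Lemma smooth_conv Z rho : la.-integrable setT (EFin \o Z) -> test_function setT rho ->
  smooth (conv Z rho).
Proof.
move=> iZ tr; apply: (@smooth_class _ _ [set f | exists2 r, test_function setT r & f = conv Z r]).
- by move=> _ [r tr' ->] x; exact: (conv_derivative x iZ tr').1.
- move=> _ j [r tr' ->]; rewrite pderive_conv//; exists (pderive j r) => //.
  exact: test_function_pderive.
- by exists rho.
Qed.

End convolution_smooth.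

(** * Normalized bumps as kernels *)

Section mollifier.
Variables (R : realType) (n : nat).
Local Notation la := (lebesgue_rV R n).
Implicit Types (a x y : 'rV[R]_n) (s : R).

Lemma ge0_integral_shift (f : 'rV[R]_n -> \bar R) (h : 'rV[R]_n) :
  measurable_fun setT f -> (forall x, 0 <= f x)%E ->
  (\int[la]_x f (x + h)%R = \int[la]_x f x)%E.
Proof.
move=> mf f0.
pose phi : {mfun 'rV[R]_n >-> 'rV[R]_n} := mfun_Sub (mem_set (measurable_rV_shift h)).
rewrite -[LHS](@ge0_integral_pushforward _ _ _ _ R phi (measurable_rV_shift h) la setT f)//.
by apply: eq_measure_integral => A mA _; exact: lebesgue_rV_shift.
Qed.

Lemma measurable_bump a s : measurable_fun setT (bump a s).
Proof. by apply: smooth_measurable; exact: smooth_bump. Qed.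

Lemma integral_bump_shift a s :
  (\int[la]_x (bump a s x)%:E = \int[la]_x (bump 0 s x)%:E)%E.
Proof.
rewrite -(@ge0_integral_shift _ a); last 2 first.
- by apply/measurable_EFinP; exact: measurable_bump.
- by move=> x; rewrite lee_fin bump_ge0.
by apply: eq_integral => x _; rewrite bump_shift subrr.
Qed.

Lemma rint_bump a s : 0 < s -> la.-integrable setT (EFin \o bump a s).
Proof.
move=> s0; have mB : measurable (ball a s) by apply: open_measurable_mx; exact: ball_open.
have E : (bump a s) \_ (ball a s) = bump a s.
  apply/funext => x; rewrite patchE; case: ifPn => //; rewrite notin_setE -cube_ball// => nb.
  have [j H] : exists j, s <= `|x 0 j - a 0 j|.
    apply: contrapT => /forallNP H; apply: nb => i j.
    by rewrite ord1 ltNge; apply/negP/H.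
  by rewrite (bump_eq0 H).
have : la.-integrable (ball a s) (EFin \o bump a s).
  apply: (@rint_bdd _ _ _ _ _ mB _ 1).
    by have := ltry ((s *+ 2) ^+ n); rewrite -(lebesgue_rV_ball a s0).
    by apply: measurable_funTS; exact: measurable_bump.
  by move=> x _; rewrite ger0_norm ?bump_ge0// bump_le1.
by move=> /(integrable_mkcond _ mB); rewrite restrict_EFin E.
Qed.

Definition bump_mass s := \int[la]_x bump 0 s x.

Lemma bump_massE a s : 0 < s -> (\int[la]_x (bump a s x)%:E = (bump_mass s)%:E)%E.
Proof.
by move=> s0; rewrite integral_bump_shift /bump_mass RintegralE//; exact: rint_bump.
Qed.

(** A vanishing integral would make the bump zero almost everywhere, although it is positive on a
    ball of positive measure. *)
Lemma bump_mass_gt0 s : 0 < s -> 0 < bump_mass s.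
Proof.
move=> s0; rewrite lt_neqAle andbC; apply/andP; split.
  by apply: Rintegral_ge0 => x _; exact: bump_ge0.
apply/eqP => H; have := bump_massE 0 s0; rewrite -H => H0.
have : (\int[la]_x `|(bump 0 s x)%:E| = 0)%E.
  by rewrite -[RHS]H0; apply: eq_integral => x _; rewrite gee0_abs// lee_fin bump_ge0.
move/(ae_eq_integral_abs _ measurableT) => -[].
  by apply/measurable_EFinP; exact: measurable_bump.
move=> N [mN N0 sub].
have : (la (ball (0%R : 'rV[R]_n) s) <= la N)%E.
  apply: le_measure; rewrite ?inE//; first by apply: open_measurable_mx; exact: ball_open.
  move=> x; rewrite -cube_ball// => xs; apply: sub => /=.
  apply/not_implyP; split => // -[]; apply/eqP; rewrite gt_eqF//.
  by apply: bump_gt0 => j; exact: xs.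
by rewrite N0 [X in (X <= _)%E](lebesgue_rV_ball _ s0) lee_fin leNgt exprn_gt0// pmulrn_lgt0.
Qed.

(** The centre [a] is free: a kernel centred away from the origin translates the field while
    smoothing it, which is needed near the boundary. *)
Definition mollifier a s y := (bump_mass s)^-1 * bump a s y.

Lemma mollifier_ge0 a s y : 0 < s -> 0 <= mollifier a s y.
Proof. by move=> s0; rewrite mulr_ge0 ?bump_ge0// invr_ge0 ltW// bump_mass_gt0. Qed.

Lemma test_mollifier a s : test_function setT (mollifier a s).
Proof. by apply: test_functionZ; exact: test_bump. Qed.

Lemma mollifier_eq0 a s y j : s <= `|y 0 j - a 0 j| -> mollifier a s y = 0.
Proof. by move=> H; rewrite /mollifier (bump_eq0 H) mulr0. Qed.

Lemma integral_mollifier_l a s y : 0 < s ->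
  (\int[la]_x (mollifier a s (x - y))%:E = 1)%E.
Proof.
move=> s0; have m0 := bump_mass_gt0 s0.
have mb : measurable_fun setT (EFin \o bump (a + y) s).
  by apply/measurable_EFinP; exact: measurable_bump.
under eq_integral do rewrite /mollifier bump_shift opprK EFinM.
rewrite ge0_integralZl//; last 2 first.
- by move=> x _; rewrite lee_fin bump_ge0.
- by rewrite lee_fin invr_ge0 ltW.
by rewrite bump_massE// -EFinM mulVf// gt_eqF.
Qed.

Lemma integral_mollifier_r a s x : 0 < s ->
  (\int[la]_y (mollifier a s (x - y))%:E = 1)%E.
Proof.
move=> s0; have m0 := bump_mass_gt0 s0.
have mb : measurable_fun setT (EFin \o bump (x - a) s).
  by apply/measurable_EFinP; exact: measurable_bump.
under eq_integral do rewrite /mollifier bump_sym EFinM.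
rewrite ge0_integralZl//; last 2 first.
- by move=> y _; rewrite lee_fin bump_ge0.
- by rewrite lee_fin invr_ge0 ltW.
by rewrite bump_massE// -EFinM mulVf// gt_eqF.
Qed.

Lemma measurable_mollifier2 a s :
  measurable_fun setT (fun p : 'rV[R]_n * 'rV[R]_n => mollifier a s (p.1 - p.2)).
Proof.
apply: (measurableT_comp (f := mollifier a s)).
  by apply: smooth_measurable; case: (test_mollifier a s).
apply: measurable_fun_mx => i j; under eq_fun do rewrite !mxE.
have mc := @measurable_mx_coord _ (measurableTypeR R) 1 n i j.
by apply: measurable_funB; [exact: (measurableT_comp mc measurable_fst)|
  exact: (measurableT_comp mc measurable_snd)].
Qed.

End mollifier.

(** * Fubini for mollified integrals *)

Section kernel_fubini.
Variables (R : realType) (n : nat) (a : 'rV[R]_n) (s : R).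
Hypothesis s0 : 0 < s.
Local Notation la := (lebesgue_rV R n).
Local Notation k := (fun x y : 'rV[R]_n => mollifier a s (x - y)).
Variables (f g F G : 'rV[R]_n -> R).
Hypotheses (fi : la.-integrable setT (EFin \o f)) (gi : la.-integrable setT (EFin \o g))
  (Fi : la.-integrable setT (EFin \o F)) (Gi : la.-integrable setT (EFin \o G))
  (F0 : forall x, 0 <= F x) (G0 : forall x, 0 <= G x)
  (fgFG : forall x y, `|f y * g x| <= F y + G x).

Let H (p : 'rV[R]_n * 'rV[R]_n) := f p.2 * k p.1 p.2 * g p.1.

Let mcomp1 (h : 'rV[R]_n -> R) : la.-integrable setT (EFin \o h) ->
  measurable_fun setT (fun p : 'rV[R]_n * 'rV[R]_n => h p.1).
Proof. by move=> /rint_measurable mh; exact: (measurableT_comp mh measurable_fst). Qed.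

Let mcomp2 (h : 'rV[R]_n -> R) : la.-integrable setT (EFin \o h) ->
  measurable_fun setT (fun p : 'rV[R]_n * 'rV[R]_n => h p.2).
Proof. by move=> /rint_measurable mh; exact: (measurableT_comp mh measurable_snd). Qed.

Let mH : measurable_fun setT H.
Proof.
apply: measurable_funM; last exact: mcomp1.
by apply: measurable_funM; [exact: mcomp2|exact: measurable_mollifier2].
Qed.

(** The kernel has mass one in each variable, so a bound [F y + G x] for the product integrates to
    the sum of the two integrals. The additive form covers a bounded function times an integrable
    one (take [F = 0]) and, by Young's inequality, the product of two square integrable ones. *)
Let bound : (\int[la]_x \int[la]_y `|(H (x, y))%:E| <= (\int[la]_x F x + \int[la]_x G x)%R%:E)%E.
Proof.
have mk := measurable_mollifier2 a s.
have mkF : measurable_fun setT (fun p : 'rV[R]_n * 'rV[R]_n => (k p.1 p.2 * F p.2)%:E).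
  by apply/measurable_EFinP; apply: measurable_funM; [exact: mk|exact: mcomp2].
have mkG : measurable_fun setT (fun p : 'rV[R]_n * 'rV[R]_n => (k p.1 p.2 * G p.1)%:E).
  by apply/measurable_EFinP; apply: measurable_funM; [exact: mk|exact: mcomp1].
have kF0 p : (0 <= (k p.1 p.2 * F p.2)%:E)%E by rewrite lee_fin mulr_ge0// mollifier_ge0.
have kG0 p : (0 <= (k p.1 p.2 * G p.1)%:E)%E by rewrite lee_fin mulr_ge0// mollifier_ge0.
apply: (@le_trans _ _ (\int[la]_x \int[la]_y ((k x y * F y)%:E + (k x y * G x)%:E))%E).
  have mHa : measurable_fun setT (fun p => `|(H p)%:E|%E).
    by apply: measurableT_comp => //; exact/measurable_EFinP.
  have mS : measurable_fun setT (fun p : 'rV[R]_n * 'rV[R]_n =>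
      (k p.1 p.2 * F p.2)%:E + (k p.1 p.2 * G p.1)%:E)%E.
    exact: emeasurable_funD.
  apply: ge0_le_integral => //.
  - by move=> x _; exact: integral_ge0.
  - exact: (measurable_fun_fubini_tonelli_F _ mHa).
  - exact: (measurable_fun_fubini_tonelli_F _ mS (fun p => adde_ge0 (kF0 p) (kG0 p))).
  - move=> x _; apply: ge0_le_integral => //.
    + exact: (measurable_fun_pair2 x mHa).
    + exact: (measurable_fun_pair2 x mS).
    + move=> y _; rewrite lee_fin /H /= mulrAC normrM (ger0_norm (mollifier_ge0 _ _ s0)).
      by rewrite -mulrDr mulrC ler_wpM2l// mollifier_ge0.
have -> : (\int[la]_x \int[la]_y ((k x y * F y)%:E + (k x y * G x)%:E) =
    \int[la]_x (\int[la]_y (k x y * F y)%:E + \int[la]_y (k x y * G x)%:E))%E.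
  apply: eq_integral => x _; rewrite ge0_integralD//.
  - by move=> y _; exact: (kF0 (x, y)).
  - exact: (measurable_fun_pair2 x mkF).
  - by move=> y _; exact: (kG0 (x, y)).
  - exact: (measurable_fun_pair2 x mkG).
rewrite ge0_integralD//; last 4 first.
- by move=> x _; apply: integral_ge0 => y _; exact: (kF0 (x, y)).
- exact: (measurable_fun_fubini_tonelli_F _ mkF).
- by move=> x _; apply: integral_ge0 => y _; exact: (kG0 (x, y)).
- exact: (measurable_fun_fubini_tonelli_F _ mkG).
rewrite EFinD leeD//.
  rewrite (fubini_tonelli (fun p : 'rV[R]_n * 'rV[R]_n => (k p.1 p.2 * F p.2)%:E))//=.
  rewrite RintegralE// le_eqVlt; apply/orP; left; apply/eqP.
  apply: eq_integral => y _; under eq_integral do rewrite mulrC EFinM.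
  have mky : measurable_fun setT (fun x => (k x y)%:E).
    by apply/measurable_EFinP; exact: (measurable_fun_pair1 y mk).
  rewrite ge0_integralZl//; last 2 first.
  - by move=> x _; rewrite lee_fin mollifier_ge0.
  - by rewrite lee_fin.
  by rewrite integral_mollifier_l// mule1.
rewrite RintegralE// le_eqVlt; apply/orP; left; apply/eqP.
apply: eq_integral => x _; under eq_integral do rewrite mulrC EFinM.
have mkx : measurable_fun setT (fun y => (k x y)%:E).
  by apply/measurable_EFinP; exact: (measurable_fun_pair2 x mk).
rewrite ge0_integralZl//; last 2 first.
- by move=> y _; rewrite lee_fin mollifier_ge0.
- by rewrite lee_fin.
by rewrite integral_mollifier_r// mule1.
Qed.

Let iH : (la \x la)%E.-integrable setT (EFin \o H).
Proof.
apply/integrable12ltyP; first exact/measurable_EFinP.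
by apply: le_lt_trans bound _; rewrite ltry.
Qed.

Let innerx x : (\int[la]_y (H (x, y))%:E = (conv f (mollifier a s) x * g x)%:E)%E.
Proof.
have i1 := rint_conv x fi (test_mollifier a s).
rewrite /conv -RintegralZr// RintegralE//.
by apply: (@eq_rint _ _ _ _ _ measurableT (fun y => g x * (f y * k x y))) (rintZ _ _ i1) => // y _; rewrite mulrC.
Qed.

Let innery y : (\int[la]_x (H (x, y))%:E = (f y * \int[la]_x (k x y * g x))%R%:E)%E.
Proof.
have [M M0 kM] := test_function_bounded (test_mollifier a s).
have i1 : la.-integrable setT (EFin \o (fun x => k x y * g x)).
  apply: (@rint_bddM _ _ _ _ _ measurableT _ _ M) => //.
  exact: (measurable_fun_pair1 y (measurable_mollifier2 a s)).
have i2 := rintZ measurableT (f y) i1.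
transitivity (\int[la]_x (f y * (k x y * g x))%:E)%E.
  by apply: eq_integral => x _; rewrite /H/= -!mulrA.
by rewrite -(RintegralE measurableT i2) RintegralZl.
Qed.

Lemma rint_conv_mul : la.-integrable setT (EFin \o (fun x => conv f (mollifier a s) x * g x)).
Proof.
rewrite (_ : EFin \o _ = fun x => (\int[la]_y (H (x, y))%:E)%E); last first.
  by apply/funext => x; rewrite innerx.
exact: (integrable_fubini_F iH).
Qed.

Lemma rint_adj_mul :
  la.-integrable setT (EFin \o (fun y => f y * \int[la]_x (k x y * g x))).
Proof.
rewrite (_ : EFin \o _ = fun y => (\int[la]_x (H (x, y))%:E)%E); last first.
  by apply/funext => y; rewrite innery.
apply/integrableP; split; first exact: (measurable_fubini_G iH).
have mHa : measurable_fun setT (fun p => `|(H p)%:E|%E).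
  by apply: measurableT_comp => //; exact/measurable_EFinP.
apply: (@le_lt_trans _ _ (\int[la]_y \int[la]_x `|(H (x, y))%:E|)%E).
  apply: ge0_le_integral => //.
  - by apply: measurableT_comp => //; exact: (measurable_fubini_G iH).
  - exact: (measurable_fun_fubini_tonelli_G _ mHa).
  - move=> y _; apply: le_abse_integral => //.
    by apply: (measurable_fun_pair1 y (f := fun p => (H p)%:E)); exact/measurable_EFinP.
rewrite -(fubini_tonelli (fun p => `|(H p)%:E|%E))//.
by apply: le_lt_trans bound _; rewrite ltry.
Qed.

Lemma conv_fubini : \int[la]_x (conv f (mollifier a s) x * g x) =
  \int[la]_y (f y * \int[la]_x (k x y * g x)).
Proof.
rewrite /Rintegral; congr fine.
under eq_integral do rewrite -innerx.
rewrite (Fubini iH).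
by apply: eq_integral => y _; exact: innery.
Qed.

Lemma conv_bound : `|\int[la]_x (conv f (mollifier a s) x * g x)| <=
  \int[la]_x F x + \int[la]_x G x.
Proof.
rewrite -lee_fin; apply: le_trans bound.
rewrite EFin_normr_Rintegral//; last exact: rint_conv_mul.
apply: (le_trans (le_abse_integral _ measurableT _)).
  exact: (measurable_int _ rint_conv_mul).
have mHa : measurable_fun setT (fun p => `|(H p)%:E|%E).
  by apply: measurableT_comp => //; exact/measurable_EFinP.
apply: ge0_le_integral => //.
- by apply: measurableT_comp => //; exact: (measurable_int _ rint_conv_mul).
- exact: (measurable_fun_fubini_tonelli_F _ mHa).
- move=> x _; rewrite -innerx; apply: le_abse_integral => //.
  by apply: (measurable_fun_pair2 x (f := fun p => (H p)%:E)); exact/measurable_EFinP.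
Qed.

End kernel_fubini.

(** * Weak convergence of mollifications as kernels shrink to the origin *)

Section weak_convergence.
Variables (R : realType) (n : nat) (Om : set 'rV[R]_n).
Hypotheses (oOm : open Om) (Omfin : (lebesgue_rV R n Om < +oo)%E).
Local Notation la := (lebesgue_rV R n).
Local Notation rint f := (la.-integrable setT (EFin \o f)).

Let mOm : measurable Om. Proof. exact: open_measurable_mx. Qed.

Lemma rint_test phi : test_function Om phi -> rint phi.
Proof.
move=> tp; have [M M0 pM] := test_function_bounded tp; case: tp => sp cp pO.
have E : phi \_ Om = phi.
  apply/funext => x; rewrite patchE; case: ifPn => // xO; apply/esym/eqP.
  apply: contraNT xO => px; apply/mem_set/pO/subset_closure; exact: px.
have : la.-integrable Om (EFin \o phi).
  by apply: (@rint_bdd _ _ _ _ _ mOm _ M) => //; exact: smooth_measurable.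
by move=> /(integrable_mkcond _ mOm); rewrite restrict_EFin E.
Qed.

Lemma Rintegral_supp (f : 'rV[R]_n -> R) : (forall x, ~ Om x -> f x = 0) ->
  \int[la]_x f x = \int[la]_(x in Om) f x.
Proof.
move=> f0; rewrite [RHS]Rintegral_mkcond; apply: eq_Rintegral => x _.
by rewrite patchE; case: ifPn => //; rewrite notin_setE => /f0.
Qed.

Lemma Rintegral_mollifier (a : 'rV[R]_n) (s : R) (y : 'rV[R]_n) : 0 < s ->
  rint (fun x => mollifier a s (x - y)) /\ \int[la]_x mollifier a s (x - y) = 1.
Proof.
move=> s0; split; last by rewrite /Rintegral integral_mollifier_l.
apply/integrableP; split.
  by apply/measurable_EFinP; exact: (measurable_fun_pair1 y (measurable_mollifier2 a s)).
rewrite (eq_integral (fun x : 'rV[R]_n => (mollifier a s (x - y))%:E)) ?integral_mollifier_l ?ltry//.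
by move=> x _; rewrite gee0_abs// lee_fin mollifier_ge0.
Qed.

(** The kernel vanishes unless [|x - y| <= |a| + s], so the adjoint convolution averages values of
    [phi] taken close to [y]. *)
Lemma adjoint_mollifier_close (phi : 'rV[R]_n -> R) (e r : R) (a : 'rV[R]_n) (s : R) y :
  test_function Om phi -> 0 <= e ->
  (forall h, `|h| < r -> forall x, `|phi (x + h) - phi x| <= e) ->
  0 < s -> `|a| + s < r ->
  `|\int[la]_x (mollifier a s (x - y) * phi x) - phi y| <= e.
Proof.
move=> tp e0 er s0 asr.
have [ik k1] := Rintegral_mollifier a y s0.
have [M M0 pM] := test_function_bounded tp.
have ikp : rint (fun x => mollifier a s (x - y) * phi x).
  apply: (@eq_rint _ _ _ _ _ measurableT (fun x => phi x * mollifier a s (x - y))) => [x _|].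
    by rewrite mulrC.
  apply: (@rint_bddM _ _ _ _ _ measurableT _ _ M) => //.
  by apply: smooth_measurable; case: tp.
have -> : phi y = \int[la]_x (mollifier a s (x - y) * phi y).
  by rewrite RintegralZr// k1 mul1r.
have ikpy : rint (fun x => mollifier a s (x - y) * phi y).
  by apply: eq_rint (rintZ measurableT (phi y) ik) => // x _; rewrite mulrC.
rewrite -RintegralB//.
have -> : e = \int[la]_x (e * mollifier a s (x - y)) by rewrite RintegralZl// k1 mulr1.
apply: le_norm_Rintegral => //; [exact: rintB|exact: rintZ|move=> x _].
rewrite -mulrBr normrM (ger0_norm (mollifier_ge0 _ _ s0)) [leRHS]mulrC.
have [H|/existsNP[j /negP]] := pselect (forall j, `|(x - y) 0 j - a 0 j| < s); last first.
  by rewrite -leNgt => H; rewrite (mollifier_eq0 H) !mul0r.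
rewrite ler_wpM2l ?mollifier_ge0// -(subrKC y x) er// (le_lt_trans _ asr)//.
apply: ler_norm_coord => [|i j]; first by rewrite addr_ge0// ltW.
rewrite ord1 -(subrK (a 0 j) ((x - y) 0 j)) addrC (le_trans (ler_normD _ _))// lerD//.
  exact: ler_coord_norm.
exact: ltW.
Qed.

(** Replacing [w] by a test function costs at most [M] times an L^1 error, on both sides. For a test
    function the kernel is moved onto it, where convergence is uniform. The radius controls shift
    and width together. *)
Theorem conv_weak_bounded (Z w : 'rV[R]_n -> R) (M e : R) :
  rint Z -> (forall x, `|Z x| <= M) -> rint w -> (forall x, ~ Om x -> w x = 0) -> 0 < e ->
  exists2 r, 0 < r & forall a s, 0 < s -> `|a| + s < r ->
  `|\int[la]_x (conv Z (mollifier a s) x * w x) - \int[la]_x (Z x * w x)| <= e.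
Proof.
move=> iZ ZM iw w0 e0.
have M0 : 0 <= M by exact: le_trans (ZM 0).
have M1 : 0 < M + 1 by rewrite ltr_wpDl.
have iwO : la.-integrable Om (EFin \o w) by exact: (integrableS measurableT).
have e3 : 0 < e / 3 by rewrite divr_gt0.
have [phi tp wp] := test_dense_L1 oOm Omfin iwO (divr_gt0 e3 M1).
have ip := rint_test tp.
pose I := \int[la]_x `|Z x|.
have I0 : 0 <= I by exact: Rintegral_ge0.
have I1 : 0 < I + 1 by rewrite ltr_wpDl.
have [sp cp pO] := tp.
have := compact_support_unif (smooth_continuous sp) cp (divr_gt0 e3 I1).
move=> /nbhs_ballP[r /= r0 rH].
have {}rH h : `|h| < r -> forall x, `|phi (x + h) - phi x| <= e / 3 / (I + 1).
  by move=> hr; apply: rH; rewrite -ball_normE /ball_/= sub0r normrN.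
exists r => // a s s0 asr.
pose g x := w x - phi x.
have ig : rint g by exact: rintB.
have gE : \int[la]_x `|g x| <= e / 3 / (M + 1).
  rewrite Rintegral_supp; first exact: ltW.
  move=> x nO; rewrite /g w0// sub0r normrN; apply/eqP; rewrite normr_eq0.
  by apply: contra_notT nO => px; apply/pO/subset_closure; exact: px.
have gM : M * \int[la]_x `|g x| <= e / 3.
  rewrite (le_trans (ler_wpM2l M0 gE))//.
  have -> : M * (e / 3 / (M + 1)) = (M / (M + 1)) * (e / 3) by ring.
  by rewrite ler_piMl ?(ltW e3)// ler_pdivrMr// mul1r lerDl.
have cond x y : `|Z y * g x| <= cst 0 y + M * `|g x|.
  by rewrite add0r normrM ler_wpM2r.
have iMg : rint (fun x => M * `|g x|) by apply: rintZ => //; exact: rint_norm.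
have g0 x : 0 <= M * `|g x| by rewrite mulr_ge0.
have ic0 : rint (cst 0) by exact: rint0.
have Mp : forall x y, `|Z y * phi x| <= cst 0 y + M * `|phi x|.
  by move=> x y; rewrite add0r normrM ler_wpM2r.
have iMp : rint (fun x => M * `|phi x|) by apply: rintZ => //; exact: rint_norm.
have p0 x : 0 <= M * `|phi x| by rewrite mulr_ge0.
have c00 : forall x : 'rV[R]_n, 0 <= (cst 0 x : R) by [].
have b1 := conv_bound a s0 iZ ig ic0 iMg c00 g0 cond.
have c1 := rint_conv_mul a s0 iZ ig ic0 iMg c00 g0 cond.
have c2 := rint_conv_mul a s0 iZ ip ic0 iMp c00 p0 Mp.
have f2 := conv_fubini a s0 iZ ip ic0 iMp c00 p0 Mp.
rewrite Rintegral_cst// mul0r add0r RintegralZl// in b1; last exact: rint_norm.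
have mZ := rint_measurable iZ.
have iZg : rint (fun x => Z x * g x) by apply: (@rint_bddM _ _ _ _ _ measurableT _ _ M).
have iZp : rint (fun x => Z x * phi x) by apply: (@rint_bddM _ _ _ _ _ measurableT _ _ M).
have -> : \int[la]_x (conv Z (mollifier a s) x * w x) =
    \int[la]_x (conv Z (mollifier a s) x * g x) +
    \int[la]_x (conv Z (mollifier a s) x * phi x).
  by rewrite -RintegralD//; apply: eq_Rintegral => x _; rewrite -mulrDr subrK.
have -> : \int[la]_x (Z x * w x) = \int[la]_x (Z x * g x) + \int[la]_x (Z x * phi x).
  by rewrite -RintegralD//; apply: eq_Rintegral => x _; rewrite -mulrDr subrK.
have b2 : `|\int[la]_x (Z x * g x)| <= e / 3.
  apply: le_trans gM; rewrite -RintegralZl//; last exact: rint_norm.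
  by apply: le_norm_Rintegral => // x _; rewrite normrM ler_wpM2r.
have b3 : `|\int[la]_x (conv Z (mollifier a s) x * phi x) - \int[la]_x (Z x * phi x)| <= e / 3.
  rewrite f2.
  have adjb y := adjoint_mollifier_close y tp (ltW (divr_gt0 e3 I1)) rH s0 asr.
  have iadj := rint_adj_mul a s0 iZ ip ic0 iMp c00 p0 Mp.
  rewrite -RintegralB//.
  apply: (@le_trans _ _ (\int[la]_y (e / 3 / (I + 1) * `|Z y|))).
    apply: le_norm_Rintegral => //; [exact: rintB|by apply: rintZ => //; exact: rint_norm|].
    by move=> y _; rewrite -mulrBr normrM mulrC ler_wpM2r.
  rewrite RintegralZl//; last exact: rint_norm.
  rewrite -/I; have -> : e / 3 / (I + 1) * I = (I / (I + 1)) * (e / 3) by ring.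
  by rewrite ler_piMl ?(ltW e3)// ler_pdivrMr// mul1r lerDl.
set A1 := \int[la]_x _ in b1 *; set A2 := \int[la]_x _ in b3 *.
set B1 := \int[la]_x _ in b2 *; set B2 := \int[la]_x _ in b3 *.
have -> : A1 + A2 - (B1 + B2) = A1 + - B1 + (A2 - B2) by ring.
apply: (le_trans (ler_normD _ _)); apply: (le_trans (lerD (ler_normD _ _) b3)).
rewrite normrN; move: (le_trans b1 gM) => ?; lra.
Qed.

(** Truncation at a level [N] reduces to the bounded case; the tail is small in L^2 and is estimated
    by Young's inequality, uniformly in the kernel. *)
Theorem conv_weak_L2 (W w : 'rV[R]_n -> R) (e : R) :
  rint W -> rint (fun x => W x ^+ 2) -> rint w -> rint (fun x => w x ^+ 2) ->
  (forall x, ~ Om x -> w x = 0) -> 0 < e ->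
  exists2 r, 0 < r & forall a s, 0 < s -> `|a| + s < r ->
  `|\int[la]_x (conv W (mollifier a s) x * w x) - \int[la]_x (W x * w x)| <= e.
Proof.
move=> iW iW2 iw iw2 w0 e0.
have mW := rint_measurable iW.
pose J := \int[la]_x (w x ^+ 2).
have J0 : 0 <= J by apply: Rintegral_ge0 => x _; exact: sqr_ge0.
have e3 : 0 < e / 3 by rewrite divr_gt0.
(* The parameter of Young's inequality: it makes the term of [w] at most [e / 6]. Only then is [N]
   chosen, so that the term of the tail, which carries the factor [l / 2], is at most [e / 6]
   too. *)
pose l := (J + 1) / (e / 3).
have l0 : 0 < l by rewrite divr_gt0// ltr_wpDl.
pose W1 N x : R := if `|W x| <= N%:R then W x else 0.
pose W2 N x : R := W x - W1 N x.
have mW1 N : measurable_fun setT (W1 N).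
  by apply: measurable_fun_ifT => //; apply: measurable_fun_ler => //; exact: measurableT_comp.
have W1le N x : `|W1 N x| <= `|W x| by rewrite /W1; case: ifP; rewrite ?normr0.
have W2le N x : `|W2 N x| <= `|W x|.
  by rewrite /W2 /W1; case: ifP; rewrite ?subrr ?normr0 ?subr0.
have iW1 N : rint (W1 N) by apply: (rint_le measurableT (mW1 N) _ (rint_norm iW)).
have iW2' N : rint (W2 N) by exact: rintB.
have sq (A B : R) : `|A| <= `|B| -> A ^+ 2 <= B ^+ 2.
  by move=> AB; rewrite -(real_normK (num_real A)) -(real_normK (num_real B)) lerXn2r ?nnegrE.
have iW2s N : rint (fun x => W2 N x ^+ 2).
  apply: (rint_le measurableT _ _ iW2); first by apply: measurable_funX; exact: rint_measurable.
  by move=> x _; rewrite ger0_norm ?sqr_ge0// sq.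
have [N HN] : exists N, \int[la]_x (W2 N x ^+ 2) < e / 3 / l.
  have [||||_] := @Rdominated_cvg _ _ _ la setT (fun N x => W2 N x ^+ 2) (fun=> 0)
      (fun x => W x ^+ 2) measurableT.
  - by move=> k; exact: rint_measurable (iW2s k).
  - move=> x _; apply: cvg_near_cst; near=> k; rewrite /W2 /W1 ifT ?subrr ?expr0n//.
    near: k; exact: nbhs_infty_ger.
  - exact: iW2.
  - by move=> k x _; rewrite ger0_norm ?sqr_ge0// sq.
  rewrite Rintegral_cst// mul0r => /cvgrPdist_lt/(_ _ (divr_gt0 e3 l0))[K _ /(_ K (leqnn K))].
  rewrite sub0r normrN ger0_norm; last by apply: Rintegral_ge0 => x _; exact: sqr_ge0.
  by exists K.
have W1N x : `|W1 N x| <= N%:R by rewrite /W1; case: ifP => // _; rewrite normr0.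
have [r r0 rH] := conv_weak_bounded (iW1 N) W1N iw w0 e3.
exists r => // a s s0 asr.
have amgm (A B : R) : `|A * B| <= l / 2 * A ^+ 2 + (2 * l)^-1 * B ^+ 2.
  rewrite normrM -(real_normK (num_real A)) -(real_normK (num_real B)).
  move: `|A| `|B| => {}A {}B; have := sqr_ge0 (l * A - B).
  have -> : l / 2 * A ^+ 2 + (2 * l)^-1 * B ^+ 2 = (2 * l)^-1 * (l ^+ 2 * A ^+ 2 + B ^+ 2).
    by field; rewrite gt_eqF.
  have -> : A * B = (2 * l)^-1 * (2 * l * A * B) by field; rewrite gt_eqF.
  move=> H; apply: ler_wpM2l; first by rewrite invr_ge0 mulr_ge0// ltW.
  by rewrite -subr_ge0 (_ : _ - _ = (l * A - B) ^+ 2)//; ring.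
have cond x y : `|W2 N y * w x| <= l / 2 * W2 N y ^+ 2 + (2 * l)^-1 * w x ^+ 2 by [].
have cond' x y : `|W1 N y * w x| <= cst 0 y + N%:R * `|w x|.
  by rewrite add0r normrM ler_wpM2r.
have iF : rint (fun y => l / 2 * W2 N y ^+ 2) by exact: rintZ.
have iG : rint (fun y => (2 * l)^-1 * w y ^+ 2) by exact: rintZ.
have F0 y : 0 <= l / 2 * W2 N y ^+ 2 by rewrite mulr_ge0 ?sqr_ge0// divr_ge0// ltW.
have G0 y : 0 <= (2 * l)^-1 * w y ^+ 2.
  by rewrite mulr_ge0 ?sqr_ge0// invr_ge0 mulr_ge0// ltW.
have iG' : rint (fun x => N%:R * `|w x|) by apply: rintZ => //; exact: rint_norm.
have G0' x : 0 <= N%:R * `|w x| by rewrite mulr_ge0.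
have ic0 : rint (cst 0) by exact: rint0.
have c00 : forall x : 'rV[R]_n, 0 <= (cst 0 x : R) by [].
have b1 := conv_bound a s0 (iW2' N) iw iF iG F0 G0 cond.
have c1 := rint_conv_mul a s0 (iW2' N) iw iF iG F0 G0 cond.
have c2 := rint_conv_mul a s0 (iW1 N) iw ic0 iG' c00 G0' cond'.
have iW1w : rint (fun x => W1 N x * w x) by apply: (@rint_bddM _ _ _ _ _ measurableT _ _ N%:R).
have iW2w : rint (fun x => W2 N x * w x).
  apply: (rint_le measurableT _ _ (rintD measurableT iF iG)) => //.
  apply: measurable_funM; [exact: (rint_measurable (iW2' N))|exact: (rint_measurable iw)].
have small : \int[la]_x (l / 2 * W2 N x ^+ 2) + \int[la]_x ((2 * l)^-1 * w x ^+ 2) <= e / 3.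
  rewrite !RintegralZl// -/J.
  have lJ : (2 * l)^-1 * J <= e / 6.
    have J1 : 0 < J + 1 by rewrite ltr_wpDl.
    have -> : (2 * l)^-1 * J = (J / (J + 1)) * (e / 6).
      by rewrite /l; field; rewrite !gt_eqF.
    by rewrite ler_piMl ?divr_ge0 ?(ltW e0)// ler_pdivrMr// mul1r lerDl.
  have : l / 2 * \int[la]_x (W2 N x ^+ 2) <= e / 6.
    move: HN; rewrite ltr_pdivlMr// => /ltW; move: (\int[la]_x _) => I HI.
    have -> : l / 2 * I = I * l / 2 by ring.
    move: (I * l) HI => t; lra.
  lra.
have b2 : `|\int[la]_x (W2 N x * w x)| <= e / 3.
  apply: le_trans small; rewrite -RintegralD//; apply: le_norm_Rintegral => //.
  exact: rintD.
have -> : \int[la]_x (conv W (mollifier a s) x * w x) =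
    \int[la]_x (conv (W2 N) (mollifier a s) x * w x) +
    \int[la]_x (conv (W1 N) (mollifier a s) x * w x).
  rewrite -RintegralD//; apply: eq_Rintegral => x _; rewrite -mulrDl; congr (_ * _).
  rewrite /conv -RintegralD//; [|exact: (rint_conv _ _ (test_mollifier _ _))..].
  by apply: eq_Rintegral => y _; rewrite -mulrDl /W2 subrK.
have -> : \int[la]_x (W x * w x) = \int[la]_x (W2 N x * w x) + \int[la]_x (W1 N x * w x).
  by rewrite -RintegralD//; apply: eq_Rintegral => x _; rewrite -mulrDl subrK.
have b3 := rH a s s0 asr; have b1' := le_trans b1 small.
set A1 := \int[la]_x _ in b1' *; set A2 := \int[la]_x _ in b3 *.
set B1 := \int[la]_x _ in b2 *; set B2 := \int[la]_x _ in b3 *.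
have -> : A1 + A2 - (B1 + B2) = A1 + - B1 + (A2 - B2) by ring.
apply: (le_trans (ler_normD _ _)); apply: (le_trans (lerD (ler_normD _ _) b3)).
rewrite normrN; lra.
Unshelve. all: by end_near. Qed.

End weak_convergence.

(** * Functionals on L^1 and densities of charges *)

Section L1_induction.
Context d (T : measurableType d) (R : realType) (mu : {measure set T -> \bar R}) (D : set T).
Hypotheses (mD : measurable D) (Dfin : (mu D < +oo)%E).
Local Notation rint f := (mu.-integrable D (EFin \o f)).
Import HBSimple.

Lemma rint_indic E : measurable E -> rint (\1_E : T -> R).
Proof.
move=> mE; apply: (@rint_bdd _ _ _ _ _ mD _ 1) => //.
by move=> x _; rewrite indicE; case: (_ \in _); rewrite ?normr1 ?normr0.
Qed.

Lemma L1_ind (P : (T -> R) -> Prop) :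
  (forall c E, measurable E -> P (fun x => c * \1_E x)) ->
  (forall g h, rint g -> rint h -> P g -> P h -> P (fun x => g x + h x)) ->
  (forall f, rint f -> (forall e, 0 < e ->
     exists g, [/\ rint g, P g & \int[mu]_(x in D) `|f x - g x| < e]) -> P f) ->
  forall f, rint f -> P f.
Proof.
move=> Pind Psum Plim f fi; apply: Plim => // e e0.
have [g [gi _ gf]] := approximation_sfun_integrable mD fi.
move: gf => /fine_cvgP[_ /cvgrPdist_lt/(_ _ e0)[K _ /(_ K (leqnn K))]] /=.
rewrite sub0r normrN => gK; exists (g K); split; [exact: gi| |].
- have Pbig (I : Type) (r : seq I) (F : I -> T -> R) : (forall i, rint (F i) /\ P (F i)) ->
    rint (fun x => \sum_(i <- r) F i x) /\ P (fun x => \sum_(i <- r) F i x).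
    move=> PF; split; first by apply: rint_sum => // i _; case: (PF i).
    elim: r => [|i r IH].
      by have := Pind 0 setT measurableT; congr P; apply/funext => x; rewrite big_nil mul0r.
    under eq_fun do rewrite big_cons; apply: Psum => //; try by case: (PF i).
    by apply: rint_sum => // j _; case: (PF j).
  rewrite (funext (fimfunEord (g K))).
  apply: (Pbig _ _ _ _).2 => i; split; last by apply: Pind; exact: measurable_sfunP.
  by apply: rintZ => //; apply: rint_indic; exact: measurable_sfunP.
- by move: gK; rewrite ger0_norm; [exact|apply: fine_ge0; exact: integral_ge0].
Qed.

End L1_induction.

(** The bound on sets forces the parts of [D] where [g0 > C] or [g0 < - C] to be null. Clipping then
    changes no integral and makes the bound hold at every point. *)
Lemma clip_density d (T : measurableType d) (R : realType) (mu : {measure set T -> \bar R})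
    (D : set T) (C : R) (g0 : T -> R) :
  measurable D -> (mu D < +oo)%E -> 0 <= C -> mu.-integrable setT (EFin \o g0) ->
  (forall E, measurable E -> E `<=` D -> `|\int[mu]_(x in E) g0 x| <= C * fine (mu E)) ->
  exists g : T -> R, [/\ measurable_fun setT g, (forall x, `|g x| <= C) &
    forall E, measurable E -> \int[mu]_(x in E `&` D) g0 x = \int[mu]_(x in E `&` D) g x].
Proof.
move=> mD Dfin C0 ig0 g0bd.
have ig0S E : measurable E -> mu.-integrable E (EFin \o g0).
  by move=> mE; exact: (integrableS measurableT).
have mg0 : measurable_fun setT g0 by exact: (rint_measurable ig0).
have nul (c : R) (F : set T) : measurable F -> F `<=` D ->
    (forall x, F x -> 0 < c * g0 x - C) -> `|c| = 1 -> mu F = 0%E.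
  move=> mF FD pos c1.
  have Ffin : (mu F < +oo)%E.
    by apply: le_lt_trans Dfin; rewrite le_measure ?inE.
  have ic : mu.-integrable F (EFin \o cst C).
    by apply: (@rint_bdd _ _ _ _ _ mF _ C) => // x _; rewrite ger0_norm.
  have icg : mu.-integrable F (EFin \o (fun x => c * g0 x)).
    by apply: rintZ => //; exact: ig0S.
  have le0 : \int[mu]_(x in F) (c * g0 x - C) <= 0.
    rewrite (@RintegralB _ _ _ _ _ (fun x => c * g0 x) (cst C))//.
    rewrite RintegralZl//; last exact: ig0S.
    rewrite Rintegral_cst// subr_le0; apply: le_trans (g0bd _ mF FD).
    by rewrite (le_trans (ler_norm _))// normrM c1 mul1r.
  have ib : mu.-integrable F (EFin \o (fun x => c * g0 x - C)) by exact: rintB.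
  have eq0 : (\int[mu]_(x in F) `|(c * g0 x - C)%:E| = 0)%E.
    rewrite (eq_integral (fun x => (c * g0 x - C)%:E)); last first.
      by move=> x /[!inE] Fx; rewrite gee0_abs// lee_fin ltW// pos.
    rewrite -RintegralE//; congr _%:E; apply/eqP; rewrite eq_le le0/=.
    by apply: Rintegral_ge0 => x Fx; rewrite ltW// pos.
  have [N [mN N0 sub]] := (ae_eq_integral_abs _ mF (measurable_int _ ib)).1 eq0.
  apply/eqP; rewrite eq_le measure_ge0 andbT -N0 le_measure ?inE// => x Fx.
  apply: sub => /= /(_ Fx) []; have := pos x Fx; by move=> /[swap] ->; rewrite ltxx.
pose g x := Num.max (- C) (Num.min C (g0 x)).
have mg : measurable_fun setT g by apply: measurable_maxr => //; exact: measurable_minr.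
have gC x : `|g x| <= C.
  rewrite ler_norml /g le_max lexx/= ge_max (le_trans _ C0) ?oppr_le0//=.
  by rewrite ge_min lexx.
have gg0 E : measurable E -> \int[mu]_(x in E `&` D) g0 x = \int[mu]_(x in E `&` D) g x.
  move=> mE; have mED : measurable (E `&` D) by exact: measurableI.
  rewrite /Rintegral; congr fine; apply: ae_eq_integral => //.
  - exact: (measurable_int _ (ig0S _ mED)).
  - by apply/measurable_EFinP; exact: measurable_funTS.
  pose N1 := D `&` g0 @^-1` `]C, +oo[; pose N2 := D `&` g0 @^-1` `]-oo, - C[.
  have mN1 : measurable N1.
    by apply: measurableI => //; rewrite -[X in measurable X]setTI; exact: mg0.
  have mN2 : measurable N2.
    by apply: measurableI => //; rewrite -[X in measurable X]setTI; exact: mg0.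
  exists (N1 `|` N2); split; first exact: measurableU.
    rewrite measureU0//; [apply: (nul 1) => //|apply: (nul (-1)) => //].
    + by move=> x [].
    + by move=> x [_] /=; rewrite in_itv/= andbT; lra.
    + by rewrite normr1.
    + by move=> x [].
    + by move=> x [_] /=; rewrite in_itv/=; lra.
    + by rewrite normrN1.
  move=> x /=; apply: contra_notP => /not_orP[H1 H2] [_ Dx].
  have c1 : g0 x <= C by rewrite leNgt; apply/negP => ?; apply: H1; split => //=; rewrite in_itv/= andbT.
  have c2 : - C <= g0 x by rewrite leNgt; apply/negP => ?; apply: H2; split => //=; rewrite in_itv.
  by congr _%:E; rewrite /g; rewrite (min_idPr c1) (max_idPr c2).
by exists g.
Qed.

Section L1_functional.
Local Open Scope charge_scope.
Context d (T : measurableType d) (R : realType) (mu : {sigma_finite_measure set T -> \bar R}).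
Variables (D : set T) (L : (T -> R) -> R) (C : R).
Hypotheses (mD : measurable D) (Dfin : (mu D < +oo)%E) (C0 : 0 <= C).
Local Notation rint f := (mu.-integrable D (EFin \o f)).
Hypothesis L_lin : forall a f g, rint f -> rint g -> L (fun x => a * f x + g x) = a * L f + L g.
Hypothesis L_bdd : forall f, rint f -> `|L f| <= C * \int[mu]_(x in D) `|f x|.

(** The bound on [L] implies that it depends only on values in [D]. *)
Let Leq f g : rint f -> rint g -> (forall x, D x -> f x = g x) -> L f = L g.
Proof.
move=> fi gi fg; apply/eqP; rewrite -subr_eq0 -normr_le0.
have -> : L f - L g = L (fun x => -1 * g x + f x) by rewrite L_lin// mulN1r addrC.
have i1 : rint (fun x => -1 * g x + f x) by apply: rintD => //; exact: rintZ.
apply: (le_trans (L_bdd i1)); rewrite (@eq_Rintegral _ _ _ _ _ (fun=> 0)).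
  by rewrite Rintegral_cst// mul0r mulr0.
by move=> x /[!inE] Dx; rewrite fg// mulN1r addNr normr0.
Qed.

Let ri E : measurable E -> rint (\1_E : T -> R). Proof. exact: rint_indic. Qed.

Let L0 : L (fun=> 0) = 0.
Proof.
have i0 : rint (fun=> 0) by exact: rint0.
have H := L_lin 1 i0 i0; rewrite [1 * L _]mul1r in H.
have : L (fun=> 0) = L (fun=> 0) + L (fun=> 0).
  by rewrite -H; congr L; apply/funext => x; rewrite mulr0 addr0.
lra.
Qed.

Let LD f g : rint f -> rint g -> L (fun x => f x + g x) = L f + L g.
Proof.
move=> fi gi; have := L_lin 1 fi gi; rewrite mul1r => <-; congr L.
by apply/funext => x; rewrite mul1r.
Qed.

Let LB f g : rint f -> rint g -> L (fun x => f x - g x) = L f - L g.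
Proof.
move=> fi gi; have := L_lin (-1) gi fi; rewrite mulN1r addrC => <-; congr L.
by apply/funext => x; rewrite mulN1r addrC.
Qed.

(** Countable additivity comes from the L^1 bound by dominated convergence, and domination by [mu]
    from the same bound; the Radon-Nikodym density of this charge, clipped at [C], represents
    [L]. *)
Let nu (E : set T) : \bar R := (L \1_E)%:E.

Let nu0 : nu set0 = 0%E.
Proof. by rewrite /nu indic0 L0. Qed.

Let nu_fin E : measurable E -> nu E \is a fin_num. Proof. by []. Qed.

Let nu_sigma : semi_sigma_additive nu.
Proof.
move=> F mF tF mUF; rewrite /nu.
pose G k := \big[setU/set0]_(0 <= i < k) F i.
have mG k : measurable (G k) by exact: bigsetU_measurable.
have GE k : (\sum_(0 <= i < k) (L \1_(F i))%:E = (L \1_(G k))%:E)%E.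
  rewrite /G; elim: k => [|k IH]; first by rewrite !big_nil indic0 L0.
  rewrite !big_nat_recr//= IH -EFinD -LD; [|by apply: ri; exact: mG|exact: ri].
  congr (L _)%:E; apply/funext => x; rewrite !indicE in_setU.
  have [xk|] := boolP (x \in F k); last by rewrite orbF addr0.
  rewrite orbT memNset ?add0r//; rewrite big_mkord -(bigcup_mkord) => -[i /= ik Fi].
  move/trivIsetP : tF => /(_ i k I I); rewrite neq_ltn ik => /(_ isT) Fik.
  have : (F i `&` F k) x by split => //; move: xk; rewrite inE.
  by rewrite Fik.
under eq_fun do rewrite GE; apply: cvg_EFin; first exact: nearW.
have [||||_] := @Rdominated_cvg _ _ _ mu D
    (fun k x => `|\1_(\bigcup_k F k) x - \1_(G k) x|) (fun=> 0) (cst 1) mD.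
- move=> k; apply: measurableT_comp => //; apply: measurable_funB; exact: measurable_indic.
- move=> x _; apply: cvg_near_cst; rewrite indicE.
  have [/set_mem[k _ Ek]|nE] := boolP (x \in \bigcup_k F k).
    near=> j; rewrite indicE mem_set ?subrr ?normr0//.
    rewrite /G big_mkord -(bigcup_mkord); exists k => //=; near: j; exact: nbhs_infty_gt.
  apply: nearW => k; rewrite indicE memNset ?subrr ?normr0//.
  move: nE; rewrite notin_setE; apply: contra_not; rewrite /G big_mkord -(bigcup_mkord) => -[i _ Ei].
  by exists i.
- by apply: (@rint_bdd _ _ _ _ _ mD _ 1) => // x _; rewrite normr1.
- by move=> k x _; rewrite !indicE normr_id; do 2!case: (_ \in _) => /=; rewrite ler_norml; apply/andP; split; lra.
rewrite Rintegral_cst// mul0r => H.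
apply/cvgrPdist_le => e e0.
have C1 : 0 < C + 1 by rewrite ltr_wpDl.
move/cvgrPdist_lt : H => /(_ _ (divr_gt0 e0 C1)); apply: filterS => k.
rewrite sub0r normrN ger0_norm; last by apply: Rintegral_ge0.
rewrite ltr_pdivlMr// => H; rewrite /= -LB; [|exact: ri|by apply: ri; exact: mG].
have i1 : rint (fun x => \1_(\bigcup_k F k) x - \1_(G k) x : R) by apply: rintB => //; apply: ri => //; exact: mG.
apply: (le_trans (L_bdd i1)); apply: le_trans (ltW H).
by rewrite mulrC ler_wpM2l ?lerDl//; exact: Rintegral_ge0.
Unshelve. all: by end_near. Qed.

HB.instance Definition _ := isCharge.Build _ _ _ nu nu0 nu_fin nu_sigma.

Theorem L1_functional_repr : exists g : T -> R,
  [/\ measurable_fun setT g, (forall x, `|g x| <= C) &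
    forall f, rint f -> L f = \int[mu]_(x in D) (f x * g x)].
Proof.
have nubd E : measurable E -> `|L \1_E| <= C * fine (mu (E `&` D)).
  move=> mE; apply: (le_trans (L_bdd (ri mE))); apply: ler_wpM2l => //.
  rewrite (@eq_Rintegral _ _ _ _ _ (\1_E)); last first.
    by move=> x _; rewrite ger0_norm// indicE.
  by rewrite /Rintegral integral_indic.
have dom : nu `<< mu.
  apply/null_content_dominatesP => E mE E0; rewrite /nu; congr _%:E.
  apply/eqP; rewrite -normr_le0; apply: (le_trans (nubd _ mE)).
  rewrite (_ : mu (E `&` D) = 0%E) ?mulr0//.
  by apply/eqP; rewrite eq_le measure_ge0 andbT -E0 le_measure// inE//; exact: measurableI.
pose h := 'd (nu : {charge set T -> \bar R}) '/d mu.
have hfin x : h x \is a fin_num by exact: Radon_Nikodym_fin_num.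
pose g0 x := fine (h x).
have g0E : EFin \o g0 = h by apply/funext => x; rewrite /g0/= fineK.
have ig0 : mu.-integrable setT (EFin \o g0) by rewrite g0E; exact: Radon_Nikodym_integrable.
have ig0S E : measurable E -> mu.-integrable E (EFin \o g0).
  by move=> mE; exact: (integrableS measurableT).
have mg0 : measurable_fun setT g0 by exact: (rint_measurable ig0).
have Lind : forall E, measurable E -> L \1_E = \int[mu]_(x in E) g0 x.
  move=> E mE; apply: EFin_inj; rewrite RintegralE//; last exact: ig0S.
  rewrite (eq_integral h) => [|x _]; last by rewrite -g0E.
  exact: (Radon_Nikodym_integral dom mE).
have LindD : forall F, measurable F -> L \1_F = \int[mu]_(x in F `&` D) g0 x.
  move=> F mF; rewrite -Lind; last exact: measurableI.
  apply: Leq; [exact: ri|by apply: ri; exact: measurableI|move=> x Dx].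
  by rewrite !indicE in_setI (mem_set Dx) andbT.
have [g [mg gC gg0]] : exists g : T -> R, [/\ measurable_fun setT g,
    (forall x, `|g x| <= C) &
    forall E, measurable E -> \int[mu]_(x in E `&` D) g0 x = \int[mu]_(x in E `&` D) g x].
  apply: clip_density => // E mE ED; rewrite -Lind//.
  by have := nubd E mE; rewrite (setIidl ED).
exists g; split => // f fi.
move: f fi; apply: L1_ind => //.
- move=> c E mE.
  have -> : L (fun x => c * \1_E x) = c * L \1_E.
    have := L_lin c (ri mE) (rint0 _ _); rewrite L0 addr0 => <-; congr L.
    by apply/funext => x; rewrite addr0.
  rewrite LindD// gg0//.
  transitivity (\int[mu]_(x in D) (c * (\1_E x * g x))); last first.
    by apply: eq_Rintegral => x _; rewrite mulrA.
  rewrite RintegralZl//; last first.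
    apply: (@rint_bddM _ _ _ _ _ mD _ _ 1) => //; last first.
      by move=> x _; rewrite indicE; case: (_ \in _); rewrite ?normr1 ?normr0.
    by apply: (@rint_bdd _ _ _ _ _ mD _ C) => //; exact: measurable_funTS.
  congr (_ * _); rewrite setIC Rintegral_mkcondr; apply: eq_Rintegral => x _.
  by rewrite patchE indicE; case: ifP; rewrite ?mul1r ?mul0r.
- move=> f1 f2 i1 i2 E1 E2; rewrite LD// E1 E2 -RintegralD//; last 2 first.
    + apply: (@eq_rint _ _ _ _ _ mD (fun x => g x * f1 x)) => [x _|]; first by rewrite mulrC.
      by apply: (@rint_bddM _ _ _ _ _ mD _ _ C) => //; exact: measurable_funTS.
    + apply: (@eq_rint _ _ _ _ _ mD (fun x => g x * f2 x)) => [x _|]; first by rewrite mulrC.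
      by apply: (@rint_bddM _ _ _ _ _ mD _ _ C) => //; exact: measurable_funTS.
  by apply: eq_Rintegral => x _; rewrite mulrDl.
- move=> f fi H; apply/eqP; rewrite -subr_eq0 -normr_le0; apply/ler_addgt0Pl => e e0.
  rewrite addr0; have C1 : 0 < 2 * C + 1 by rewrite ltr_wpDl// mulr_ge0.
  have [f1 [i1 E1 fe]] := H _ (divr_gt0 e0 C1).
  have ifg : rint (fun x => f x - f1 x) by exact: rintB.
  have igf (u : T -> R) : rint u -> rint (fun x => u x * g x).
    move=> iu; apply: (@eq_rint _ _ _ _ _ mD (fun x => g x * u x)) => [x _|]; first by rewrite mulrC.
    by apply: (@rint_bddM _ _ _ _ _ mD _ _ C) => //; exact: measurable_funTS.
  have -> : L f - \int[mu]_(x in D) (f x * g x) =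
      L (fun x => f x - f1 x) - \int[mu]_(x in D) ((f x - f1 x) * g x).
    under [in RHS]eq_Rintegral do rewrite mulrBl.
    by rewrite LB// RintegralB//; [rewrite E1; ring|exact: igf..].
  apply: (le_trans (ler_normB _ _)).
  apply: (@le_trans _ _ (C * \int[mu]_(x in D) `|f x - f1 x| + C * \int[mu]_(x in D) `|f x - f1 x|)).
    apply: lerD; first exact: L_bdd.
    rewrite -RintegralZl//; last exact: rint_norm.
    apply: le_norm_Rintegral => //; [exact: igf|by apply: rintZ => //; exact: rint_norm|].
    by move=> x _; rewrite normrM mulrC ler_wpM2r.
  move: fe; rewrite ltr_pdivlMr// => /ltW; apply: le_trans.
  have : 0 <= \int[mu]_(x in D) `|f x - f1 x| by exact: Rintegral_ge0.
  by move: (\int[mu]_(x in D) _) => I I0; nra.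
Qed.

End L1_functional.

(** * Integrals against charges given by densities *)

Section charge_density.
Context d (X : measurableType d) (R : realType).
Local Open Scope charge_scope.

(** The two Jordan parts are dominated by [mu], and the difference of their densities equals [s]
    almost everywhere because both define [nu]. *)
Lemma charge_integral_density (nu : {charge set X -> \bar R})
    (mu : {sigma_finite_measure set X -> \bar R}) (s h : X -> R) (M : R) :
  mu.-integrable setT (EFin \o s) ->
  (forall E, measurable E -> nu E = (\int[mu]_(x in E) (s x)%:E)%E) ->
  measurable_fun setT h -> (forall x, `|h x| <= M) ->
  charge_integral nu h = \int[mu]_x (h x * s x).
Proof.
move=> si nus mh hM.
have dom : nu `<< mu.
  apply/null_content_dominatesP => E mE E0; rewrite nus//.
  by rewrite null_set_integral//; apply: measurable_funTS; exact: (measurable_int mu).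
set PN := hahn_pos_neg nu.
have change (J : {finite_measure set X -> \bar R}) (E : set X) : J `<< mu ->
    exists p : X -> R, [/\ mu.-integrable setT (EFin \o p),
     (forall E, measurable E -> J E = (\int[mu]_(x in E) (p x)%:E)%E) &
     \int[J]_x h x = \int[mu]_x (h x * p x)].
  move=> Jmu; pose p x := fine (('d (charge_of_finite_measure J) '/d mu) x).
  have pE : EFin \o p = 'd (charge_of_finite_measure J) '/d mu.
    by apply/funext => x; rewrite /p/= fineK//; exact: Radon_Nikodym_fin_num.
  exists p; split.
  - by rewrite pE; exact: Radon_Nikodym_integrable.
  - move=> F mF; rewrite (eq_integral ('d (charge_of_finite_measure J) '/d mu)).
      by rewrite -Radon_Nikodym_integral.
    by move=> x _; rewrite -pE.
  - rewrite /Rintegral -(Radon_Nikodym_change_of_variables Jmu)//; last first.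
      apply: (@rint_bdd _ _ _ _ _ measurableT _ M) => //.
      by rewrite -ge0_fin_numE// fin_num_measure.
    by congr fine; apply: eq_integral => x _; rewrite -pE -EFinM.
have [p [ip pE hp]] := change (jordan_pos PN) setT (jordan_pos_dominates PN dom).
have [q [iq qE hq]] := change (jordan_neg PN) setT (jordan_neg_dominates PN dom).
have ih (u : X -> R) : mu.-integrable setT (EFin \o u) -> mu.-integrable setT (EFin \o (fun x => h x * u x)).
  by move=> iu; apply: (@rint_bddM _ _ _ _ _ measurableT _ _ M).
rewrite /charge_integral -/PN hp hq -RintegralB//; [|exact: ih..].
have pqs : ae_eq mu setT (EFin \o (fun x => p x - q x)) (EFin \o s).
  apply: integral_ae_eq => //; first exact: rintB.
    exact: (measurable_int mu).
  move=> E _ mE; rewrite -nus// (jordan_decomp PN mE) /cadd/= cscaleN1.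
  rewrite integralB_EFin//; [|exact: (integrableS measurableT)..].
  by congr (_ - _)%E; apply/esym; [exact: pE|exact: qE].
rewrite /Rintegral; congr fine; apply: ae_eq_integral => //.
- by apply: (measurable_int mu); apply: rintB => //; exact: ih.
- by apply: (measurable_int mu); exact: ih.
case: pqs => N [mN N0 sub]; exists N; split => // x /= H; apply: sub => /= H1; apply: H => _.
by have := H1 I; rewrite -mulrBr => -[->].
Qed.

(** Both sides are the integral of [h] against one and the same charge, the one induced by [s1]
    restricted to [D]. *)
Lemma density_integral_eq (mu1 mu2 : {sigma_finite_measure set X -> \bar R}) (D : set X)
    (s1 s2 h : X -> R) (M : R) : measurable D ->
  mu1.-integrable setT (EFin \o s1) -> mu2.-integrable setT (EFin \o s2) ->
  (forall E, measurable E -> E `<=` D ->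
    (\int[mu1]_(x in E) (s1 x)%:E = \int[mu2]_(x in E) (s2 x)%:E)%E) ->
  measurable_fun setT h -> (forall x, `|h x| <= M) ->
  \int[mu1]_(x in D) (h x * s1 x) = \int[mu2]_(x in D) (h x * s2 x).
Proof.
move=> mD i1 i2 E12 mh hM.
have iD (mu : {sigma_finite_measure set X -> \bar R}) s : mu.-integrable setT (EFin \o s) ->
    mu.-integrable setT (EFin \o (s \_ D)).
  move=> i; rewrite -restrict_EFin; apply/(integrable_mkcond _ mD).
  exact: (integrableS measurableT).
have eD (mu : {sigma_finite_measure set X -> \bar R}) s E :
    (\int[mu]_(x in E) ((s \_ D) x)%:E = \int[mu]_(x in E `&` D) (s x)%:E)%E.
  by rewrite integral_mkcondr; apply: eq_integral => x _; rewrite restrict_EFin.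
have eDh (mu : {sigma_finite_measure set X -> \bar R}) s :
    \int[mu]_x (h x * (s \_ D) x) = \int[mu]_(x in D) (h x * s x).
  rewrite [RHS]Rintegral_mkcond; apply: eq_Rintegral => x _.
  by rewrite !patchE; case: ifP; rewrite ?mulr0.
rewrite -!eDh.
rewrite -(@charge_integral_density (induced_charge (iD _ _ i1)) mu1 _ h M (iD _ _ i1))//.
apply: (@charge_integral_density (induced_charge (iD _ _ i1)) mu2 _ h M (iD _ _ i2)) => //.
move=> E mE; rewrite eD -E12; [|exact: measurableI|exact: subIsetr].
by rewrite -eD.
Qed.

End charge_density.

Lemma measurable_frob_ip d (X : measurableType d) (R : realType) (m n : nat) (D : set X)
    (f g : X -> 'M[R]_(m, n)) :
  (forall i j, measurable_fun D (fun x => f x i j)) ->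
  (forall i j, measurable_fun D (fun x => g x i j)) ->
  measurable_fun D (fun x => frob_ip (f x) (g x)).
Proof.
move=> mf mg; apply: measurable_sum => i; apply: measurable_sum => j.
exact: measurable_funM.
Qed.

Lemma measurable_frob d (X : measurableType d) (R : realType) (m n : nat) (D : set X)
    (f : X -> 'M[R]_(m, n)) :
  (forall i j, measurable_fun D (fun x => f x i j)) -> measurable_fun D (fun x => frob (f x)).
Proof.
move=> mf; apply: (measurableT_comp (f := @Num.sqrt R)); last exact: measurable_frob_ip.
by apply: continuous_measurable_fun; exact: sqrt_continuous.
Qed.

(** * Matrix-valued charges, their variation and Lebesgue decomposition *)

Section matrix_charges.
Context d (X : measurableType d) (R : realType) (m n : nat).
Implicit Types mu nu : mx_charge X R m n.
Local Open Scope charge_scope.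

Lemma ler_entry_frob (y : 'M[R]_(m, n)) i j : `|y i j| <= frob y.
Proof.
rewrite -(ler_pXn2r (ltn0Sn 1)) ?nnegrE ?frob_ge0// frob_sqr real_normK ?num_real//.
rewrite /frob_ip (bigD1 i)//= (bigD1 j)//= -expr2 -addrA lerDl addr_ge0//.
  by apply: sumr_ge0 => k _; rewrite -expr2 sqr_ge0.
by do 2![apply: sumr_ge0 => ? _]; rewrite -expr2 sqr_ge0.
Qed.

Lemma frob_le_variation mu E : measurable E ->
  ((frob (charge_mx mu E))%:E <= mx_variation mu E)%E.
Proof.
move=> mE; pose F k : set X := if k is 0%N then E else set0.
apply: (@le_trans _ _ (\sum_(k <oo) (frob (charge_mx mu (F k)))%:E)%E).
  apply: le_trans (@nneseries_lim_ge _ (fun k => (frob (charge_mx mu (F k)))%:E) xpredT 0%N 1%N _).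
    by rewrite big_nat1.
  by move=> k _; rewrite lee_fin frob_ge0.
apply: ereal_sup_ubound; exists F => //; split.
- by case=> [|k]; [exact: mE|exact: measurable0].
- by apply/trivIsetP => -[|i] [|j] //= _ _ _; rewrite ?setI0 ?set0I.
- by move=> x [[|k] _].
Qed.

Lemma entry_le_variation mu i j E : measurable E ->
  (`|mu i j E| <= mx_variation mu E)%E.
Proof.
move=> mE; apply: le_trans (frob_le_variation mu mE).
rewrite -(fineK (fin_num_measure (mu i j) _ mE)) /= lee_fin.
by have := ler_entry_frob (charge_mx mu E) i j; rewrite mxE.
Qed.

Lemma entry_dominated mu i j : mu i j `<< mx_variation mu.
Proof.
apply/null_content_dominatesP => E mE E0; apply/eqP; rewrite -abse_eq0 eq_le abse_ge0 andbT.
by rewrite -E0 entry_le_variation.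
Qed.

Lemma rint_finite_measure (V : {finite_measure set X -> \bar R}) (g : X -> R) (C : R) (E : set X) :
  measurable_fun setT g -> (forall x, `|g x| <= C) -> measurable E -> V.-integrable E (EFin \o g).
Proof.
move=> mg gC mE; apply: (@rint_bdd _ _ _ _ _ mE _ C) => //.
- by rewrite -ge0_fin_numE// fin_num_measure.
- exact: measurable_funTS.
Qed.

(** A version of the polar density with entries bounded at every point, obtained by clipping. It
    replaces [polar_density] in all estimates, since boundedness and measurability are then
    immediate. *)
Lemma variation_density mu : exists s : X -> 'M[R]_(m, n),
  [/\ forall i j, measurable_fun setT (fun x => s x i j),
     forall x i j, `|s x i j| <= 1 &
     forall i j E, measurable E -> mu i j E = (\int[mx_variation mu]_(x in E) (s x i j)%:E)%E].
Proof.
set V := mx_variation mu.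
have Vfin (E : set X) : measurable E -> (V E < +oo)%E.
  by move=> mE; rewrite -ge0_fin_numE// fin_num_measure.
have /choice[g Hg] : forall ij : 'I_m * 'I_n, exists g : X -> R,
    [/\ measurable_fun setT g, forall x, `|g x| <= 1 &
     forall E, measurable E -> mu ij.1 ij.2 E = (\int[V]_(x in E) (g x)%:E)%E].
  move=> [i j] /=; pose h := 'd (mu i j) '/d V.
  have dom := @entry_dominated mu i j.
  pose g0 x := fine (h x).
  have g0E : EFin \o g0 = h.
    by apply/funext => x; rewrite /g0/= fineK//; exact: Radon_Nikodym_fin_num.
  have ig0 : V.-integrable setT (EFin \o g0) by rewrite g0E; exact: Radon_Nikodym_integrable.
  have muE E : measurable E -> mu i j E = (\int[V]_(x in E) g0 x)%:E.
    move=> mE; rewrite RintegralE//; last exact: (integrableS measurableT).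
    rewrite (eq_integral h) => [|x _]; last by rewrite -g0E.
    exact: (Radon_Nikodym_integral dom mE).
  have [g [mg g1 gg0]] : exists g : X -> R, [/\ measurable_fun setT g,
      (forall x, `|g x| <= 1) &
      forall E, measurable E -> \int[V]_(x in E `&` setT) g0 x = \int[V]_(x in E `&` setT) g x].
    apply: clip_density => //; first exact: Vfin.
    move=> E mE _; rewrite mul1r -lee_fin fineK ?fin_num_measure//.
    by have := entry_le_variation mu i j mE; rewrite muE.
  exists g; split => // E mE; rewrite muE//.
  have := gg0 E mE; rewrite !setIT => ->; rewrite RintegralE//.
  exact: (@rint_finite_measure (mx_variation mu) g 1).
exists (fun x => \matrix_(i, j) g (i, j) x); split.
- by move=> i j; under eq_fun do rewrite mxE; case: (Hg (i, j)).
- by move=> x i j; rewrite mxE; case: (Hg (i, j)).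
- move=> i j E mE; under eq_integral do rewrite mxE.
  by case: (Hg (i, j)) => _ _ /(_ _ mE).
Qed.

Lemma variation_eq mu nu E : measurable E ->
  (forall i j F, measurable F -> F `<=` E -> mu i j F = nu i j F) ->
  mx_variation mu E = mx_variation nu E.
Proof.
move=> mE H; rewrite /mx_variation; congr ereal_sup.
have K F k : disjoint_family E F -> charge_mx mu (F k) = charge_mx nu (F k).
  move=> [mF _ FE]; apply/matrixP => i j; rewrite !mxE H// => x Fx; apply: FE.
  by exists k.
by apply/seteqP; split => _ [F FE <-]; exists F => //; apply: eq_eseriesr => k _; rewrite K.
Qed.

Lemma polar_densityE mu i j E : measurable E ->
  mu i j E = (\int[mx_variation mu]_(x in E) (polar_density mu x i j)%:E)%E.
Proof.
move=> mE; rewrite (Radon_Nikodym_integral (@entry_dominated mu i j) mE).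
apply: eq_integral => x _; rewrite mxE fineK//.
exact: Radon_Nikodym_fin_num (@entry_dominated mu i j).
Qed.

Lemma rint_polar_density mu i j :
  (mx_variation mu).-integrable setT (EFin \o (fun x => polar_density mu x i j)).
Proof.
rewrite (_ : EFin \o _ = 'd (mu i j) '/d (mx_variation mu)).
  exact: Radon_Nikodym_integrable (@entry_dominated mu i j).
apply/funext => x; rewrite /= mxE fineK//.
exact: Radon_Nikodym_fin_num (@entry_dominated mu i j).
Qed.

Lemma variation0 mu E : measurable E ->
  (forall i j F, measurable F -> F `<=` E -> mu i j F = 0%E) -> mx_variation mu E = 0%E.
Proof.
move=> mE H; pose z : mx_charge X R m n := fun _ _ => czero : {charge set X -> \bar R}.
rewrite (@variation_eq _ z)//; apply/eqP; rewrite eq_le measure_ge0 andbT.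
apply: ge_ereal_sup => _ [F _ <-]; rewrite eseries0// => k _ _.
rewrite (_ : charge_mx z (F k) = 0) ?frob0//.
by apply/matrixP => i j; rewrite !mxE.
Qed.

(** Null sets whose [V]-measures approach the supremum have a null union that attains it; a further
    null set disjoint from the union and charged by [V] would exceed the supremum. *)
Lemma maximal_null_set (la V : {measure set X -> \bar R}) : (V setT < +oo)%E ->
  exists N, [/\ measurable N, la N = 0%E &
    forall E, measurable E -> la E = 0%E -> E `&` N = set0 -> V E = 0%E].
Proof.
move=> Vfin; pose A := [set V N | N in [set N | measurable N /\ la N = 0%E]].
pose S := ereal_sup A.
have VT E : measurable E -> (V E <= V setT)%E by move=> mE; rewrite le_measure ?inE.
have Sfin : S \is a fin_num.
  have : (S <= V setT)%E by apply: ge_ereal_sup => _ [N [mN _] <-]; exact: VT.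
  have : (0 <= S)%E.
    by apply: ereal_sup_ubound; exists set0; rewrite ?measure0.
  by move=> S0 SV; rewrite ge0_fin_numE// (le_lt_trans SV).
have /choice[N HN] : forall k : nat, exists N, [/\ measurable N, la N = 0%E &
    (S - (k.+1%:R^-1)%:E < V N)%E].
  move=> k; have k0 : (0 < (k.+1%:R^-1 : R)) by rewrite invr_gt0.
  have [_ [N [mN N0] <-] SN] := ub_ereal_sup_adherent k0 Sfin.
  by exists N.
pose M := \bigcup_k N k.
have mM : measurable M by apply: bigcup_measurable => k _; case: (HN k).
have laM : la M = 0%E.
  apply/eqP; rewrite eq_le measure_ge0 andbT.
  have mN k : measurable (N k) by case: (HN k).
  have : (la M <= \sum_(k <oo) la (N k))%E by apply: measure_sigma_subadditive.
  move/le_trans; apply.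
  by rewrite eseries0// => k _ _; case: (HN k).
exists M; split => // E mE E0 EM.
have VM : (S <= V M)%E.
  apply/lee_addgt0Pr => e e0.
  have [k ke] : exists k : nat, k.+1%:R^-1 < e.
    by have [k _ /(_ k (leqnn k))] := near_infty_natSinv_lt (PosNum e0); exists k.
  have [mNk _ /ltW SN] := HN k.
  rewrite leeBlDr// in SN; apply: (le_trans SN); apply: leeD; last by rewrite lee_fin ltW.
  by apply: le_measure; rewrite ?inE// => x Nx; exists k.
have VEM : (V E + V M <= S)%E.
  rewrite -measureU//; apply: ereal_sup_ubound; exists (E `|` M) => //; split.
    exact: measurableU.
  by rewrite null_set_setU.
have VMfin : V M \is a fin_num by rewrite ge0_fin_numE// (le_lt_trans (VT _ mM)).
apply/eqP; rewrite eq_le measure_ge0 andbT.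
by rewrite -(leeD2rE _ _ VMfin) add0e (le_trans VEM).
Qed.

Lemma crestr0E (nu : {charge set X -> \bar R}) (D E : set X) (mD : measurable D) :
  measurable E -> crestr0 nu mD E = nu (E `&` D).
Proof. by move=> mE; rewrite /crestr0 mem_set. Qed.

(** Take [N] maximal among the [la]-null sets for the variation. The restriction to [N] is the
    singular part; the restriction to the complement is dominated by [la] by maximality. *)
Lemma lebesgue_decomposition_exists (la : {sigma_finite_measure set X -> \bar R}) mu :
  exists p, is_lebesgue_decomposition la mu p.
Proof.
have Vfin : (mx_variation mu setT < +oo)%E.
  by rewrite -ge0_fin_numE// fin_num_measure.
have [N [mN N0 Nmax]] := maximal_null_set la Vfin.
have mNC : measurable (~` N) by exact: measurableC.
have dom i j : crestr0 (mu i j) mNC `<< la.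
  apply/null_content_dominatesP => E mE E0; rewrite crestr0E//.
  have mEN : measurable (E `&` ~` N) by exact: measurableI.
  have V0 : mx_variation mu (E `&` ~` N) = 0%E.
    apply: Nmax => //.
      by apply/eqP; rewrite eq_le measure_ge0 andbT -E0 le_measure ?inE.
    by rewrite -setIA setICl setI0.
  apply/eqP; rewrite -abse_eq0 eq_le abse_ge0 andbT -V0.
  exact: entry_le_variation.
pose a x := \matrix_(i < m, j < n) fine (('d (crestr0 (mu i j) mNC) '/d la) x).
pose nus i j : {charge set X -> \bar R} := crestr0 (mu i j) mN.
have aE i j : EFin \o (fun x => a x i j) = 'd (crestr0 (mu i j) mNC) '/d la.
  by apply/funext => x; rewrite /= mxE fineK//; exact: Radon_Nikodym_fin_num (dom i j).
have ia i j : la.-integrable setT (EFin \o (fun x => a x i j)).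
  by rewrite aE; exact: Radon_Nikodym_integrable (dom i j).
have ma i j : measurable_fun setT (fun x => a x i j) by exact: rint_measurable (ia i j).
have ma' : measurable_fun setT a by exact: measurable_fun_mx.
have mfrob : measurable_fun setT (fun x => frob (a x)) by exact: measurable_frob.
exists (a, nus); split.
- split=> //=.
  apply: (rint_le measurableT mfrob (g := fun x => \sum_i \sum_j `|a x i j|)).
    by move=> x _; rewrite ger0_norm ?frob_ge0// frob_le_sum.
  by do 2![apply: rint_sum => // ? _]; exact: rint_norm.
- exists N; split => // i j E mE EN; by rewrite /nus/= crestr0E// EN charge0.
- move=> i j E mE /=.
  have -> : (\int[la]_(x in E) (a x i j)%:E = crestr0 (mu i j) mNC E)%E.
    rewrite (Radon_Nikodym_integral (dom i j) mE).
    by apply: eq_integral => x _; rewrite -aE.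
  rewrite /nus/= !crestr0E// -chargeU//; [|exact: measurableI..|].
  + by rewrite -setIUr setUC setUCr setIT.
  + by rewrite setIACA setICl setI0.
Qed.

Lemma lebesgue_decompositionP (la : {sigma_finite_measure set X -> \bar R}) mu :
  is_lebesgue_decomposition la mu (lebesgue_decomposition la mu).
Proof.
rewrite /lebesgue_decomposition /choose_or; case: pselect => [e|ne].
  exact: svalP (cid e).
by exfalso; apply: ne; exact: lebesgue_decomposition_exists.
Qed.

End matrix_charges.

(** * The pairing measure *)

Lemma exchange_big_quadruple (R : nmodType) (I J K L : finType) (F : I -> J -> K -> L -> R) :
  \sum_i \sum_j \sum_k \sum_l F i j k l = \sum_k \sum_l \sum_i \sum_j F i j k l.
Proof.
under eq_bigr do rewrite exchange_big/=; rewrite exchange_big; apply: eq_bigr => k _.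
by under eq_bigr do rewrite exchange_big/=; rewrite exchange_big.
Qed.

(** * Mollified fields tested against A u *)

Section mollified_pairing.
Variables (R : realType) (m n : nat) (Om : set 'rV[R]_n).
Hypotheses (oOm : open Om) (Omfin : (lebesgue_rV R n Om < +oo)%E).
Variable A : {linear 'M[R]_(m, n) -> 'M[R]_(m, n)}.
Hypothesis A_sym : forall y y', frob_ip (A y) y' = frob_ip y (A y').
Local Notation la := (lebesgue_rV R n).
Local Notation rint f := (la.-integrable setT (EFin \o f)).

Lemma frob_ip_delta (y : 'M[R]_(m, n)) i j : frob_ip y (delta_mx i j) = y i j.
Proof.
rewrite /frob_ip (bigD1 i)//= (bigD1 j)//= !mxE !eqxx mulr1 big1 ?addr0.
  rewrite big1 ?addr0// => k ki; apply: big1 => l _.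
  by rewrite !mxE (negbTE ki) mulr0.
by move=> l lj; rewrite !mxE (negbTE lj) andbF mulr0.
Qed.

Lemma linear_entries (y : 'M[R]_(m, n)) i j :
  A y i j = \sum_k \sum_l y k l * A (delta_mx k l) i j.
Proof.
rewrite {1}(matrix_sum_delta y) linear_sum summxE; apply: eq_bigr => k _.
rewrite linear_sum summxE; apply: eq_bigr => l _.
by rewrite linearZ mxE.
Qed.

Lemma linear_entries_sym i j k l : A (delta_mx k l) i j = A (delta_mx i j) k l.
Proof. by rewrite -frob_ip_delta A_sym frob_ipC frob_ip_delta. Qed.

Variables (Z : 'rV[R]_n -> 'M[R]_(m, n)) (W u : 'rV[R]_n -> 'rV[R]_m) (M : R).
Hypotheses (mZ : forall i j, measurable_fun setT (fun x => Z x i j))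
  (ZM : forall x i j, `|Z x i j| <= M) (AZ : forall x, A (Z x) = Z x)
  (Z0 : forall x, ~ Om x -> Z x = 0).
Hypotheses (iW : forall i, rint (fun x => W x 0 i)) (iW2 : forall i, rint (fun x => W x 0 i ^+ 2)).
Hypotheses (iu : forall i, rint (fun x => u x 0 i)) (iu2 : forall i, rint (fun x => u x 0 i ^+ 2))
  (u0 : forall x, ~ Om x -> u x = 0).
Variables (mu : mx_charge 'rV[R]_n R m n) (s : 'rV[R]_n -> 'M[R]_(m, n)).
Hypothesis u_mu : is_Agrad Om A u mu.
Local Notation V := (mx_variation mu).
Hypotheses (ms : forall i j, measurable_fun setT (fun x => s x i j))
  (s1 : forall x i j, `|s x i j| <= 1)
  (mus : forall i j E, measurable E -> mu i j E = (\int[V]_(x in E) (s x i j)%:E)%E).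

Let mOm : measurable Om. Proof. exact: open_measurable_mx. Qed.

Let ris i j (E : set 'rV[R]_n) : measurable E -> V.-integrable E (EFin \o (fun x => s x i j)).
Proof. by move=> mE; exact: (@rint_finite_measure _ _ _ V _ 1). Qed.

Lemma rint_Zij i j : rint (fun x => Z x i j).
Proof.
have : la.-integrable Om (EFin \o (fun x => Z x i j)).
  by apply: (@rint_bdd _ _ _ _ _ mOm _ M) => //; exact: measurable_funTS.
move=> /(integrable_mkcond _ mOm); rewrite restrict_EFin; congr (integrable _ _ (EFin \o _)).
apply/funext => x; rewrite patchE; case: ifPn => //; rewrite notin_setE => /Z0 ->.
by rewrite mxE.
Qed.

Let bounded_mul (f g : 'rV[R]_n -> R) (C : R) : measurable_fun setT f -> (forall x, `|f x| <= C) ->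
  rint g -> rint (fun x => f x * g x).
Proof. by move=> mf fC ig; apply: (@rint_bddM _ _ _ _ _ measurableT _ _ C). Qed.

Let test_bd (phi : 'rV[R]_n -> R) : test_function setT phi ->
  measurable_fun setT phi /\ exists C, forall x, `|phi x| <= C.
Proof.
move=> tp; have [C _ HC] := test_function_bounded tp; split; last by exists C.
by case: tp => sp _ _; exact: smooth_measurable.
Qed.

Let testT phi : test_function Om phi -> test_function setT phi.
Proof. exact: test_functionS. Qed.

Lemma rint_u_pderive phi i j : test_function setT phi -> rint (fun x => u x 0 i * pderive j phi x).
Proof.
move=> /(test_function_pderive j) /test_bd[mp [C pC]].
by apply: (@eq_rint _ _ _ _ _ measurableT (fun x => pderive j phi x * u x 0 i)) => [x _|];
  [rewrite mulrC|exact: bounded_mul pC _].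
Qed.

Lemma Agrad_test phi k l : test_function Om phi ->
  \int[V]_x (phi x * s x k l) =
  - \sum_i \sum_j A (delta_mx i j) k l * \int[la]_x (u x 0 i * pderive j phi x).
Proof.
move=> tp; have [mp [C pC]] := test_bd (testT tp).
rewrite -(charge_integral_density (ris k l measurableT) (@mus k l) mp pC).
have /matrixP/(_ k l) := u_mu.2 _ tp; rewrite !mxE => ->.
rewrite linear_entries -sumrN; apply: eq_bigr => i _; rewrite -sumrN; apply: eq_bigr => j _.
rewrite mxE mulNr mulrC; congr (- (_ * _)).
by rewrite -Rintegral_supp// => x nO; rewrite u0// mxE mul0r.
Qed.

(** The map [A], which acts on the distribution Du, is moved onto the test field by symmetry and
    disappears since [A zeta = zeta]. What is left is the distributional gradient tested with
    [zeta]. *)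
Lemma Agrad_test_field (zeta : 'rV[R]_n -> 'M[R]_(m, n)) :
  (forall i j, test_function Om (fun x => zeta x i j)) -> (forall x, A (zeta x) = zeta x) ->
  \sum_i \sum_j \int[V]_x (zeta x i j * s x i j) =
  - \sum_i \sum_j \int[la]_x (u x 0 i * pderive j (fun x => zeta x i j) x).
Proof.
move=> tz Az.
pose G k l i j := \int[la]_x (u x 0 k * pderive l (fun x => zeta x i j) x).
transitivity (\sum_i \sum_j - (\sum_k \sum_l A (delta_mx k l) i j * G k l i j)).
  by apply: eq_bigr => i _; apply: eq_bigr => j _; rewrite Agrad_test.
under eq_bigr do rewrite sumrN; rewrite sumrN; congr (- _).
have Gij k l : G k l k l = \sum_i \sum_j A (delta_mx k l) i j * G k l i j.
  have sz i j : smooth (fun x => zeta x i j) by case: (tz i j).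
  have dz i j x : derivable (fun x => zeta x i j) x (delta_mx 0 l).
    by apply/diff_derivable/smooth_differentiable.
  have E : (fun x => zeta x k l) = \sum_i \sum_j (A (delta_mx k l) i j \*: (fun x => zeta x i j)).
    apply/funext => x; rewrite -{1}Az linear_entries fct_sumE; apply: eq_bigr => i _.
    rewrite fct_sumE; apply: eq_bigr => j _.
    by rewrite linear_entries_sym mulrC.
  have Ed x : pderive l (fun x => zeta x k l) x =
      \sum_i \sum_j A (delta_mx k l) i j * pderive l (fun x => zeta x i j) x.
    rewrite E /pderive derive_sum; last first.
      by move=> i; apply: derivable_sum => j; exact: derivableZ.
    apply: eq_bigr => i _; rewrite derive_sum; last by move=> j; exact: derivableZ.
    by apply: eq_bigr => j _; rewrite deriveZ.
  have ri i j : rint (fun x => A (delta_mx k l) i j * (u x 0 k * pderive l (fun x => zeta x i j) x)).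
    by apply: rintZ => //; apply: rint_u_pderive; exact: testT.
  rewrite /G; transitivity (\int[la]_x (\sum_i \sum_j A (delta_mx k l) i j *
      (u x 0 k * pderive l (fun x => zeta x i j) x))).
    apply: eq_Rintegral => x _; rewrite Ed mulr_sumr; apply: eq_bigr => i _.
    by rewrite mulr_sumr; apply: eq_bigr => j _; rewrite mulrCA.
  rewrite Rintegral_sum//; last by move=> i _; apply: rint_sum => // j _; exact: ri.
  apply: eq_bigr => i _; rewrite Rintegral_sum//.
  apply: eq_bigr => j _; rewrite RintegralZl//; apply: rint_u_pderive; exact: testT.
transitivity (\sum_k \sum_l \sum_i \sum_j A (delta_mx k l) i j * G k l i j); last first.
  by apply: eq_bigr => k _; apply: eq_bigr => l _; rewrite -Gij.
by rewrite exchange_big_quadruple.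
Qed.

Definition mollified (a : 'rV[R]_n) (t : R) (x : 'rV[R]_n) : 'M[R]_(m, n) :=
  \matrix_(i, j) conv (fun y => Z y i j) (mollifier a t) x.

Lemma A_mollified a t x : A (mollified a t x) = mollified a t x.
Proof.
have ic i j := rint_conv x (rint_Zij i j) (test_mollifier a t).
apply/matrixP => i j; rewrite linear_entries mxE.
transitivity (\int[la]_y (\sum_k \sum_l A (delta_mx k l) i j * (Z y k l * mollifier a t (x - y)))).
  rewrite Rintegral_sum//; last by move=> k _; apply: rint_sum => // l _; exact: rintZ.
  apply: eq_bigr => k _; rewrite Rintegral_sum//; last by move=> l _; exact: rintZ.
  by apply: eq_bigr => l _; rewrite RintegralZl// mxE mulrC.
apply: eq_Rintegral => y _; rewrite -{2}AZ linear_entries mulr_suml; apply: eq_bigr => k _.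
by rewrite mulr_suml; apply: eq_bigr => l _; rewrite mulrA [A _ _ _ * _]mulrC.
Qed.

Lemma mollified_le a t x i j : 0 < t -> `|mollified a t x i j| <= M.
Proof.
move=> t0; have M0 : 0 <= M by exact: le_trans (ZM 0 i j).
have k1 : \int[la]_y mollifier a t (x - y) = 1 by rewrite /Rintegral integral_mollifier_r.
have ik : rint (fun y => mollifier a t (x - y)).
  apply/integrableP; split.
    by apply/measurable_EFinP; exact: (measurable_fun_pair2 x (measurable_mollifier2 a t)).
  rewrite (eq_integral (fun y : 'rV[R]_n => (mollifier a t (x - y))%:E)) ?integral_mollifier_r ?ltry//.
  by move=> y _; rewrite gee0_abs// lee_fin mollifier_ge0.
rewrite mxE -[leRHS]mulr1 -k1 -RintegralZl//.
apply: (le_norm_Rintegral measurableT).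
- exact: rint_conv (rint_Zij i j) (test_mollifier a t).
- exact: rintZ.
- by move=> y _; rewrite normrM (ger0_norm (mollifier_ge0 _ _ t0)) ler_wpM2r ?mollifier_ge0.
Qed.

Lemma smooth_mollified a t i j : smooth (fun x => mollified a t x i j).
Proof.
rewrite (_ : (fun x => _) = conv (fun y => Z y i j) (mollifier a t)).
  exact: smooth_conv (rint_Zij i j) (test_mollifier a t).
by apply/funext => x; rewrite mxE.
Qed.

(** The distribution of [is_pairing], with [W] for the divergence and all functions extended by
    zero, so that integrals run over the whole space and [eta] need not be supported in [Om]. *)
Definition pairing_form (eta : 'rV[R]_n -> R) : R :=
  - \int[la]_x (eta x * \sum_i W x 0 i * u x 0 i +
                \sum_i \sum_j pderive j eta x * Z x i j * u x 0 i).

Let rint_Wu i : rint (fun x => W x 0 i * u x 0 i).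
Proof.
apply: (rint_le measurableT (g := fun x => W x 0 i ^+ 2 + u x 0 i ^+ 2)).
- apply: measurable_funM; [exact: (rint_measurable (iW i))|exact: (rint_measurable (iu i))].
- move=> x _; rewrite normrM -[W x 0 i ^+ 2]real_normK ?num_real//.
  rewrite -[u x 0 i ^+ 2]real_normK ?num_real//.
  by have := sqr_ge0 (`|W x 0 i| - `|u x 0 i|); have := normr_ge0 (W x 0 i);
    have := normr_ge0 (u x 0 i); nra.
- exact: rintD.
Qed.

Lemma pairing_formE eta : test_function setT eta -> pairing_form eta =
  - (\sum_i \int[la]_x (W x 0 i * (eta x * u x 0 i)) +
     \sum_i \sum_j \int[la]_x (Z x i j * (pderive j eta x * u x 0 i))).
Proof.
move=> te; have [me [C eC]] := test_bd te.
have i1 i : rint (fun x => W x 0 i * (eta x * u x 0 i)).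
  apply: (@eq_rint _ _ _ _ _ measurableT (fun x => eta x * (W x 0 i * u x 0 i))) => [x _|].
    by rewrite mulrCA.
  exact: bounded_mul eC _.
have i2 i j : rint (fun x => Z x i j * (pderive j eta x * u x 0 i)).
  have [mp [C' pC']] := test_bd (test_function_pderive j te).
  by apply: bounded_mul (ZM ^~ i ^~ j) _ => //; exact: bounded_mul pC' _.
rewrite /pairing_form; congr (- _).
under [X in X + _]eq_bigr do rewrite -[\int[la]_x _]/(_).
rewrite -(Rintegral_sum measurableT)//.
under [X in _ + X]eq_bigr do rewrite -(Rintegral_sum measurableT)//.
rewrite -(Rintegral_sum measurableT)//; last by move=> i _; exact: rint_sum.
rewrite -RintegralD//; [|exact: rint_sum|by apply: rint_sum => // i _; exact: rint_sum].
apply: eq_Rintegral => x _; congr (_ + _).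
  by rewrite mulr_sumr; apply: eq_bigr => i _; rewrite mulrCA.
by apply: eq_bigr => i _; apply: eq_bigr => j _; rewrite mulrA [Z x i j * _]mulrC.
Qed.

(** By the product rule the divergence of [eta] times the mollified field splits into a convolution
    of [W], which converges weakly against L^2, and one of [Z], which converges weakly against L^1.
    Only the product has to be supported in [Om], not [eta] itself; this is what makes the result
    usable at the boundary. *)
Theorem mollified_pairing_cvg (eta : 'rV[R]_n -> R) (e : R) : test_function setT eta -> 0 < e ->
  exists2 r, 0 < r & forall a t, 0 < t -> `|a| + t < r ->
   (forall i j, test_function Om (eta * (fun x => mollified a t x i j))) ->
   (forall x, eta x != 0 -> forall i,
      \sum_j pderive j (fun x => mollified a t x i j) x =
      conv (fun y => W y 0 i) (mollifier a t) x) ->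
   `|\sum_i \sum_j \int[V]_x (eta x * mollified a t x i j * s x i j) - pairing_form eta| <= e.
Proof.
move=> te e0; have [me [C eC]] := test_bd te.
(* Counts the limits involved, [m] for [W] and [m n] for [Z]; the 1 keeps it positive. *)
pose c : R := m%:R + m%:R * n%:R + 1.
have c0 : 0 < c by rewrite ltr_wpDl// addr_ge0// mulr_ge0.
have ec : 0 < e / c by rewrite divr_gt0.
have ieu i : rint (fun x => eta x * u x 0 i) by exact: bounded_mul eC _.
have ieu2 i : rint (fun x => (eta x * u x 0 i) ^+ 2).
  apply: (@eq_rint _ _ _ _ _ measurableT (fun x => eta x ^+ 2 * u x 0 i ^+ 2)) => [x _|].
    by rewrite exprMn.
  apply: (bounded_mul (C := C ^+ 2)) => //; first exact: measurable_funX.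
  by move=> x; rewrite normrX lerXn2r ?nnegrE// (le_trans _ (eC x)).
have ieu0 i x : ~ Om x -> eta x * u x 0 i = 0 by move=> nO; rewrite u0// mxE mulr0.
have idu i j : rint (fun x => pderive j eta x * u x 0 i).
  by have [mp [C' pC']] := test_bd (test_function_pderive j te); exact: bounded_mul pC' _.
have idu0 i j x : ~ Om x -> pderive j eta x * u x 0 i = 0 by move=> nO; rewrite u0// mxE mulr0.
have /choice[r1 Hr1] : forall i : 'I_m, exists r, 0 < r /\ forall a t, 0 < t -> `|a| + t < r ->
    `|\int[la]_x (conv (fun y => W y 0 i) (mollifier a t) x * (eta x * u x 0 i)) -
      \int[la]_x (W x 0 i * (eta x * u x 0 i))| <= e / c.
  move=> i; have [r r0 rH] := conv_weak_L2 oOm Omfin (iW i) (iW2 i) (ieu i) (ieu2 i) (ieu0 i) ec.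
  by exists r.
have /choice[r2 Hr2] : forall ij : 'I_m * 'I_n, exists r, 0 < r /\ forall a t, 0 < t -> `|a| + t < r ->
    `|\int[la]_x (conv (fun y => Z y ij.1 ij.2) (mollifier a t) x * (pderive ij.2 eta x * u x 0 ij.1)) -
      \int[la]_x (Z x ij.1 ij.2 * (pderive ij.2 eta x * u x 0 ij.1))| <= e / c.
  move=> [i j]; have [r r0 rH] := conv_weak_bounded oOm Omfin (rint_Zij i j)
    (fun x => ZM x i j) (idu i j) (@idu0 i j) ec.
  by exists r.
have [r r0 [rr1 rr2]] : exists2 r, 0 < r & (forall i, r <= r1 i) /\ (forall ij, r <= r2 ij).
  have [ra ra0 Ha] : exists2 r : R, 0 < r & forall i, r <= r1 i.
    exists (\big[Num.min/1]_i r1 i).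
      by elim/big_ind : _ => // [x y x0 y0|i _]; [rewrite lt_min x0|case: (Hr1 i)].
    by move=> i; exact: (bigmin_le_cond _ _ (j := i)).
  have [rb rb0 Hb] : exists2 r : R, 0 < r & forall i, r <= r2 i.
    exists (\big[Num.min/1]_i r2 i).
      by elim/big_ind : _ => // [x y x0 y0|i _]; [rewrite lt_min x0|case: (Hr2 i)].
    by move=> i; exact: (bigmin_le_cond _ _ (j := i)).
  exists (Num.min ra rb); first by rewrite lt_min ra0.
  by split=> i; rewrite ge_min; [rewrite Ha|rewrite Hb orbT].
exists r => // a t t0 atr tZ divZ.
have zA x : A (eta x *: mollified a t x) = eta x *: mollified a t x.
  by rewrite linearZ/= A_mollified.
have zE i j : (fun x => (eta x *: mollified a t x) i j) = eta * (fun x => mollified a t x i j).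
  by apply/funext => x; rewrite mxE.
have tz i j : test_function Om (fun x => (eta x *: mollified a t x) i j) by rewrite zE.
have -> : \sum_i \sum_j \int[V]_x (eta x * mollified a t x i j * s x i j) =
    \sum_i \sum_j \int[V]_x ((eta x *: mollified a t x) i j * s x i j).
  by do 2![apply: eq_bigr => ? _]; apply: eq_Rintegral => x _; rewrite [in RHS]mxE.
rewrite (Agrad_test_field tz zA).
have -> : \sum_i \sum_j \int[la]_x (u x 0 i * pderive j (fun x => (eta x *: mollified a t x) i j) x) =
    \sum_i \int[la]_x (conv (fun y => W y 0 i) (mollifier a t) x * (eta x * u x 0 i)) +
    \sum_i \sum_j \int[la]_x (conv (fun y => Z y i j) (mollifier a t) x * (pderive j eta x * u x 0 i)).
  rewrite -big_split/=; apply: eq_bigr => i _.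
  have ir j : rint (fun x => eta x * pderive j (fun x => mollified a t x i j) x * u x 0 i).
    have tp : test_function setT (eta * pderive j (fun x => mollified a t x i j)).
      apply: test_functionM => //.
      have := smooth_pderive j (smooth_mollified a t i j); exact.
    by have [mp [C' pC']] := test_bd tp; exact: bounded_mul pC' _.
  have ir2 j : rint (fun x => conv (fun y => Z y i j) (mollifier a t) x * (pderive j eta x * u x 0 i)).
    have iM := smooth_measurable (smooth_mollified a t i j).
    apply: (@eq_rint _ _ _ _ _ measurableT (fun x => mollified a t x i j * (pderive j eta x * u x 0 i))).
      by move=> x _; rewrite mxE.
    by apply: (bounded_mul (C := M)) => // x; exact: mollified_le.
  transitivity (\sum_j (\int[la]_x (eta x * pderive j (fun x => mollified a t x i j) x * u x 0 i) +
      \int[la]_x (conv (fun y => Z y i j) (mollifier a t) x * (pderive j eta x * u x 0 i)))).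
    apply: eq_bigr => j _; rewrite -RintegralD//; apply: eq_Rintegral => x _.
    rewrite zE pderiveM; last 2 first.
      by move=> y; apply: smooth_differentiable; case: te.
      by move=> y; apply: smooth_differentiable; exact: smooth_mollified.
    by rewrite !fctE mxE; ring.
  rewrite big_split/=; congr (_ + _); rewrite -(Rintegral_sum measurableT)//.
  apply: eq_Rintegral => x _.
  have [ex|ex] := eqVneq (eta x) 0; first by rewrite ex big1 => [|j _]; rewrite !mul0r// mulr0.
  by rewrite -divZ// -mulr_suml -mulr_sumr; ring.
rewrite pairing_formE// opprK addrC opprD addrACA -!sumrB.
have s1le : `|\sum_i (\int[la]_x (W x 0 i * (eta x * u x 0 i)) -
    \int[la]_x (conv (fun y => W y 0 i) (mollifier a t) x * (eta x * u x 0 i)))| <= m%:R * (e / c).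
  rewrite (le_trans (ler_norm_sum _ _ _))//.
  rewrite (le_trans (ler_sum _ (G := fun=> e / c) _))//; last first.
    by rewrite sumr_const card_ord mulr_natl.
  move=> i _; rewrite distrC; case: (Hr1 i) => _; apply => //; exact: lt_le_trans (rr1 i).
have s2le : `|\sum_i (\sum_j \int[la]_x (Z x i j * (pderive j eta x * u x 0 i)) -
    \sum_j \int[la]_x (conv (fun y => Z y i j) (mollifier a t) x * (pderive j eta x * u x 0 i)))|
    <= m%:R * n%:R * (e / c).
  rewrite (le_trans (ler_norm_sum _ _ _))//.
  rewrite (le_trans (ler_sum _ (G := fun=> n%:R * (e / c)) _))//; last first.
    by rewrite sumr_const card_ord -mulrA [leRHS]mulr_natl.
  move=> i _; rewrite -sumrB (le_trans (ler_norm_sum _ _ _))//.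
  rewrite (le_trans (ler_sum _ (G := fun=> e / c) _))//; last first.
    by rewrite sumr_const card_ord mulr_natl.
  move=> j _; rewrite distrC; case: (Hr2 (i, j)) => _; apply => //; exact: lt_le_trans (rr2 _).
rewrite (le_trans (ler_normD _ _))// (le_trans (lerD s1le s2le))//.
rewrite -mulrDl mulrCA ger_pMr// ler_pdivrMr// mul1r /c lerDl//.
Qed.

End mollified_pairing.

Lemma pderive_reflect (R : realType) (n : nat) (rho : 'rV[R]_n -> R) (x y : 'rV[R]_n) j :
  (forall x, differentiable rho x) ->
  pderive j (fun y => rho (x - y)) y = - pderive j rho (x - y).
Proof.
move=> dr; pose g : 'rV[R]_n -> 'rV[R]_n := fun y => x - y.
have [dg Dg] : is_diff y g (fun v => - v).
  by apply: is_diff_eq; apply/funext => v; rewrite !fctE sub0r.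
rewrite /pderive (_ : (fun y => _) = rho \o g)// !deriveE//; last exact: differentiable_comp.
have E := @diff_comp R _ _ _ g rho y dg (dr (x - y)).
transitivity ('d rho (x - y) ('d g y (delta_mx 0 j))); first exact: (congr1 (fun F => F (delta_mx 0 j)) E).
rewrite (congr1 (fun F => F (delta_mx 0 j)) Dg) /=; exact: linearN.
Qed.

Lemma compact_margin (R : realType) (n : nat) (K Om : set 'rV[R]_n) : open Om ->
  compact K -> K `<=` Om -> exists2 r : R, 0 < r & forall x, K x -> forall y, `|x - y| < r -> Om y.
Proof.
move=> oOm cK KO; move/compact_near_coveringP : cK => cK.
have /(_ _)[x Kx|] := cK R (0 : R)^'+ (fun e x => forall y, `|x - y| < e -> Om y).
  have /nbhs_ballP[e /= e0 eO] : nbhs x Om by apply: open_nbhs_nbhs; split=> //; exact: KO.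
  have e2 : 0 < e / 2 by rewrite divr_gt0.
  exists (ball x (e / 2), [set h : R | h < e / 2]) => /=.
    by split; [exact: nbhsx_ballx|exact: nbhs_right_lt].
  case=> x' h; rewrite /setX /mkset /=; case=> + b y xy;  rewrite -ball_normE /ball_/= => a; apply: eO.
  rewrite -ball_normE /ball_/= (splitr e) -(subrKC x' y) opprD addrA.
  by rewrite (le_lt_trans (ler_normB _ _))// ltrD// distrC (lt_trans xy).
move=> r /= r0 rH; exists (r / 2); first by rewrite divr_gt0.
apply: (rH (r / 2)) => /=; last by rewrite divr_gt0.
by rewrite sub0r normrN gtr0_norm ?divr_gt0// ltr_pdivrMr// ltr_pMr// ltr1n.
Qed.

Lemma test_function_out (R : realType) (n : nat) (Om : set 'rV[R]_n) phi x :
  test_function Om phi -> ~ Om x -> phi x = 0.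
Proof. by move=> [_ _ KO] nO; apply/eqP; apply: contrapT => /negP p; apply/nO/KO/subset_closure. Qed.

(** * Existence of a bounded density for the pairing *)

Section pairing_density.
Variables (R : realType) (m n : nat) (Om : set 'rV[R]_n).
Hypotheses (oOm : open Om) (Omfin : (lebesgue_rV R n Om < +oo)%E).
Variable A : {linear 'M[R]_(m, n) -> 'M[R]_(m, n)}.
Hypothesis A_sym : forall y y', frob_ip (A y) y' = frob_ip y (A y').
Local Notation la := (lebesgue_rV R n).
Local Notation rint f := (la.-integrable setT (EFin \o f)).
Variables (Z : 'rV[R]_n -> 'M[R]_(m, n)) (W u : 'rV[R]_n -> 'rV[R]_m) (M : R).
Hypotheses (mZ : forall i j, measurable_fun setT (fun x => Z x i j))
  (ZM : forall x i j, `|Z x i j| <= M) (AZ : forall x, A (Z x) = Z x)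
  (Z0 : forall x, ~ Om x -> Z x = 0).
Hypotheses (iW : forall i, rint (fun x => W x 0 i)) (iW2 : forall i, rint (fun x => W x 0 i ^+ 2)).
Hypotheses (iu : forall i, rint (fun x => u x 0 i)) (iu2 : forall i, rint (fun x => u x 0 i ^+ 2))
  (u0 : forall x, ~ Om x -> u x = 0).
Variables (mu : mx_charge 'rV[R]_n R m n) (s : 'rV[R]_n -> 'M[R]_(m, n)).
Hypothesis u_mu : is_Agrad Om A u mu.
Local Notation V := (mx_variation mu).
Hypotheses (ms : forall i j, measurable_fun setT (fun x => s x i j))
  (s1 : forall x i j, `|s x i j| <= 1)
  (mus : forall i j E, measurable E -> mu i j E = (\int[V]_(x in E) (s x i j)%:E)%E).
Local Notation Zmol := (mollified Z).
Local Notation Pf := (pairing_form Z W u).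

Let mOm : measurable Om. Proof. exact: open_measurable_mx. Qed.

Lemma variation_off E : measurable E -> E `&` Om = set0 -> V E = 0%E.
Proof.
move=> mE EO; apply: variation0 => // i j F mF FE; apply: (u_mu.1 i j) => //.
by rewrite -subset0 -EO; exact: setSI.
Qed.

Lemma Vfin E : measurable E -> (V E < +oo)%E.
Proof. by move=> mE; rewrite -ge0_fin_numE// fin_num_measure. Qed.

Lemma RintegralV E g : measurable E -> V.-integrable E (EFin \o g) ->
  \int[V]_(x in E) g x = \int[V]_(x in E `&` Om) g x.
Proof.
move=> mE ig; rewrite -[E in LHS](setUIDK E Om) Rintegral_setU//=.
- rewrite [X in _ + X](_ : _ = 0) ?addr0// /Rintegral.
  rewrite null_set_integral//; first exact: measurableD.
    by apply: (measurable_funS mE (@subDsetl _ _ _)); exact: measurable_int ig.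
  apply: variation_off; first exact: measurableD.
  by rewrite setDE -setIA setICl setI0.
- exact: measurableI.
- exact: measurableD.
- by rewrite setUIDK.
- apply/disj_setPS => x [[_ ?] [_ ?]]; contradiction.
Qed.

(** The hypothesis is the divergence identity for the reflected kernel
    [y |-> mollifier a t (x - y)]. It is asked at the single point [x], because for a general field
    it is available only when that kernel is supported in [Om]. *)
Lemma div_mollified a t (x : 'rV[R]_n) i :
  (\int[la]_y (\sum_j Z y i j * pderive j (fun y => mollifier a t (x - y)) y) =
    - (\int[la]_y (W y 0 i * mollifier a t (x - y)))) ->
  \sum_j pderive j (fun x => Zmol a t x i j) x = conv (fun y => W y 0 i) (mollifier a t) x.
Proof.
move=> H; rewrite /conv -[RHS]opprK -H.
have tm := test_mollifier a t.
have dm y : differentiable (mollifier a t) y by apply: smooth_differentiable; case: tm.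
have iz j := rint_conv x (rint_Zij oOm Omfin mZ ZM Z0 i j) (test_function_pderive j tm).
rewrite -RintegralN//; last first.
  apply: rint_sum => // j _.
  apply: (@eq_rint _ _ _ _ _ measurableT (fun y => - (Z y i j * pderive j (mollifier a t) (x - y)))).
    by move=> y _; rewrite pderive_reflect// mulrN.
  exact: rintN.
transitivity (\sum_j \int[la]_y (Z y i j * pderive j (mollifier a t) (x - y))).
  apply: eq_bigr => j _.
  rewrite (_ : (fun x => Zmol a t x i j) = conv (fun y => Z y i j) (mollifier a t)); last first.
    by apply/funext => y; rewrite mxE.
  by rewrite pderive_conv//; exact: (rint_Zij oOm Omfin mZ ZM Z0).
rewrite -(Rintegral_sum measurableT)//; apply: eq_Rintegral => y _.
by rewrite -sumrN; apply: eq_bigr => j _; rewrite pderive_reflect// mulrN opprK.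
Qed.

Lemma mollified_pairing_bound (eta : 'rV[R]_n -> R) a t : 0 < t ->
  measurable_fun setT eta -> (exists C, forall x, `|eta x| <= C) ->
  `|\sum_i \sum_j \int[V]_x (eta x * Zmol a t x i j * s x i j)| <=
  m%:R * n%:R * M * \int[V]_x `|eta x|.
Proof.
move=> t0 me [C eC].
have ie : V.-integrable setT (EFin \o eta) by apply: (@rint_finite_measure _ _ _ V _ C).
have mZm i j : measurable_fun setT (fun x => Zmol a t x i j).
  by apply: smooth_measurable; exact: (smooth_mollified oOm Omfin mZ ZM Z0).
have ies i j : V.-integrable setT (EFin \o (fun x => eta x * Zmol a t x i j * s x i j)).
  apply: (@eq_rint _ _ _ _ _ measurableT (fun x => (Zmol a t x i j * s x i j) * eta x)) => [x _|].
    by rewrite mulrC mulrA.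
  apply: (@rint_bddM _ _ _ _ _ measurableT _ _ (M * 1)) => //; first exact: measurable_funM.
  by move=> x _; rewrite normrM ler_pM// (mollified_le oOm Omfin mZ ZM Z0).
rewrite (le_trans (ler_norm_sum _ _ _))//.
rewrite (le_trans (ler_sum _ (G := fun=> n%:R * (M * \int[V]_x `|eta x|)) _))//; last first.
  by rewrite sumr_const card_ord -!mulrA [leRHS]mulr_natl.
move=> i _; rewrite (le_trans (ler_norm_sum _ _ _))//.
rewrite (le_trans (ler_sum _ (G := fun=> M * \int[V]_x `|eta x|) _))//; last first.
  by rewrite sumr_const card_ord mulr_natl.
move=> j _; rewrite -RintegralZl//; last exact: rint_norm.
apply: (le_norm_Rintegral measurableT) => //; first by apply: rintZ => //; exact: rint_norm.
move=> x _; rewrite (_ : eta x * _ * _ = (Zmol a t x i j * s x i j) * eta x); last by ring.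
rewrite normrM ler_wpM2r// normrM -[leRHS]mulr1.
by apply: ler_pM => //; exact: (mollified_le oOm Omfin mZ ZM Z0).
Qed.

Let bounded_mul (f g : 'rV[R]_n -> R) (C : R) : measurable_fun setT f -> (forall x, `|f x| <= C) ->
  rint g -> rint (fun x => f x * g x).
Proof. by move=> mf fC ig; apply: (@rint_bddM _ _ _ _ _ measurableT _ _ C). Qed.

Lemma rint_mul_L2 (v w : 'rV[R]_n -> R) : rint v -> rint w ->
  rint (fun x => v x ^+ 2) -> rint (fun x => w x ^+ 2) -> rint (fun x => v x * w x).
Proof.
move=> iv iw iv2 iw2; apply: (rint_le measurableT (g := fun x => v x ^+ 2 + w x ^+ 2)).
- by apply: measurable_funM; [exact: (rint_measurable iv)|exact: (rint_measurable iw)].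
- move=> x _; rewrite normrM -[v x ^+ 2]real_normK ?num_real//.
  rewrite -[w x ^+ 2]real_normK ?num_real//.
  by have := sqr_ge0 (`|v x| - `|w x|); have := normr_ge0 (v x); have := normr_ge0 (w x); nra.
- exact: rintD.
Qed.

Lemma rint_pairing_form eta : test_function setT eta ->
  rint (fun x => eta x * (\sum_i W x 0 i * u x 0 i) +
    \sum_i \sum_j pderive j eta x * Z x i j * u x 0 i).
Proof.
move=> te; have [se _ _] := te; have [C _ eC] := test_function_bounded te.
apply: rintD => //.
  apply: bounded_mul eC _; first exact: smooth_measurable.
  by apply: rint_sum => // i _; exact: rint_mul_L2.
apply: rint_sum => // i _; apply: rint_sum => // j _.
have tp := test_function_pderive j te; have [C' _ eC'] := test_function_bounded tp.
apply: (@eq_rint _ _ _ _ _ measurableT (fun x => pderive j eta x * (Z x i j * u x 0 i))).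
  by move=> x _; rewrite mulrA.
apply: bounded_mul eC' _; first by apply: smooth_measurable; case: tp.
exact: bounded_mul (fun x => ZM x i j) _.
Qed.

Lemma pairing_form_lin c eta phi : test_function setT eta -> test_function setT phi ->
  Pf (fun x => c * eta x + phi x) = c * Pf eta + Pf phi.
Proof.
move=> te tp; have ie := rint_pairing_form te; have ip := rint_pairing_form tp.
have [se _ _] := te; have [sp _ _] := tp.
rewrite /pairing_form mulrN -opprD -RintegralZl// -RintegralD//; last exact: rintZ.
congr (- _); apply: eq_Rintegral => x _.
have pd j : pderive j (fun x => c * eta x + phi x) x = c * pderive j eta x + pderive j phi x.
  have de := smooth_differentiable x se; have dp := smooth_differentiable x sp.
  have vde : derivable eta x (delta_mx 0 j) by exact: diff_derivable.
  have vdp : derivable phi x (delta_mx 0 j) by exact: diff_derivable.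
  rewrite /pderive; have -> : (fun x => c * eta x + phi x) = c \*: eta + phi by [].
  rewrite deriveD ?deriveZ//.
  exact: derivableZ.
rewrite mulrDr addrACA mulrA mulrDl; congr (_ + _).
rewrite mulr_sumr -big_split/=; apply: eq_bigr => i _.
rewrite mulr_sumr -big_split/=; apply: eq_bigr => j _.
by rewrite pd; ring.
Qed.

Hypothesis divZ : forall phi, test_function Om phi -> forall i,
  \int[la]_x (\sum_j Z x i j * pderive j phi x) = - \int[la]_x (W x 0 i * phi x).

(** The support of [eta] has positive distance to the complement of [Om], so for small kernels the
    reflected kernel at each of its points is a test function of [Om]. *)
Theorem interior_pairing_cvg (eta : 'rV[R]_n -> R) (e : R) : test_function Om eta -> 0 < e ->
  exists2 r, 0 < r & forall a t, 0 < t -> `|a| + t < r ->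
   `|\sum_i \sum_j \int[V]_x (eta x * Zmol a t x i j * s x i j) - Pf eta| <= e.
Proof.
move=> te e0; have teT := test_functionS (@subsetT _ Om) te.
have [r1 r10 H1] := mollified_pairing_cvg oOm Omfin A_sym mZ ZM AZ Z0 iW iW2 iu iu2 u0 u_mu ms s1 mus teT e0.
have [se cK KO] := te; have [r2 r20 H2] := compact_margin oOm cK KO.
exists (Num.min r1 r2); first by rewrite lt_min r10.
move=> a t t0; rewrite lt_min => /andP[ar1 ar2]; apply: H1 => //.
  by move=> i j; apply: test_functionM => //; exact: (smooth_mollified oOm Omfin mZ ZM Z0).
move=> x ex i; apply: div_mollified.
have E : (fun y => mollifier a t (x - y)) = mollifier (x - a) t.
  by apply/funext => y; rewrite /mollifier bump_sym.
have Kx : closure [set x | eta x != 0] x by exact: subset_closure.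
apply: divZ; rewrite E; apply: test_functionZ; apply: test_bump => y /= yt.
apply: (H2 x Kx); rewrite (le_lt_trans _ ar2)//.
apply: ler_norm_coord => [|k j]; first by rewrite addr_ge0// ltW.
have := yt j; rewrite ord1 !mxE => yj.
rewrite (_ : x 0 j - y 0 j = a 0 j - (y 0 j - (x 0 j - a 0 j))); last by ring.
by rewrite (le_trans (ler_normB _ _))// lerD// ler_coord_norm.
Qed.

(** The mollified integrals satisfy the bound with a constant independent of the kernel, and it
    survives in the limit. *)
Lemma pairing_form_bound eta : test_function Om eta ->
  `|Pf eta| <= m%:R * n%:R * M * \int[V]_x `|eta x|.
Proof.
move=> te; have [se _ _] := te.
have me : measurable_fun setT eta by exact: smooth_measurable.
apply/ler_addgt0Pr => e e0; have [r r0 H] := interior_pairing_cvg te e0.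
have t0 : 0 < r / 2 by rewrite divr_gt0.
have /H : `|0 : 'rV[R]_n| + r / 2 < r by rewrite normr0 add0r ltr_pdivrMr// ltr_pMr// ltr1n.
move=> /(_ t0) He.
rewrite -[Pf eta](subrK (\sum_i \sum_j \int[V]_x (eta x * Zmol 0 (r / 2) x i j * s x i j))).
rewrite (le_trans (ler_normD _ _))// addrC lerD//; last by rewrite distrC.
apply: mollified_pairing_bound => //; have [C _ HC] := test_function_bounded te; by exists C.
Qed.

(** The bound makes the pairing a functional on test functions continuous for the norm of L^1(V);
    its Hahn-Banach extension is the integral against a bounded function. *)
Lemma pairing_density_exists : exists th : 'rV[R]_n -> R,
  [/\ measurable_fun setT th, (exists C, forall x, `|th x| <= C), (forall x, ~ Om x -> th x = 0) &
   forall phi, test_function Om phi -> Pf phi = \int[V]_x (phi x * th x)].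
Proof.
pose C := Num.max 0 (m%:R * n%:R * M).
have C0 : 0 <= C by rewrite le_max lexx.
pose D : set ('rV[R]_n -> R^o) := [set f : 'rV[R]_n -> R^o | V.-integrable setT (EFin \o (f : 'rV[R]_n -> R))].
pose p (f : 'rV[R]_n -> R^o) : R := C * \int[V]_x `|f x|.
pose G : set (('rV[R]_n -> R^o) * R) := [set fr | test_function Om fr.1 /\ fr.2 = Pf fr.1].
have testT phi : test_function Om phi -> test_function setT phi by exact: test_functionS.
have VT : (V setT < +oo)%E by exact: Vfin.
have Dtest phi : test_function Om phi -> D phi.
  move=> tp; have [M' _ HM] := test_function_bounded tp; have [sp _ _] := tp.
  by apply: (@rint_finite_measure _ _ _ V _ M') => //; exact: smooth_measurable.
have Dlin (a : R) f g : D f -> D g -> D (a *: f + g).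
  by move=> Df Dg; apply: rintD => //; exact: rintZ.
have [||||L [L1' L2' L3']] := @hahn_banach_graph R ('rV[R]_n -> R^o) D p Dlin _ G.
- move=> f g t Df Dg t0 t1; rewrite /p (mulrCA t) (mulrCA (1 - t)) -mulrDr ler_wpM2l//.
  have t1' : 0 <= 1 - t by rewrite subr_ge0 ltW.
  have nf : V.-integrable setT (EFin \o (fun x => `|f x|)) by exact: rint_norm.
  have ng : V.-integrable setT (EFin \o (fun x => `|g x|)) by exact: rint_norm.
  rewrite -RintegralZl// -RintegralZl// -RintegralD//; try exact: rintZ.
  apply: le_Rintegral => //.
  + by apply: rint_norm; apply: rintD => //; exact: rintZ.
  + by apply: rintD => //; exact: rintZ.
  + move=> x _; rewrite (le_trans (ler_normD _ _))// lerD//.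
      by rewrite normrM (gtr0_norm t0).
    by rewrite normrM (ger0_norm t1').
- split; first exact: test_function0.
  have t0 : test_function setT (cst 0 : 'rV[R]_n -> R) by exact: test_function0.
  have := pairing_form_lin (-1) t0 t0; rewrite mulN1r addNr /= => <-.
  by congr (Pf _); apply/funext => x; rewrite mulr0 addr0.
- rewrite /G => a f r g t /= [tf ->] [tg ->]; split=> /=.
    by apply: test_functionD => //; exact: test_functionZ.
  by rewrite -pairing_form_lin//; exact: testT.
- rewrite /G => f r /= [tf ->]; split; first exact: Dtest.
  rewrite (le_trans (ler_norm _))// (le_trans (pairing_form_bound tf))//.
  by rewrite ler_wpM2r ?le_max ?lexx ?orbT//; apply: Rintegral_ge0.
have D0 : D 0 by exact: Dtest (@test_function0 _ _ Om).
have L0' : L 0 = 0 by have := L1' (-1) 0 0 D0 D0; rewrite scaler0 addr0 mulN1r addNr.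
have [||g [mg gC gE]] := @L1_functional_repr _ _ R V setT L C measurableT VT C0.
- by move=> a f h If Ih; exact: (L1' a f h).
- move=> f If; rewrite ler_norml; apply/andP; split; last exact: L2'.
  have DNf : D (- f) by exact: rintN.
  have := L2' (- f) DNf; have := L1' (-1) f 0 If D0; rewrite addr0 scaleN1r L0' addr0 mulN1r => ->.
  rewrite /p lerNl; under eq_Rintegral do rewrite normrN.
  by [].
exists (fun x => g x * \1_Om x); split.
- by apply: measurable_funM => //; exact: measurable_indic.
- exists C => x; rewrite normrM -[leRHS]mulr1 ler_pM// indicE.
  by case: (_ \in _); rewrite ?normr1 ?normr0.
- by move=> x nO; rewrite indicE memNset// mulr0.
- move=> phi tp; rewrite -(L3' phi (Pf phi))// gE; last exact: Dtest.
  apply: eq_Rintegral => x _; have [Ox|nO] := pselect (Om x).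
    by rewrite indicE mem_set// mulr1.
  by rewrite (test_function_out tp nO) !mul0r.
Qed.

End pairing_density.

(** * Values and bounds of the pairing density *)

Section pairing_values.
Variables (R : realType) (m n : nat) (Om : set 'rV[R]_n).
Hypotheses (oOm : open Om) (Omfin : (lebesgue_rV R n Om < +oo)%E).
Variable A : {linear 'M[R]_(m, n) -> 'M[R]_(m, n)}.
Hypothesis A_sym : forall y y', frob_ip (A y) y' = frob_ip y (A y').
Local Notation la := (lebesgue_rV R n).
Local Notation rint f := (la.-integrable setT (EFin \o f)).
Variables (Z : 'rV[R]_n -> 'M[R]_(m, n)) (W u : 'rV[R]_n -> 'rV[R]_m) (M : R).
Hypotheses (mZ : forall i j, measurable_fun setT (fun x => Z x i j))
  (ZM : forall x i j, `|Z x i j| <= M) (AZ : forall x, A (Z x) = Z x)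
  (Z0 : forall x, ~ Om x -> Z x = 0).
Hypotheses (iW : forall i, rint (fun x => W x 0 i)) (iW2 : forall i, rint (fun x => W x 0 i ^+ 2)).
Hypotheses (iu : forall i, rint (fun x => u x 0 i)) (iu2 : forall i, rint (fun x => u x 0 i ^+ 2))
  (u0 : forall x, ~ Om x -> u x = 0).
Variables (mu : mx_charge 'rV[R]_n R m n) (s : 'rV[R]_n -> 'M[R]_(m, n)).
Hypothesis u_mu : is_Agrad Om A u mu.
Local Notation V := (mx_variation mu).
Hypotheses (ms : forall i j, measurable_fun setT (fun x => s x i j))
  (s1 : forall x i j, `|s x i j| <= 1)
  (mus : forall i j E, measurable E -> mu i j E = (\int[V]_(x in E) (s x i j)%:E)%E).
Local Notation Zmol := (mollified Z).
Local Notation Pf := (pairing_form Z W u).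
Hypothesis divZ : forall phi, test_function Om phi -> forall i,
  \int[la]_x (\sum_j Z x i j * pderive j phi x) = - \int[la]_x (W x 0 i * phi x).
Variables (th : 'rV[R]_n -> R) (C : R).
Hypotheses (mth : measurable_fun setT th) (thC : forall x, `|th x| <= C)
  (thP : forall phi, test_function Om phi -> Pf phi = \int[V]_x (phi x * th x)).

Let mOm : measurable Om. Proof. exact: open_measurable_mx. Qed.

Let rV (g : 'rV[R]_n -> R) c E : measurable_fun setT g -> (forall x, `|g x| <= c) ->
  measurable E -> V.-integrable E (EFin \o g).
Proof. exact: rint_finite_measure. Qed.

Let mZm a t i j : measurable_fun setT (fun x => Zmol a t x i j).
Proof. by apply: smooth_measurable; exact: (smooth_mollified oOm Omfin mZ ZM Z0). Qed.

Let ZmM a t x i j : 0 < t -> `|Zmol a t x i j| <= M.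
Proof. exact: (mollified_le oOm Omfin mZ ZM Z0). Qed.

Let bmul (f g : 'rV[R]_n -> R) c c' : (forall x, `|f x| <= c) -> (forall x, `|g x| <= c') ->
  forall x, `|f x * g x| <= c * c'.
Proof. by move=> fc gc x; rewrite normrM ler_pM. Qed.

Let rterm (h : 'rV[R]_n -> R) c a t i j : measurable_fun setT h -> (forall x, `|h x| <= c) ->
  0 < t -> V.-integrable setT (EFin \o (fun x => h x * Zmol a t x i j * s x i j)).
Proof.
move=> mh hc t0; apply: (rV (c := c * M * 1)) => //.
  by apply: measurable_funM => //; exact: measurable_funM.
by apply: bmul => //; apply: bmul => // x; exact: ZmM.
Qed.

(** Test functions are dense in L^1(V), and both the mollified fields and [th] are bounded uniformly
    in the kernel; hence convergence extends to bounded measurable [h], in particular to indicators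
    of sets. *)
Theorem mollified_weak_cvg (h : 'rV[R]_n -> R) (c e : R) : measurable_fun setT h ->
  (forall x, `|h x| <= c) -> 0 < e ->
  exists2 r, 0 < r & forall a t, 0 < t -> `|a| + t < r ->
   `|\sum_i \sum_j \int[V]_x (h x * Zmol a t x i j * s x i j) - \int[V]_x (h x * th x)| <= e.
Proof.
move=> mh hc e0; have e3 : 0 < e / 3 by rewrite divr_gt0.
have C0 : 0 <= C by exact: le_trans (thC 0).
pose K := `|m%:R * n%:R * M| + C + 1.
have K0 : 0 < K by rewrite ltr_wpDl// addr_ge0.
have ih := rV mh hc measurableT; have ihO := rV mh hc mOm.
have [phi tp hp] := test_dense_L1 oOm (Vfin mu mOm) ihO (divr_gt0 e3 K0).
have [sp _ _] := tp; have [c' _ pc] := test_function_bounded tp.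
have mp : measurable_fun setT phi by exact: smooth_measurable.
pose g x := h x - phi x.
have mg : measurable_fun setT g by exact: measurable_funB.
have gc x : `|g x| <= c + c' by rewrite (le_trans (ler_normB _ _))// lerD.
have gint : \int[V]_x `|g x| < e / 3 / K.
  rewrite (@RintegralV _ _ _ Om oOm A u mu u_mu)//; first by rewrite setTI.
  exact: rint_norm (rV mg gc measurableT).
have [r r0 H] := interior_pairing_cvg oOm Omfin A_sym mZ ZM AZ Z0 iW iW2 iu iu2 u0 u_mu ms s1 mus divZ tp e3.
exists r => // a t t0 atr; have {}H := H a t t0 atr.
have -> : \sum_i \sum_j \int[V]_x (h x * Zmol a t x i j * s x i j) =
    \sum_i \sum_j \int[V]_x (phi x * Zmol a t x i j * s x i j) +
    \sum_i \sum_j \int[V]_x (g x * Zmol a t x i j * s x i j).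
  rewrite -big_split/=; apply: eq_bigr => i _; rewrite -big_split/=; apply: eq_bigr => j _.
  rewrite -RintegralD//; [|exact: (rterm _ _ _ _ pc)|exact: (rterm _ _ _ _ gc)].
  by apply: eq_Rintegral => x _; rewrite /g; ring.
have -> : \int[V]_x (h x * th x) = Pf phi + \int[V]_x (g x * th x).
  rewrite thP// -RintegralD//.
  - by apply: eq_Rintegral => x _; rewrite /g; ring.
  - by apply: (rV (c := c' * C)) => //; [exact: measurable_funM|exact: bmul].
  - by apply: (rV (c := (c + c') * C)) => //; [exact: measurable_funM|exact: bmul].
rewrite opprD addrACA.
have B1 : `|\sum_i \sum_j \int[V]_x (g x * Zmol a t x i j * s x i j)| <= e / 3.
  have gb : exists c, forall x, `|g x| <= c by exists (c + c').
  rewrite (le_trans (@mollified_pairing_bound _ _ _ _ oOm Omfin _ _ mZ ZM Z0 mu s ms s1 g a t t0 mg gb))//.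
  have I0 : 0 <= \int[V]_x `|g x| by exact: Rintegral_ge0.
  have e3' : e / 3 = K * (e / 3 / K) by rewrite [RHS]mulrC divfK// gt_eqF.
  apply: (@le_trans _ _ (K * \int[V]_x `|g x|)); last by rewrite e3' ler_wpM2l// ltW.
  by rewrite ler_wpM2r// (le_trans (ler_norm _))// /K -addrA lerDl addr_ge0.
have B2 : `|\int[V]_x (g x * th x)| <= e / 3.
  have I0 : 0 <= \int[V]_x `|g x| by exact: Rintegral_ge0.
  have e3' : e / 3 = K * (e / 3 / K) by rewrite [RHS]mulrC divfK// gt_eqF.
  apply: (@le_trans _ _ (C * \int[V]_x `|g x|)); last first.
    apply: (@le_trans _ _ (K * \int[V]_x `|g x|)); last by rewrite e3' ler_wpM2l// ltW.
    by rewrite ler_wpM2r// /K -addrA addrCA lerDl addr_ge0.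
  have ign := rint_norm (rV mg gc measurableT).
  rewrite -RintegralZl//; apply: (le_norm_Rintegral measurableT).
  - by apply: (rV (c := (c + c') * C)) => //; [exact: measurable_funM|exact: bmul].
  - exact: rintZ.
  - by move=> x _; rewrite normrM mulrC ler_wpM2r.
rewrite (le_trans (ler_normD _ _))// (_ : e = e / 3 + (e / 3 + e / 3)); last by lra.
by rewrite lerD// (le_trans (ler_normB _ _))// lerD.
Qed.

Let Rint_setE (g : 'rV[R]_n -> R) E : measurable E ->
  \int[V]_x (\1_E x * g x) = \int[V]_(x in E) g x.
Proof.
move=> mE; rewrite (@Rintegral_mkcond _ _ _ _ E) /=; apply: eq_Rintegral => x _.
by rewrite patchE indicE; case: ifP; rewrite ?mul1r ?mul0r.
Qed.

Let ind1 (E : set 'rV[R]_n) (x : 'rV[R]_n) : `|\1_E x : R| <= 1.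
Proof. by rewrite indicE; case: (_ \in _); rewrite ?normr1 ?normr0. Qed.

(** On such a set the mollified integrals against [V] are Lebesgue integrals against [a]. The same
    family thus converges to the integral of [th] and, by weak convergence of the mollified field,
    to that of [Z : a]. *)
Theorem pairing_ac_part (a : 'rV[R]_n -> 'M[R]_(m, n)) E : measurable E ->
  (forall i j, rint (fun x => a x i j)) ->
  (forall i j F, measurable F -> F `<=` E -> mu i j F = (\int[la]_(x in F) (a x i j)%:E)%E) ->
  \int[V]_(x in E) th x = \int[la]_(x in E `&` Om) frob_ip (Z x) (a x).
Proof.
move=> mE ia mua.
have mEO : measurable (E `&` Om) by exact: measurableI.
rewrite (RintegralV oOm u_mu mE (rV mth thC mE)).
set F := E `&` Om in mEO *.
have sM t i j (a0 : 'rV[R]_n) : 0 < t ->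
    \int[V]_x (\1_F x * Zmol a0 t x i j * s x i j) =
    \int[la]_x (conv (fun y => Z y i j) (mollifier a0 t) x * (\1_F x * a x i j)).
  move=> t0.
  transitivity (\int[V]_(x in F) (Zmol a0 t x i j * s x i j)).
    by rewrite -(Rint_setE _ mEO); apply: eq_Rintegral => x _; rewrite mulrA.
  have rs := rV (ms i j) (fun x => s1 x i j) measurableT.
  rewrite (@density_integral_eq _ _ _ V la F _ (fun x => a x i j) _ M mEO rs (ia i j))//.
  - rewrite [LHS]Rintegral_mkcond; apply: eq_Rintegral => x _.
    by rewrite patchE indicE mxE; case: ifP; rewrite ?mul1r ?mul0r ?mulr0.
  - move=> G mG GF; rewrite -mus// mua//; exact: subset_trans GF (@subIsetl _ _ _).
  - by move=> x; exact: ZmM.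
have ra i j : rint (fun x => \1_F x * a x i j).
  by apply: (@rint_bddM _ _ _ _ _ measurableT _ _ 1) => //; exact: measurable_indic.
have rZa i j : rint (fun x => Z x i j * (\1_F x * a x i j)).
  by apply: (@rint_bddM _ _ _ _ _ measurableT _ _ M) => // x _; exact: ZM.
have -> : \int[la]_(x in F) frob_ip (Z x) (a x) =
    \sum_i \sum_j \int[la]_x (Z x i j * (\1_F x * a x i j)).
  under eq_bigr do rewrite -(Rintegral_sum measurableT)//.
  rewrite -(Rintegral_sum measurableT)//; last by move=> i _; exact: rint_sum.
  rewrite [LHS]Rintegral_mkcond; apply: eq_Rintegral => x _.
  rewrite patchE; case: ifPn => xF.
    by apply: eq_bigr => i _; apply: eq_bigr => j _; rewrite indicE xF mul1r.
  by rewrite big1// => i _; rewrite big1// => j _; rewrite indicE (negbTE xF) mul0r mulr0.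
rewrite -Rint_setE//; apply/eqP; rewrite -subr_eq0 -normr_le0; apply/ler_addgt0Pr => e e0.
have c0 : 0 < (m%:R * n%:R + 1 : R) by rewrite ltr_wpDl// mulr_ge0.
have e2 : 0 < e / 2 by rewrite divr_gt0.
have [r1 r10 H1] := mollified_weak_cvg (measurable_indic mEO) (ind1 F) e2.
have /choice[r2 Hr2] : forall ij : 'I_m * 'I_n, exists r, 0 < r /\ forall b t, 0 < t -> `|b| + t < r ->
    `|\int[la]_x (conv (fun y => Z y ij.1 ij.2) (mollifier b t) x * (\1_F x * a x ij.1 ij.2)) -
      \int[la]_x (Z x ij.1 ij.2 * (\1_F x * a x ij.1 ij.2))| <= e / 2 / (m%:R * n%:R + 1).
  move=> [i j]; have F0 x : ~ Om x -> \1_F x * a x i j = 0.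
    by move=> nO; rewrite indicE memNset ?mul0r// => -[].
  have [r r0 rH] := conv_weak_bounded oOm Omfin (rint_Zij oOm Omfin mZ ZM Z0 i j)
    (fun x => ZM x i j) (ra i j) F0 (divr_gt0 e2 c0).
  by exists r.
have [r r0 [rr1 rr2]] : exists2 r, 0 < r & r <= r1 /\ (forall ij, r <= r2 ij).
  exists (\big[Num.min/r1]_i r2 i).
    by elim/big_ind : _ => // [x y x0 y0|i _]; [rewrite lt_min x0|case: (Hr2 i)].
  by split; [exact: bigmin_le_id|move=> i; exact: bigmin_le].
have t0 : 0 < r / 2 by rewrite divr_gt0.
have atr : `|0 : 'rV[R]_n| + r / 2 < r by rewrite normr0 add0r ltr_pdivrMr// ltr_pMr// ltr1n.
have {}H1 := H1 0 _ t0 (lt_le_trans atr rr1).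
set S := \sum_i \sum_j _ in H1.
rewrite add0r (le_trans (ler_distD S _ _))// [leRHS](splitr e) lerD//; first by rewrite distrC.
rewrite /S -sumrB (le_trans (ler_norm_sum _ _ _))//.
rewrite (le_trans (ler_sum _ (G := fun=> n%:R * (e / 2 / (m%:R * n%:R + 1))) _))//; last first.
  rewrite sumr_const card_ord -[leLHS]mulr_natl.
  rewrite [leLHS](_ : _ = e / 2 * (m%:R * n%:R / (m%:R * n%:R + 1))); last by ring.
  by apply: ler_piMr; [exact: ltW|rewrite ler_pdivrMr// mul1r lerDl].
move=> i _; rewrite -sumrB (le_trans (ler_norm_sum _ _ _))//.
rewrite (le_trans (ler_sum _ (G := fun=> e / 2 / (m%:R * n%:R + 1)) _))//; last first.
  by rewrite sumr_const card_ord [leRHS]mulr_natl.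
move=> j _; rewrite sM//; case: (Hr2 (i, j)) => _; apply => //; exact: lt_le_trans atr (rr2 _).
Qed.

Theorem pairing_upper E (q t0 : R) : measurable E -> 0 < t0 ->
  (forall x t, E x -> 0 < t -> t < t0 -> frob_ip (Zmol 0 t x) (s x) <= q) ->
  \int[V]_(x in E) th x <= q * fine (V E).
Proof.
move=> mE t00 H; apply/ler_addgt0Pr => e e0.
have [r1 r10 H1] := mollified_weak_cvg (measurable_indic mE) (ind1 E) e0.
pose r := Num.min r1 t0; have r0 : 0 < r by rewrite lt_min r10.
have t10 : 0 < r / 2 by rewrite divr_gt0.
have rr : r / 2 < r by rewrite ltr_pdivrMr// ltr_pMr// ltr1n.
have atr : `|0 : 'rV[R]_n| + r / 2 < r1 by rewrite normr0 add0r (lt_le_trans rr)// ge_min lexx.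
have := H1 0 _ t10 atr; rewrite ler_distlC => /andP[_ +]; rewrite Rint_setE//.
move=> /le_trans; apply; rewrite lerD2r.
have rE i j : V.-integrable E (EFin \o (fun x => Zmol 0 (r / 2) x i j * s x i j)).
  apply: (rV (c := M * 1)) => //; first exact: measurable_funM.
  by apply: bmul => // x; exact: ZmM.
rewrite (_ : \sum_i _ = \int[V]_(x in E) frob_ip (Zmol 0 (r / 2) x) (s x)).
  rewrite -Rintegral_cst//; apply: le_Rintegral => //.
  - by apply: rint_sum => // i _; apply: rint_sum.
  - exact: (rV (c := `|q|)).
  - by move=> x Ex; apply: H => //; rewrite (lt_le_trans rr)// ge_min lexx orbT.
have -> : \sum_i \sum_j \int[V]_x (\1_E x * Zmol 0 (r / 2) x i j * s x i j) =
    \sum_i \sum_j \int[V]_(x in E) (Zmol 0 (r / 2) x i j * s x i j).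
  apply: eq_bigr => i _; apply: eq_bigr => j _; rewrite -(Rint_setE _ mE).
  by apply: eq_Rintegral => x _; rewrite mulrA.
under eq_bigr do rewrite -(Rintegral_sum mE)//.
by rewrite -(Rintegral_sum mE)// => i _; exact: rint_sum.
Qed.

(** A mollified field is an average of values of [Z] over a cube of half side [t], so a linear bound
    on these values persists. *)
Lemma mollified_frob_le (x : 'rV[R]_n) (sigma : 'M[R]_(m, n)) q t : 0 < t ->
  (forall y, `|x - y| < t -> frob_ip (Z y) sigma <= q) -> frob_ip (Zmol 0 t x) sigma <= q.
Proof.
move=> t0 H.
have k1 : \int[la]_y mollifier 0 t (x - y) = 1 by rewrite /Rintegral integral_mollifier_r.
have ik : rint (fun y => mollifier 0 t (x - y)).
  apply/integrableP; split.
    by apply/measurable_EFinP; exact: (measurable_fun_pair2 x (measurable_mollifier2 0 t)).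
  rewrite (eq_integral (fun y : 'rV[R]_n => (mollifier 0 t (x - y))%:E)) ?integral_mollifier_r ?ltry//.
  by move=> y _; rewrite gee0_abs// lee_fin mollifier_ge0.
have ic i j := rint_conv x (rint_Zij oOm Omfin mZ ZM Z0 i j) (test_mollifier 0 t).
have ics i j : rint (fun y => sigma i j * (Z y i j * mollifier 0 t (x - y))) by exact: rintZ.
rewrite -[leRHS]mulr1 -k1 -RintegralZl//.
rewrite (_ : frob_ip _ _ = \int[la]_y \sum_i \sum_j sigma i j * (Z y i j * mollifier 0 t (x - y))).
  apply: le_Rintegral => //.
  - by apply: rint_sum => // i _; exact: rint_sum.
  - exact: rintZ.
  - move=> y _; have -> : \sum_i \sum_j sigma i j * (Z y i j * mollifier 0 t (x - y)) =
        frob_ip (Z y) sigma * mollifier 0 t (x - y).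
      rewrite /frob_ip mulr_suml; apply: eq_bigr => i _; rewrite mulr_suml; apply: eq_bigr => j _.
      by ring.
    have [xy|xy] := ltP `|x - y| t.
      by rewrite ler_wpM2r ?mollifier_ge0// H.
    have [j Hj] : exists j, t <= `|(x - y) 0 j|.
      apply: contrapT => /forallNP Hn; move: xy; rewrite leNgt => /negP; apply.
      have : cube 0 t (x - y) by move=> i j; rewrite ord1 [X in _ - X]mxE subr0 ltNge; exact/negP.
      by rewrite cube_ball// -ball_normE /ball_/= sub0r normrN.
    by rewrite (@mollifier_eq0 _ _ 0 t (x - y) j) ?mulr0// [X in _ - X]mxE subr0.
rewrite (Rintegral_sum measurableT); last by move=> i _; exact: rint_sum.
apply: eq_bigr => i _; rewrite (Rintegral_sum measurableT)//.
by apply: eq_bigr => j _; rewrite RintegralZl// mxE mulrC.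
Qed.

End pairing_values.

(** * Green's formula *)

Lemma frob_le_norm (R : realType) (n : nat) (v : 'rV[R]_n) : frob v <= n%:R * `|v|.
Proof.
rewrite (le_trans (frob_le_sum v))// big_ord1 (le_trans (ler_sum _ (G := fun=> `|v|) _))//.
  by move=> i _; exact: ler_coord_norm.
by rewrite sumr_const card_ord mulr_natl.
Qed.

(* [e] is the inward graph direction, so a shift by [tau *: e] absorbs errors up to [kappa * tau]. *)
Lemma lipschitz_boundary_push (R : realType) (n : nat) (Om : set 'rV[R]_n.+1) x0 :
  lipschitz_boundary Om -> boundary Om x0 ->
  exists (e : 'rV[R]_n.+1) (rho kappa : R), [/\ 0 < rho, 0 < kappa <= 1, `|e| <= 1 &
    forall tau t x y, 0 < tau -> 3 * tau < rho -> 0 < t -> t <= kappa * tau ->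
      `|x - x0| < rho -> Om y -> `|x - tau *: e - y| <= 2 * t -> Om x].
Proof.
move=> lip /lip[Q [r [k [g [QQ r0 lg OmE]]]]].
have QtQ : Q^T *m Q = 1%:M by exact: mulmx1C.
have Q1 i j : `|Q i j| <= 1.
  have /matrixP/(_ i i) := QQ; rewrite !mxE eqxx mulr1n => S.
  have : `|Q i j| ^+ 2 <= 1 ^+ 2.
    rewrite expr1n -[leRHS]S real_normK ?num_real// expr2 (bigD1 j)//= !mxE lerDl sumr_ge0// => l _.
    by rewrite mxE -expr2 sqr_ge0.
  by rewrite ler_pXn2r// nnegrE.
pose N : R := n.+1%:R.
have N1 : 1 <= N by rewrite ler1n.
have N0 : 0 < N by rewrite (lt_le_trans _ N1).
pose em : 'rV[R]_n.+1 := delta_mx 0 ord_max.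
pose e : 'rV[R]_n.+1 := em *m Q^T.
have eQ : e *m Q = em by rewrite /e -mulmxA QtQ mulmx1.
have e1 : `|e| <= 1.
  apply: ler_norm_coord => // i j; rewrite mxE (bigD1 ord_max)//= big1 ?addr0.
    by rewrite !mxE !eqxx/= ord1 eqxx mul1r.
  by move=> l lm; rewrite !mxE (negbTE lm) andbF mul0r.
(* The graph description holds in a Euclidean ball while distances here are in the sup norm, which
   loses a factor [N]; the 2 keeps both [x] and [y] in that ball. *)
pose rho := r / (2 * N).
(* In rotated coordinates the error is at most [2 N t]. It enters once through the height and once,
   times the Lipschitz constant, through the graph, in total at most [tau / 2]. *)
pose kappa := (4 * N * (1 + `|k|))^-1.
have k1 : 0 < 1 + `|k| by rewrite ltr_pwDl.
have D0 : 1 <= 4 * N * (1 + `|k|).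
  have := normr_ge0 k; nra.
exists e, rho, kappa; split.
- by rewrite divr_gt0// mulr_gt0.
- by rewrite invr_gt0 (lt_le_trans _ D0)//= invf_le1// (lt_le_trans _ D0).
- by [].
move=> tau t x y tau0 taur t0 tk xx0 Oy xy.
pose d := x - tau *: e - y.
have xE : x = y + tau *: e + d by rewrite /d addrCA addrACA; apply/rowP => i; rewrite !mxE; ring.
have t1 : 4 * N * (1 + `|k|) * t <= tau.
  by move: tk; rewrite /kappa ler_pdivlMl// (lt_le_trans _ D0).
have ttau : t <= tau by have := normr_ge0 k; nra.
have rE : N * (rho + rho) = r by rewrite /rho; field; rewrite gt_eqF.
have Bx : frob (x - x0) < r.
  rewrite (le_lt_trans (frob_le_norm _))// -rE ltr_pM2l// (lt_trans xx0)// ltrDl divr_gt0//.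
  by rewrite mulr_gt0.
have By : frob (y - x0) < r.
  rewrite (le_lt_trans (frob_le_norm _))// -rE ltr_pM2l//.
  rewrite (_ : y - x0 = x - x0 - (tau *: e + d)); last by rewrite xE; apply/rowP => i; rewrite !mxE; ring.
  rewrite (le_lt_trans (ler_normB _ _))// ltrD//.
  rewrite (le_lt_trans (ler_normD _ _))// normrZ gtr0_norm//.
  have : tau * `|e| <= tau by rewrite ler_piMr// ltW.
  lra.
apply/(OmE _ Bx); have /(OmE _ By) gy := Oy.
have dQ j : `|(d *m Q) 0 j| <= N * (2 * t).
  rewrite mxE (le_trans (ler_norm_sum _ _ _))//.
  rewrite (le_trans (ler_sum _ (G := fun=> 2 * t) _))//; last by rewrite sumr_const card_ord [leRHS]mulr_natl.
  move=> i _; rewrite normrM -[leRHS]mulr1 ler_pM//.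
  by rewrite (le_trans (ler_coord_norm _ _ _)).
have xQ : x *m Q = y *m Q + tau *: em + d *m Q by rewrite xE !mulmxDl -scalemxAl eQ.
have xQE l : (x *m Q) 0 l = (y *m Q) 0 l + tau * em 0 l + (d *m Q) 0 l.
  by rewrite xQ; move: (y *m Q) (d *m Q) => Y D; rewrite !mxE.
have gxy : `|g (col' ord_max (x *m Q)) - g (col' ord_max (y *m Q))| <= `|k| * (N * (2 * t)).
  have /= lgxy := lg (col' ord_max (x *m Q), col' ord_max (y *m Q)) (conj I I).
  apply: (le_trans lgxy).
  rewrite (le_trans (ler_wpM2r _ (ler_norm k)))// ler_wpM2l//.
  apply: ler_norm_coord => [|i j]; first by rewrite mulr_ge0 ?mulr_ge0// ltW.
  pose l := lift (ord_max : 'I_n.+1) j.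
  have eml : em 0 l = 0 by rewrite mxE [_ == ord_max]eq_sym (negbTE (neq_lift _ _)) andbF.
  rewrite [X in `|X|](_ : _ = (x *m Q) 0 l - (y *m Q) 0 l); last by rewrite ord1 !mxE.
  by rewrite xQE eml mulr0 addr0 addrAC subrr add0r.
have xm : (x *m Q) 0 ord_max = (y *m Q) 0 ord_max + tau + (d *m Q) 0 ord_max.
  by rewrite xQE [em _ _]mxE !eqxx mulr1.
rewrite xm; have := dQ ord_max; rewrite ler_norml => /andP[+ _].
have := gxy; rewrite ler_distl => /andP[_]; have := normr_ge0 k; nra.
Qed.

Section cutoff.
Variables (R : realType) (n : nat).
Local Notation la := (lebesgue_rV R n).

(** The indicator of the ball of radius [3 rho / 4] is smoothed at width [rho / 8]: the result is
    still 1 at distance less than [rho / 2] and vanishes from [7 rho / 8] on. *)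
Lemma cutoff_exists (x0 : 'rV[R]_n) (rho : R) : 0 < rho -> exists b,
  test_function (ball x0 rho) b /\ forall x, `|x0 - x| < rho / 2 -> b x = 1.
Proof.
move=> r0.
have s0 : 0 < rho / 8 by rewrite divr_gt0.
have q0 : 0 < 3 * rho / 4 by rewrite divr_gt0// mulr_gt0.
have h0 : 0 < 7 * rho / 8 by rewrite divr_gt0// mulr_gt0.
pose B := ball x0 (3 * rho / 4).
have mB : measurable B by apply: open_measurable_mx; exact: ball_open.
have fB : (la B < +oo)%E by rewrite [X in (X < _)%E](lebesgue_rV_ball x0 q0) ltry.
have iB : la.-integrable setT (EFin \o (\1_B : 'rV[R]_n -> R)).
  have /(integrable_mkcond _ mB) : la.-integrable B (EFin \o (cst 1 : 'rV[R]_n -> R)).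
    by apply: (@rint_bdd _ _ _ _ _ mB _ 1) => // x _; rewrite normr1.
  rewrite restrict_EFin; congr (integrable _ _ (EFin \o _)); apply/funext => x.
  by rewrite patchE indicE; case: ifP.
pose b := conv \1_B (mollifier 0 (rho / 8)).
have coord (v : 'rV[R]_n) c : 0 < c -> c <= `|v| -> exists j, c <= `|v 0 j|.
  move=> c0 cv; apply: contrapT => /forallNP Hn; move: cv; rewrite leNgt => /negP; apply.
  have : cube 0 c v by move=> i j; rewrite ord1 [X in _ - X]mxE subr0 ltNge; exact/negP.
  by rewrite cube_ball// -ball_normE /ball_/= sub0r normrN.
exists b; split.
  (* This bump serves only to exhibit a compact support inside the ball. *)
  apply: (@test_function_supp _ _ _ (bump x0 (7 * rho / 8))).
  - exact: smooth_conv iB (test_mollifier _ _).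
  - apply: test_bump => x /= xb; rewrite -ball_normE /ball_/=.
    have : `|x0 - x| <= 7 * rho / 8.
      by apply: ler_norm_coord => [|i j]; [exact: ltW|rewrite ord1 !mxE distrC].
    lra.
  - move=> x bx; rewrite /b /conv.
    have xx : 7 * rho / 8 <= `|x0 - x|.
      rewrite leNgt; apply/negP => xlt.
      suff : 0 < bump x0 (7 * rho / 8) x by rewrite bx ltxx.
      apply: bump_gt0 => j; rewrite distrC (le_lt_trans _ xlt)//.
      by have := ler_coord_norm (x0 - x) 0 j; rewrite !mxE.
    transitivity (\int[la]_(y in setT) (0 : R)); last by rewrite Rintegral_cst// mul0r.
    apply: eq_Rintegral => y _.
    have [By|By] := pselect (B y); last by rewrite indicE memNset// mul0r.
    have [|j Hj] := @coord (x - y) _ s0.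
      move: By; rewrite /B -ball_normE /ball_/= => By.
      have := ler_distD y x0 x; rewrite [`|y - x|]distrC; lra.
    by rewrite (@mollifier_eq0 _ _ _ _ _ j) ?mulr0// [X in _ - X]mxE subr0.
move=> x xx; rewrite /b /conv.
transitivity (\int[la]_y mollifier 0 (rho / 8) (x - y)); last by rewrite /Rintegral integral_mollifier_r.
apply: eq_Rintegral => y _.
have [By|By] := pselect (B y); first by rewrite indicE mem_set// mul1r.
have [|j Hj] := @coord (x - y) _ s0.
  move: By; rewrite /B -ball_normE /ball_/= => /negP; rewrite -leNgt => By.
  have := ler_distD x x0 y; lra.
rewrite indicE memNset// mul0r (@mollifier_eq0 _ _ _ _ _ j)//.
by rewrite [(0 : 'rV[R]_n) 0 j]mxE subr0.
Qed.

End cutoff.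

(** * The total mass of the pairing for fields with zero normal trace *)

Section green.
Variables (R : realType) (m n : nat) (Om : set 'rV[R]_n.+1).
Hypotheses (oOm : open Om) (bOm : bounded_set Om) (lOm : lipschitz_boundary Om).
Hypothesis (Omfin : (lebesgue_rV R n.+1 Om < +oo)%E).
Variable A : {linear 'M[R]_(m, n.+1) -> 'M[R]_(m, n.+1)}.
Hypothesis A_sym : forall y y', frob_ip (A y) y' = frob_ip y (A y').
Local Notation la := (lebesgue_rV R n.+1).
Local Notation rint f := (la.-integrable setT (EFin \o f)).
Variables (Z : 'rV[R]_n.+1 -> 'M[R]_(m, n.+1)) (W u : 'rV[R]_n.+1 -> 'rV[R]_m) (M : R).
Hypotheses (mZ : forall i j, measurable_fun setT (fun x => Z x i j))
  (ZM : forall x i j, `|Z x i j| <= M) (AZ : forall x, A (Z x) = Z x)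
  (Z0 : forall x, ~ Om x -> Z x = 0).
Hypotheses (iW : forall i, rint (fun x => W x 0 i)) (iW2 : forall i, rint (fun x => W x 0 i ^+ 2)).
Hypotheses (iu : forall i, rint (fun x => u x 0 i)) (iu2 : forall i, rint (fun x => u x 0 i ^+ 2))
  (u0 : forall x, ~ Om x -> u x = 0).
Variables (mu : mx_charge 'rV[R]_n.+1 R m n.+1) (s : 'rV[R]_n.+1 -> 'M[R]_(m, n.+1)).
Hypothesis u_mu : is_Agrad Om A u mu.
Local Notation V := (mx_variation mu).
Hypotheses (ms : forall i j, measurable_fun setT (fun x => s x i j))
  (s1 : forall x i j, `|s x i j| <= 1)
  (mus : forall i j E, measurable E -> mu i j E = (\int[V]_(x in E) (s x i j)%:E)%E).
Local Notation Zmol := (mollified Z).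
Local Notation Pf := (pairing_form Z W u).
Hypothesis divZ : forall phi, test_function setT phi -> forall i,
  \int[la]_x (\sum_j Z x i j * pderive j phi x) = - (\int[la]_x (W x 0 i * phi x)).
Variables (th : 'rV[R]_n.+1 -> R) (C : R).
Hypotheses (mth : measurable_fun setT th) (thC : forall x, `|th x| <= C)
  (thP : forall phi, test_function Om phi -> Pf phi = \int[V]_x (phi x * th x)).

Let mOm : measurable Om. Proof. exact: open_measurable_mx. Qed.

Let tT (U : set 'rV[R]_n.+1) phi : test_function U phi -> test_function setT phi.
Proof. exact: test_functionS. Qed.

Let divZO phi : test_function Om phi -> forall i,
  \int[la]_x (\sum_j Z x i j * pderive j phi x) = - (\int[la]_x (W x 0 i * phi x)).
Proof. by move=> /tT; exact: divZ. Qed.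

(** Along kernels that keep the product supported in [Om], the mollified integrals tend both to the
    form and to the integral of [eta th]. The divergence identity holds here for all test functions
    of the space, so the position of the kernel is immaterial to it. *)
Lemma pairing_form_approx (eta : 'rV[R]_n.+1 -> R) : test_function setT eta ->
  (forall r, 0 < r -> exists a t, [/\ 0 < t, `|a| + t < r &
     forall i j, test_function Om (eta * (fun x => Zmol a t x i j))]) ->
  Pf eta = \int[V]_x (eta x * th x).
Proof.
move=> te H; have [se _ _] := te; have [c _ ec] := test_function_bounded te.
have me : measurable_fun setT eta by exact: smooth_measurable.
apply/eqP; rewrite -subr_eq0 -normr_le0; apply/ler_addgt0Pr => e e0; rewrite add0r.
have e2 : 0 < e / 2 by rewrite divr_gt0.
have [r1 r10 H1] := mollified_pairing_cvg oOm Omfin A_sym mZ ZM AZ Z0 iW iW2 iu iu2 u0 u_mu ms s1 mus te e2.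
have [r2 r20 H2] := mollified_weak_cvg oOm Omfin A_sym mZ ZM AZ Z0 iW iW2 iu iu2 u0 u_mu ms s1 mus
  divZO mth thC thP me ec e2.
have [|a [t [t0 atr tZ]]] := H (Num.min r1 r2); first by rewrite lt_min r10.
move: atr; rewrite lt_min => /andP[ar1 ar2].
rewrite (le_trans (ler_distD (\sum_i \sum_j \int[V]_x (eta x * Zmol a t x i j * s x i j)) _ _))//.
rewrite [leRHS](splitr e) lerD//; last exact: H2.
rewrite distrC; apply: H1 => // x _ i; apply: (div_mollified oOm Omfin mZ ZM Z0).
apply: divZ.
have E : (fun y => mollifier a t (x - y)) = mollifier (x - a) t.
  by apply/funext => y; rewrite /mollifier bump_sym.
by rewrite E; exact: test_mollifier.
Qed.

(** In the bound [2 t], one [t] is the width of the kernel and the other passes from a point of the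
    closure to a nearby point where the product is nonzero. *)
Lemma test_mul_mollified (eta : 'rV[R]_n.+1 -> R) a t i j : test_function setT eta -> 0 < t ->
  (forall x y, closure [set x | eta x != 0] x -> Om y -> `|x - a - y| <= 2 * t -> Om x) ->
  test_function Om (eta * (fun x => Zmol a t x i j)).
Proof.
move=> te t0 H; have sZ := smooth_mollified oOm Omfin mZ ZM Z0 a t i j.
have [sp cp _] := test_functionM te sZ; split => // x cx.
have [x' [/= ex' xx']] := cx _ (nbhsx_ballx x t t0).
move: ex'; rewrite mulf_eq0 negb_or => /andP[ex' Zx'].
have [y [Oy x'y]] : exists y, Om y /\ `|x' - a - y| < t.
  apply: contrapT => /forallNP Hn; move/eqP : Zx'; apply; rewrite mxE /conv.
  transitivity (\int[la]_(y in setT) (0 : R)); last by rewrite Rintegral_cst// mul0r.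
  apply: eq_Rintegral => y _; have [Oy|/Z0->] := pselect (Om y); last by rewrite mxE mul0r.
  have [k Hk] : exists k, t <= `|(x' - a - y) 0 k|.
    apply: contrapT => /forallNP Hk; apply: (Hn y); split=> //.
    have : cube 0 t (x' - a - y) by move=> k l; rewrite ord1 [X in _ - X]mxE subr0 ltNge; exact/negP.
    by rewrite cube_ball// -ball_normE /ball_/= sub0r normrN.
  rewrite (@mollifier_eq0 _ _ _ _ _ k) ?mulr0// (le_trans Hk)// le_eqVlt; apply/orP; left.
  by apply/eqP; congr `|_|; rewrite !mxE; ring.
apply: (H x y) => //.
  move: cx; apply: closure_subset => z /=; rewrite mulf_eq0 negb_or => /andP[]//.
move: xx'; rewrite -ball_normE /ball_/= => xx'.
rewrite (_ : x - a - y = (x - x') + (x' - a - y)); last by apply/rowP => k; rewrite !mxE; ring.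
by rewrite (le_trans (ler_normD _ _))// mulr_natl mulr2n lerD// ltW.
Qed.

Lemma pairing_form_local x0 : closure Om x0 -> exists2 rho, 0 < rho &
  forall eta, test_function (ball x0 rho) eta -> Pf eta = \int[V]_x (eta x * th x).
Proof.
move=> cx0; have [Ox0|nOx0] := pselect (Om x0).
  have /nbhs_ballP[rho /= r0 rO] : nbhs x0 Om by apply: open_nbhs_nbhs.
  by exists rho => // eta te; apply: thP; exact: test_functionS te.
have bx0 : boundary Om x0 by split=> // /interior_subset.
have [e [rho [kappa [r0 /andP[k0 k1] e1 H]]]] := lipschitz_boundary_push lOm bx0.
exists rho => // eta te; apply: pairing_form_approx; first exact: tT te.
move=> r rr0; pose tau := Num.min (r / 3) (rho / 4).
have tau0 : 0 < tau by rewrite lt_min !divr_gt0.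
have taur : tau <= r / 3 by rewrite ge_min lexx.
have taurho : tau <= rho / 4 by rewrite ge_min lexx orbT.
have t0 : 0 < kappa * tau by rewrite mulr_gt0.
exists (tau *: e), (kappa * tau); split => //.
  rewrite normrZ gtr0_norm//.
  have : tau * `|e| <= tau by rewrite ler_piMr// ltW.
  have : kappa * tau <= tau by rewrite ler_piMl// ltW.
  lra.
move=> i j; apply: test_mul_mollified => //; first exact: tT te.
move=> x y sx Oy xy; apply: (H tau (kappa * tau) x y) => //; first by lra.
have [_ _ /(_ _ sx)] := te; rewrite -ball_normE /ball_/= distrC; exact.
Qed.

(** The identity between form and integral is local, by [pairing_form_local]. A finite cover of the
    closure carries it to a cutoff equal to 1 on [Om], where the derivative terms drop out. *)
Theorem green_formula : \int[V]_x th x = - (\int[la]_x \sum_i W x 0 i * u x 0 i).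
Proof.
pose T (eta : 'rV[R]_n.+1 -> R) := Pf eta - \int[V]_x (eta x * th x).
have rV eta : test_function setT eta -> V.-integrable setT (EFin \o (fun x => eta x * th x)).
  move=> te; have [se _ _] := te; have [c _ ec] := test_function_bounded te.
  apply: (@rint_finite_measure _ _ _ V _ (c * C)) => //.
    by apply: measurable_funM => //; exact: smooth_measurable.
  by move=> x; rewrite normrM ler_pM.
have Tlin eta phi : test_function setT eta -> test_function setT phi ->
    T (fun x => -1 * eta x + phi x) = - T eta + T phi.
  move=> te tp; rewrite /T (pairing_form_lin mZ ZM iW iW2 iu iu2 _ te tp).
  have -> : \int[V]_x ((-1 * eta x + phi x) * th x) =
      -1 * \int[V]_x (eta x * th x) + \int[V]_x (phi x * th x).
    rewrite -RintegralZl ?rV// -RintegralD ?rV//; last by apply: rintZ => //; exact: rV.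
    by apply: eq_Rintegral => x _; rewrite mulrDl mulrA.
  by move: (Pf eta) (Pf phi) (\int[V]_x (eta x * th x)) (\int[V]_x (phi x * th x)) => p q v w; ring.
have /choice[rho Hrho] : forall x0, exists rho, 0 < rho /\ (closure Om x0 ->
    forall eta, test_function (ball x0 rho) eta -> T eta = 0).
  move=> x0; have [cx0|] := pselect (closure Om x0); last by exists 1.
  have [rho r0 rH] := pairing_form_local cx0; exists rho; split=> // _ eta te.
  by rewrite /T rH// subrr.
have /choice[b Hb] : forall x0, exists b, test_function (ball x0 (rho x0)) b /\
    forall x, `|x0 - x| < rho x0 / 2 -> b x = 1.
  by move=> x0; apply: cutoff_exists; case: (Hrho x0).
have [B [B0 OB]] : exists B : R, 0 < B /\ forall x, Om x -> `|x| < B.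
  case: bOm => N [_ HN]; exists (`|N| + 2); split; first by rewrite ltr_wpDl.
  move=> x Ox; have : `|x| <= `|N| + 1 by apply: HN => //; rewrite (le_lt_trans (ler_norm N))// ltrDl.
  by lra.
have cK : compact (closure Om).
  apply: bounded_closed_compact; last exact: closed_closure.
  exists (B + 1); split; first exact: num_real.
  move=> N BN x cx; have [y [Oy]] := cx _ (nbhsx_ballx x 1 ltr01).
  rewrite -ball_normE /ball_/= => xy; rewrite -(subrK y x) (le_trans (ler_normD _ _))//.
  by have := OB _ Oy; lra.
have [D DO KD] : finite_subset_cover (closure Om) (fun x => ball x (rho x / 2)) (closure Om).
  move: cK; rewrite compact_cover; apply; first by move=> x _; exact: ball_open.
  by move=> x Kx; exists x => //; apply: ballxx; rewrite divr_gt0//; case: (Hrho x).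
have [eta0 [te0 eta01]] : exists b, test_function (ball (0 : 'rV[R]_n.+1) (2 * B)) b /\
    forall x, `|0 - x| < 2 * B / 2 -> b x = 1.
  by apply: cutoff_exists; rewrite mulr_gt0.
have eta0O x : Om x -> eta0 x = 1.
  by move=> Ox; apply: eta01; rewrite sub0r normrN mulrAC divff// mul1r OB.
(* Instead of a normalized partition of unity: passing from [r] to [x0 :: r] subtracts [b x0 * P r],
   a local test function on which [T] vanishes. So [T] is the same for [eta0] and for the final
   product, which is zero on [Om] because some factor vanishes at each point. *)
pose P (r : seq 'rV[R]_n.+1) x := eta0 x * \prod_(i <- r) (1 - b i x).
have tP r : {subset r <= closure Om} -> test_function setT (P r) /\ T (P r) = T eta0.
  elim: r => [_|x0 r IH rO].
    have -> : P [::] = eta0 by apply/funext => x; rewrite /P big_nil mulr1.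
    by split => //; exact: tT te0.
  have [|tr Tr] := IH; first by move=> x xr; apply: rO; rewrite in_cons xr orbT.
  have tb : test_function (ball x0 (rho x0)) (b x0 * P r).
    by apply: test_functionM; [case: (Hb x0)|case: tr].
  have E : P (x0 :: r) = fun x => -1 * (b x0 * P r) x + P r x.
    by apply/funext => x; rewrite /P big_cons !fctE; ring.
  have tbT := tT tb; split.
    by rewrite E; apply: test_functionD => //; exact: test_functionZ.
  rewrite E Tlin// Tr; case: (Hrho x0) => _ -> //; first by rewrite oppr0 add0r.
  by have := rO x0; rewrite in_cons eqxx => /(_ isT); rewrite inE.
have [|tD TD] := tP (finmap.enum_fset D); first by move=> x xD; apply: DO.
have PO x : Om x -> P (finmap.enum_fset D) x = 0.
  move=> Ox; have [x0 x0D xx0] := KD x (subset_closure Ox).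
  rewrite /P (big_rem x0)//= (_ : b x0 x = 1) ?subrr ?mul0r ?mulr0//.
  by case: (Hb x0) => _; apply; move: xx0; rewrite -ball_normE.
have derO eta c x j : (forall y, Om y -> eta y = c) -> Om x -> pderive j eta x = 0.
  move=> eO Ox; rewrite /pderive -(derive_cst c (delta_mx 0 j) x).
  apply: near_eq_derive; have : nbhs x Om by apply: open_nbhs_nbhs.
  by apply: filterS => y Oy; rewrite eO.
have Tval eta c : test_function setT eta -> (forall y, Om y -> eta y = c) ->
    T eta = - (c * \int[la]_x \sum_i W x 0 i * u x 0 i) - c * \int[V]_x th x.
  move=> te eO; rewrite /T; congr (_ - _).
    rewrite /pairing_form; congr (- _); rewrite -RintegralZl//; last first.
      by apply: rint_sum => // i _; exact: (rint_mul_L2).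
    apply: eq_Rintegral => x _; have [Ox|nO] := pselect (Om x); last first.
      rewrite !big1 ?mulr0 ?addr0// => i _; rewrite ?big1// => *; rewrite u0// mxE mulr0//.
    rewrite eO// [X in _ + X]big1 ?addr0// => i _; rewrite big1// => j _.
    by rewrite (derO eta c)// !mul0r.
  have ith : V.-integrable setT (EFin \o th) by exact: (@rint_finite_measure _ _ _ V _ C).
  rewrite -RintegralZl// (RintegralV oOm u_mu measurableT (rV _ te)).
  rewrite (RintegralV oOm u_mu measurableT (rintZ measurableT c ith)) !setTI.
  by apply: eq_Rintegral => x /set_mem Ox; rewrite eO.
have := Tval _ 0 tD PO; rewrite TD (Tval _ 1 (tT te0) eta0O) !mul0r !mul1r oppr0 addr0.
by move=> /eqP; rewrite subr_eq0 => /eqP <-.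
Qed.

End green.

(** * Fields defined almost everywhere on Om *)

Lemma ae_eq_Rintegral_in d (T : measurableType d) (R : realType)
    (mu : {measure set T -> \bar R}) (D : set T) (f g : T -> R) : measurable D ->
  measurable_fun D f -> measurable_fun D g -> {ae mu, forall x, D x -> f x = g x} ->
  \int[mu]_(x in D) f x = \int[mu]_(x in D) g x.
Proof.
move=> mD mf mg fg; rewrite /Rintegral; congr fine; apply: ae_eq_integral => //.
- exact/measurable_EFinP.
- exact/measurable_EFinP.
- by apply: filterS fg => x fgx Dx; rewrite fgx.
Qed.

Lemma ae_null_set d (T : measurableType d) (R : realType) (mu : {measure set T -> \bar R})
    (P : T -> Prop) : {ae mu, forall x, P x} ->
  exists N, [/\ measurable N, mu N = 0%E & forall x, ~ N x -> P x].
Proof.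
move=> [N [mN N0 sub]]; exists N; split=> // x nN.
by apply: contrapT => nP; apply/nN/sub.
Qed.

Section zero_extension.
Variables (R : realType) (n : nat) (Om : set 'rV[R]_n).
Hypotheses (oOm : open Om) (Omfin : (lebesgue_rV R n Om < +oo)%E).
Local Notation la := (lebesgue_rV R n).
Local Notation rint f := (la.-integrable setT (EFin \o f)).

Let mOm : measurable Om. Proof. exact: open_measurable_mx. Qed.

Definition zext (T : zmodType) (v : 'rV[R]_n -> T) (x : 'rV[R]_n) : T :=
  if `[< Om x >] then v x else 0.

Lemma zextE (T : zmodType) (v : 'rV[R]_n -> T) x : Om x -> zext v x = v x.
Proof. by move=> Ox; rewrite /zext asboolT. Qed.

Lemma zext0 (T : zmodType) (v : 'rV[R]_n -> T) x : ~ Om x -> zext v x = 0.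
Proof. by move=> Ox; rewrite /zext asboolF. Qed.

Lemma rint_zext (g : 'rV[R]_n -> R) (h : 'rV[R]_n -> R) :
  la.-integrable Om (EFin \o g) -> (forall x, Om x -> h x = g x) -> (forall x, ~ Om x -> h x = 0) ->
  rint h.
Proof.
move=> /(integrable_mkcond _ mOm); rewrite restrict_EFin => H hg h0.
move: H; congr (integrable _ _ (EFin \o _)); apply/funext => x; rewrite patchE.
by case: ifPn => [/set_mem /hg//|/negP xO]; rewrite h0// => Ox; apply/xO/mem_set.
Qed.

Lemma measurable_entry m k (g : 'rV[R]_n -> 'M[R]_(m, k)) D i j :
  measurable_fun D g -> measurable_fun D (fun x => g x i j).
Proof. move=> mg; exact: (measurableT_comp (measurable_mx_coord i j) mg). Qed.

Lemma L1_entry m k (g : 'rV[R]_n -> 'M[R]_(m, k)) i j : L1 la Om g ->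
  la.-integrable Om (EFin \o (fun x => g x i j)).
Proof.
move=> [mg ig]; apply: (rint_le mOm (measurable_entry i j mg) _ ig) => x _.
exact: ler_entry_frob.
Qed.

Lemma L2_entry_sqr m k (g : 'rV[R]_n -> 'M[R]_(m, k)) i j : L2 la Om g ->
  la.-integrable Om (EFin \o (fun x => g x i j ^+ 2)).
Proof.
move=> [mg ig]; apply: (rint_le mOm _ _ ig).
  by apply: measurable_funX; exact: measurable_entry.
move=> x _; rewrite normrX ler_pXn2r ?nnegrE ?frob_ge0//; exact: ler_entry_frob.
Qed.

Lemma L2_L1 m k (g : 'rV[R]_n -> 'M[R]_(m, k)) : L2 la Om g -> L1 la Om g.
Proof.
move=> [mg ig]; split=> //.
have mf : measurable_fun Om (fun x => frob (g x)).
  by apply: measurable_frob => i j; exact: measurable_entry.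
apply: (rint_le mOm mf (g := fun x => 1 + frob (g x) ^+ 2)).
  move=> x _; rewrite ger0_norm ?frob_ge0//; have := sqr_ge0 (frob (g x) - 1); have := frob_ge0 (g x); nra.
apply: rintD => //; apply: (@rint_bdd _ _ _ _ _ mOm _ 1) => // x _; by rewrite normr1.
Qed.

Lemma rint_zext_L2 m k (g : 'rV[R]_n -> 'M[R]_(m, k)) i j : L2 la Om g ->
  rint (fun x => zext g x i j) /\ rint (fun x => zext g x i j ^+ 2).
Proof.
move=> g2; split.
- apply: (rint_zext (L1_entry i j (L2_L1 g2))) => x Ox; first by rewrite zextE.
  by rewrite zext0// mxE.
- apply: (rint_zext (L2_entry_sqr i j g2)) => x Ox; first by rewrite zextE.
  by rewrite zext0// mxE expr0n.
Qed.

(** Null sets matter once the field is also tested against [V], so a representative is needed whose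
    properties hold at every point. It is 0 on the exceptional set, whence the alternative in the
    last clause. *)
Lemma clean_field m A (z : 'rV[R]_n -> 'M[R]_(m, n)) (P : 'rV[R]_n -> 'M[R]_(m, n) -> Prop) :
  A 0 = 0 -> X2 Om A z -> {ae la, forall x, Om x -> P x (z x)} ->
  exists (Z : 'rV[R]_n -> 'M[R]_(m, n)) (M : R),
  [/\ forall i j, measurable_fun setT (fun x => Z x i j),
    forall x i j, `|Z x i j| <= M, forall x, A (Z x) = Z x, forall x, ~ Om x -> Z x = 0 &
    {ae la, forall x, Om x -> Z x = z x} /\ forall x, Om x -> Z x = 0 \/ P x (Z x)].
Proof.
move=> A0 [[mz [M zM]] Az _] aeP.
have [N [mN N0 NH]] : exists N, [/\ measurable N, la N = 0%E &
    forall x, ~ N x -> Om x -> [/\ frob (z x) <= M, A (z x) = z x & P x (z x)]].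
  apply: ae_null_set; apply: filterS (filterI zM (filterI Az aeP)) => x [a [b c]] Ox.
  by split; [exact: a|exact: b|exact: c].
pose Z x := if `[< Om x /\ ~ N x >] then z x else 0.
exists Z, `|M|; split.
- move=> i j; pose D := Om `\` N; have mD : measurable D by exact: measurableD.
  rewrite (_ : (fun x => _) = (fun x => z x i j) \_ D).
    by apply/(measurable_restrictT _ mD); apply: measurable_entry; exact: (measurable_funS mOm (@subDsetl _ _ _) mz).
  apply/funext => x; rewrite patchE /Z; case: asboolP => [[Ox nN]|H].
    by rewrite mem_set.
  by rewrite memNset ?mxE.
- move=> x i j; rewrite /Z; case: asboolP => [[Ox nN]|_]; last by rewrite mxE normr0.
  have [zx _ _] := NH _ nN Ox; rewrite (le_trans (ler_entry_frob _ _ _))// (le_trans zx)//.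
  exact: ler_norm.
- by move=> x; rewrite /Z; case: asboolP => [[Ox nN]|_] //; have [] := NH _ nN Ox.
- by move=> x nO; rewrite /Z asboolF// => -[].
- split; last by move=> x Ox; rewrite /Z; case: asboolP => [[_ nN]|_]; [right; have [] := NH _ nN Ox|left].
  exists N; split=> // x /= H; apply: contrapT => nN; apply: H => Ox.
  by rewrite /Z asboolT.
Qed.

Lemma wdiv_spec m A (z : 'rV[R]_n -> 'M[R]_(m, n)) : X2 Om A z ->
  L2 la Om (wdiv Om z) /\ is_wdiv Om z (wdiv Om z).
Proof.
move=> [_ _ [w w2 zw]]; rewrite /wdiv /choose_or; case: pselect => [p|]; last by case; exists w.
by case: (cid p) => v [].
Qed.

End zero_extension.

Section test_charge.
Variables (R : realType) (n : nat) (Om : set 'rV[R]_n).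
Hypothesis oOm : open Om.

Let mOm : measurable Om. Proof. exact: open_measurable_mx. Qed.

(** Viewed as a 1 by 1 matrix charge, [nu] has a bounded density with respect to its variation.
    Comparing this density with [g] on test functions, in both directions, gives equality on Borel
    sets. *)
Lemma charge_eq_density (nu : {charge set 'rV[R]_n -> \bar R}) 
    (mu : {measure set 'rV[R]_n -> \bar R}) (g : 'rV[R]_n -> R) :
  concentrated Om nu -> (mu Om < +oo)%E -> mu.-integrable Om (EFin \o g) ->
  (forall phi, test_function Om phi -> charge_integral nu phi = \int[mu]_(x in Om) (phi x * g x)) ->
  forall E, measurable E -> nu E = (\int[mu]_(x in E `&` Om) g x)%:E.
Proof.
move=> cnu muO ig H; pose numx : mx_charge 'rV[R]_n R 1 1 := fun _ _ => nu.
have [s [ms s1 nus]] := variation_density numx.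
pose s' (x : 'rV[R]_n) : R := s x 0 0.
have Vfin : (mx_variation numx Om < +oo)%E by rewrite -ge0_fin_numE// fin_num_measure.
have iVs D : measurable D -> (mx_variation numx).-integrable D (EFin \o s').
  move=> mD; apply: rint_finite_measure mD; first exact: (ms 0 0).
  by move=> x; exact: (s1 x 0 0).
have nuE E : measurable E -> nu E = (\int[mx_variation numx]_(x in E `&` Om) s' x)%:E.
  move=> mE; have mEO : measurable (E `&` Om) by exact: measurableI.
  rewrite RintegralE//; last exact: iVs.
  rewrite -(nus 0 0)//= /numx -[in LHS](setUIDK E Om) chargeU//; last 2 first.
    exact: measurableD.
    by rewrite setDE setICA !setIA -setIA setICr setI0.
  rewrite [X in (_ + X)%E](cnu (E `\` Om)) ?adde0//; first exact: measurableD.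
  by rewrite setDE -setIA setICl setI0.
have test phi : test01 Om phi -> \int[mx_variation numx]_(x in Om) (s' x * phi x) = \int[mu]_(x in Om) (g x * phi x).
  move=> [tp p01]; have [sp _ _] := tp.
  have pM x : `|phi x| <= 1 by have /andP[p0 p1] := p01 x; rewrite ger0_norm.
  have mp : measurable_fun setT phi by exact: smooth_measurable.
  transitivity (charge_integral nu phi).
    rewrite (@charge_integral_density _ _ _ nu (mx_variation numx) s' phi 1)//; last 2 first.
      exact: iVs.
      by move=> E mE; exact: (nus 0 0).
    rewrite [LHS]Rintegral_mkcond; apply: eq_Rintegral => x _; rewrite patchE.
    case: ifPn => [_|]; first by rewrite mulrC.
    by rewrite notin_setE => nO; rewrite (test_function_out tp nO) mul0r.
  by rewrite H//; apply: eq_Rintegral => x _; rewrite mulrC.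
have ind (la : {measure set 'rV[R]_n -> \bar R}) (h : 'rV[R]_n -> R) E : measurable E ->
    \int[la]_(x in Om) (h x * \1_E x) = \int[la]_(x in E `&` Om) h x.
  move=> mE; rewrite [LHS]Rintegral_mkcond [RHS]Rintegral_mkcond.
  apply: eq_Rintegral => x _; rewrite !patchE indicE in_setI.
  by case: (x \in E); case: (x \in Om); rewrite ?mulr1 ?mulr0.
have isO := iVs _ mOm.
move=> E mE; rewrite nuE//; congr EFin; apply/eqP; rewrite eq_le; apply/andP; split.
- rewrite -subr_ge0 addrC.
  have Ns : (mx_variation numx).-integrable Om (EFin \o (fun x => - s' x)) by exact: rintN.
  have := @test_le_set _ _ _ oOm (mx_variation numx) mu (fun x => - s' x) g Vfin muO Ns ig _ E mE.
  have mEO : measurable (E `&` Om) by exact: measurableI.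
  rewrite !ind// (RintegralN mEO); last by apply: (integrableS mOm) => //; exact: measurableI.
  apply => phi tp; rewrite -test//.
  under eq_Rintegral do rewrite mulNr.
  rewrite RintegralN// ?addNr//; have [[sp _ _] p01] := tp.
  apply: (@eq_rint _ _ _ _ _ mOm (fun x => phi x * s' x)) => [x _|]; first by rewrite mulrC.
  apply: (@rint_bddM _ _ _ _ _ mOm _ _ 1) => //; first by apply: smooth_measurable; case: tp => -[].
  by move=> x _; have /andP[p0 p1] := tp.2 x; rewrite ger0_norm.
- rewrite -subr_ge0.
  have Ng : mu.-integrable Om (EFin \o (fun x => - g x)) by exact: rintN.
  have := @test_le_set _ _ _ oOm (mx_variation numx) mu s' (fun x => - g x) Vfin muO isO Ng _ E mE.
  have mEO : measurable (E `&` Om) by exact: measurableI.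
  rewrite !ind// (RintegralN mEO); last by apply: (integrableS mOm) => //; exact: measurableI.
  apply => phi tp; rewrite test//.
  under [X in _ + X]eq_Rintegral do rewrite mulNr.
  rewrite RintegralN// ?subrr//.
  apply: (@eq_rint _ _ _ _ _ mOm (fun x => phi x * g x)) => [x _|]; first by rewrite mulrC.
  apply: (@rint_bddM _ _ _ _ _ mOm _ _ 1) => //; first by apply: smooth_measurable; case: tp => -[].
  by move=> x _; have /andP[p0 p1] := tp.2 x; rewrite ger0_norm.
Qed.

End test_charge.

(** * Transfer to the pairing of the original functions *)

Section pairing_package.
Variables (R : realType) (m n : nat) (Om : set 'rV[R]_n.+1).
Hypotheses (oOm : open Om) (bOm : bounded_set Om) (lOm : lipschitz_boundary Om).
Hypothesis (Omfin : (lebesgue_rV R n.+1 Om < +oo)%E).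
Variable A : {linear 'M[R]_(m, n.+1) -> 'M[R]_(m, n.+1)}.
Hypothesis A_sym : forall y y', frob_ip (A y) y' = frob_ip y (A y').
Local Notation la := (lebesgue_rV R n.+1).
Local Notation rint f := (la.-integrable setT (EFin \o f)).

Let mOm : measurable Om. Proof. exact: open_measurable_mx. Qed.

Lemma Agrad_spec u : BVA Om A u -> is_Agrad Om A u (Agrad Om A u).
Proof.
move=> [_ [mu0 H]]; rewrite /Agrad /choose_or; case: pselect => [p|]; last by case; exists mu0.
exact: svalP (cid p).
Qed.

Variables (z : 'rV[R]_n.+1 -> 'M[R]_(m, n.+1)) (u : 'rV[R]_n.+1 -> 'rV[R]_m).
Hypotheses (zX2 : X2 Om A z) (u2 : L2 la Om u) (uBV : BVA Om A u).
Variable P : 'rV[R]_n.+1 -> 'M[R]_(m, n.+1) -> Prop.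
Hypothesis zP : {ae la, forall x, Om x -> P x (z x)}.
Local Notation mu := (Agrad Om A u).
Local Notation V := (mx_variation mu).
Variable s : 'rV[R]_n.+1 -> 'M[R]_(m, n.+1).
Hypotheses (ms : forall i j, measurable_fun setT (fun x => s x i j))
  (s1 : forall x i j, `|s x i j| <= 1)
  (mus : forall i j E, measurable E -> mu i j E = (\int[V]_(x in E) (s x i j)%:E)%E).

(** The predicate [P] keeps the pointwise information on [z] abstract: it becomes finiteness of the
    conjugate when the bound by the recession function is needed, and a trivial condition
    otherwise. *)
Theorem pairing_package : exists (th : 'rV[R]_n.+1 -> R) (C : R),
  [/\ measurable_fun setT th, (forall x, `|th x| <= C),
   is_pairing Om z u (pairing Om z u) /\
   (forall E, measurable E -> pairing Om z u E = (\int[V]_(x in E) th x)%:E) &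
   [/\ (forall (a : 'rV[R]_n.+1 -> 'M[R]_(m, n.+1)) E, measurable E -> (forall i j, rint (fun x => a x i j)) ->
         (forall i j F, measurable F -> F `<=` E ->
            mu i j F = (\int[la]_(x in F) (a x i j)%:E)%E) ->
         \int[V]_(x in E) th x = \int[la]_(x in E `&` Om) frob_ip (z x) (a x)),
     (forall (E : set 'rV[R]_n.+1) (q t0 : R), measurable E -> 0 < t0 -> 0 <= q ->
       (forall x y Y, E x -> Om y -> `|x - y| < t0 -> P y Y -> frob_ip Y (s x) <= q) ->
       \int[V]_(x in E) th x <= q * fine (V E)) &
     ((forall phi, test_function setT phi -> forall i,
        \int[la]_(x in Om) (\sum_j z x i j * pderive j phi x) =
        - (\int[la]_(x in Om) (wdiv Om z x 0 i * phi x))) ->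
      \int[V]_x th x = - (\int[la]_(x in Om) \sum_i wdiv Om z x 0 i * u x 0 i))]].
Proof.
have [w2 zw] := wdiv_spec zX2.
have [Z [M [mZ ZM AZ Z0 [Zz ZP]]]] := clean_field oOm (raddf0 A) zX2 zP.
pose W := zext Om (wdiv Om z); pose U := zext Om u.
have iW i : rint (fun x => W x 0 i) by case: (rint_zext_L2 oOm Omfin 0 i w2).
have iW2 i : rint (fun x => W x 0 i ^+ 2) by case: (rint_zext_L2 oOm Omfin 0 i w2).
have iU i : rint (fun x => U x 0 i) by case: (rint_zext_L2 oOm Omfin 0 i u2).
have iU2 i : rint (fun x => U x 0 i ^+ 2) by case: (rint_zext_L2 oOm Omfin 0 i u2).
have U0 x : ~ Om x -> U x = 0 by exact: zext0.
have W0 x : ~ Om x -> W x = 0 by exact: zext0.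
have UE x : Om x -> U x = u x by exact: zextE.
have WE x : Om x -> W x = wdiv Om z x by exact: zextE.
have mz i j : measurable_fun Om (fun x => z x i j).
  by apply: measurable_entry; case: zX2 => -[].
have mu' i : measurable_fun Om (fun x => u x 0 i) by apply: measurable_entry; case: u2.
have mw i : measurable_fun Om (fun x => wdiv Om z x 0 i) by apply: measurable_entry; case: w2.
have mtest phi : test_function setT phi -> measurable_fun Om phi.
  by move=> [sp _ _]; exact: smooth_measurable.
have mU_mu : is_Agrad Om A U mu.
  have [cmu Hmu] := Agrad_spec uBV; split=> // phi tp; rewrite Hmu//; congr (A _).
  apply/matrixP => i j; rewrite !mxE; congr (- _); apply: eq_Rintegral => x /set_mem Ox.
  by rewrite UE.
have divE phi : test_function setT phi -> forall i,
    \int[la]_(x in Om) (\sum_j z x i j * pderive j phi x) =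
      - (\int[la]_(x in Om) (wdiv Om z x 0 i * phi x)) ->
    \int[la]_x (\sum_j Z x i j * pderive j phi x) = - (\int[la]_x (W x 0 i * phi x)).
  move=> tp i H.
  rewrite (@Rintegral_supp _ _ Om (fun x => W x 0 i * phi x)); last first.
    by move=> x nO; rewrite W0// mxE mul0r.
  rewrite (@Rintegral_supp _ _ Om); last first.
    by move=> x nO; rewrite big1// => j _; rewrite Z0// mxE mul0r.
  transitivity (\int[la]_(x in Om) (\sum_j z x i j * pderive j phi x)).
    apply: ae_eq_Rintegral_in => //.
    - apply: measurable_sum => j; apply: measurable_funM; first exact: measurable_funTS.
      exact: mtest (test_function_pderive j tp).
    - apply: measurable_sum => j; apply: measurable_funM => //.
      exact: mtest (test_function_pderive j tp).
    - by apply: filterS Zz => x H1 Ox; rewrite H1.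
  by rewrite H; congr (- _); apply: eq_Rintegral => x /set_mem Ox; rewrite WE.
have tT phi : test_function Om phi -> test_function setT phi by exact: test_functionS.
have divZ phi : test_function Om phi -> forall i,
    \int[la]_x (\sum_j Z x i j * pderive j phi x) = - (\int[la]_x (W x 0 i * phi x)).
  by move=> tp i; apply: divE; [exact: tT|exact: zw].
have [th [mth [C thC] th0 thP]] := pairing_density_exists oOm Omfin A_sym mZ ZM AZ Z0 iW iW2 iU iU2 U0
  mU_mu ms s1 mus divZ.
have ith E : measurable E -> V.-integrable E (EFin \o th).
  by move=> mE; apply: rint_finite_measure mE; [exact: mth|exact: thC].
have pfE phi : test_function Om phi -> pairing_form Z W U phi =
    - \int[la]_(x in Om)
        (phi x * \sum_i wdiv Om z x 0 i * u x 0 i +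
         \sum_i \sum_j pderive j phi x * z x i j * u x 0 i).
  move=> tp; rewrite /pairing_form; congr (- _).
  rewrite (@Rintegral_supp _ _ Om); last first.
    move=> x nO; rewrite !big1 ?mulr0 ?addr0// => i _; last by rewrite U0// mxE mulr0.
    by rewrite big1// => j _; rewrite U0// mxE mulr0.
  have mp := mtest _ (tT _ tp); have mdp j := mtest _ (test_function_pderive j (tT _ tp)).
  have mZO i j : measurable_fun Om (fun x => Z x i j) by exact: measurable_funTS.
  have mWO i : measurable_fun Om (fun x => W x 0 i).
    by apply: measurable_funTS; exact: (rint_measurable (iW i)).
  have mUO i : measurable_fun Om (fun x => U x 0 i).
    by apply: measurable_funTS; exact: (rint_measurable (iU i)).
  apply: ae_eq_Rintegral_in => //.
  - apply: measurable_funD.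
      by apply: measurable_funM => //; apply: measurable_sum => i; exact: measurable_funM.
    apply: measurable_sum => i; apply: measurable_sum => j; apply: measurable_funM => //.
    exact: measurable_funM.
  - apply: measurable_funD.
      by apply: measurable_funM => //; apply: measurable_sum => i; exact: measurable_funM.
    apply: measurable_sum => i; apply: measurable_sum => j; apply: measurable_funM => //.
    exact: measurable_funM.
  - apply: filterS Zz => x H1 Ox; rewrite H1// UE// WE//.
have iT := ith _ measurableT.
(* The charge with density [th] shows that a pairing exists. The chosen one may be another charge a
   priori and is identified below with the density by testing. *)
pose nu0 : {charge set 'rV[R]_n.+1 -> \bar R} := induced_charge iT.
have VO E := variation_off mU_mu (E := E).
have nu0P : is_pairing Om z u nu0.
  split.
    move=> E mE EO; rewrite /nu0/= /induced_charge null_set_integral//; last exact: VO.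
    by apply/measurable_EFinP; exact: measurable_funTS.
  move=> phi tp; rewrite -pfE// thP//.
  have [c _ pc] := test_function_bounded tp; have [sp _ _] := tp.
  by rewrite (@charge_integral_density _ _ _ nu0 V th phi c)//; exact: smooth_measurable.
have prP : is_pairing Om z u (pairing Om z u).
  rewrite /pairing /choose_or; case: pselect => [p|]; last by case; exists nu0.
  exact: svalP (cid p).
exists th, C; split=> //.
  split=> // E mE; rewrite (RintegralV oOm mU_mu mE (ith _ mE)).
  have VOm : (V Om < +oo)%E by exact: Vfin.
  apply: (charge_eq_density oOm prP.1 VOm (ith _ mOm)) => // phi tp.
  rewrite prP.2// -pfE// thP//.
  have [c _ pc] := test_function_bounded tp; have [sp _ _] := tp.
  rewrite (RintegralV oOm mU_mu measurableT) ?setTI//.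
  apply: (@rint_bddM _ _ _ _ _ measurableT _ _ c) => //; exact: smooth_measurable.
split.
- move=> a E mE ia Ha.
  rewrite (pairing_ac_part oOm Omfin A_sym mZ ZM AZ Z0 iW iW2 iU iU2 U0 mU_mu ms s1 mus divZ mth thC thP mE ia Ha).
  have EO : E `&` Om `<=` Om by exact: subIsetr.
  apply: ae_eq_Rintegral_in; first exact: measurableI.
  + apply: measurable_frob_ip => i j; apply: measurable_funTS => //; exact: (rint_measurable (ia i j)).
  + apply: measurable_frob_ip => i j; first exact: (measurable_funS mOm).
    apply: measurable_funTS; exact: (rint_measurable (ia i j)).
  + by apply: filterS Zz => x H1 [_ Ox]; rewrite H1.
- move=> E q t0 mE t00 q0 H.
  apply: (pairing_upper oOm Omfin A_sym mZ ZM AZ Z0 iW iW2 iU iU2 U0 mU_mu ms s1 mus divZ mth thC thP mE t00).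
  move=> x t Ex tp tt0; apply: (mollified_frob_le oOm Omfin mZ ZM Z0 tp) => y xy.
  have z0 : frob_ip (0 : 'M[R]_(m, n.+1)) (s x) <= q.
    by rewrite /frob_ip big1// => i _; rewrite big1// => j _; rewrite mxE mul0r.
  have [Oy|nO] := pselect (Om y); last by rewrite Z0.
  by have [->//|PZ] := ZP y Oy; apply: (H x y) => //; exact: lt_trans tt0.
- move=> H.
  rewrite (green_formula oOm bOm lOm Omfin A_sym mZ ZM AZ Z0 iW iW2 iU iU2 U0 mU_mu ms s1 mus _ mth thC thP).
    congr (- _); rewrite (@Rintegral_supp _ _ Om); last first.
      by move=> x nO; rewrite big1// => i _; rewrite U0// mxE mulr0.
    by apply: eq_Rintegral => x /set_mem Ox; rewrite UE// WE.
  by move=> phi tp i; apply: divE => //; exact: H.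
Qed.

End pairing_package.

(** * Recession function and conjugate *)

Section frobenius_complements.
Variables (R : realType) (m n : nat).
Implicit Types y w : 'M[R]_(m, n).

Lemma frob_ipDl y y' w : frob_ip (y + y') w = frob_ip y w + frob_ip y' w.
Proof. by have := frob_ipDZ 1 1 y y' w; rewrite !scale1r !mul1r. Qed.

Lemma frob_ipZl (a : R) y w : frob_ip (a *: y) w = a * frob_ip y w.
Proof. by have := frob_ipDZ a 0 y 0 w; rewrite scaler0 addr0 mul0r addr0. Qed.

Lemma frob_ipNl y w : frob_ip (- y) w = - frob_ip y w.
Proof. by rewrite -scaleN1r frob_ipZl mulN1r. Qed.

Lemma frob_ipBl y y' w : frob_ip (y - y') w = frob_ip y w - frob_ip y' w.
Proof. by rewrite frob_ipDl frob_ipNl. Qed.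

Lemma frob_ipDr y y' w : frob_ip w (y + y') = frob_ip w y + frob_ip w y'.
Proof. by rewrite ![frob_ip w _]frob_ipC frob_ipDl. Qed.

Lemma frob_ipZr (a : R) y w : frob_ip w (a *: y) = a * frob_ip w y.
Proof. by rewrite ![frob_ip w _]frob_ipC frob_ipZl. Qed.

Lemma frob_ipBr y y' w : frob_ip w (y - y') = frob_ip w y - frob_ip w y'.
Proof. by rewrite ![frob_ip w _]frob_ipC frob_ipBl. Qed.

Lemma frob_ip0l w : frob_ip 0 w = 0.
Proof. by have := frob_ipZl 0 0 w; rewrite scale0r mul0r. Qed.

Lemma frob_ip0r w : frob_ip w 0 = 0.
Proof. by rewrite frob_ipC frob_ip0l. Qed.

Lemma frobZ (a : R) y : frob (a *: y) = `|a| * frob y.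
Proof. by rewrite /frob frob_ipZl frob_ipZr mulrA -expr2 sqrtrM ?sqr_ge0// sqrtr_sqr. Qed.

Lemma frob_eq0 y : frob_ip y y <= 0 -> y = 0.
Proof.
rewrite -frob_sqr => y0; apply/matrixP => i j; rewrite mxE; apply/eqP; rewrite -normr_le0.
apply: le_trans (ler_entry_frob y i j) _.
by have := frob_ge0 y; move: y0; nra.
Qed.

Lemma frob_cauchy_schwarz_norm y w : `|frob_ip y w| <= frob y * frob w.
Proof.
rewrite ler_norml frob_cauchy_schwarz andbT lerNl -frob_ipNl -(frobN y).
exact: frob_cauchy_schwarz.
Qed.

End frobenius_complements.

Lemma le0_bounded_slope (R : realType) (a b : R) : (forall t, 0 < t -> t * a <= b) -> a <= 0.
Proof.
move=> H; rewrite leNgt; apply/negP => a0; have b1 : 0 < `|b| + 1 by rewrite ltr_wpDl.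
have := H ((`|b| + 1) / a); rewrite divr_gt0// divfK ?gt_eqF// => /(_ isT).
have := ler_norm b; lra.
Qed.

(** * Conjugate, subgradients and recession function of the integrand *)

Section integrand.
Variables (R : realType) (m n : nat) (Om : set 'rV[R]_n).
Hypothesis oOm : open Om.
Variable A : {linear 'M[R]_(m, n) -> 'M[R]_(m, n)}.
Hypotheses (A_sym : forall y y', frob_ip (A y) y' = frob_ip y (A y'))
  (A_idem : forall y, A (A y) = A y).
Variables (f : 'rV[R]_n -> 'M[R]_(m, n) -> R) (c0 C0 : R).
Local Notation cl := (closure Om).
Hypotheses (f_ge0 : forall x y, cl x -> 0 <= f x y)
  (f_conv : forall x, cl x -> forall u v (t : R), 0 < t -> t < 1 ->
    f x (t *: u + (1 - t) *: v) <= t * f x u + (1 - t) * f x v)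
  (c0_gt0 : 0 < c0) (C0_gt0 : 0 < C0)
  (f_gr : forall x y, cl x -> c0 * frob (A y) <= f x y <= C0 * (1 + frob (A y)))
  (f_rec : forall x y, cl x -> cvg (recession_quotient f y @ recession_filter Om x)).

(** The conjugate of [f x] at [p] is at most [c], stated without extended reals. *)
Definition conj_le x p (c : R) := forall y, frob_ip p y - f x y <= c.

Lemma frob_proj_le y : frob (A y) <= frob y.
Proof.
have := frob_cauchy_schwarz y (A y); rewrite -{1}A_idem -A_sym -frob_sqr.
by have := frob_ge0 (A y); have := frob_ge0 y; nra.
Qed.

(** By the growth condition [f] is bounded on the kernel of [A], so a linear form dominated by [f]
    up to a constant vanishes there; test with multiples of [p - A p]. *)
Lemma conj_le_proj x p c : cl x -> conj_le x p c -> A p = p.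
Proof.
move=> cx pc; pose k := p - A p.
have Ak : A k = 0 by rewrite linearB A_idem subrr.
have pk : frob_ip p k <= 0.
  apply: (@le0_bounded_slope _ _ (c + C0)) => t t0.
  have := pc (t *: k); have /andP[_] := f_gr (t *: k) cx.
  by rewrite linearZ/= Ak scaler0 /frob frob_ip0l sqrtr0 addr0 mulr1 frob_ipZr; lra.
apply/esym/subr0_eq; apply: frob_eq0; rewrite -/k (le_trans _ pk)// -subr_ge0 -frob_ipBl.
by rewrite /k opprB addrC subrK A_sym -/k Ak frob_ip0r.
Qed.

(** Testing with large multiples of [p] itself compares [|p|^2] with [C0 |p|]. *)
Lemma conj_le_bound x p c : cl x -> conj_le x p c -> frob p <= C0.
Proof.
move=> cx pc; have Ap := conj_le_proj cx pc.
have : frob p ^+ 2 - C0 * frob p <= 0.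
  apply: (@le0_bounded_slope _ _ (c + C0)) => t t0.
  have := pc (t *: p); have /andP[_] := f_gr (t *: p) cx.
  by rewrite linearZ/= Ap frobZ gtr0_norm// frob_ipZr -frob_sqr; lra.
by have := frob_ge0 p; have := C0_gt0; nra.
Qed.

Lemma subgradient_exists x y : cl x -> exists p,
  (forall y', f x y + frob_ip p (y' - y) <= f x y') /\ conj_le x p (frob_ip p y - f x y).
Proof.
move=> cx; have [p Hp] := convex_subgradient (f_conv cx) y; exists p; split=> // y'.
by have := Hp y'; rewrite frob_ipBr; lra.
Qed.

(** Every subgradient has a finite conjugate, hence norm at most [C0]. *)
Lemma f_lipschitz x y y' : cl x -> `|f x y - f x y'| <= C0 * frob (y - y').
Proof.
move=> cx.
have one u v : f x u - f x v <= C0 * frob (u - v).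
  have [p [Hp pc]] := subgradient_exists u cx.
  have := Hp v; rewrite -opprB -scaleN1r frob_ipZr mulN1r => H.
  have pb := conj_le_bound cx pc; have cs := frob_cauchy_schwarz p (u - v).
  have := ler_wpM2r (frob_ge0 (u - v)) pb; lra.
rewrite ler_norml one andbT lerNl opprB -(frobN (y - y')) opprB; exact: one.
Qed.

Lemma f_proj x y : cl x -> f x (A y) = f x y.
Proof.
move=> cx.
have one u v : A u = A v -> f x u <= f x v.
  move=> uv; have [p [Hp pc]] := subgradient_exists u cx.
  have := Hp v; rewrite -(conj_le_proj cx pc) A_sym linearB/= uv subrr frob_ip0r; lra.
by apply/eqP; rewrite eq_le !one// A_idem.
Qed.

Lemma f0_le x : cl x -> f x 0 <= C0.
Proof.
by move=> cx; have /andP[_] := f_gr 0 cx; rewrite linear0 /frob frob_ip0l sqrtr0 addr0 mulr1.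
Qed.

Lemma recession_near x y e : cl x -> 0 < e -> exists d T, [/\ 0 < d, 0 < T &
  forall x' t, cl x' -> `|x - x'| < d -> T < t -> `|t^-1 * f x' (t *: y) - finfty Om f x y| <= e].
Proof.
move=> cx e0; have : recession_quotient f y p @[p --> recession_filter Om x] --> finfty Om f x y.
  exact: f_rec.
move=> /cvgrPdist_le/(_ _ e0)[[/= P Q] /= [HP HQ] PQ].
have /nbhs_ballP[d /= d0 dP] : nbhs x (fun x' => cl x' -> P x') := HP.
have [T [_ TQ]] := HQ.
exists d, (`|T| + 1); split=> // x' t cx' xx' Tt.
rewrite distrC; apply: (PQ (x', t)); split => /=.
  by apply: dP => //; rewrite -ball_normE.
by apply: TQ; have := ler_norm T; lra.
Qed.

(** Evaluate the conjugate inequality at [t y] and divide by [t]; with the chosen [t], [c]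
    contributes at most [e / 2]. *)
Lemma finfty_ge x p c y : cl x -> conj_le x p c -> frob_ip p y <= finfty Om f x y.
Proof.
move=> cx pc; apply/ler_addgt0Pr => e e0; have e2 : 0 < e / 2 by rewrite divr_gt0.
have [d [T [d0 T0 H]]] := recession_near y cx e2.
pose t := T + 1 + 2 * `|c| / e.
have u0 : 0 <= 2 * `|c| / e by rewrite divr_ge0 ?mulr_ge0// ltW.
have t0 : 0 < t by rewrite /t; lra.
have tc : `|c| <= t * (e / 2).
  have -> : t * (e / 2) = (T + 1) * (e / 2) + `|c| by rewrite /t; field; rewrite gt_eqF.
  by rewrite lerDr ltW// mulr_gt0// addr_gt0.
have := H x t cx; rewrite subrr normr0 d0 => /(_ isT).
have -> : T < t by rewrite /t; lra.
move=> /(_ isT); rewrite ler_distl => /andP[_ H1].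
have := pc (t *: y); rewrite frob_ipZr => H2.
have : f x (t *: y) <= t * (finfty Om f x y + e / 2) by rewrite -ler_pdivrMl.
have := ler_norm c; move=> cn H3; rewrite -(ler_pM2l t0).
rewrite (_ : t * (finfty Om f x y + e) = t * (finfty Om f x y + e / 2) + t * (e / 2)); last by field.
lra.
Qed.

Lemma finfty_ge0 x y : cl x -> 0 <= finfty Om f x y.
Proof.
move=> cx; rewrite -(frob_ip0l y); apply: (@finfty_ge _ _ 0) => // w.
by rewrite frob_ip0l sub0r oppr_le0 f_ge0.
Qed.

Lemma finfty_lipschitz x y y' : cl x -> `|finfty Om f x y - finfty Om f x y'| <= C0 * frob (y - y').
Proof.
move=> cx; apply/ler_addgt0Pr => e e0; have e2 : 0 < e / 2 by rewrite divr_gt0.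
have [d [T [d0 T0 H]]] := recession_near y cx e2.
have [d' [T' [d0' T0' H']]] := recession_near y' cx e2.
pose t := T + T' + 1; have t0 : 0 < t by rewrite /t; lra.
have := H x t cx; have := H' x t cx; rewrite subrr normr0 d0 d0' => /(_ isT) + /(_ isT).
have -> : T < t by rewrite /t; lra.
have -> : T' < t by rewrite /t; lra.
move=> /(_ isT) h1 /(_ isT) h2.
have h3 : `|t^-1 * f x (t *: y) - t^-1 * f x (t *: y')| <= C0 * frob (y - y').
  rewrite -mulrBr normrM gtr0_norm ?invr_gt0// ler_pdivrMl//.
  by rewrite (le_trans (f_lipschitz _ _ cx))// -scalerBr frobZ gtr0_norm// mulrCA.
move: h1 h2 h3; rewrite -/t.
move: (finfty Om f x y) (finfty Om f x y') (t^-1 * f x (t *: y)) (t^-1 * f x (t *: y')) => a b c d1.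
by rewrite !ler_norml => /andP[? ?] /andP[? ?] /andP[? ?]; apply/andP; split; lra.
Qed.

(** Continuity in [x] is contained in the joint limit: for large [t] the same quotient at [x'] is
    close to the values at [x] and at [x']. *)
Lemma finfty_cont x y e : cl x -> 0 < e -> exists2 d, 0 < d &
  forall x', cl x' -> `|x - x'| < d -> `|finfty Om f x' y - finfty Om f x y| <= e.
Proof.
move=> cx e0; have e2 : 0 < e / 2 by rewrite divr_gt0.
have [d [T [d0 T0 H]]] := recession_near y cx e2; exists d => // x' cx' xx'.
have [d' [T' [d0' T0' H']]] := recession_near y cx' e2.
pose t := T + T' + 1; have t0 : 0 < t by rewrite /t; lra.
have := H x' t cx' xx'; have := H' x' t cx'; rewrite subrr normr0 d0' => /(_ isT).
have -> : T < t by rewrite /t; lra.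
have -> : T' < t by rewrite /t; lra.
move=> /(_ isT) + /(_ isT).
rewrite !ler_norml => /andP[? ?] /andP[? ?]; apply/andP; split; lra.
Qed.

(** A subgradient at a far point [t y] has slope at least [(f x (t y) - f x 0) / t] in direction
    [y], and [f x 0] contributes at most [C0 / t]. *)
Lemma finfty_sup x y e : cl x -> 0 < e -> exists p c,
  conj_le x p c /\ finfty Om f x y - e <= frob_ip p y.
Proof.
move=> cx e0; have e2 : 0 < e / 2 by rewrite divr_gt0.
have [d [T [d0 T0 H]]] := recession_near y cx e2.
pose t := T + 1 + 2 * C0 / e.
have u0 : 0 <= 2 * C0 / e by rewrite divr_ge0 ?mulr_ge0// ltW.
have t0 : 0 < t by rewrite /t; lra.
have tc : C0 <= t * (e / 2).
  have -> : t * (e / 2) = (T + 1) * (e / 2) + C0 by rewrite /t; field; rewrite gt_eqF.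
  by rewrite lerDr ltW// mulr_gt0// addr_gt0.
have := H x t cx; rewrite subrr normr0 d0 => /(_ isT).
have -> : T < t by rewrite /t; lra.
move=> /(_ isT); rewrite ler_distl => /andP[H1 _].
have [p [Hp pc]] := subgradient_exists (t *: y) cx; exists p; eexists; split; first exact: pc.
have := Hp 0; rewrite sub0r -scaleN1r !frob_ipZr => H2.
have H3 : t * (finfty Om f x y - e / 2) <= f x (t *: y).
  by rewrite -ler_pdivlMl.
have H4 := f0_le cx; rewrite -(ler_pM2l t0).
rewrite (_ : t * (finfty Om f x y - e) = t * (finfty Om f x y - e / 2) - t * (e / 2)); last by field.
lra.
Qed.

(** Grid points with entries k/N - 1 approximate each entry within 1/N, hence the matrix within m n
    / N. *)
Lemma finite_net (d : R) : 0 < d -> exists (I : finType) (q : I -> 'M[R]_(m, n)),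
  forall y : 'M[R]_(m, n), (forall i j, `|y i j| <= 1) -> exists k, frob (y - q k) <= d.
Proof.
move=> d0; pose N := (Num.truncn ((m * n)%:R / d)).+1.
have N0 : 0 < N%:R :> R by rewrite ltr0n.
have Nd : (m * n)%:R / N%:R <= d.
  by rewrite ler_pdivrMr// mulrC -ler_pdivrMr// ltW// truncnS_gt.
exists 'M['I_(2 * N).+1]_(m, n); exists (fun k : 'M['I_(2 * N).+1]_(m, n) => \matrix_(i, j) (((k i j : nat)%:R / N%:R) - 1)).
move=> y y1.
have idx i j : (Num.truncn (N%:R * (y i j + 1)) < (2 * N).+1)%N.
  have := y1 i j; rewrite ler_norml => /andP[l u].
  rewrite ltnS -(ler_nat R); apply: (@le_trans _ _ (N%:R * (y i j + 1))).
    by rewrite truncn_le mulr_ge0//; lra.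
  by rewrite natrM mulrC ler_pM2r//; lra.
exists (\matrix_(i, j) Ordinal (idx i j)).
rewrite (le_trans (frob_le_sum _))// (le_trans _ Nd)//.
rewrite (le_trans (ler_sum _ (G := fun=> n%:R / N%:R) _))//; last first.
  by rewrite sumr_const card_ord -[leLHS]mulr_natl natrM mulrA.
move=> i _; rewrite (le_trans (ler_sum _ (G := fun=> N%:R^-1) _))//; last first.
  by rewrite sumr_const card_ord [leRHS]mulr_natl.
move=> j _; rewrite !mxE/=; set v := N%:R * (y i j + 1).
have v0 : 0 <= v by rewrite /v mulr_ge0//; have := y1 i j; rewrite ler_norml => /andP[]; lra.
have /andP[t1 t2] := truncn_itv v0.
rewrite (_ : y i j - _ = N%:R^-1 * (v - (Num.truncn v)%:R)); last by rewrite /v; field; rewrite gt_eqF.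
rewrite normrM ger0_norm ?invr_ge0// -[leRHS]mulr1 ler_wpM2l ?invr_ge0//.
move: t2; rewrite -natr1 ger0_norm; lra.
Qed.

(* By compactness of the unit cube of directions. *)
Lemma recession_unif x e : cl x -> 0 < e -> exists d T, [/\ 0 < d, 0 < T &
  forall x' t (y : 'M[R]_(m, n)), cl x' -> `|x - x'| < d -> T < t -> (forall i j, `|y i j| <= 1) ->
    t * (finfty Om f x y - e) <= f x' (t *: y)].
Proof.
move=> cx e0; pose d1 := e / 4 / C0; have d10 : 0 < d1 by rewrite !divr_gt0.
have e2 : 0 < e / 2 by rewrite divr_gt0.
have [I [q Hq]] := finite_net d10.
have /choice[dT HdT] : forall k, exists dT : R * R, [/\ 0 < dT.1, 0 < dT.2 &
  forall x' t, cl x' -> `|x - x'| < dT.1 -> dT.2 < t ->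
    `|t^-1 * f x' (t *: q k) - finfty Om f x (q k)| <= e / 2].
  by move=> k; have [d [T H]] := recession_near (q k) cx e2; exists (d, T).
exists (\big[Num.min/1]_k (dT k).1), (\big[Num.max/1]_k (dT k).2); split.
- by elim/big_ind : _ => // [a b a0 b0|k _]; [rewrite lt_min a0|case: (HdT k)].
- exact: lt_le_trans ltr01 (bigmax_ge_id _ _ _ _).
move=> x' t y cx' xx' Tt y1; have [k yk] := Hq y y1.
have [_ _ /(_ x' t cx')] := HdT k.
rewrite (lt_le_trans xx') ?bigmin_le//.
have -> : (dT k).2 < t by apply: le_lt_trans Tt; exact: le_bigmax.
have t0 : 0 < t.
  have [_ T0 _] := HdT k; apply: lt_trans T0 _; apply: le_lt_trans Tt; exact: le_bigmax.
move=> /(_ isT isT); rewrite ler_distl => /andP[H1 _].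
have H2 : t * (finfty Om f x (q k) - e / 2) <= f x' (t *: q k) by rewrite -ler_pdivlMl.
have := f_lipschitz (t *: y) (t *: q k) cx'; rewrite -scalerBr frobZ (gtr0_norm t0) => H3.
have H4 := finfty_lipschitz y (q k) cx.
have Cd : C0 * frob (y - q k) <= e / 4.
  by rewrite (_ : e / 4 = C0 * d1) ?ler_pM2l// /d1; field; rewrite gt_eqF.
have H5 : C0 * (t * frob (y - q k)) <= t * (e / 4) by rewrite mulrCA ler_pM2l.
move: H3 H4; rewrite !ler_norml => /andP[H6 _] /andP[_ H7].
have H8 : t * (finfty Om f x y - finfty Om f x (q k)) <= t * (e / 4) by rewrite ler_pM2l//; lra.
have -> : t * (finfty Om f x y - e) = t * (finfty Om f x (q k) - e / 2) +
  t * (finfty Om f x y - finfty Om f x (q k)) - t * (e / 4) - t * (e / 4) by field.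
lra.
Qed.

(* Shrinking [p] by the factor [1 - e] leaves room in the growth condition, which keeps the
   conjugate bounded near [x]. *)
Lemma conj_le_rational x p c e : Om x -> conj_le x p c -> 0 < e -> e < 1 ->
  exists (q : 'M[rat]_(m, n)) (a : 'rV[rat]_n) (r : rat),
  [/\ cube (@rat_mx R _ _ a) (ratr r) x, ccube (@rat_mx R _ _ a) (ratr r) `<=` Om,
    (exists2 M, 0 <= M & forall x', cube (@rat_mx R _ _ a) (ratr r) x' ->
      conj_le x' (A (@rat_mx R _ _ q)) M),
    frob (A (@rat_mx R _ _ q) - p) <= e * (C0 + c0) &
    conj_le x (A (@rat_mx R _ _ q)) ((1 - e) * c)].
Proof.
move=> Ox pc e0 e1; have cx : cl x by exact: subset_closure.
have Ap := conj_le_proj cx pc; have pC := conj_le_bound cx pc.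
have c4 : 0 < c0 / 4 by rewrite divr_gt0.
have d0 : 0 < e * (c0 / 4) / (m%:R * n%:R + 1).
  by rewrite divr_gt0 ?mulr_gt0// ltr_wpDl// mulr_ge0.
have [q Hq] := rat_mx_dense ((1 - e) *: p) d0.
pose w := A (rat_mx R q) - (1 - e) *: p.
have wE : w = A (rat_mx R q - (1 - e) *: p) by rewrite linearB/= linearZ/= Ap.
have wle : frob w <= e * (c0 / 4).
  rewrite wE (le_trans (frob_proj_le _))// (le_trans (frob_le_sum _))//.
  pose D := e * (c0 / 4) / (m%:R * n%:R + 1).
  rewrite (le_trans (ler_sum _ (G := fun=> n%:R * D) _))//.
    move=> i _; rewrite (le_trans (ler_sum _ (G := fun=> D) _))//.
      by move=> j _; rewrite [X in `|X|](_ : _ = - (((1 - e) *: p) i j - rat_mx R q i j)) ?normrN ?ltW// !mxE opprB.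
    by rewrite sumr_const card_ord [leRHS]mulr_natl.
  rewrite sumr_const card_ord -[leLHS]mulr_natl /D.
  rewrite [leLHS](_ : _ = e * (c0 / 4) * (m%:R * n%:R / (m%:R * n%:R + 1))); last by ring.
  apply: ler_piMr; first by rewrite mulr_ge0// ltW.
  by rewrite ler_pdivrMr ?mul1r ?lerDl// ltr_wpDl// mulr_ge0.
have Aw : A w = w by rewrite wE A_idem.
have wy y : frob_ip w y <= e * (c0 / 4) * frob (A y).
  rewrite -Aw A_sym (le_trans (frob_cauchy_schwarz _ _))// ler_wpM2r// frob_ge0//.
have qy y : frob_ip (A (rat_mx R q)) y = (1 - e) * frob_ip p y + frob_ip w y.
  by rewrite /w frob_ipBl frob_ipZl; ring.
(* Shrinking gains [e f >= e c0 |A y|]. The rounding of [p] and the error in the recession limit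
   each use at most a quarter of that bound. *)
have ec : 0 < e * c0 / 4 by rewrite divr_gt0// mulr_gt0.
have [d [T [d_gt0 T0 H]]] := recession_unif cx ec.
have oU : open (Om `&` ball x d) by apply: openI => //; exact: ball_open.
have xU : (Om `&` ball x d) x by split=> //; exact: ballxx.
have [a [r [r0 ax aU]]] := rat_cube_nbhs oU xU.
exists q, a, r; split => //.
- by move=> x' /aU[].
- exists (frob (A (rat_mx R q)) * T); first by rewrite mulr_ge0 ?frob_ge0// ltW.
  move=> x' ax' y.
  have [Ox' xd] : (Om `&` ball x d) x' by apply: aU => i j; exact/ltW/ax'.
  have cx' : cl x' by exact: subset_closure.
  have xx' : `|x - x'| < d by move: xd; rewrite -ball_normE.
  set tau := frob (A y); have tau0 : 0 <= tau by exact: frob_ge0.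
  have zy : frob_ip (A (rat_mx R q)) y = frob_ip (A (rat_mx R q)) (A y) by rewrite -A_sym A_idem.
  have f0' := f_ge0 y cx'.
  (* Below [T] Cauchy-Schwarz bounds the conjugate; above it the uniform recession estimate
     applies. *)
  have [tT|Tt] := leP tau T.
    have := frob_cauchy_schwarz (A (rat_mx R q)) (A y); rewrite -zy -/tau => H1.
    have := ler_wpM2l (frob_ge0 (A (rat_mx R q))) tT; lra.
  have t0 : 0 < tau by exact: lt_trans Tt.
  pose eta := tau^-1 *: A y.
  have yE : tau *: eta = A y by rewrite scalerA divff ?scale1r// gt_eqF.
  have eta1 i j : `|eta i j| <= 1.
    rewrite (le_trans (ler_entry_frob _ _ _))// frobZ gtr0_norm ?invr_gt0// mulVf// gt_eqF//.
  have H1 := H x' tau eta cx' xx' Tt eta1; rewrite yE (f_proj _ cx') in H1.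
  have H2 := finfty_ge eta cx pc.
  have H3 : frob_ip p y = tau * frob_ip p eta by rewrite -frob_ipZr yE -A_sym Ap.
  have H4 : frob_ip p y <= f x' y + tau * (e * c0 / 4).
    by rewrite H3; have := ler_wpM2l tau0 H2; lra.
  have H5 := wy y; rewrite -/tau in H5.
  have /andP[H6 _] := f_gr y cx'; rewrite -/tau in H6.
  rewrite qy; have H7 : 0 <= frob (A (rat_mx R q)) * T by rewrite mulr_ge0 ?frob_ge0// ltW.
  have H8 : (1 - e) * frob_ip p y <= (1 - e) * (f x' y + tau * (e * c0 / 4)) by rewrite ler_wpM2l//; lra.
  have H9 : e * (c0 * tau) <= e * f x' y by rewrite ler_pM2l.
  have H10 : 0 <= tau * (e * c0) by rewrite !mulr_ge0// ltW.
  have H11 : 0 <= e * (tau * (e * c0)) by rewrite mulr_ge0// ltW.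
  lra.
- rewrite (_ : A _ - p = w - e *: p); last first.
    by rewrite /w scalerBl scale1r; apply/matrixP => i j; rewrite !mxE; ring.
  rewrite (le_trans (ler_frobD _ _))// frobN frobZ gtr0_norm//.
  have := ler_wpM2l (ltW e0) pC; have := ltW (mulr_gt0 e0 c0_gt0); lra.
- move=> y; rewrite qy; have H1 := pc y; have H5 := wy y.
  have /andP[H6 _] := f_gr y cx.
  have H8 : (1 - e) * (frob_ip p y - f x y) <= (1 - e) * c by rewrite ler_wpM2l//; lra.
  have H9 : e * (c0 * frob (A y)) <= e * f x y by rewrite ler_pM2l.
  have H10 : 0 <= e * (c0 * frob (A y)) by rewrite !mulr_ge0 ?frob_ge0// ltW.
  lra.
Qed.

End integrand.

(** * Measurability of compositions with the integrand *)

Section measurability.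
Variables (R : realType) (n : nat) (Om : set 'rV[R]_n).
Hypothesis oOm : open Om.

Let mOm : measurable Om. Proof. exact: open_measurable_mx. Qed.

Lemma continuous_in_measurable (g : 'rV[R]_n -> R) :
  (forall x e, Om x -> 0 < e -> exists2 d, 0 < d &
     forall x', Om x' -> `|x - x'| < d -> `|g x' - g x| <= e) -> measurable_fun Om g.
Proof.
move=> gc; apply: (measurability _ (RGenOpens.measurableE R)).
move=> _ [_ [a [b ->]] <-]; apply: open_measurable_mx; rewrite openE => x [Ox gx].
have /nbhs_ballP[e /= e0 eI] : nbhs (g x) `]a, b[%classic.
  by apply: open_nbhs_nbhs; split=> //; exact: interval_open.
have e2 : 0 < e / 2 by rewrite divr_gt0.
have [d d0 H] := gc x _ Ox e2.
have HO : nbhs x Om by apply: open_nbhs_nbhs.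
have Hd : nbhs x (ball x d) by exact: nbhsx_ballx.
apply: filterS (filterI HO Hd) => x' [Ox' xx']; split=> //; apply: eI.
rewrite -ball_normE /ball_/= distrC; apply: le_lt_trans (H x' Ox' _) _.
  by move: xx'; rewrite -ball_normE.
by rewrite ltr_pdivrMr// ltr_pMr// ltr1n.
Qed.

(** The sequence starts with 0 because comparison with the value at 0 later bounds suprema over it
    from below. *)
Lemma rat_mx_seq (m k : nat) : exists q : nat -> 'M[R]_(m, k),
  [/\ q 0%N = 0 & forall y e, 0 < e -> exists i, frob (y - q i) <= e].
Proof.
pose q0 i : 'M[R]_(m, k) := if unpickle i is Some M then rat_mx R (M : 'M[rat]_(m, k)) else 0.
exists (fun i => if i is j.+1 then q0 j else 0); split=> // y e e0.
pose c : R := m%:R * k%:R + 1; have c1 : 0 < c by rewrite ltr_wpDl// mulr_ge0.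
have [M HM] := rat_mx_dense y (divr_gt0 e0 c1).
exists (pickle M).+1; rewrite /q0 pickleK (le_trans (frob_le_sum _))//.
rewrite (le_trans (ler_sum _ (G := fun=> k%:R * (e / c)) _))//.
  move=> i _; rewrite (le_trans (ler_sum _ (G := fun=> e / c) _))//.
    by move=> j _; rewrite !mxE ltW//; have := HM i j; rewrite !mxE.
  by rewrite sumr_const card_ord [leRHS]mulr_natl.
rewrite sumr_const card_ord -[leLHS]mulr_natl [leLHS](_ : _ = e * (m%:R * k%:R / c)); last by ring.
by apply: ler_piMr; [exact: ltW|rewrite ler_pdivrMr// mul1r lerDl].
Qed.

(** By the Lipschitz condition, g(x, G x) is the infimum over a dense sequence of g(x, q_i) + C |G x
    - q_i|, a countable infimum of measurable functions. *)
Lemma measurable_lipschitz_comp (m k : nat) (g : 'rV[R]_n -> 'M[R]_(m, k) -> R) (C : R)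
    (G : 'rV[R]_n -> 'M[R]_(m, k)) : 0 <= C ->
  (forall y, measurable_fun Om (g ^~ y)) ->
  (forall x y y', Om x -> `|g x y - g x y'| <= C * frob (y - y')) ->
  (forall i j, measurable_fun Om (fun x => G x i j)) -> measurable_fun Om (fun x => g x (G x)).
Proof.
move=> C0 mg gC mG; have [q [_ qd]] := rat_mx_seq m k.
pose h i x := g x (q i) + C * frob (G x - q i).
have hge x i : Om x -> g x (G x) <= h i x.
  by move=> Ox; have := gC x (G x) (q i) Ox; rewrite ler_norml /h => /andP[_]; lra.
have hlb x : Om x -> has_lbound (range (h ^~ x)).
  by move=> Ox; exists (g x (G x)) => _ [i _ <-]; exact: hge.
have mh i : measurable_fun Om (h i).
  apply: measurable_funD => //; apply: measurable_funM => //.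
  apply: measurable_frob => i' j'; under eq_fun do rewrite !mxE.
  by apply: measurable_funB => //; exact: measurable_cst.
have := @measurable_fun_infs _ _ _ Om h 0%N hlb mh.
apply: eq_measurable_fun => x /set_mem Ox; rewrite /infs/=.
have lb : has_lbound (sdrop (h ^~ x) 0) by exists (g x (G x)) => _ [i _ <-]; exact: hge.
apply/eqP; rewrite eq_le; apply/andP; split; last first.
  by apply: lb_le_inf => [|_ [i _ <-]]; [exists (h 0%N x), 0%N|exact: hge].
apply/ler_addgt0Pr => e e0; pose d := e / (2 * (C + 1)).
have C1 : 0 < 2 * (C + 1) by rewrite mulr_gt0// ltr_wpDl.
have [i Hi] := qd (G x) d (divr_gt0 e0 C1).
apply: (@le_trans _ _ (h i x)); first by apply: ge_inf => //; exists i.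
have := gC x (G x) (q i) Ox; rewrite ler_norml => /andP[H _].
have H1 : C * frob (G x - q i) <= e / 2.
  apply: (@le_trans _ _ ((C + 1) * d)); last by rewrite /d le_eqVlt; apply/orP; left; apply/eqP; field; rewrite gt_eqF// ltr_wpDl.
  by apply: ler_pM => //; [exact: frob_ge0|rewrite lerDl].
by rewrite /h; lra.
Qed.

End measurability.

Section integrand_measurability.
Variables (R : realType) (m n : nat) (Om : set 'rV[R]_n).
Hypothesis oOm : open Om.
Variable A : {linear 'M[R]_(m, n) -> 'M[R]_(m, n)}.
Hypotheses (A_sym : forall y y', frob_ip (A y) y' = frob_ip y (A y'))
  (A_idem : forall y, A (A y) = A y).
Variables (f : 'rV[R]_n -> 'M[R]_(m, n) -> R) (c0 C0 : R).
Local Notation cl := (closure Om).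
Hypotheses (f_cont : {within cl `*` [set: 'M[R]_(m, n)],
    continuous (fun p : 'rV[R]_n * 'M[R]_(m, n) => f p.1 p.2)})
  (f_conv : forall x, cl x -> forall u v (t : R), 0 < t -> t < 1 ->
    f x (t *: u + (1 - t) *: v) <= t * f x u + (1 - t) * f x v)
  (C0_gt0 : 0 < C0)
  (f_gr : forall x y, cl x -> c0 * frob (A y) <= f x y <= C0 * (1 + frob (A y)))
  (f_rec : forall x y, cl x -> cvg (recession_quotient f y @ recession_filter Om x)).

Let mOm : measurable Om. Proof. exact: open_measurable_mx. Qed.

Let Ocl x : Om x -> cl x. Proof. exact: subset_closure. Qed.

Lemma measurable_f_cst y : measurable_fun Om (f ^~ y).
Proof.
apply: continuous_in_measurable => // x e Ox e0.
move/subspace_continuousP : f_cont => /(_ (x, y) (conj (Ocl Ox) I)) /cvgrPdist_le/(_ _ e0).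
move=> [[P Q]/= [/nbhs_ballP[d /= d0 dP] HQ] PQ]; exists d => // x' Ox' xx'.
rewrite distrC; apply: (PQ (x', y)) => //=; last by split=> //; exact: Ocl.
by split; [apply: dP; rewrite -ball_normE|exact: nbhs_singleton].
Qed.

Lemma measurable_f_comp (G : 'rV[R]_n -> 'M[R]_(m, n)) :
  (forall i j, measurable_fun Om (fun x => G x i j)) -> measurable_fun Om (fun x => f x (G x)).
Proof.
move=> mG.
have fL x y y' : Om x -> `|f x y - f x y'| <= C0 * frob (y - y').
  by move=> Ox; apply: (f_lipschitz A_sym A_idem f_conv C0_gt0 f_gr); exact: Ocl.
exact: (@measurable_lipschitz_comp _ _ _ m n f C0 G (ltW C0_gt0) measurable_f_cst fL mG).
Qed.

Lemma measurable_finfty_comp (G : 'rV[R]_n -> 'M[R]_(m, n)) :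
  (forall i j, measurable_fun Om (fun x => G x i j)) -> measurable_fun Om (fun x => finfty Om f x (G x)).
Proof.
move=> mG.
have mf y : measurable_fun Om (finfty Om f ^~ y).
  apply: continuous_in_measurable => // x e Ox e0.
  have [d d0 H] := finfty_cont f_rec y (Ocl Ox) e0.
  by exists d => // x' Ox' xx'; apply: H => //; exact: Ocl.
have fL x y y' : Om x -> `|finfty Om f x y - finfty Om f x y'| <= C0 * frob (y - y').
  by move=> Ox; apply: (finfty_lipschitz A_sym A_idem f_conv C0_gt0 f_gr f_rec); exact: Ocl.
exact: (@measurable_lipschitz_comp _ _ _ m n (finfty Om f) C0 G (ltW C0_gt0) mf fL mG).
Qed.

Lemma fconjugate_le x p c : (fconjugate f x p <= c%:E)%E <-> conj_le f x p c.
Proof.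
split=> [H y|H]; last by apply: ge_ereal_sup => _ [y _ <-]; rewrite lee_fin.
by rewrite -lee_fin (le_trans _ H)//; apply: ereal_sup_ubound; exists y.
Qed.

Lemma fconjugate_ge x p y : ((frob_ip p y - f x y)%:E <= fconjugate f x p)%E.
Proof. by apply: ereal_sup_ubound; exists y. Qed.

Lemma fconjugate_fin x p : fconjugate f x p \is a fin_num -> conj_le f x p (fine (fconjugate f x p)).
Proof. by move=> H; apply/fconjugate_le; rewrite fineK. Qed.

Lemma conj_le_fin x p c : conj_le f x p c -> fconjugate f x p \is a fin_num.
Proof.
move=> pc; rewrite fin_numE; apply/andP; split.
  by rewrite -ltNye; apply: lt_le_trans (fconjugate_ge x p 0); rewrite ltNyr.
by rewrite -ltey; apply: le_lt_trans (ltry c); apply/fconjugate_le.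
Qed.

(** The function whose supremum is taken is Lipschitz in [y], so a dense sequence suffices; this
    gives measurability and monotone approximation. *)
Lemma fconjugate_seq : exists q : nat -> 'M[R]_(m, n), q 0%N = 0 /\
  forall x p, cl x -> fconjugate f x p = ereal_sup (range (fun i => (frob_ip p (q i) - f x (q i))%:E)).
Proof.
have [q [q0 qd]] := rat_mx_seq R m n; exists q; split=> // x p cx.
apply/eqP; rewrite eq_le; apply/andP; split; last first.
  by apply: ge_ereal_sup => _ [i _ <-]; exact: fconjugate_ge.
apply: ge_ereal_sup => _ [y _ <-]; apply/lee_addgt0Pr => e e0.
have D0 : 0 < frob p + C0 by rewrite ltr_wpDl// frob_ge0.
have [i Hi] := qd y _ (divr_gt0 e0 D0).
apply: (@le_trans _ _ ((frob_ip p (q i) - f x (q i))%:E + e%:E)%E); last first.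
  by rewrite leeD2r//; apply: ereal_sup_ubound; exists i.
rewrite -EFinD lee_fin.
have := f_lipschitz A_sym A_idem f_conv C0_gt0 f_gr y (q i) cx; rewrite ler_norml => /andP[H1 _].
have := frob_cauchy_schwarz p (y - q i); rewrite frob_ipBr => H2.
have : (frob p + C0) * frob (y - q i) <= e.
  by rewrite mulrC -ler_pdivlMr.
lra.
Qed.

Lemma measurable_fconjugate (z : 'rV[R]_n -> 'M[R]_(m, n)) :
  (forall i j, measurable_fun Om (fun x => z x i j)) ->
  measurable_fun Om (fun x => fconjugate f x (z x)).
Proof.
move=> mz; have [q [_ Hq]] := fconjugate_seq.
pose h i x := (frob_ip (z x) (q i) - f x (q i))%:E.
have mh i : measurable_fun Om (h i).
  apply/measurable_EFinP; apply: measurable_funB; last exact: measurable_f_cst.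
  by apply: measurable_frob_ip => // i' j'; exact: measurable_cst.
have := measurable_fun_esups mh 0%N; apply: eq_measurable_fun => x /set_mem Ox.
rewrite /esups/= Hq; last exact: Ocl.
by congr ereal_sup; apply/seteqP; split=> _ [i _ <-]; exists i.
Qed.

End integrand_measurability.

(** * A null set carrying the singular part *)

Section singular_part_facts.
Variables (R : realType) (m n : nat).
Local Notation la := (lebesgue_rV R n).
Variables (mu : mx_charge 'rV[R]_n R m n) (s : 'rV[R]_n -> 'M[R]_(m, n)).
Local Notation V := (mx_variation mu).
Local Notation S := (singular_part la mu).
Hypotheses (ms : forall i j, measurable_fun setT (fun x => s x i j))
  (s1 : forall x i j, `|s x i j| <= 1)
  (mus : forall i j E, measurable E -> mu i j E = (\int[V]_(x in E) (s x i j)%:E)%E).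

(** On [N] the charge and its singular part coincide, hence so do their variations and polar
    densities, and the singular part lives on [N]. This lets statements about the polar density of
    the singular part be proved with [s] and [V]. *)
Theorem singular_set_exists : exists N, [/\ measurable N, la N = 0%E,
  (forall i j, la.-integrable setT (EFin \o (fun x => ac_density la mu x i j))),
  (forall i j E, measurable E -> E `<=` ~` N ->
     mu i j E = (\int[la]_(x in E) (ac_density la mu x i j)%:E)%E) &
  forall P : 'rV[R]_n -> 'M[R]_(m, n) -> Prop,
    {ae V, forall x, N x -> P x (s x)} <-> {ae mx_variation S, forall x, P x (polar_density S x)}].
Proof.
have [[_ ia] [N [mN N0 SN]] dec] := lebesgue_decompositionP la mu.
have [mac iac] : L1 la setT (ac_density la mu) by have [] := lebesgue_decompositionP la mu.
have disj E : E `<=` ~` N -> E `&` N = set0 by move/disjoints_subset.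
have iaij i j : la.-integrable setT (EFin \o (fun x => ac_density la mu x i j)).
  apply: (rint_le measurableT (measurable_entry i j mac) _ iac) => x _; exact: ler_entry_frob.
have muN i j E : measurable E -> E `<=` N -> mu i j E = S i j E.
  move=> mE EN; rewrite dec// null_set_integral ?add0e//.
    by apply/measurable_EFinP; apply: measurable_funTS; exact: rint_measurable (iaij i j).
  by apply: (subset_measure0 mE mN EN).
have VS E : measurable E -> E `<=` N -> V E = mx_variation S E.
  move=> mE EN; apply: variation_eq => // i j F mF FE; apply: muN => //; exact: subset_trans EN.
have SNC : mx_variation S (~` N) = 0%E.
  apply: variation0; first exact: measurableC.
  by move=> i j F mF FN; apply: SN => //; exact: disj.
exists N; split=> //.
  move=> i j E mE EN; rewrite dec// SN ?adde0//; exact: disj.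
pose W := mx_variation S.
have iW (g : 'rV[R]_n -> R) c E : measurable_fun setT g -> (forall x, `|g x| <= c) ->
    measurable E -> (mx_variation S).-integrable E (EFin \o g).
  by move=> mg gc mE; apply: rint_finite_measure mE; [exact: mg|exact: gc].
have sS : {ae mx_variation S, forall x, s x = polar_density S x}.
  have ij i j : {ae mx_variation S, forall x, s x i j = polar_density S x i j}.
    have : ae_eq (mx_variation S) setT (EFin \o (fun x => s x i j)) (EFin \o (fun x => polar_density S x i j)).
      apply: integral_ae_eq => //; first exact: iW (ms i j) (fun x => s1 x i j) measurableT.
        by apply: (measurable_int (mx_variation S)); exact: rint_polar_density.
      move=> E _ mE; rewrite -polar_densityE//.
      have mEN : measurable (E `&` N) by exact: measurableI.
      have mED : measurable (E `\` N) by exact: measurableD.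
      have EN : E `&` N `<=` N by exact: subIsetr.
      have SE : S i j E = S i j (E `&` N).
        rewrite -[in LHS](setUIDK E N) chargeU//; last first.
          by rewrite setDE setICA !setIA -setIA setICr setI0.
        rewrite [X in (_ + X)%E](SN i j (E `\` N)) ?adde0//.
        by rewrite setDE -setIA setICl setI0.
      have e1 : S i j E = (\int[V]_(x in E `&` N) (s x i j)%:E)%E.
        by rewrite SE -(muN _ _ _ mEN EN) (mus _ _ mEN).
      have e2 : (\int[V]_(x in E `&` N) (s x i j)%:E = \int[mx_variation S]_(x in E `&` N) (s x i j)%:E)%E.
        apply: eq_measure_integral => F mF FE; apply: VS => //; exact: subset_trans EN.
      have e3 := @negligible_integral _ _ _ (mx_variation S) E (~` N) _ (measurableC mN) mE
        (iW _ _ _ (ms i j) (fun x => s1 x i j) mE) SNC.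
      rewrite setDE setCK in e3.
      by rewrite e1 e2; exact: e3.
    by apply: filterS => x /(_ I) [].
  have : \forall x \ae mx_variation S, forall ij : 'I_m * 'I_n, s x ij.1 ij.2 = polar_density S x ij.1 ij.2.
    by apply: filter_forall => -[i j]; exact: ij.
  by apply: filterS => x H; apply/matrixP => i j; exact: (H (i, j)).
move=> P; split.
- move=> [B [mB VB sub]].
  have BN : {ae mx_variation S, forall x, ~ (B `&` N) x}.
    exists (B `&` N); split; first exact: measurableI.
      rewrite -VS; [|exact: measurableI|exact: subIsetr].
      by apply: (subset_measure0 (measurableI _ _ mB mN) mB (@subIsetl _ _ _) VB).
    by move=> x /contrapT.
  have WN : {ae mx_variation S, forall x, N x}.
    by exists (~` N); split=> //; exact: measurableC.
  apply: filterS (filterI BN (filterI WN sS)) => x [h1 [h2 <-]].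
  by apply: contrapT => nP; apply: h1; split=> //; apply: sub => /(_ h2).
- move=> H; have [B [mB VB sub]] := filterI H sS.
  exists (B `&` N); split; first exact: measurableI.
    rewrite VS; [|exact: measurableI|exact: subIsetr].
    by apply: (subset_measure0 (measurableI _ _ mB mN) mB (@subIsetl _ _ _) VB).
  move=> x /= Hx; have [Nx|nN] := pselect (N x); last by exfalso; apply: Hx.
  split=> //; apply: sub => /= -[h1 h2]; apply: Hx => _; by rewrite h2.
Qed.

End singular_part_facts.

(** * Pointwise consequences of integral inequalities *)

Lemma fundamental_lemma (R : realType) (n : nat) (Om : set 'rV[R]_n)
    (mu1 mu2 : {measure set 'rV[R]_n -> \bar R}) (h1 h2 : 'rV[R]_n -> R) : open Om ->
  (mu1 Om < +oo)%E -> (mu2 Om < +oo)%E ->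
  mu1.-integrable Om (EFin \o h1) -> mu2.-integrable Om (EFin \o h2) ->
  (forall phi, test01 Om phi ->
    0 <= \int[mu1]_(x in Om) (h1 x * phi x) + \int[mu2]_(x in Om) (h2 x * phi x)) ->
  forall E, measurable E -> E `<=` Om ->
    0 <= \int[mu1]_(x in E) h1 x + \int[mu2]_(x in E) h2 x.
Proof.
move=> oOm f1 f2 i1 i2 H E mE EO.
have ind (la : {measure set 'rV[R]_n -> \bar R}) (h : 'rV[R]_n -> R) :
    \int[la]_(x in Om) (h x * \1_E x) = \int[la]_(x in E) h x.
  rewrite [LHS]Rintegral_mkcond [RHS]Rintegral_mkcond.
  apply: eq_Rintegral => x _; rewrite !patchE indicE.
  case: (boolP (x \in E)) => [/set_mem /EO Ox|_]; first by rewrite mem_set// mulr1.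
  by case: ifP; rewrite ?mulr0.
by have := test_le_set oOm f1 f2 i1 i2 H mE; rewrite !ind.
Qed.

(** Apply the hypothesis to the set where [g] is negative: the integral there is zero and the set is
    null. *)
Lemma nonneg_sets_ae d (T : measurableType d) (R : realType) (mu : {measure set T -> \bar R})
    (D : set T) (g : T -> R) : measurable D -> mu.-integrable D (EFin \o g) ->
  (forall E, measurable E -> E `<=` D -> 0 <= \int[mu]_(x in E) g x) ->
  {ae mu, forall x, D x -> 0 <= g x}.
Proof.
move=> mD ig H; have mg : measurable_fun D g by exact: (rint_measurable ig).
pose E := D `&` [set x | g x < 0].
have mE : measurable E by have := mg mD `]-oo, (0 : R)[%classic (measurable_itv _);
  rewrite set_itvE.
have ED : E `<=` D by exact: subIsetl.
have igE : mu.-integrable E (EFin \o g) by exact: (integrableS mD).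
have e1 : ae_eq mu E (EFin \o g) (cst 0%E).
  have mgE : measurable_fun E (EFin \o g) by apply/measurable_EFinP; exact: measurable_funS mg.
  apply/(ae_eq_integral_abs mu mE mgE).
  rewrite (eq_integral (fun x => (- g x)%:E)); last first.
    by move=> x /set_mem [_ gx]; rewrite /= ltr0_norm.
  have ign : mu.-integrable E (EFin \o (fun x => - g x)) by exact: rintN.
  rewrite -RintegralE//; congr EFin; rewrite RintegralN//.
  apply/eqP; rewrite eq_le oppr_le0 H//= -RintegralN//.
  by apply: Rintegral_ge0 => x [_ /= gx]; rewrite oppr_ge0 ltW.
apply: filterS e1 => x Hx Dx; rewrite leNgt; apply/negP => gx.
by have [g0] := Hx (conj Dx gx); move: gx; rewrite g0 ltxx.
Qed.

(** * Uniqueness of the divergence and the upper bound for the pairing density *)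

Section pairing_facts.
Variables (R : realType) (m n : nat) (Om : set 'rV[R]_n).
Hypotheses (oOm : open Om) (Omfin : (lebesgue_rV R n Om < +oo)%E).
Variable A : {linear 'M[R]_(m, n) -> 'M[R]_(m, n)}.
Hypotheses (A_sym : forall y y', frob_ip (A y) y' = frob_ip y (A y'))
  (A_idem : forall y, A (A y) = A y).
Local Notation la := (lebesgue_rV R n).

Let mOm : measurable Om. Proof. exact: open_measurable_mx. Qed.

Lemma wdiv_unique z w : X2 Om A z -> L2 la Om w -> is_wdiv Om z w ->
  {ae la, forall x, Om x -> wdiv Om z x = w x}.
Proof.
move=> zX w2 zw; have [v2 zv] := wdiv_spec zX.
have iv i := L1_entry oOm 0 i (L2_L1 oOm Omfin v2).
have iw i := L1_entry oOm 0 i (L2_L1 oOm Omfin w2).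
have comp (v v' : 'rV[R]_n -> 'rV[R]_m) i : la.-integrable Om (EFin \o (fun x => v x 0 i)) ->
    la.-integrable Om (EFin \o (fun x => v' x 0 i)) ->
    is_wdiv Om z v -> is_wdiv Om z v' -> {ae la, forall x, Om x -> 0 <= v x 0 i - v' x 0 i}.
  move=> i1 i2 d1 d2; have ib := rintB mOm i1 i2.
  apply: (nonneg_sets_ae mOm ib) => E mE EO.
  have i0 := rint0 la Om.
  have := @fundamental_lemma _ _ _ la la _ _ oOm Omfin Omfin ib i0 _ E mE EO.
  rewrite [X in _ + X](_ : _ = 0); last by rewrite Rintegral_cst// mul0r.
  rewrite addr0; apply => phi [tp p01].
  have [c _ pc] := test_function_bounded tp; have [sp _ _] := tp.
  have mp : measurable_fun Om phi by exact: smooth_measurable.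
  have ip (h : 'rV[R]_n -> R) : la.-integrable Om (EFin \o h) ->
      la.-integrable Om (EFin \o (fun x => h x * phi x)).
    move=> ih; apply: (@eq_rint _ _ _ _ _ mOm (fun x => phi x * h x)) => [x _|]; first by rewrite mulrC.
    exact: (@rint_bddM _ _ _ _ _ mOm _ _ c).
  rewrite [X in _ + X](_ : _ = 0); last first.
    transitivity (\int[la]_(x in Om) (0 : R)); last by rewrite Rintegral_cst// mul0r.
    by apply: eq_Rintegral => x _; rewrite mul0r.
  rewrite addr0; under eq_Rintegral do rewrite mulrBl.
  have := d1 _ tp i; rewrite d2// => /oppr_inj e.
  by rewrite RintegralB//; [rewrite e subrr|exact: ip..].
have : \forall x \ae la, forall i, Om x -> wdiv Om z x 0 i = w x 0 i.
  apply: filter_forall => i.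
  have c1 := comp _ _ i (iv i) (iw i) zv zw; have c2 := comp _ _ i (iw i) (iv i) zw zv.
  apply: filterS (filterI c1 c2) => x [a b] Ox; apply/eqP; rewrite eq_le.
  by rewrite -subr_ge0 b//= -subr_ge0 a.
by apply: filterS => x H Ox; apply/rowP => i; exact: H.
Qed.

Variables (z : 'rV[R]_n -> 'M[R]_(m, n)) (u : 'rV[R]_n -> 'rV[R]_m).
Local Notation V := (mx_variation (Agrad Om A u)).
Variables (th : 'rV[R]_n -> R) (C : R).
Hypotheses (mth : measurable_fun setT th) (thC : forall x, `|th x| <= C)
  (thE : forall E, measurable E -> pairing Om z u E = (\int[V]_(x in E) th x)%:E).

Let ith E : measurable E -> V.-integrable E (EFin \o th).
Proof. by move=> mE; apply: rint_finite_measure mE; [exact: mth|exact: thC]. Qed.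

Lemma theta_ae : {ae V, forall x, theta Om A z u x = (th x)%:E}.
Proof.
have thE' E : measurable E -> pairing Om z u E = (\int[V]_(x in E) (th x)%:E)%E.
  by move=> mE; rewrite thE// RintegralE//; exact: ith.
have dom : pairing Om z u `<< V.
  apply/null_content_dominatesP => E mE E0; rewrite thE'// null_set_integral//.
  by apply/measurable_EFinP; exact: measurable_funTS.
have : ae_eq V setT (theta Om A z u) (EFin \o th).
  apply: integral_ae_eq => //.
  - exact: (Radon_Nikodym_integrable dom).
  - exact/measurable_EFinP.
  - move=> E _ mE; rewrite /theta -(Radon_Nikodym_integral dom mE); exact: thE'.
by apply: filterS => x /(_ I).
Qed.

Variables (f : 'rV[R]_n -> 'M[R]_(m, n) -> R) (c0 C0 : R).
Local Notation cl := (closure Om).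
Hypotheses (f_ge0 : forall x y, cl x -> 0 <= f x y)
  (f_conv : forall x, cl x -> forall u v (t : R), 0 < t -> t < 1 ->
    f x (t *: u + (1 - t) *: v) <= t * f x u + (1 - t) * f x v)
  (C0_gt0 : 0 < C0)
  (f_gr : forall x y, cl x -> c0 * frob (A y) <= f x y <= C0 * (1 + frob (A y)))
  (f_rec : forall x y, cl x -> cvg (recession_quotient f y @ recession_filter Om x)).
Variable s : 'rV[R]_n -> 'M[R]_(m, n).
Hypothesis ms : forall i j, measurable_fun setT (fun x => s x i j).
Hypothesis th_le : forall (E : set 'rV[R]_n) (q t0 : R), measurable E -> 0 < t0 -> 0 <= q ->
  (forall x y Y, E x -> Om y -> `|x - y| < t0 -> (exists c, conj_le f y Y c) -> frob_ip Y (s x) <= q) ->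
  \int[V]_(x in E) th x <= q * fine (V E).

(* On the piece where [finfty] at nearby points exceeds its value at [x] by at most [1/l], and
   that value lies in [j/l, (j+1)/l], the density cannot exceed it by [3/l]. *)
Lemma theta_le_finfty : {ae V, forall x, Om x -> th x <= finfty Om f x (s x)}.
Proof.
have Ocl x : Om x -> cl x by exact: subset_closure.
pose g x := finfty Om f x (s x).
have msO i j : measurable_fun Om (fun x => s x i j) by exact: measurable_funTS.
have mg : measurable_fun Om g.
  exact: (measurable_finfty_comp oOm A_sym A_idem f_conv C0_gt0 f_gr f_rec).
have mthO : measurable_fun Om th by exact: measurable_funTS.
pose e l : R := l.+1%:R^-1.
have e0 l : 0 < e l by rewrite invr_gt0.
(* Only rational centres [y] are imposed in [T], to keep it measurable; continuity of [finfty]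
   extends the inequality to all points of [Om]. *)
pose near_le l k (y : 'rV[R]_n) := [set x : 'rV[R]_n | `|x - y| < e k -> finfty Om f y (s x) <= g x + e l].
pose T l k := \bigcap_i (Om `&` if unpickle i is Some q then
   if `[< Om (rat_mx R (q : 'rV[rat]_n)) >] then near_le l k (rat_mx R q) else setT else setT).
have mT l k : measurable (T l k).
  apply: bigcapT_measurable => i.
  case: unpickle => [q|]; last by rewrite setIT.
  case: asboolP => [Oq|_]; last by rewrite setIT.
  rewrite (_ : _ `&` _ = (Om `&` ~` ball (rat_mx R q) (e k)) `|`
    (Om `&` [set x | 0 <= g x + e l - finfty Om f (rat_mx R q) (s x)])).
    apply: measurableU.
      apply: measurableI => //; apply: measurableC; apply: open_measurable_mx; exact: ball_open.
    have mh : measurable_fun Om (fun x => g x + e l - finfty Om f (rat_mx R q) (s x)).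
      apply: measurable_funB; first by apply: measurable_funD.
      apply: (@measurable_lipschitz_comp _ _ Om m n (fun _ => finfty Om f (rat_mx R q)) C0 s (ltW C0_gt0)) => //.
      move=> x y y' _; exact: (finfty_lipschitz A_sym A_idem f_conv C0_gt0 f_gr f_rec _ _ (Ocl _ Oq)).
    have := mh mOm `[(0 : R), +oo[%classic (measurable_itv _); by rewrite set_itvE.
  apply/seteqP; split=> x; rewrite /near_le /=.
    move=> [Ox H]; have [xq|xq] := ltP `|x - rat_mx R q| (e k); [right|left]; split=> //.
      by rewrite subr_ge0 H.
    by rewrite -ball_normE /ball_/= distrC => /lt_geF; rewrite xq.
  move=> [[Ox H]|[Ox H]]; split=> //; last by rewrite subr_ge0 in H.
  by move=> xq; exfalso; apply: H; rewrite -ball_normE /ball_/= distrC.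
have Tnear l k x y : T l k x -> Om y -> `|x - y| < e k -> finfty Om f y (s x) <= g x + e l.
  move=> H Oy xy; have [Ox _] := H 0%N I; apply/ler_addgt0Pr => d d0.
  have [r r0 Hr] := finfty_cont f_rec (s x) (Ocl _ Oy) d0.
  have oU : open (Om `&` (ball x (e k) `&` ball y r)).
    by apply: openI => //; apply: openI; exact: ball_open.
  have yU : (Om `&` (ball x (e k) `&` ball y r)) y.
    by split=> //; split; [rewrite -ball_normE|exact: ballxx].
  have [q [rr [r0' yq qU]]] := rat_cube_nbhs oU yU.
  have [Oq [xq yq']] : (Om `&` (ball x (e k) `&` ball y r)) (rat_mx R q).
    by apply: qU => i j; rewrite subrr normr0 ltW.
  have [_] := H (pickle q) I; rewrite pickleK asboolT// /near_le/=.
  move: xq yq'; rewrite -!ball_normE /ball_/= => xq yq' /(_ xq) H1.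
  have := Hr _ (Ocl _ Oq) yq'; rewrite ler_norml => /andP[H2 _]; lra.
have Tcover l x : Om x -> exists k, T l k x.
  move=> Ox; have [d d0 Hd] := finfty_cont f_rec (s x) (Ocl _ Ox) (e0 l).
  have [k kd] : exists k, e k < d.
    by exists (Num.truncn d^-1); rewrite /e invf_plt ?posrE// truncnS_gt.
  exists k => i _; split=> //; case: unpickle => [q|//]; case: asboolP => [Oq|//].
  rewrite /near_le/= => xq; have := Hd _ (Ocl _ Oq) (lt_trans xq kd).
  by rewrite ler_norml => /andP[_]; rewrite /g; lra.
(* Here [finfty] is at most [(j + 1) e l] at all points of [Om] near [x], so the mean of [th] over
   this set is bounded by that number, whereas [th] exceeds [(j + 2) e l] on it. So the set is
   null. *)
pose B l k j := T l k `&` ((Om `&` [set x | g x <= j%:R * e l]) `&` (Om `&` [set x | (j.+1)%:R * e l < th x - e l])).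
have mB l k j : measurable (B l k j).
  apply: measurableI => //; apply: measurableI.
    by have := mg mOm `]-oo, j%:R * e l]%classic (measurable_itv _); rewrite set_itvE.
  have mh : measurable_fun Om (fun x => th x - e l) by exact: measurable_funB.
  by have := mh mOm `]j.+1%:R * e l, +oo[%classic (measurable_itv _); rewrite set_itvE.
have VB l k j : V (B l k j) = 0%E.
  have q0 : 0 <= j.+1%:R * e l by rewrite mulr_ge0// ltW.
  have := @th_le (B l k j) (j.+1%:R * e l) (e k) (mB l k j) (e0 k) q0.
  have vfin : V (B l k j) \is a fin_num by exact: fin_num_measure.
  have -> : (forall x y Y, B l k j x -> Om y -> `|x - y| < e k ->
    (exists c, conj_le f y Y c) -> frob_ip Y (s x) <= j.+1%:R * e l) = True.
    apply/propext; split=> // _ x y Y [Tx [[Ox gx] _]] Oy xy [c Yc].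
    rewrite (le_trans (finfty_ge f_rec (s x) (Ocl _ Oy) Yc))//.
    rewrite (le_trans (Tnear _ _ _ _ Tx Oy xy))// -natr1 mulrDl mul1r lerD2r; exact: gx.
  move=> /(_ I) H.
  have : (j.+1%:R * e l + e l) * fine (V (B l k j)) <= \int[V]_(x in B l k j) th x.
    rewrite -Rintegral_cst//; apply: le_Rintegral => //; first last.
    - by move=> x [_ [_ [_ /= H1]]]; rewrite ltW// -ltrBrDr.
    - exact: ith.
    - by apply: (@rint_finite_measure _ _ _ V _ `|j.+1%:R * e l + e l|).
  have v0 : 0 <= fine (V (B l k j)) by exact: fine_ge0.
  move=> H1; have := le_trans H1 H; rewrite mulrDl gerDl.
  rewrite pmulr_rle0// => H2; rewrite -(fineK vfin); congr EFin; apply/eqP.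
  by rewrite eq_le H2.
have : V.-negligible (\bigcup_l \bigcup_k \bigcup_j B l k j).
  by do 3 apply: negligible_bigcup => ?; apply/negligibleP => //; exact: VB.
apply: negligibleS => x /= /existsNP[Ox /negP]; rewrite -ltNge -/(g x) => gth.
have g0 : 0 <= g x.
  by apply: (finfty_ge0 f_ge0 f_rec); exact: Ocl.
(* One [e l] is lost in rounding [g x] up to the grid, one in passing from [j] to [j + 1], and one
   is the margin in [B]. *)
have [l lH] : exists l, 3 * e l < th x - g x.
  have d0 : 0 < th x - g x by rewrite subr_gt0.
  exists (Num.truncn (3 / (th x - g x))).
  by rewrite /e ltr_pdivrMr// mulrC -ltr_pdivrMr// truncnS_gt.
have [k Tk] := Tcover l x Ox.
pose j := (Num.truncn (g x / e l)).+1.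
have ge0' : 0 <= g x / e l by rewrite divr_ge0// ltW.
have /andP[j1 j2] := truncn_itv ge0'.
exists l => //; exists k => //; exists j => //; split=> //; split; split=> //=.
  by rewrite -ler_pdivrMr// ltW.
have : j%:R * e l <= g x + e l.
  by rewrite /j -natr1 mulrDl mul1r lerD2r -ler_pdivlMr.
by rewrite -natr1 mulrDl mul1r; lra.
Qed.

End pairing_facts.

(** * Integration by parts *)

Lemma ae_le_Rintegral d (T : measurableType d) (R : realType) (mu : {measure set T -> \bar R})
    (D : set T) (f g : T -> R) : measurable D ->
  mu.-integrable D (EFin \o f) -> mu.-integrable D (EFin \o g) ->
  {ae mu, forall x, D x -> f x <= g x} -> \int[mu]_(x in D) f x <= \int[mu]_(x in D) g x.
Proof.
move=> mD fi gi fg; have mf := rint_measurable fi; have mg := rint_measurable gi.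
pose h x := Num.max (f x) (g x).
have mh : measurable_fun D h by exact: measurable_maxr.
have ih : mu.-integrable D (EFin \o h).
  apply: (rint_le mD mh (g := fun x => `|f x| + `|g x|)).
    move=> x _; rewrite /h; have [->|->] : Num.max (f x) (g x) = f x \/ Num.max (f x) (g x) = g x.
    - by case: (leP (f x) (g x)) => _; [right|left].
    - by rewrite lerDl.
    - by rewrite lerDr.
  by apply: rintD => //; exact: rint_norm.
rewrite (@ae_eq_Rintegral_in _ _ _ mu D g h mD mg mh); last first.
  by apply: filterS fg => x H Dx; rewrite /h; apply/esym/max_idPr/H.
by apply: le_Rintegral => // x _; rewrite /h le_max lexx.
Qed.

Lemma rint_ae_le d (T : measurableType d) (R : realType) (mu : {measure set T -> \bar R})
    (D : set T) (f g : T -> R) : measurable D -> measurable_fun D f ->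
  mu.-integrable D (EFin \o g) -> {ae mu, forall x, D x -> `|f x| <= g x} ->
  mu.-integrable D (EFin \o f).
Proof.
move=> mD mf gi fg; apply/integrableP; split; first exact/measurable_EFinP.
have /integrableP[mg gfin] := gi; apply: le_lt_trans gfin.
apply: ae_ge0_le_integral => //.
- by apply/measurable_EFinP; exact: measurableT_comp.
- exact: measurableT_comp.
- by apply: filterS fg => x H Dx /=; rewrite lee_fin (le_trans (H Dx))// ler_norm.
Qed.

Section integration_by_parts.
Variables (R : realType) (n : nat).
Local Notation la := (lebesgue_rV R n).
Local Notation rint f := (la.-integrable setT (EFin \o f)).

Lemma Rintegral_shift (psi : 'rV[R]_n -> R) h : measurable_fun setT psi ->
  \int[la]_x psi (x + h) = \int[la]_x psi x.
Proof.
move=> mp; have mpE : measurable_fun setT (EFin \o psi) by exact/measurable_EFinP.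
rewrite /Rintegral integralE [in RHS]integralE; congr (fine (_ - _)).
  rewrite -[RHS](ge0_integral_shift h)//; first by apply: eq_integral => x _; rewrite !funeposE.
  exact: measurable_funepos.
rewrite -[RHS](ge0_integral_shift h)//; first by apply: eq_integral => x _; rewrite !funenegE.
exact: measurable_funeneg.
Qed.

Lemma test_function_ball (psi : 'rV[R]_n -> R) : test_function setT psi ->
  exists2 r, 0 < r & test_function (ball (0 : 'rV[R]_n) r) psi.
Proof.
move=> [sp cp _]; have /compact_bounded[N [_ HN]] := cp.
exists (`|N| + 2); first by rewrite ltr_wpDl.
split=> // x cx; rewrite -ball_normE /ball_/= sub0r normrN.
have : `|x| <= `|N| + 1 by apply: HN => //; rewrite (le_lt_trans (ler_norm N))// ltrDl.
by lra.
Qed.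

Lemma test_function_fin (psi : 'rV[R]_n -> R) : test_function setT psi -> rint psi.
Proof.
move=> tp; have [r r0 tr] := test_function_ball tp.
have oB : open (ball (0 : 'rV[R]_n) r) by exact: ball_open.
by apply: (rint_test oB _ tr); rewrite [X in (X < _)%E](lebesgue_rV_ball _ r0) ltry.
Qed.

(** Translation invariance makes the integral of [psi (x + h) - psi x] vanish, and the uniform
    Taylor expansion replaces the increment by [t] times the derivative. This avoids iterated
    integration. *)
Lemma Rintegral_pderive0 (psi : 'rV[R]_n -> R) j : test_function setT psi ->
  \int[la]_x pderive j psi x = 0.
Proof.
move=> tp; have [r r0 tr] := test_function_ball tp; have [sp _ _] := tp.
have mp : measurable_fun setT psi by exact: smooth_measurable.
have ip := test_function_fin tp; have tdp := test_function_pderive j tp.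
have idp := test_function_fin tdp.
pose B := ball (0 : 'rV[R]_n) (r + 1); have r10 : 0 < r + 1 by rewrite addr_gt0.
have mB : measurable B by apply: open_measurable_mx; exact: ball_open.
have fB : (la B < +oo)%E by rewrite [X in (X < _)%E](lebesgue_rV_ball _ r10) ltry.
pose c := fine (la B); have c0 : 0 <= c by exact: fine_ge0.
apply/eqP; rewrite -normr_le0; apply/ler_addgt0Pr => e e0; rewrite add0r.
have c1 : 0 < c + 1 by rewrite ltr_wpDl.
have := smooth_taylor tp (divr_gt0 e0 c1) => /nbhs_ballP[d /= d0 Hd].
(* Keeping [t < 1] confines the translated support to the ball of radius [r + 1]. *)
pose t := Num.min (d / 2) (1 / 2); have t0 : 0 < t by rewrite lt_min !divr_gt0.
have td : t < d by rewrite gt_min ltr_pdivrMr// ltr_pMr// ltr1n.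
have t1 : t < 1 by rewrite gt_min; apply/orP; right; lra.
pose h : 'rV[R]_n := t *: delta_mx 0 j.
have hn : `|h| <= t.
  apply: ler_norm_coord => [|i k]; first exact: ltW.
  rewrite !mxE; case: (_ && _); last by rewrite mulr0 normr0 ltW.
  by rewrite mulr1 gtr0_norm.
have hB : ball 0 d h by rewrite -ball_normE /ball_/= sub0r normrN (le_lt_trans hn).
have {Hd} H x : `|psi (x + h) - psi x - t * pderive j psi x| <= e / (c + 1) * t.
  have := Hd h hB x; rewrite (bigD1 j)//= big1 ?addr0.
    rewrite !mxE !eqxx mulr1 => /le_trans; apply; rewrite ler_wpM2l// ltW// divr_gt0//.
  by move=> k kj; rewrite !mxE (negbTE kj) andbF mulr0 mul0r.
have ish : rint (fun x => psi (x + h)).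
  have /integrableP[_ fin] := ip; apply/integrableP; split.
    by apply/measurable_EFinP; apply: (measurableT_comp mp); exact: measurable_rV_shift.
  rewrite (ge0_integral_shift (f := fun x => `|(psi x)%:E|%E))//.
  by apply: measurableT_comp => //; exact/measurable_EFinP.
have ig : rint (fun x => psi (x + h) - psi x - t * pderive j psi x).
  by apply: rintB => //; [exact: rintB|exact: rintZ].
have E : \int[la]_x (psi (x + h) - psi x - t * pderive j psi x) = - t * \int[la]_x pderive j psi x.
  rewrite RintegralB//; [|exact: rintB|exact: rintZ].
  by rewrite RintegralB// Rintegral_shift// subrr sub0r RintegralZl// mulNr.
have : `|- t * \int[la]_x pderive j psi x| <= e / (c + 1) * t * c.
  rewrite -E (@Rintegral_supp _ _ B); last first.
    move=> x nB; have nb : r + 1 <= `|x|.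
      by rewrite leNgt; apply/negP => xr; apply: nB; rewrite /B -ball_normE /ball_/= sub0r normrN.
    have o1 y : r <= `|y| -> psi y = 0.
      move=> ry; apply: (test_function_out tr); rewrite -ball_normE /ball_/= sub0r normrN.
      by apply/negP; rewrite -leNgt.
    have o2 : pderive j psi x = 0.
      apply: (test_function_out (test_function_pderive j tr)); rewrite -ball_normE /ball_/= sub0r normrN.
      by apply/negP; rewrite -leNgt; lra.
    rewrite o2 mulr0 (o1 x) ?(o1 (x + h)) ?subrr//; last by lra.
    have := ler_normB (x + h) h; rewrite addrK; lra.
  rewrite -[leRHS](@Rintegral_cst _ _ _ la B mB).
  apply: (le_norm_Rintegral mB) => //; first by apply: (integrableS measurableT).
  by apply: (@rint_bdd _ _ _ _ _ mB _ `|e / (c + 1) * t|).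
have nt : `|- t| = t by rewrite normrN gtr0_norm.
rewrite normrM nt (_ : e / (c + 1) * t * c = t * (e * (c / (c + 1)))); last by ring.
rewrite ler_pM2l// => /le_trans; apply.
by apply: ler_piMr; [exact: ltW|rewrite ler_pdivrMr// mul1r lerDl].
Qed.

Lemma pderive_by_parts (Om : set 'rV[R]_n) (phi psi : 'rV[R]_n -> R) j :
  test_function setT phi -> test_function Om psi ->
  \int[la]_(x in Om) (phi x * pderive j psi x) = - (\int[la]_(x in Om) (pderive j phi x * psi x)).
Proof.
move=> tf tp; have tpT := test_functionS (@subsetT _ Om) tp.
have [sf _ _] := tf; have [sp _ _] := tp.
have df x := smooth_differentiable x sf; have dp x := smooth_differentiable x sp.
have t1 : test_function setT (pderive j psi * phi) by apply: test_functionM => //; exact: test_function_pderive.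
have t2 : test_function setT (pderive j phi * psi) by apply: test_functionM => //; exact: test_function_pderive.
rewrite -!(@Rintegral_supp _ _ Om); first last.
- by move=> x nO; rewrite (test_function_out (test_function_pderive j tp) nO) mulr0.
- by move=> x nO; rewrite (test_function_out tp nO) mulr0.
have tm : test_function setT (phi * psi) by exact: test_functionM.
have := Rintegral_pderive0 j tm; rewrite pderiveM// => H.
apply/eqP; rewrite -addr_eq0 -RintegralD//.
- by apply/eqP; rewrite -[RHS]H; apply: eq_Rintegral => x _; rewrite !fctE; ring.
- by apply: (@eq_rint _ _ _ _ _ measurableT _ _ _ (test_function_fin t1)) => x _; rewrite fctE mulrC.
- exact: (test_function_fin t2).
Qed.

End integration_by_parts.

Section null_boundary.
Variables (d : measure_display) (T : measurableType d) (R : realType).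
Variable mu : {measure set T -> \bar R}.
Hypothesis mu_complete : measure_is_complete mu.

(** Nothing is known about measurability of [g], in the application a boundary trace times a null
    function. Completeness makes any function vanishing almost everywhere measurable. *)
Lemma complete_Rintegral0 (D : set T) (g : T -> R) :
  {ae mu, forall x, D x -> g x = 0} -> \int[mu]_(x in D) g x = 0.
Proof.
move=> g0; rewrite /Rintegral integral_mkcond.
pose h := (fun x => (g x)%:E) \_ D.
have h0 : {ae mu, forall x, h x = 0%E}.
  by apply: filterS g0 => x H; rewrite /h patchE; case: ifPn => // /set_mem /H ->.
have mh : measurable_fun setT h.
  move=> _ Y mY; rewrite setTI.
  have neg (Y' : set (\bar R)) : ~ Y' 0%E -> measurable (h @^-1` Y').
    move=> nY; apply: mu_complete; move: h0 => [N [mN N0 sub]]; exists N; split=> // x Yx.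
    by apply: sub => /= hx; apply: nY; rewrite -hx.
  have [Y0|nY] := pselect (Y 0%E); last exact: neg.
  rewrite -[h @^-1` Y]setCK; apply: measurableC.
  exact: (neg (~` Y)).
have -> : (\int[mu]_x h x = \int[mu]_x 0)%E; last by rewrite integral0.
by apply: ae_eq_integral => //; apply: filterS h0 => x -> _.
Qed.

End null_boundary.

(** * Duality *)

Lemma bounded_lebesgue_fin (R : realType) (n : nat) (Om : set 'rV[R]_n) : open Om ->
  bounded_set Om -> (lebesgue_rV R n Om < +oo)%E.
Proof.
move=> oOm [N [_ HN]]; have r0 : 0 < `|N| + 2 by rewrite ltr_wpDl.
apply: (@le_lt_trans _ _ (lebesgue_rV R n (ball (0 : 'rV[R]_n) (`|N| + 2)))); last first.
  by rewrite [X in (X < _)%E](lebesgue_rV_ball _ r0) ltry.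
apply: le_measure; rewrite ?inE; try exact: open_measurable_mx.
  by apply: open_measurable_mx; exact: ball_open.
move=> x Ox; rewrite -ball_normE /ball_/= sub0r normrN.
have : `|x| <= `|N| + 1 by apply: HN => //; rewrite (le_lt_trans (ler_norm N))// ltrDl.
lra.
Qed.

Lemma rint_L2_ip (R : realType) (n m k : nat) (Om : set 'rV[R]_n) (v w : 'rV[R]_n -> 'M[R]_(m, k)) :
  open Om -> L2 (lebesgue_rV R n) Om v -> L2 (lebesgue_rV R n) Om w ->
  (lebesgue_rV R n).-integrable Om (EFin \o (fun x => frob_ip (v x) (w x))).
Proof.
move=> oOm [mv iv] [mw iw]; have mOm : measurable Om by exact: open_measurable_mx.
apply: (rint_le mOm (g := fun x => frob (v x) ^+ 2 + frob (w x) ^+ 2)).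
- by apply: measurable_frob_ip => i j; exact: measurable_entry.
- move=> x _; apply: le_trans (frob_cauchy_schwarz_norm _ _) _.
  have := frob_ge0 (v x); have := frob_ge0 (w x); have := sqr_ge0 (frob (v x) - frob (w x)); nra.
- exact: rintD.
Qed.

Lemma frob_ip_row (R : realType) (m : nat) (v w : 'rV[R]_m) : frob_ip v w = \sum_i v 0 i * w 0 i.
Proof. by rewrite /frob_ip big_ord1. Qed.

Lemma measurable_fun_mx_in d1 d2 (S : measurableType d1) (T : measurableType d2) m n
    (D : set S) (g : S -> 'M[T]_(m, n)) : measurable D ->
  (forall i j, measurable_fun D (fun x => g x i j)) -> measurable_fun D g.
Proof.
move=> mD mg; apply: (measurability (@mx_cylinders _ T m n) erefl).
by move=> _ [_ [i [j [B [mB ->]]]] <-]; exact: (mg i j mD B mB).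
Qed.

Lemma L1_entries (R : realType) (n m k : nat) (Om : set 'rV[R]_n) (g : 'rV[R]_n -> 'M[R]_(m, k)) :
  open Om -> (forall i j, (lebesgue_rV R n).-integrable Om (EFin \o (fun x => g x i j))) ->
  L1 (lebesgue_rV R n) Om g.
Proof.
move=> oOm ig; have mOm : measurable Om by exact: open_measurable_mx.
have mg i j : measurable_fun Om (fun x => g x i j) by exact: (rint_measurable (ig i j)).
split; first exact: measurable_fun_mx_in.
apply: (rint_le mOm (measurable_frob mg) (g := fun x => \sum_i \sum_j `|g x i j|)).
  by move=> x _; rewrite ger0_norm ?frob_ge0//; exact: frob_le_sum.
by apply: rint_sum => // i _; apply: rint_sum => // j _; exact: rint_norm.
Qed.

Section duality.
Variables (R : realType) (m n : nat) (Om : set 'rV[R]_n.+1).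
Hypotheses (oOm : open Om) (bOm : bounded_set Om) (lOm : lipschitz_boundary Om).
Variable A : {linear 'M[R]_(m, n.+1) -> 'M[R]_(m, n.+1)}.
Hypotheses (A_sym : forall y y', frob_ip (A y) y' = frob_ip y (A y'))
  (A_idem : forall y, A (A y) = A y).
Variables (f : 'rV[R]_n.+1 -> 'M[R]_(m, n.+1) -> R) (c0 C0 : R).
Local Notation cl := (closure Om).
Hypotheses (f_ge0 : forall x y, cl x -> 0 <= f x y)
  (f_cont : {within cl `*` [set: 'M[R]_(m, n.+1)],
    continuous (fun p : 'rV[R]_n.+1 * 'M[R]_(m, n.+1) => f p.1 p.2)})
  (f_conv : forall x, cl x -> forall u v (t : R), 0 < t -> t < 1 ->
    f x (t *: u + (1 - t) *: v) <= t * f x u + (1 - t) * f x v)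
  (c0_gt0 : 0 < c0) (C0_gt0 : 0 < C0)
  (f_gr : forall x y, cl x -> c0 * frob (A y) <= f x y <= C0 * (1 + frob (A y)))
  (f_rec : forall x y, cl x -> cvg (recession_quotient f y @ recession_filter Om x)).
Local Notation la := (lebesgue_rV R n.+1).

Let mOm : measurable Om. Proof. exact: open_measurable_mx. Qed.

Let Omfin : (la Om < +oo)%E. Proof. exact: bounded_lebesgue_fin. Qed.

Let Ocl x : Om x -> cl x. Proof. exact: subset_closure. Qed.

Definition conj_val (z : 'rV[R]_n.+1 -> 'M[R]_(m, n.+1)) x : R := fine (fconjugate f x (z x)).

Lemma Zset_conj z : Zset Om A f z ->
  [/\ la.-integrable Om (EFin \o conj_val z),
    (\int[la]_(x in Om) (- fconjugate f x (z x)) = (- \int[la]_(x in Om) conj_val z x)%:E)%E &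
    {ae la, forall x, Om x -> conj_le f x (z x) (conj_val z x)}].
Proof.
move=> [_ iz]; have mz := measurable_int _ iz.
have mc : measurable_fun Om (EFin \o conj_val z).
  by apply/measurable_EFinP; apply: (measurableT_comp (fine_measurable measurableT) mz).
have ic : la.-integrable Om (EFin \o conj_val z).
  apply: (le_integrable mOm mc _ iz) => x Ox /=; rewrite /conj_val.
  by case: (fconjugate f x (z x)) => [a| |] //=; rewrite ?normr0 ?lexx// leey.
have fin := integrable_ae mOm iz.
split=> //.
- rewrite -RintegralN// RintegralE//; last exact: rintN.
  apply: ae_eq_integral => //.
  + exact: measurableT_comp.
  + by apply: (measurable_int la); exact: rintN.
  + by apply: filterS fin => x H Ox; rewrite /= EFinN fineK//; exact: H.
- by apply: filterS fin => x H Ox; apply: fconjugate_fin; exact: H.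
Qed.

Section fixed_function.
Variable u : 'rV[R]_n.+1 -> 'rV[R]_m.
Hypotheses (uBV : BVA Om A u) (u2 : L2 la Om u).
Local Notation mu := (Agrad Om A u).
Local Notation V := (mx_variation mu).
Local Notation a := (ac_density la mu).
Variables (s : 'rV[R]_n.+1 -> 'M[R]_(m, n.+1)) (N : set 'rV[R]_n.+1).
Hypotheses (ms : forall i j, measurable_fun setT (fun x => s x i j))
  (s1 : forall x i j, `|s x i j| <= 1)
  (mus : forall i j E, measurable E -> mu i j E = (\int[V]_(x in E) (s x i j)%:E)%E).
Hypotheses (mN : measurable N) (N0 : la N = 0%E)
  (ia : forall i j, la.-integrable setT (EFin \o (fun x => a x i j)))
  (muN : forall i j E, measurable E -> E `<=` ~` N ->
     mu i j E = (\int[la]_(x in E) (a x i j)%:E)%E).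

(** Off [N] the pairing is the Lebesgue integral of [z : a]; on [N] only the bound by the recession
    function is left. All later comparisons use this splitting. *)
Theorem pairing_value z : Zset Om A f z -> exists (th : 'rV[R]_n.+1 -> R) (C : R),
  [/\ measurable_fun setT th /\ (forall x, `|th x| <= C),
   is_pairing Om z u (pairing Om z u) /\
   (forall E, measurable E -> pairing Om z u E = (\int[V]_(x in E) th x)%:E),
   la.-integrable Om (EFin \o (fun x => frob_ip (z x) (a x))) /\
   (forall E, measurable E -> \int[V]_(x in E) th x =
     \int[la]_(x in E `&` Om) frob_ip (z x) (a x) + \int[V]_(x in E `&` N) th x),
   {ae V, forall x, Om x -> th x <= finfty Om f x (s x)} /\
   {ae V, forall x, theta Om A z u x = (th x)%:E} &
   ((forall phi, test_function setT phi -> forall i,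
        \int[la]_(x in Om) (\sum_j z x i j * pderive j phi x) =
        - (\int[la]_(x in Om) (wdiv Om z x 0 i * phi x))) ->
      pairing Om z u Om = (- (\int[la]_(x in Om) frob_ip (wdiv Om z x) (u x)))%:E)].
Proof.
move=> zZ; have [zX _] := zZ; have [ic Ec aec] := Zset_conj zZ.
have zP : {ae la, forall x, Om x -> exists c, conj_le f x (z x) c}.
  by apply: filterS aec => x H Ox; exists (conj_val z x); exact: H.
have [th [C [mth thC [prP thE] [thA thU thG]]]] :=
  @pairing_package _ _ _ _ oOm bOm lOm Omfin A A_sym z u zX u2 uBV
    (fun x Y => exists c, conj_le f x Y c) zP s ms s1 mus.
have ith E : measurable E -> V.-integrable E (EFin \o th).
  by move=> mE; apply: rint_finite_measure mE; [exact: mth|exact: thC].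
have zM : exists M, {ae la, forall x, Om x -> frob (z x) <= M} by case: zX => -[].
have iza : la.-integrable Om (EFin \o (fun x => frob_ip (z x) (a x))).
  have [M HM] := zM.
  apply: (rint_ae_le mOm (g := fun x => M * \sum_i \sum_j `|a x i j|)).
  - apply: measurable_frob_ip => i j; first by apply: measurable_entry; case: zX => -[].
    by apply: measurable_funTS; exact: (rint_measurable (ia i j)).
  - apply: rintZ => //; apply: rint_sum => // i _; apply: rint_sum => // j _.
    by apply: rint_norm; apply: (integrableS measurableT).
  - apply: filterS HM => x H Ox; apply: le_trans (frob_cauchy_schwarz_norm _ _) _.
    by apply: ler_pM; rewrite ?frob_ge0//; [exact: H|exact: frob_le_sum].
exists th, C; split=> //.
- split=> // E mE.
  have mEN : measurable (E `&` N) by exact: measurableI.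
  have mED : measurable (E `\` N) by exact: measurableD.
  rewrite -[E in LHS](setUIDK E N) Rintegral_setU//; last 2 first.
  + by rewrite setUIDK; exact: ith.
  + by apply/disj_setPS => x [[_ Nx] [_ nN]].
  rewrite addrC; congr (_ + _).
  rewrite (thA a)//; last by move=> i j F mF FE; apply: muN => //; apply: subset_trans FE _ => x [].
  have mEO : measurable (E `&` Om) by exact: measurableI.
  have iEO : la.-integrable (E `&` Om) (EFin \o (fun x => frob_ip (z x) (a x))).
    by apply: (integrableS mOm) => //; exact: subIsetr.
  rewrite /Rintegral [in RHS](@negligible_integral _ _ _ la (E `&` Om) N)//.
  by congr (fine (integral _ _ _)); rewrite !setDE setIAC.
- split.
    exact: (theta_le_finfty oOm A_sym A_idem mth thC f_ge0 f_conv C0_gt0 f_gr f_rec ms thU).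
  exact: (theta_ae mth thC thE).
- move=> H; rewrite thE//; congr EFin.
  transitivity (\int[V]_x th x).
    by rewrite (RintegralV oOm (Agrad_spec uBV) measurableT) ?setTI//; exact: ith.
  rewrite thG//; congr (- _); apply: eq_Rintegral => x _.
  by rewrite frob_ip_row.
Qed.

End fixed_function.

Definition test_vec (phi : 'rV[R]_n.+1 -> R) (i : 'I_m) (x : 'rV[R]_n.+1) : 'rV[R]_m :=
  phi x *: delta_mx 0 i.

Definition test_grad (phi : 'rV[R]_n.+1 -> R) (i : 'I_m) (x : 'rV[R]_n.+1) : 'M[R]_(m, n.+1) :=
  \matrix_(k, j) ((k == i)%:R * pderive j phi x).

Lemma frob_ip_test_vec (w : 'rV[R]_m) phi i x : frob_ip w (test_vec phi i x) = w 0 i * phi x.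
Proof. by rewrite frob_ipZr frob_ip_delta mulrC. Qed.

Lemma frob_ip_test_grad (y : 'M[R]_(m, n.+1)) phi i x :
  frob_ip y (test_grad phi i x) = \sum_j y i j * pderive j phi x.
Proof.
rewrite /frob_ip (bigD1 i)//= [X in _ + X]big1 ?addr0.
  by apply: eq_bigr => j _; rewrite mxE eqxx mul1r.
by move=> k ki; rewrite big1// => j _; rewrite mxE (negbTE ki) mul0r mulr0.
Qed.

Lemma test_sobolev phi i : test_function setT phi ->
  [/\ L1 la Om (test_vec phi i), L2 la Om (test_vec phi i), L1 la Om (test_grad phi i) &
    is_wgrad Om (test_vec phi i) (test_grad phi i)].
Proof.
move=> tp; pose v := test_vec phi i; pose G := test_grad phi i.
have mp : measurable_fun setT phi by case: tp => sp _ _; exact: smooth_measurable.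
have mdp j : measurable_fun setT (pderive j phi).
  by case: (test_function_pderive j tp) => sp _ _; exact: smooth_measurable.
have [M M0 pM] := test_function_bounded tp.
have mv : measurable_fun Om v.
  apply: measurable_funTS; apply: measurable_fun_mx => k l; under eq_fun do rewrite mxE.
  by apply: measurable_funM => //; exact: measurable_cst.
have mG : measurable_fun Om G.
  apply: measurable_funTS; apply: measurable_fun_mx => k l; under eq_fun do rewrite mxE.
  by apply: measurable_funM => //; exact: measurable_cst.
have vx x : frob (v x) <= M * frob (delta_mx 0 i : 'rV[R]_m) by rewrite frobZ ler_wpM2r ?frob_ge0.
have mfv : measurable_fun Om (fun x => frob (v x)).
  by apply: measurable_frob => k l; exact: measurable_entry.
have v1 : L1 la Om v.
  split=> //; apply: (@rint_bdd _ _ _ _ _ mOm _ (M * frob (delta_mx 0 i : 'rV[R]_m))) => // x _.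
  by rewrite ger0_norm ?frob_ge0.
have v2 : L2 la Om v.
  split=> //; apply: (@rint_bdd _ _ _ _ _ mOm _ ((M * frob (delta_mx 0 i : 'rV[R]_m)) ^+ 2)) => //.
    exact: measurable_funX.
  by move=> x _; rewrite ger0_norm ?sqr_ge0// lerXn2r ?nnegrE ?frob_ge0// mulr_ge0 ?frob_ge0// ltW.
have Gb : exists K, forall x, frob (G x) <= K.
  have /choice[B HB] : forall j, exists B, forall x, `|pderive j phi x| <= B.
    by move=> j; have [B _ HB] := test_function_bounded (test_function_pderive j tp); exists B.
  exists (\sum_(k < m) \sum_j B j) => x; apply: le_trans (frob_le_sum _) _.
  apply: ler_sum => k _; apply: ler_sum => j _; rewrite mxE normrM.
  apply: le_trans (HB j x); rewrite ler_piMl//.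
  by case: (k == i); rewrite ?normr1 ?normr0.
have G1 : L1 la Om G.
  have [K HK] := Gb; split=> //; apply: (@rint_bdd _ _ _ _ _ mOm _ K) => //.
    by apply: measurable_frob => k l; exact: measurable_entry.
  by move=> x _; rewrite ger0_norm ?frob_ge0.
have vG : is_wgrad Om v G.
  move=> psi tpsi k j.
  have [->|ki] := eqVneq k i.
    transitivity (\int[la]_(x in Om) (phi x * pderive j psi x)).
      by apply: eq_Rintegral => x _; rewrite !mxE !eqxx mulr1.
    rewrite (pderive_by_parts j tp tpsi); congr (- _); apply: eq_Rintegral => x _.
    by rewrite mxE eqxx mul1r.
  rewrite [in RHS](_ : \int[la]_(x in Om) _ = 0).
    rewrite oppr0; transitivity (\int[la]_(x in Om) (0 : R)); last by rewrite Rintegral_cst// mul0r.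
    by apply: eq_Rintegral => x _; rewrite !mxE (negbTE ki) mulr0 mul0r.
  transitivity (\int[la]_(x in Om) (0 : R)); last by rewrite Rintegral_cst// mul0r.
  by apply: eq_Rintegral => x _; rewrite mxE (negbTE ki) !mul0r.
by split.
Qed.

(** The definition of the normal trace, tested with [phi e_i]: the boundary integral is zero
    whatever [btrace] is, and what remains is the divergence identity for test functions of the
    whole space. *)
Lemma zero_trace_divergence z : X2 Om A z ->
  (exists2 w, is_normal_trace Om z w &
    {ae hausdorff_measure R n.+1 n, forall x, boundary Om x -> w x = 0}) ->
  forall phi, test_function setT phi -> forall i,
    \int[la]_(x in Om) (\sum_j z x i j * pderive j phi x) =
    - (\int[la]_(x in Om) (wdiv Om z x 0 i * phi x)).
Proof.
move=> zX [w [_ Hw] w0] phi tp i.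
have [v1 v2 G1 vG] := test_sobolev i tp.
have := Hw _ _ v1 v2 G1 vG.
rewrite [RHS](_ : _ = 0); last first.
  apply: complete_Rintegral0; first exact: measure_is_complete_caratheodory.
  case: w0 => B [mB B0 sub]; exists B; split=> // x Hx; apply: sub => /= H; apply: Hx => bx.
  by rewrite H// frob_ip0r.
have [M _ pM] := test_function_bounded tp.
have mp : measurable_fun setT phi by case: tp => sp _ _; exact: smooth_measurable.
have mdp j : measurable_fun setT (pderive j phi).
  by case: (test_function_pderive j tp) => sp _ _; exact: smooth_measurable.
have [w2 _] := wdiv_spec zX.
have iw := L1_entry oOm 0 i (L2_L1 oOm Omfin w2).
have iwp : la.-integrable Om (EFin \o (fun x => wdiv Om z x 0 i * phi x)).
  apply: (@eq_rint _ _ _ _ _ mOm (fun x => phi x * wdiv Om z x 0 i)) => [x _|]; first by rewrite mulrC.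
  by apply: (@rint_bddM _ _ _ _ _ mOm _ _ M) => //; exact: measurable_funTS.
have zM : exists M, {ae la, forall x, Om x -> frob (z x) <= M} by case: zX => -[].
have izp : la.-integrable Om (EFin \o (fun x => \sum_j z x i j * pderive j phi x)).
  apply: rint_sum => // j _; have [K HK] := zM.
  have [B _ HB] := test_function_bounded (test_function_pderive j tp).
  have mzij : measurable_fun Om (fun x => z x i j) by apply: measurable_entry; case: zX => -[].
  apply: (rint_ae_le mOm (g := fun=> K * B)).
  - by apply: measurable_funM => //; exact: measurable_funTS.
  - by apply: (@rint_bdd _ _ _ _ _ mOm _ `|K * B|).
  - apply: filterS HK => x H Ox; rewrite normrM; apply: ler_pM => //.
    by apply: le_trans (H Ox); exact: ler_entry_frob.
have -> : \int[la]_(x in Om) (frob_ip (wdiv Om z x) (test_vec phi i x) + frob_ip (z x) (test_grad phi i x)) =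
    \int[la]_(x in Om) (wdiv Om z x 0 i * phi x) + \int[la]_(x in Om) (\sum_j z x i j * pderive j phi x).
  rewrite -RintegralD//; apply: eq_Rintegral => x _.
  by rewrite frob_ip_test_vec frob_ip_test_grad.
by move=> /eqP; rewrite addrC addr_eq0 => /eqP.
Qed.

Lemma pairing_green z w : Zset Om A f z -> BVA Om A w -> L2 la Om w ->
  (forall phi, test_function setT phi -> forall i,
    \int[la]_(x in Om) (\sum_j z x i j * pderive j phi x) =
    - (\int[la]_(x in Om) (wdiv Om z x 0 i * phi x))) ->
  pairing Om z w Om = (- (\int[la]_(x in Om) frob_ip (wdiv Om z x) (w x)))%:E.
Proof.
move=> zZ wBV w2 H; have [s [ms s1 mus]] := variation_density (Agrad Om A w).
have [N [mN N0 ia muN _]] := singular_set_exists ms s1 mus.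
have [th [C [_ _ _ _ thG]]] := pairing_value
  wBV w2 ms s1 mus mN N0 ia muN zZ.
exact: thG.
Qed.

Lemma L2_wdiv_ip z w r : X2 Om A z -> L2 la Om r -> L2 la Om w ->
  {ae la, forall x, Om x -> r x = - wdiv Om z x} ->
  - (\int[la]_(x in Om) frob_ip (wdiv Om z x) (w x)) = \int[la]_(x in Om) frob_ip (r x) (w x).
Proof.
move=> zX r2 w2 rz; have [v2 _] := wdiv_spec zX.
have i1 := rint_L2_ip oOm v2 w2; have i2 := rint_L2_ip oOm r2 w2.
rewrite -RintegralN//; apply: ae_eq_Rintegral_in => //.
- by apply: (rint_measurable (mu := la)); exact: rintN.
- exact: (rint_measurable i2).
- by apply: filterS rz => x H Ox; rewrite H// frob_ipNl.
Qed.

Theorem optimality_sufficient (u r : 'rV[R]_n.+1 -> 'rV[R]_m) z :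
  L2 la Om u -> L2 la Om r -> BVA Om A u -> Zset Om A f z ->
  {ae la, forall x, Om x -> r x = - wdiv Om z x} ->
  (exists2 w, is_normal_trace Om z w &
    {ae hausdorff_measure R n.+1 n, forall x, boundary Om x -> w x = 0}) ->
  {ae la, forall x, Om x -> subdiff setT (@frob_ip R m n.+1) (fun y => (f x y)%:E)
    (ac_density la (Agrad Om A u) x) (z x)} ->
  {ae mx_variation (singular_part la (Agrad Om A u)),
    forall x, Om x -> theta Om A z u x = (finfty Om f x
      (polar_density (singular_part la (Agrad Om A u)) x))%:E} ->
  subdiff (L2 la Om) (L2_ip Om) (Fdual Om A f) u r.
Proof.
move=> u2 r2 uBV zZ rz tr0 sub sing; have [zX _] := zZ.
have divz := zero_trace_divergence zX tr0.
have [s [ms s1 mus]] := variation_density (Agrad Om A u).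
have [N [mN N0 ia muN aeN]] := singular_set_exists ms s1 mus.
have val z' zZ' := pairing_value
  uBV u2 ms s1 mus mN N0 ia muN (z := z') zZ'.
have [th [C [[mth thC] [_ thE] [iza thS] [thU thT] _]]] := val z zZ.
have [ic Ec aec] := Zset_conj zZ.
have term w : BVA Om A w -> L2 la Om w ->
    (\int[la]_(x in Om) (- fconjugate f x (z x)) + pairing Om z w Om)%E =
    (- (\int[la]_(x in Om) conj_val z x) + \int[la]_(x in Om) frob_ip (r x) (w x))%:E.
  by move=> wBV w2; rewrite Ec pairing_green// (L2_wdiv_ip zX r2 w2 rz) EFinD EFinN.
set K := - (\int[la]_(x in Om) conj_val z x) + \int[la]_(x in Om) frob_ip (r x) (u x).
have sing' : {ae mx_variation (Agrad Om A u), forall x, N x -> Om x ->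
    theta Om A z u x = (finfty Om f x (s x))%:E}.
  exact/(aeN (fun x y => Om x -> theta Om A z u x = (finfty Om f x y)%:E)).
have Fu : Fdual Om A f u = K%:E.
  rewrite /Fdual asboolT//; apply/eqP; rewrite eq_le; apply/andP; split; last first.
    by rewrite /K -term//; apply: ereal_sup_ubound; exists z.
  apply: ge_ereal_sup => _ [z' zZ' <-]; rewrite /K -term//.
  have [th' [C' [[mth' thC'] [_ thE'] [iza' thS'] [thU' thT'] _]]] := val z' zZ'.
  have [ic' Ec' aec'] := Zset_conj zZ'.
  rewrite Ec Ec' thE// thE'// thS// thS'// !setIid -!EFinD lee_fin !addrA.
  (* The Lebesgue parts compare by equality in Young's inequality for [z]; the parts on [N] compare
     because [th] attains the recession bound there. *)
  apply: lerD.
    rewrite ![- _ + _]addrC -!RintegralB//.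
    apply: ae_le_Rintegral => //; [exact: rintB|exact: rintB|].
    apply: filterS (filterI aec' (filterI aec sub)) => x [h1 [h2 h3]] Ox.
    have {}h1 := h1 Ox; have {}h2 := h2 Ox; have [_ {}h3] := h3 Ox.
    set a := ac_density _ _ x in h3 *.
    have H1 := h1 a.
    have H2 : conj_val z x <= frob_ip (z x) a - f x a.
      have zc : conj_le f x (z x) (frob_ip (z x) a - f x a).
        move=> y; have := h3 y I; rewrite -EFinB lee_fin frob_ipBr; lra.
      have fin := conj_le_fin zc.
      by rewrite -lee_fin /conj_val fineK//; apply/fconjugate_le.
    lra.
  have ith (h : 'rV[R]_n.+1 -> R) c E : measurable_fun setT h -> (forall x, `|h x| <= c) -> measurable E ->
      (mx_variation (Agrad Om A u)).-integrable E (EFin \o h).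
    by move=> mh hc mE; apply: rint_finite_measure mE; [exact: mh|exact: hc].
  have mON : measurable (Om `&` N) by exact: measurableI.
  apply: ae_le_Rintegral => //; [exact: ith mth' thC' mON|exact: ith mth thC mON|].
  apply: filterS (filterI thU' (filterI thT sing')) => x [h1 [h2 h3]] [Ox Nx].
  by have := h3 Nx Ox; rewrite h2 => -[->]; exact: h1.
split=> // w w2; rewrite Fu.
have [wBV|nBV] := pselect (BVA Om A w); last first.
  by rewrite /Fdual asboolF// addye// leey.
have Fw : ((- (\int[la]_(x in Om) conj_val z x) + \int[la]_(x in Om) frob_ip (r x) (w x))%:E <=
    Fdual Om A f w)%E.
  by rewrite -term// /Fdual asboolT//; apply: ereal_sup_ubound; exists z.
rewrite leeBrDr//; apply: le_trans Fw.
rewrite -EFinD lee_fin /L2_ip /K.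
have i1 := rint_L2_ip oOm r2 w2; have i2 := rint_L2_ip oOm r2 u2.
have -> : \int[la]_(x in Om) frob_ip (r x) ((w - u) x) =
   \int[la]_(x in Om) frob_ip (r x) (w x) - \int[la]_(x in Om) frob_ip (r x) (u x).
  by rewrite -RintegralB//; apply: eq_Rintegral => x _; rewrite -frob_ipBr.
by rewrite addrCA subrK.
Qed.

Lemma rint_f_comp G : L1 la Om G -> la.-integrable Om (EFin \o (fun x => f x (G x))).
Proof.
move=> [mG iG]; have mGij i j : measurable_fun Om (fun x => G x i j) by exact: measurable_entry.
apply: (rint_le mOm (g := fun x => C0 * (1 + frob (G x)))).
- exact: (measurable_f_comp oOm A_sym A_idem f_cont f_conv C0_gt0 f_gr).
- move=> x Ox; rewrite ger0_norm ?f_ge0//; last exact: Ocl.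
  have /andP[_ H] := f_gr (G x) (Ocl Ox); apply: le_trans H _.
  by rewrite ler_pM2l// lerD2l; exact: (frob_proj_le A_sym A_idem).
- apply: rintZ => //; apply: rintD => //.
  by apply: (@rint_bdd _ _ _ _ _ mOm _ 1) => // x _; rewrite normr1.
Qed.

(** For Sobolev [w] the measure A w has the density A G, so every term in the definition of [Fdual]
    is the integral of [z : A G] minus the conjugate, at most [f x (A G) = f x G]. *)
Theorem sobolev_value w G : L1 la Om w -> L2 la Om w -> L1 la Om G -> is_wgrad Om w G ->
  BVA Om A w /\ (Fdual Om A f w <= (\int[la]_(x in Om) f x (G x))%:E)%E.
Proof.
move=> w1 w2 G1 wG.
have iG i j := L1_entry oOm i j G1.
have iAG i j : la.-integrable Om (EFin \o (fun x => A (G x) i j)).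
  apply: (@eq_rint _ _ _ _ _ mOm (fun x => \sum_k \sum_l A (delta_mx k l) i j * G x k l)).
    by move=> x _; rewrite linear_entries; do 2!(apply: eq_bigr => ? _); rewrite mulrC.
  by apply: rint_sum => // k _; apply: rint_sum => // l _; exact: rintZ.
pose AG := zext Om (fun x => A (G x)).
have iAGT i j : la.-integrable setT (EFin \o (fun x => AG x i j)).
  apply: (rint_zext oOm (iAG i j)) => x Ox; first by rewrite /AG zextE.
  by rewrite /AG zext0// mxE.
have AGint i j phi : test_function Om phi ->
    \int[la]_(x in Om) (phi x * A (G x) i j) = A (\matrix_(k, l) - \int[la]_(x in Om) (w x 0 k * pderive l phi x)) i j.
  move=> tp; have [M _ pM] := test_function_bounded tp; have [sp _ _] := tp.
  have mp : measurable_fun Om phi by exact: smooth_measurable.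
  have ip k l : la.-integrable Om (EFin \o (fun x => G x k l * phi x)).
    apply: (@eq_rint _ _ _ _ _ mOm (fun x => phi x * G x k l)) => [x _|]; first by rewrite mulrC.
    exact: (@rint_bddM _ _ _ _ _ mOm _ _ M).
  rewrite linear_entries.
  transitivity (\int[la]_(x in Om) (\sum_k \sum_l A (delta_mx k l) i j * (G x k l * phi x))).
    apply: eq_Rintegral => x _; rewrite linear_entries mulr_sumr; apply: eq_bigr => k _.
    by rewrite mulr_sumr; apply: eq_bigr => l _; ring.
  rewrite (Rintegral_sum mOm); last by move=> k _; apply: rint_sum => // l _; exact: rintZ.
  apply: eq_bigr => k _; rewrite (Rintegral_sum mOm); last by move=> l _; exact: rintZ.
  by apply: eq_bigr => l _; rewrite RintegralZl// mxE wG// opprK mulrC.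
pose mu0 : mx_charge 'rV[R]_n.+1 R m n.+1 := fun i j => induced_charge (iAGT i j).
have mu0P : is_Agrad Om A w mu0.
  split=> [i j E mE EO|phi tp].
    rewrite /mu0/= /induced_charge (eq_integral (cst 0%E)) ?integral0// => x /set_mem Ex.
    by rewrite /= /AG zext0 ?mxE// => Ox; have : (E `&` Om) x by []; rewrite EO.
  apply/matrixP => i j; rewrite mxE -AGint//.
  have [M _ pM] := test_function_bounded tp; have [sp _ _] := tp.
  rewrite (@charge_integral_density _ _ _ (mu0 i j) la (fun x => AG x i j) phi M)//; last first.
    exact: smooth_measurable.
  rewrite (@Rintegral_supp _ _ Om); last by move=> x nO; rewrite /AG zext0// mxE mulr0.
  by apply: eq_Rintegral => x /set_mem Ox; rewrite /AG zextE.
have wBV : BVA Om A w by split=> //; exists mu0.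
have [cmu Hmu] := Agrad_spec wBV.
have muE i j E : measurable E -> Agrad Om A w i j E = (\int[la]_(x in E) (AG x i j)%:E)%E.
  move=> mE; rewrite (charge_eq_density oOm (cmu i j) Omfin (iAG i j))//; last first.
    by move=> phi tp; have /matrixP/(_ i j) := Hmu phi tp; rewrite mxE => ->; rewrite AGint.
  rewrite -RintegralE//; last by apply: (integrableS measurableT).
  congr EFin; rewrite [LHS]Rintegral_mkcond [RHS]Rintegral_mkcond; apply: eq_Rintegral => x _.
  rewrite !patchE in_setI; case: (x \in E) => //=; case: (boolP (x \in Om)) => [/set_mem Ox|].
    by rewrite /AG zextE.
  by rewrite notin_setE => nO; rewrite /AG zext0// mxE.
split=> //; rewrite /Fdual asboolT//; apply: ge_ereal_sup => _ [z zZ <-].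
have [zX _] := zZ; have [ic Ec aec] := Zset_conj zZ.
have [s [ms s1 mus]] := variation_density (Agrad Om A w).
have zP : {ae la, forall x, Om x -> True} by apply: aeW.
have [th [C [mth thC [_ thE] [thA _ _]]]] := @pairing_package _ _ _ _ oOm bOm lOm Omfin A A_sym z w zX w2 wBV
    (fun x Y => True) zP s ms s1 mus.
have -> : pairing Om z w Om = (\int[la]_(x in Om) frob_ip (z x) (A (G x)))%:E.
  rewrite thE//; congr EFin; rewrite (thA AG)//; last by move=> i j F mF _; exact: muE.
  by rewrite setIid; apply: eq_Rintegral => x /set_mem Ox; rewrite /AG zextE.
have mzij i j : measurable_fun Om (fun x => z x i j) by apply: measurable_entry; case: zX => -[].
have izG : la.-integrable Om (EFin \o (fun x => frob_ip (z x) (A (G x)))).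
  have [M HM] : exists M, {ae la, forall x, Om x -> frob (z x) <= M} by case: zX => -[].
  apply: (rint_ae_le mOm (g := fun x => M * \sum_i \sum_j `|A (G x) i j|)).
  - by apply: measurable_frob_ip => // i j; exact: (rint_measurable (iAG i j)).
  - apply: rintZ => //; apply: rint_sum => // i _; apply: rint_sum => // j _.
    exact: rint_norm.
  - apply: filterS HM => x H Ox; apply: le_trans (frob_cauchy_schwarz_norm _ _) _.
    by apply: ler_pM; rewrite ?frob_ge0//; [exact: H|exact: frob_le_sum].
rewrite Ec -EFinD lee_fin addrC -RintegralB//.
apply: ae_le_Rintegral => //; [exact: rintB|exact: rint_f_comp|].
apply: filterS aec => x H Ox; have := H Ox (A (G x)).
by rewrite (f_proj A_sym A_idem f_conv f_gr _ (Ocl Ox)); lra.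
Qed.

Let L1_0 : L1 la Om (fun=> 0 : 'M[R]_(m, n.+1)).
Proof.
apply: L1_entries => // i j; apply: (@eq_rint _ _ _ _ _ mOm (fun=> 0)); first by move=> x _; rewrite mxE.
exact: rint0.
Qed.

Lemma L1_lin k l (t : R) (G H : 'rV[R]_n.+1 -> 'M[R]_(k, l)) : L1 la Om G -> L1 la Om H ->
  L1 la Om (fun x => t *: G x + H x).
Proof.
move=> G1 H1; apply: L1_entries => // i j.
apply: (@eq_rint _ _ _ _ _ mOm (fun x => t * G x i j + H x i j)).
  by move=> x _; rewrite !mxE.
by apply: rintD => //; [apply: rintZ => //|]; exact: L1_entry.
Qed.

(** The growth of [f] bounds [L (t G)] by [t C0 int |G|] plus a constant; letting [t] grow removes
    the constant and leaves continuity on L^1. The representation is then made entry by entry. *)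
Lemma dominated_functional_repr (L : ('rV[R]_n.+1 -> 'M[R]_(m, n.+1)) -> R) (c : R) :
  (forall t G H, L1 la Om G -> L1 la Om H -> L (fun x => t *: G x + H x) = t * L G + L H) ->
  (forall G, L1 la Om G -> L G <= \int[la]_(x in Om) f x (G x) + c) ->
  exists z : 'rV[R]_n.+1 -> 'M[R]_(m, n.+1), [/\ forall i j, measurable_fun setT (fun x => z x i j),
    forall x i j, `|z x i j| <= C0 &
    forall G, L1 la Om G -> L G = \int[la]_(x in Om) frob_ip (z x) (G x)].
Proof.
move=> L_lin L_le.
have L0 : L (fun=> 0) = 0.
  have := L_lin (-1) _ _ L1_0 L1_0; rewrite (_ : (fun _ => _) = (fun=> 0)); last first.
    by apply/funext => x; rewrite scaler0 addr0.
  by rewrite mulN1r addNr.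
have LZ t G : L1 la Om G -> L (fun x => t *: G x) = t * L G.
  move=> G1; have := L_lin t _ _ G1 L1_0; rewrite L0 addr0 => <-.
  by congr L; apply/funext => x; rewrite addr0.
have L_bd G : L1 la Om G -> L G <= C0 * \int[la]_(x in Om) frob (G x).
  move=> G1; have [mG iG] := G1; rewrite -subr_le0.
  apply: (@le0_bounded_slope _ _ (C0 * fine (la Om) + c)) => t t0.
  have tG1 : L1 la Om (fun x => t *: G x).
    have := L1_lin t G1 L1_0; rewrite (_ : (fun x => t *: G x + 0) = (fun x => t *: G x))//.
    by apply/funext => x; rewrite addr0.
  have := L_le _ tG1; rewrite LZ// => H.
  have i1 : la.-integrable Om (EFin \o (fun=> C0)) by apply: (@rint_bdd _ _ _ _ _ mOm _ `|C0|).
  have i2 : la.-integrable Om (EFin \o (fun x => (C0 * t) * frob (G x))) by exact: rintZ.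
  have H2 : \int[la]_(x in Om) f x (t *: G x) <= \int[la]_(x in Om) (C0 + (C0 * t) * frob (G x)).
    apply: le_Rintegral => //.
    - exact: (rint_f_comp tG1).
    - exact: rintD.
    - move=> x Ox; have /andP[_ H2] := f_gr (t *: G x) (Ocl Ox); apply: le_trans H2 _.
      rewrite mulrDr mulr1 lerD2l -mulrA ler_pM2l// linearZ/= frobZ (gtr0_norm t0) ler_pM2l//.
      exact: (frob_proj_le A_sym A_idem).
  move: H2; rewrite RintegralD// Rintegral_cst// RintegralZl// => H2.
  have := le_trans H (lerD H2 (lexx c)).
  set I1 := \int[la]_(x in Om) frob (G x); rewrite mulrBr lerBlDr mulrA (mulrC t C0).
  by rewrite addrAC.
have dG1 g i j : la.-integrable Om (EFin \o g) -> L1 la Om (fun x => g x *: (delta_mx i j : 'M[R]_(m, n.+1))).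
  move=> ig; apply: L1_entries => // k l.
  apply: (@eq_rint _ _ _ _ _ mOm (fun x => (delta_mx i j : 'M[R]_(m, n.+1)) k l * g x)).
    by move=> x _; rewrite [in RHS]mxE mulrC.
  exact: rintZ.
pose Lij i j (g : 'rV[R]_n.+1 -> R) := L (fun x => g x *: delta_mx i j).
have frob_delta i j : frob (delta_mx i j : 'M[R]_(m, n.+1)) = 1.
  by rewrite /frob frob_ip_delta mxE !eqxx sqrtr1.
have /choice[zz Hz] : forall ij : 'I_m * 'I_n.+1, exists g : 'rV[R]_n.+1 -> R,
   [/\ measurable_fun setT g, (forall x, `|g x| <= C0) &
    forall h, la.-integrable Om (EFin \o h) -> Lij ij.1 ij.2 h = \int[la]_(x in Om) (h x * g x)].
  move=> [i j] /=; apply: (L1_functional_repr mOm Omfin (ltW C0_gt0)).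
  - move=> t g h ig ih; rewrite /Lij -L_lin//; try exact: dG1.
    by congr L; apply/funext => x; rewrite scalerDl scalerA.
  - have one h : la.-integrable Om (EFin \o h) -> Lij i j h <= C0 * \int[la]_(x in Om) `|h x|.
      move=> ih; apply: le_trans (L_bd _ (dG1 _ i j ih)) _.
      rewrite ler_pM2l// le_eqVlt; apply/orP; left; apply/eqP; apply: eq_Rintegral => x _.
      by rewrite frobZ frob_delta mulr1.
    move=> h ih; rewrite ler_norml one// andbT lerNl.
    have := one _ (rintN ih); under eq_Rintegral do rewrite normrN.
    rewrite /Lij (_ : (fun x => - h x *: delta_mx i j) = (fun x => -1 *: (h x *: delta_mx i j))).
      by rewrite LZ ?mulN1r//; exact: dG1.
    by apply/funext => x; rewrite scalerA mulN1r.
pose z x : 'M[R]_(m, n.+1) := \matrix_(i, j) zz (i, j) x.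
exists z; split.
- by move=> i j; under eq_fun do rewrite mxE; case: (Hz (i, j)).
- by move=> x i j; rewrite mxE; case: (Hz (i, j)).
- move=> G G1; have iG i j := L1_entry oOm i j G1.
  have Lsum (I : Type) (r : seq I) (F : I -> 'rV[R]_n.+1 -> 'M[R]_(m, n.+1)) : (forall k, L1 la Om (F k)) ->
      L (fun x => \sum_(k <- r) F k x) = \sum_(k <- r) L (F k) /\ L1 la Om (fun x => \sum_(k <- r) F k x).
    move=> HF; elim: r => [|k r [IH1 IH2]].
      rewrite big_nil (_ : (fun _ => _) = (fun=> 0))//.
      by apply/funext => x; rewrite big_nil.
    have E : (fun x => \sum_(k <- k :: r) F k x) = (fun x => 1 *: F k x + \sum_(k <- r) F k x).
      by apply/funext => x; rewrite big_cons scale1r.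
    by rewrite E big_cons L_lin// IH1 mul1r; split => //; exact: L1_lin.
  have iz i j h : la.-integrable Om (EFin \o h) -> la.-integrable Om (EFin \o (fun x => h x * z x i j)).
    move=> ih; apply: (@eq_rint _ _ _ _ _ mOm (fun x => z x i j * h x)) => [x _|]; first by rewrite mulrC.
    apply: (@rint_bddM _ _ _ _ _ mOm _ _ C0) => //.
      apply: measurable_funTS; under eq_fun do rewrite mxE; by case: (Hz (i, j)).
    by move=> x _; rewrite mxE; case: (Hz (i, j)).
  have -> : G = (fun x => \sum_i \sum_j G x i j *: delta_mx i j).
    by apply/funext => x; rewrite {1}(matrix_sum_delta (G x)).
  have row1 i := Lsum _ (index_enum 'I_n.+1) (fun j x => G x i j *: delta_mx i j) (fun j => dG1 _ i j (iG i j)).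
  have [-> _] := Lsum _ (index_enum 'I_m) (fun i x => \sum_j G x i j *: delta_mx i j) (fun i => (row1 i).2).
  transitivity (\sum_i \sum_j \int[la]_(x in Om) (G x i j * z x i j)).
    apply: eq_bigr => i _; rewrite (row1 i).1.
    apply: eq_bigr => j _; case: (Hz (i, j)) => _ _ /(_ _ (iG i j)) /= H; rewrite /Lij in H; rewrite H.
    by apply: eq_Rintegral => x _; rewrite mxE.
  transitivity (\sum_i \int[la]_(x in Om) \sum_j (G x i j * z x i j)).
    by apply: eq_bigr => i _; rewrite (Rintegral_sum mOm)// => j _; apply: iz; exact: iG.
  rewrite -(Rintegral_sum mOm); last by move=> i _; apply: rint_sum => // j _; apply: iz; exact: iG.
  apply: eq_Rintegral => x _; rewrite -(matrix_sum_delta (G x)) frob_ipC.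
  by [].
Qed.

(** The supremum defining the conjugate is approached by selecting at each point the best among
    finitely many constants. These selections are bounded and measurable, hence admissible, and
    increase the integrand monotonically to the conjugate. *)
Lemma conjugate_integral_le (z : 'rV[R]_n.+1 -> 'M[R]_(m, n.+1)) (c : R) :
  (forall i j, measurable_fun setT (fun x => z x i j)) -> (forall x i j, `|z x i j| <= C0) ->
  (forall G, L1 la Om G -> \int[la]_(x in Om) frob_ip (z x) (G x) <= \int[la]_(x in Om) f x (G x) + c) ->
  la.-integrable Om (fun x => fconjugate f x (z x)) /\
  (\int[la]_(x in Om) fconjugate f x (z x) <= c%:E)%E.
Proof.
move=> mz zC zG; have [q [q0 Hq]] := fconjugate_seq A_sym A_idem f_conv C0_gt0 f_gr.
have mzO i j : measurable_fun Om (fun x => z x i j) by exact: measurable_funTS.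
pose val (y : 'M[R]_(m, n.+1)) x := frob_ip (z x) y - f x y.
pose sel := fix sel k (x : 'rV[R]_n.+1) : 'M[R]_(m, n.+1) := if k is k'.+1 then
  (if val (sel k' x) x < val (q k) x then q k else sel k' x) else q 0%N.
have mval (G : 'rV[R]_n.+1 -> 'M[R]_(m, n.+1)) : (forall i j, measurable_fun Om (fun x => G x i j)) -> measurable_fun Om (fun x => val (G x) x).
  move=> mG; apply: measurable_funB; first exact: measurable_frob_ip.
  exact: (measurable_f_comp oOm A_sym A_idem f_cont f_conv C0_gt0 f_gr mG).
have mcst (y : 'M[R]_(m, n.+1)) i j : measurable_fun Om (fun _ : 'rV[R]_n.+1 => y i j) by exact: measurable_cst.
have msel k i j : measurable_fun Om (fun x => sel k x i j).
  elim: k i j => [|k IH] i j /=; first exact: mcst.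
  rewrite (_ : (fun x => _) = (fun x => if val (sel k x) x < val (q k.+1) x then q k.+1 i j else sel k x i j)).
    apply: measurable_fun_if => //.
    - by apply: measurable_fun_ltr; apply: mval => // i' j'; exact: mcst.
    - by apply: measurable_funS (IH i j) => // x [].
  by apply/funext => x; case: ifP.
have sel_bd k : exists B, forall x i j, `|sel k x i j| <= B.
  elim: k => [|k [B HB]] /=; first by exists (frob (q 0%N)) => x i j; exact: ler_entry_frob.
  exists (Num.max B (frob (q k.+1))) => x i j; case: ifP => _.
    by rewrite le_max ler_entry_frob orbT.
  by rewrite le_max HB.
have sel1 k : L1 la Om (sel k).
  have [B HB] := sel_bd k; apply: L1_entries => // i j.
  by apply: (@rint_bdd _ _ _ _ _ mOm _ B).
have val_sel k x i : (i <= k)%N -> val (q i) x <= val (sel k x) x.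
  elim: k => [|k IH] ik; first by move: ik; rewrite leqn0 => /eqP ->.
  move: ik; rewrite leq_eqVlt => /orP[/eqP ->|]; rewrite /=; first by case: ltP.
  by rewrite ltnS => /IH H; case: ltP => // H'; apply: le_trans H (ltW H').
(* The shift by [C0] makes the sequence nonnegative: the selection is at least as good as the
   constant [q 0 = 0], whose value is [- f x 0 >= - C0]. *)
pose h k x : \bar R := (val (sel k x) x + C0)%:E.
have h0 k x : Om x -> (0 <= h k x)%E.
  move=> Ox; rewrite lee_fin; have := val_sel k x 0%N (leq0n k); rewrite q0 /val frob_ip0r.
  by have := f0_le f_gr (Ocl Ox); lra.
have hmono x : {homo h ^~ x : a b / (a <= b)%N >-> (a <= b)%E}.
  apply: homo_leq; [by move=> ?; exact: lexx|by move=> a b d; exact: le_trans|move=> k].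
  by rewrite lee_fin lerD2r /=; case: ltP => // /ltW.
have mh k : measurable_fun Om (h k).
  by apply/measurable_EFinP; apply: measurable_funD => //; exact: mval.
have hlim x : Om x -> (fconjugate f x (z x) + C0%:E)%E = limn (h ^~ x).
  move=> Ox; apply/esym/cvg_lim => //.
  have -> : (fconjugate f x (z x) + C0%:E)%E = ereal_sup (range (h ^~ x)).
    apply/eqP; rewrite eq_le; apply/andP; split.
      rewrite -leeBrDr// Hq; last exact: Ocl.
      apply: ge_ereal_sup => _ [i _ <-]; rewrite leeBrDr//.
      apply: (@le_trans _ _ (h i x)); last by apply: ereal_sup_ubound; exists i.
      by rewrite -EFinD lee_fin lerD2r; exact: val_sel.
    apply: ge_ereal_sup => _ [k _ <-]; rewrite /h EFinD leeD2r//; exact: fconjugate_ge.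
  exact: ereal_nondecreasing_cvgn.
have izsel k : la.-integrable Om (EFin \o (fun x => frob_ip (z x) (sel k x))).
  have [B HB] := sel_bd k; apply: (@rint_bdd _ _ _ _ _ mOm _ (\sum_(i < m) \sum_(j < n.+1) C0 * B)) => //.
    exact: measurable_frob_ip.
  move=> x _; apply: le_trans (ler_norm_sum _ _ _) _; apply: ler_sum => i _.
  apply: le_trans (ler_norm_sum _ _ _) _; apply: ler_sum => j _.
  by rewrite normrM ler_pM.
have ifsel k := rint_f_comp (sel1 k).
have i1 : la.-integrable Om (EFin \o (fun=> C0)) by apply: (@rint_bdd _ _ _ _ _ mOm _ `|C0|).
have hle k : (\int[la]_(x in Om) h k x <= (c + C0 * fine (la Om))%:E)%E.
  rewrite -RintegralE//; last by apply: rintD => //; exact: rintB.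
  rewrite lee_fin RintegralD//; last exact: rintB.
  by rewrite Rintegral_cst// lerD2r RintegralB// lerBlDl; exact: zG.
have Ile : (\int[la]_(x in Om) (fconjugate f x (z x) + C0%:E) <= (c + C0 * fine (la Om))%:E)%E.
  rewrite (eq_integral (fun x => limn (h ^~ x))); last by move=> x /set_mem; exact: hlim.
  rewrite monotone_convergence//.
  apply: lime_le; last exact: nearW.
  apply: ereal_nondecreasing_is_cvgn => a b ab; apply: ge0_le_integral => //.
  - by move=> x Ox; exact: h0.
  - by move=> x Ox; exact: hmono.
have mF : measurable_fun Om (fun x => fconjugate f x (z x)).
  exact: (measurable_fconjugate oOm A_sym A_idem f_cont f_conv C0_gt0 f_gr).
have F0 x : Om x -> (0 <= fconjugate f x (z x) + C0%:E)%E.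
  move=> Ox; rewrite hlim//; apply: lime_ge; last by apply: nearW => k; exact: h0.
  by apply: ereal_nondecreasing_is_cvgn => a b; exact: hmono.
have mF1 : measurable_fun Om (fun x => (fconjugate f x (z x) + C0%:E)%E).
  by apply: emeasurable_funD => //; exact: measurable_cst.
have iF1 : la.-integrable Om (fun x => (fconjugate f x (z x) + C0%:E)%E).
  apply/integrableP; split => //; rewrite (eq_integral (fun x => fconjugate f x (z x) + C0%:E)%E).
    by apply: le_lt_trans Ile _; rewrite ltry.
  by move=> x /set_mem Ox; rewrite gee0_abs//; exact: F0.
have iF : la.-integrable Om (fun x => fconjugate f x (z x)).
  have := integrableB mOm iF1 i1; apply: eq_integrable => // x _ /=.
  by rewrite addeK.
split=> //.
move: Ile; rewrite integralD//.
have -> : (\int[la]_(_ in Om) C0%:E)%E = (C0 * fine (la Om))%:E.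
  by rewrite -RintegralE// Rintegral_cst.
by rewrite EFinD leeD2rE.
Qed.

Lemma L2_lin (t : R) (w w' : 'rV[R]_n.+1 -> 'rV[R]_m) : L2 la Om w -> L2 la Om w' ->
  L2 la Om (fun x => t *: w x + w' x).
Proof.
move=> [mw iw] [mw' iw'].
have mij i j : measurable_fun Om (fun x => (t *: w x + w' x) i j).
  under eq_fun do rewrite !mxE.
  apply: measurable_funD; last exact: measurable_entry.
  by apply: measurable_funM; [exact: measurable_cst|exact: measurable_entry].
split; first exact: measurable_fun_mx_in.
apply: (rint_le mOm (g := fun x => (2 * t ^+ 2) * frob (w x) ^+ 2 + 2 * frob (w' x) ^+ 2)).
- by apply: measurable_funX; exact: measurable_frob.
- move=> x _; rewrite ger0_norm ?sqr_ge0//.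
  have H := ler_frobD (t *: w x) (w' x); rewrite frobZ in H.
  have := frob_ge0 (t *: w x + w' x); have := frob_ge0 (w x); have := frob_ge0 (w' x).
  have := normr_ge0 t; rewrite -(real_normK (num_real t)).
  move: H; move: (frob _) (frob (w x)) (frob (w' x)) `|t| => p q q' t' H t0 q'0 q0 p0.
  have : p ^+ 2 <= (t' * q + q') ^+ 2 by rewrite lerXn2r// nnegrE addr_ge0// mulr_ge0.
  by have := sqr_ge0 (t' * q - q'); nra.
- by apply: rintD => //; exact: rintZ.
Qed.

Lemma is_wgrad_lin (t : R) (w w' : 'rV[R]_n.+1 -> 'rV[R]_m) (G H : 'rV[R]_n.+1 -> 'M[R]_(m, n.+1)) :
  L1 la Om w -> L1 la Om w' -> L1 la Om G -> L1 la Om H -> is_wgrad Om w G -> is_wgrad Om w' H ->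
  is_wgrad Om (fun x => t *: w x + w' x) (fun x => t *: G x + H x).
Proof.
move=> w1 w'1 G1 H1 wG wH phi tp i j.
have bdM (g psi : 'rV[R]_n.+1 -> R) : la.-integrable Om (EFin \o g) -> test_function Om psi ->
    la.-integrable Om (EFin \o (fun x => g x * psi x)).
  move=> ig tpsi; have [M _ pM] := test_function_bounded tpsi; have [sp _ _] := tpsi.
  apply: (@eq_rint _ _ _ _ _ mOm (fun x => psi x * g x)) => [x _|]; first by rewrite mulrC.
  by apply: (@rint_bddM _ _ _ _ _ mOm _ _ M) => //; exact: smooth_measurable.
have lin (g h psi : 'rV[R]_n.+1 -> R) : la.-integrable Om (EFin \o g) -> la.-integrable Om (EFin \o h) ->
    test_function Om psi -> \int[la]_(x in Om) ((t * g x + h x) * psi x) =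
    t * \int[la]_(x in Om) (g x * psi x) + \int[la]_(x in Om) (h x * psi x).
  move=> ig ih tpsi; have i1 := bdM _ _ ig tpsi; have i2 := bdM _ _ ih tpsi.
  rewrite -RintegralZl// -RintegralD//; last exact: rintZ.
  by apply: eq_Rintegral => x _; ring.
have tpj := test_function_pderive j tp.
have iw := L1_entry oOm 0 i w1; have iw' := L1_entry oOm 0 i w'1.
have iG := L1_entry oOm i j G1; have iH := L1_entry oOm i j H1.
have -> : \int[la]_(x in Om) ((t *: w x + w' x) 0 i * pderive j phi x) =
    \int[la]_(x in Om) ((t * w x 0 i + w' x 0 i) * pderive j phi x).
  by apply: eq_Rintegral => x _; rewrite !mxE.
have -> : \int[la]_(x in Om) ((t *: G x + H x) i j * phi x) =
    \int[la]_(x in Om) ((t * G x i j + H x i j) * phi x).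
  by apply: eq_Rintegral => x _; rewrite !mxE.
by rewrite !lin// wG// wH// mulrN -opprD.
Qed.

(** The functional [int r . w] depends on [w] only through its gradient and is dominated by the
    convex integral plus [c]. The extended functional yields [z], and the constant [c] is exactly
    what makes the value of [z] at [u] reach [Fdual u]. *)
Theorem subdiff_maximizer (u r : 'rV[R]_n.+1 -> 'rV[R]_m) : L2 la Om u -> L2 la Om r ->
  subdiff (L2 la Om) (L2_ip Om) (Fdual Om A f) u r ->
  BVA Om A u /\ exists z : 'rV[R]_n.+1 -> 'M[R]_(m, n.+1),
  [/\ Zset Om A f z, {ae la, forall x, Om x -> r x = - wdiv Om z x},
    is_normal_trace Om z (fun=> 0) &
    forall z', Zset Om A f z' ->
      (\int[la]_(x in Om) (- fconjugate f x (z' x)) + pairing Om z' u Om <=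
       \int[la]_(x in Om) (- fconjugate f x (z x)) + pairing Om z u Om)%E].
Proof.
move=> u2 r2 [_ sub].
(* The inequality at [w = u] forces finiteness, because the difference of two equal infinite values
   is [-oo]. *)
have [K FuK] : exists K, Fdual Om A f u = K%:E.
  have := sub _ u2; case: (Fdual Om A f u) => [K|//|//] _; by exists K.
have uBV : BVA Om A u.
  by apply: contrapT => nBV; move: FuK; rewrite /Fdual asboolF.
split=> //.
pose c := \int[la]_(x in Om) frob_ip (r x) (u x) - K.
have iru := rint_L2_ip oOm r2 u2.
have key w G : L1 la Om w -> L2 la Om w -> L1 la Om G -> is_wgrad Om w G ->
    \int[la]_(x in Om) frob_ip (r x) (w x) <= \int[la]_(x in Om) f x (G x) + c.
  move=> w1 w2 G1 wG; have irw := rint_L2_ip oOm r2 w2.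
  have [_ Fw] := sobolev_value w1 w2 G1 wG.
  have := sub _ w2; rewrite FuK leeBrDr// -EFinD => /le_trans/(_ Fw); rewrite lee_fin /L2_ip.
  have -> : \int[la]_(x in Om) frob_ip (r x) ((w - u) x) =
     \int[la]_(x in Om) frob_ip (r x) (w x) - \int[la]_(x in Om) frob_ip (r x) (u x).
    by rewrite -RintegralB//; apply: eq_Rintegral => x _; rewrite -frob_ipBr.
  by rewrite /c; lra.
have iF G (G1 : L1 la Om G) := rint_f_comp G1.
(* A relation on gradients, since [w] is not determined by its gradient; domination makes it
   single-valued, in particular [int r . w] vanishes for [w] of zero gradient. *)
pose Gr : set (('rV[R]_n.+1 -> 'M[R]_(m, n.+1)) * R) := [set GS | exists w,
  [/\ L1 la Om w, L2 la Om w, L1 la Om GS.1, is_wgrad Om w GS.1 &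
      GS.2 = \int[la]_(x in Om) frob_ip (r x) (w x)]].
have z1 k : L1 la Om (fun=> 0 : 'M[R]_(k, n.+1)).
  apply: L1_entries => // i j; apply: (@eq_rint _ _ _ _ _ mOm (fun=> 0)); first by move=> x _; rewrite mxE.
  exact: rint0.
have [|||||L [L_lin L_le L_gr]] := @hahn_banach_graph R ('rV[R]_n.+1 -> 'M[R]_(m, n.+1))
    [set G | L1 la Om G] (fun G => \int[la]_(x in Om) f x (G x) + c) _ _ Gr.
- by move=> t G H G1 H1; exact: (L1_lin t G1 H1).
- move=> G H t G1 H1 t0 t1.
  have GH1 : L1 la Om (fun x => t *: G x + (1 - t) *: H x).
    have H1' := L1_lin (1 - t) H1 (z1 m).
    have := L1_lin t G1 H1'; congr (L1 _ _ _).
    by apply/funext => x; rewrite addr0.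
  have ig := iF _ G1; have ih := iF _ H1; have igh := iF _ GH1.
  have : \int[la]_(x in Om) f x (t *: G x + (1 - t) *: H x) <=
      \int[la]_(x in Om) (t * f x (G x) + (1 - t) * f x (H x)).
    apply: le_Rintegral => //; first by apply: rintD => //; exact: rintZ.
    by move=> x Ox; apply: f_conv => //; exact: Ocl.
  rewrite RintegralD//; [|exact: rintZ|exact: rintZ].
  rewrite RintegralZl// RintegralZl//.
  have -> : \int[la]_(x in Om) f x ((t *: G + (1 - t) *: H) x) =
    \int[la]_(x in Om) f x (t *: G x + (1 - t) *: H x) by [].
  move: (\int[la]_(x in Om) _) (\int[la]_(x in Om) f x (G x)) (\int[la]_(x in Om) f x (H x)) => p q q'.
  by lra.
- have w1 : L1 la Om (fun=> 0 : 'rV[R]_m).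
    apply: L1_entries => // i j; apply: (@eq_rint _ _ _ _ _ mOm (fun=> 0)); first by move=> x _; rewrite mxE.
    exact: rint0.
  exists (fun=> 0); split => //.
  + split; first exact: measurable_cst.
    apply: (@eq_rint _ _ _ _ _ mOm (fun=> 0)); last exact: rint0.
    by move=> x _; rewrite /frob frob_ip0l sqrtr0 expr0n.
  + move=> phi _ i j; rewrite /= (_ : (fun x => _) = (fun=> 0)); last by apply/funext => x; rewrite mxE mul0r.
    rewrite [in RHS](_ : (fun x => _) = (fun=> 0)) ?Rintegral_cst ?mul0r ?oppr0//.
    by apply/funext => x; rewrite mxE mul0r.
  + rewrite /= (_ : (fun x => _) = (fun=> 0)) ?Rintegral_cst ?mul0r//.
    by apply/funext => x; rewrite frob_ip0r.
- move=> t G s H s' [w [w1 w2 G1 wG /= ->]] [w' [w'1 w'2 H1 wH /= ->]] /=.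
  exists (fun x => t *: w x + w' x); split.
  + exact: (L1_lin t w1 w'1).
  + exact: L2_lin.
  + exact: (L1_lin t G1 H1).
  + exact: is_wgrad_lin.
  + have i1 := rint_L2_ip oOm r2 w2; have i2 := rint_L2_ip oOm r2 w'2.
    rewrite -RintegralZl// -RintegralD//; last exact: rintZ.
    by apply: eq_Rintegral => x _; rewrite frob_ipDr frob_ipZr.
- by move=> G s [w [w1 w2 G1 wG /= ->]]; split => //; exact: key.
have [z [mz zC Lz]] := dominated_functional_repr
  L_lin L_le.
have zG w G : L1 la Om w -> L2 la Om w -> L1 la Om G -> is_wgrad Om w G ->
    \int[la]_(x in Om) frob_ip (z x) (G x) = \int[la]_(x in Om) frob_ip (r x) (w x).
  by move=> w1 w2 G1 wG; rewrite -Lz//; apply: L_gr; exists w.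
have zLe G : L1 la Om G -> \int[la]_(x in Om) frob_ip (z x) (G x) <= \int[la]_(x in Om) f x (G x) + c.
  by move=> G1; rewrite -Lz//; exact: L_le.
have [iconj conjc] := conjugate_integral_le mz zC zLe.
have test_setT phi : test_function Om phi -> test_function setT phi.
  by move=> [sp cp _]; split => // x _.
have divz phi i : test_function setT phi ->
    \int[la]_(x in Om) (\sum_j z x i j * pderive j phi x) = \int[la]_(x in Om) (r x 0 i * phi x).
  move=> tp; have [v1 v2 G1 vG] := test_sobolev i tp.
  have := zG _ _ v1 v2 G1 vG.
  by under eq_Rintegral do rewrite frob_ip_test_grad; under [in RHS]eq_Rintegral do rewrite frob_ip_test_vec.
have r2N : L2 la Om (fun x => - r x).
  have z2 : L2 la Om (fun=> 0 : 'rV[R]_m).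
    split; first exact: measurable_cst.
    apply: (@eq_rint _ _ _ _ _ mOm (fun=> 0)); last exact: rint0.
    by move=> x _; rewrite /frob frob_ip0l sqrtr0 expr0n.
  have := L2_lin (-1) r2 z2; congr (L2 _ _ _).
  by apply/funext => x; rewrite addr0 scaleN1r.
have zdiv : is_wdiv Om z (fun x => - r x).
  move=> phi tp i; rewrite divz; last exact: test_setT.
  have ir := L1_entry oOm 0 i (L2_L1 oOm Omfin r2).
  have [M _ pM] := test_function_bounded tp; have [sp _ _] := tp.
  rewrite -RintegralN//; last first.
    apply: (@eq_rint _ _ _ _ _ mOm (fun x => phi x * (- r x 0 i))) => [x _|]; first by rewrite mxE mulrC.
    apply: (@rint_bddM _ _ _ _ _ mOm _ _ M) => //; [exact: rintN|exact: smooth_measurable].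
  by apply: eq_Rintegral => x _; rewrite mxE mulNr opprK.
have zX : X2 Om A z.
  split; last by exists (fun x => - r x).
  - split; first by apply: measurable_funTS; exact: measurable_fun_mx.
    exists (\sum_(i < m) \sum_(j < n.+1) C0); apply: aeW => x _; apply: le_trans (frob_le_sum _) _.
    by apply: ler_sum => i _; apply: ler_sum => j _.
  - have := integrable_ae mOm iconj; apply: filterS => x H Ox.
    exact: (conj_le_proj A_sym A_idem f_gr (Ocl Ox) (fconjugate_fin (H Ox))).
have zZ : Zset Om A f z by [].
have rz : {ae la, forall x, Om x -> r x = - wdiv Om z x}.
  by apply: filterS (wdiv_unique oOm Omfin zX r2N zdiv) => x H Ox; rewrite H// opprK.
have [wz2 _] := wdiv_spec zX.
have izG G : L1 la Om G -> la.-integrable Om (EFin \o (fun x => frob_ip (z x) (G x))).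
  move=> G1; apply: rint_sum => // i _; apply: rint_sum => // j _.
  apply: (@rint_bddM _ _ _ _ _ mOm _ _ C0) => //; first exact: (L1_entry oOm i j G1).
  exact: measurable_funTS.
exists z; split=> //.
- split.
    split; first exact: measurable_cst.
    by exists 0; apply: aeW => x _; rewrite /frob frob_ip0l sqrtr0.
  move=> phi G p1 p2 G1 pG.
  rewrite [RHS](_ : _ = 0); last first.
    rewrite (_ : (fun x => _) = (fun=> 0)); last by apply/funext => x; rewrite frob_ip0r.
    by rewrite /Rintegral integral0.
  rewrite RintegralD//; [|exact: rint_L2_ip|exact: izG].
  by rewrite (zG _ _ p1 p2 G1 pG) -(L2_wdiv_ip zX r2 p2 rz) subrr.
- move=> z' zZ'; have le1 : (\int[la]_(x in Om) (- fconjugate f x (z' x)) + pairing Om z' u Om <= K%:E)%E.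
    by rewrite -FuK /Fdual asboolT//; apply: ereal_sup_ubound; exists z'.
  apply: le_trans le1 _; have [ic Ec aec] := Zset_conj zZ.
  have divw phi (tp : test_function setT phi) i : \int[la]_(x in Om) (\sum_j z x i j * pderive j phi x) =
      - (\int[la]_(x in Om) (wdiv Om z x 0 i * phi x)).
    have [v1 v2 _ _] := test_sobolev i tp.
    rewrite divz//; have := L2_wdiv_ip zX r2 v2 rz.
    by under eq_Rintegral do rewrite frob_ip_test_vec; under [in RHS]eq_Rintegral do rewrite frob_ip_test_vec.
  rewrite (pairing_green zZ uBV u2 divw).
  rewrite (L2_wdiv_ip zX r2 u2 rz).
  have -> : (\int[la]_(x in Om) - fconjugate f x (z x) = - (\int[la]_(x in Om) fconjugate f x (z x)))%E.
    by rewrite integralN//; exact: integrable_add_def.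
  (* By the choice of [c] this middle term is [K], that is [Fdual u]. *)
  apply: (@le_trans _ _ (- c%:E + (\int[la]_(x in Om) frob_ip (r x) (u x))%:E)%E).
    by rewrite -EFinN -EFinD lee_fin /c; lra.
  by rewrite leeD2r// leeN2.
Qed.

(** * Local perturbation of a maximizer by a constant field *)

Definition perturb (z : 'rV[R]_n.+1 -> 'M[R]_(m, n.+1)) (phi : 'rV[R]_n.+1 -> R)
  (z0 : 'M[R]_(m, n.+1)) (x : 'rV[R]_n.+1) := z x + phi x *: (z0 - z x).

Section localization.
Variables (U : set 'rV[R]_n.+1) (M : R) (z0 : 'M[R]_(m, n.+1)) (phi : 'rV[R]_n.+1 -> R).
Hypotheses (UO : U `<=` Om) (Az0 : A z0 = z0) (M0 : 0 <= M)
  (UM : forall x, U x -> conj_le f x z0 M) (tphi : test01 U phi).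

Let phi01 x : 0 <= phi x <= 1. Proof. exact: tphi.2. Qed.

Let phi_out x : ~ U x -> phi x = 0. Proof. exact: test_function_out tphi.1. Qed.

Let tO : test_function Om phi. Proof. exact: test_functionS UO _ tphi.1. Qed.

Let sphi : smooth phi. Proof. by case: tO. Qed.

Let mphi D : measurable_fun D phi. Proof. exact: smooth_measurable. Qed.

Let mdphi D j : measurable_fun D (pderive j phi).
Proof. by apply: smooth_measurable; exact: smooth_pderive. Qed.

Let dphi_bd : exists B, forall j x, `|pderive j phi x| <= B.
Proof.
have /choice[B HB] : forall j, exists B, forall x, `|pderive j phi x| <= B.
  by move=> j; have [B _ HB] := test_function_bounded (test_function_pderive j tO); exists B.
exists (\sum_j `|B j|) => j x; apply: le_trans (HB j x) _; apply: le_trans (ler_norm _) _.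
by rewrite (bigD1 j)//= lerDl; apply: sumr_ge0.
Qed.

Let pderiveMx psi j x : smooth psi ->
  pderive j (fun x => phi x * psi x) x = phi x * pderive j psi x + pderive j phi x * psi x.
Proof.
move=> sp; have := pderiveM j (fun x => smooth_differentiable x sphi) (fun x => smooth_differentiable x sp).
by move=> /(congr1 (fun h => h x)) /= H; rewrite [LHS]H [X in _ = _ + X]mulrC.
Qed.

Let pderiveCMx psi j x : smooth psi -> pderive j (fun x => (1 - phi x) * psi x) x =
  (1 - phi x) * pderive j psi x - pderive j phi x * psi x.
Proof.
move=> sp; have spp : smooth (fun x => phi x * psi x) by exact: (smoothM sphi sp).
have -> : (fun x => (1 - phi x) * psi x) = psi - (fun x => phi x * psi x).
  by apply/funext => y; rewrite mulrBl mul1r.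
rewrite /pderive deriveB; [|by apply: diff_derivable; exact: smooth_differentiable..].
by have := pderiveMx j x sp; rewrite /pderive => ->; ring.
Qed.

Let test_phiM psi : test_function Om psi -> test_function Om (fun x => phi x * psi x).
Proof. by move=> [sp _ _]; exact: (test_functionM tO sp). Qed.

Let test_phiCM psi : test_function Om psi -> test_function Om (fun x => (1 - phi x) * psi x).
Proof.
move=> tp; have -> : (fun x => (1 - phi x) * psi x) = psi + (fun x => - (phi x * psi x)).
  by apply/funext => y; rewrite mulrBl mul1r.
by apply: test_functionD => //; apply: test_functionN; exact: test_phiM.
Qed.

Variable z : 'rV[R]_n.+1 -> 'M[R]_(m, n.+1).
Hypothesis zZ : Zset Om A f z.
Local Notation z' := (perturb z phi z0).

Let zX : X2 Om A z. Proof. by case: zZ. Qed.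

Let zM : exists K, {ae la, forall x, Om x -> frob (z x) <= K}. Proof. by case: zX => -[]. Qed.

Let mz i j : measurable_fun Om (fun x => z x i j).
Proof. by apply: measurable_entry; case: zX => -[]. Qed.

Let w2 : L2 la Om (wdiv Om z). Proof. by have [] := wdiv_spec zX. Qed.

Let mw i : measurable_fun Om (fun x => wdiv Om z x 0 i).
Proof. by apply: measurable_entry; case: w2. Qed.

(** The product rule for the divergence of (1 - phi) z + phi z0, in which z0, being constant, has no
    divergence of its own. *)
Definition perturb_div (x : 'rV[R]_n.+1) : 'rV[R]_m := (1 - phi x) *: wdiv Om z x +
  \row_i \sum_j pderive j phi x * (z0 i j - z x i j).

Let mz' i j : measurable_fun Om (fun x => z' x i j).
Proof.
under eq_fun do rewrite !mxE.
by apply: measurable_funD => //; apply: measurable_funM => //; apply: measurable_funB => //; exact: measurable_cst.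
Qed.

Let mrow i : measurable_fun Om (fun x => \sum_j pderive j phi x * (z0 i j - z x i j)).
Proof.
apply: measurable_sum => j; apply: measurable_funM => //; apply: measurable_funB => //; exact: measurable_cst.
Qed.

Lemma perturb_div_L2 : L2 la Om perturb_div.
Proof.
have [K HK] := zM; have [B HB] := dphi_bd.
pose D x : 'rV[R]_m := \row_i \sum_j pderive j phi x * (z0 i j - z x i j).
pose Q := \sum_(k < 1) \sum_(i < m) \sum_(j < n.+1) B * (frob z0 + K).
have md : measurable_fun Om perturb_div.
  apply: (measurable_fun_mx_in mOm) => k i; rewrite ord1; under eq_fun do rewrite !mxE.
  apply: measurable_funD => //; apply: measurable_funM => //.
  by apply: measurable_funB => //; exact: measurable_cst.
split=> //.
apply: (rint_ae_le mOm (g := fun x => 2 * frob (wdiv Om z x) ^+ 2 + 2 * Q ^+ 2)).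
- by apply: measurable_funX; apply: measurable_frob => k i; exact: measurable_entry.
- apply: rintD => //; first by apply: rintZ => //; case: w2.
  by apply: (@rint_bdd _ _ _ _ _ mOm _ `|2 * Q ^+ 2|).
- apply: filterS HK => x Hx Ox; rewrite ger0_norm ?sqr_ge0//.
  have DQ : frob (D x) <= Q.
    apply: le_trans (frob_le_sum _) _; apply: ler_sum => k _; apply: ler_sum => i _.
    rewrite mxE; apply: le_trans (ler_norm_sum _ _ _) _; apply: ler_sum => j _.
    rewrite normrM ler_pM//; apply: le_trans (ler_normB _ _) _; apply: lerD; first exact: ler_entry_frob.
    by apply: le_trans (Hx Ox); exact: ler_entry_frob.
  have H : frob (perturb_div x) <= frob (wdiv Om z x) + Q.
    apply: le_trans (ler_frobD _ _) _; apply: lerD => //; rewrite frobZ.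
    have /andP[p0 p1] := phi01 x.
    rewrite ger0_norm ?subr_ge0// ler_piMl ?frob_ge0//; lra.
  have := frob_ge0 (perturb_div x); have := frob_ge0 (wdiv Om z x).
  move: H; clear DQ; move: (frob (perturb_div x)) (frob (wdiv Om z x)) (Q) => p q Q' H q0 p0.
  have : p ^+ 2 <= (q + Q') ^+ 2 by rewrite lerXn2r// nnegrE; lra.
  by have := sqr_ge0 (q - Q'); nra.
Qed.

Let izb i j (g : 'rV[R]_n.+1 -> R) B : measurable_fun Om g -> (forall x, `|g x| <= B) ->
  la.-integrable Om (EFin \o (fun x => z x i j * g x)).
Proof.
move=> mg gB; have [K HK] := zM; apply: (rint_ae_le mOm (g := fun=> K * B)).
- exact: measurable_funM.
- by apply: (@rint_bdd _ _ _ _ _ mOm _ `|K * B|).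
- apply: filterS HK => x H Ox; rewrite normrM; apply: ler_pM => //.
  by apply: le_trans (H Ox); exact: ler_entry_frob.
Qed.

(** Split the test function: the factor [1 - phi] is absorbed into the one that tests [z], the
    factor [phi] into the one that tests [z0]. The latter contributes a constant times the integral
    of a derivative, which is zero. *)
Lemma perturb_is_wdiv : is_wdiv Om z' perturb_div.
Proof.
move=> psi tpsi i; have [sp _ _] := tpsi; have [_ zdiv] := wdiv_spec zX.
have [C _ pC] := test_function_bounded tpsi.
have t1 := test_phiCM tpsi; have t2 := test_phiM tpsi.
have mtest g D : test_function Om g -> measurable_fun D g by move=> [sg _ _]; exact: smooth_measurable.
have tbz g j : test_function Om g -> la.-integrable Om (EFin \o (fun x => z x i j * g x)).
  by move=> tg; have [B _ HB] := test_function_bounded tg; apply: (izb i j (B := B)) => //; exact: mtest.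
have tbb g : test_function Om g -> la.-integrable Om (EFin \o g).
  move=> tg; have [B _ HB] := test_function_bounded tg.
  by apply: (@rint_bdd _ _ _ _ _ mOm _ B) => //; exact: mtest.
have td g j : test_function Om g -> test_function Om (pderive j g) by exact: test_function_pderive.
have tdp j : test_function Om (fun x => pderive j phi x * psi x).
  by exact: (test_functionM (test_function_pderive j tO) sp).
have i1 : la.-integrable Om (EFin \o (fun x => \sum_j z x i j * pderive j (fun x => (1 - phi x) * psi x) x)).
  by apply: rint_sum => // j _; apply: tbz; exact: td.
have i2 : la.-integrable Om (EFin \o (fun x => \sum_j z0 i j * pderive j (fun x => phi x * psi x) x)).
  by apply: rint_sum => // j _; apply: rintZ => //; apply: tbb; exact: td.
have i3 : la.-integrable Om (EFin \o (fun x => \sum_j (z0 i j - z x i j) * (pderive j phi x * psi x))).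
  apply: rint_sum => // j _.
  apply: (@eq_rint _ _ _ _ _ mOm (fun x => z0 i j * (pderive j phi x * psi x) -
     z x i j * (pderive j phi x * psi x))) => [x _|]; first by rewrite mulrBl.
  by apply: rintB => //; [apply: rintZ => //; exact: tbb|exact: tbz].
have i4 : la.-integrable Om (EFin \o (fun x => wdiv Om z x 0 i * ((1 - phi x) * psi x))).
  have [B _ HB] := test_function_bounded t1.
  apply: (@eq_rint _ _ _ _ _ mOm (fun x => ((1 - phi x) * psi x) * wdiv Om z x 0 i)) => [x _|]; first by rewrite mulrC.
  apply: (@rint_bddM _ _ _ _ _ mOm _ _ B) => //; last exact: mtest.
  exact: (L1_entry oOm 0 i (L2_L1 oOm Omfin w2)).
transitivity (\int[la]_(x in Om) (\sum_j z x i j * pderive j (fun x => (1 - phi x) * psi x) x +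
   \sum_j z0 i j * pderive j (fun x => phi x * psi x) x - \sum_j (z0 i j - z x i j) * (pderive j phi x * psi x))).
  apply: eq_Rintegral => x _; rewrite -big_split/= -sumrB; apply: eq_bigr => j _.
  by rewrite pderiveMx// pderiveCMx// !mxE; ring.
rewrite RintegralB//; last exact: rintD.
rewrite RintegralD// zdiv// [X in _ + X - _](_ : _ = 0); last first.
  rewrite (Rintegral_sum mOm); last by move=> j _; apply: rintZ => //; apply: tbb; exact: td.
  rewrite big1// => j _; rewrite RintegralZl//; last by apply: tbb; exact: td.
  rewrite -(@Rintegral_supp _ _ Om); last by move=> x; apply: test_function_out; exact: td.
  by rewrite Rintegral_pderive0 ?mulr0//; apply: test_functionS t2.
rewrite addr0 -opprD; congr (- _); rewrite -RintegralD//; apply: eq_Rintegral => x _.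
rewrite /perturb_div !mxE [RHS]mulrDl [in RHS]mulr_suml; congr (_ + _); first by ring.
by apply: eq_bigr => j _; ring.
Qed.

Let k0 x := conj_val (fun=> z0) x.

Let k0_le x : U x -> conj_le f x z0 (k0 x) /\ `|k0 x| <= M + C0.
Proof.
move=> Ux; have H := UM Ux; have F := conj_le_fin H; split; first exact: fconjugate_fin.
have kM : k0 x <= M by rewrite -lee_fin /k0 /conj_val fineK//; apply/fconjugate_le.
have := fconjugate_fin F 0; rewrite frob_ip0r add0r -[fine _]/(k0 x).
have := f0_le f_gr (Ocl (UO Ux)); have := ltW C0_gt0.
move=> C00 f0; rewrite ler_norml lerNl => fk; apply/andP; split; last by rewrite (le_trans kM)// lerDl.
by rewrite lerNl (le_trans fk)// (le_trans f0)// lerDr.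
Qed.

Let mk0 : measurable_fun Om k0.
Proof.
apply: (measurableT_comp (fine_measurable measurableT)).
by apply: (measurable_fconjugate oOm A_sym A_idem f_cont f_conv C0_gt0 f_gr) => i j; exact: measurable_cst.
Qed.

Let ik0 : la.-integrable Om (EFin \o (fun x => phi x * k0 x)).
Proof.
apply: (@rint_bdd _ _ _ _ _ mOm _ (M + C0)) => //; first exact: measurable_funM.
move=> x _; have [Ux|nU] := pselect (U x); last by rewrite phi_out// mul0r normr0 addr_ge0// ltW.
have [_ H] := k0_le Ux; have /andP[p0 p1] := phi01 x.
by rewrite normrM ger0_norm//; apply: le_trans H; rewrite ler_piMl.
Qed.

Let iphi g : la.-integrable Om (EFin \o g) -> la.-integrable Om (EFin \o (fun x => phi x * g x)).
Proof.
move=> ig; apply: (@rint_bddM _ _ _ _ _ mOm _ _ 1) => // x _.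
by have /andP[p0 p1] := phi01 x; rewrite ger0_norm.
Qed.

(** Convexity of the conjugate along the segment from [z x] to [z0]. Where [phi] vanishes nothing is
    claimed about [z0], whose conjugate need not be finite outside [U]. *)
Lemma perturb_conj : {ae la, forall x, Om x ->
  conj_le f x (z' x) (conj_val z x + (phi x * k0 x - phi x * conj_val z x))}.
Proof.
have [_ _ aec] := Zset_conj zZ; apply: filterS aec => x H Ox y; have {}H := H Ox y.
rewrite frob_ipDl frob_ipZl frob_ipBl; have /andP[p0 p1] := phi01 x.
have [Ux|nU] := pselect (U x); last by rewrite phi_out// !mul0r subrr !addr0.
have [H1 _] := k0_le Ux; have {}H1 := H1 y.
move: H H1; move: (frob_ip _ _) (frob_ip _ _) (f x y) (k0 x) (conj_val z x) (phi x) p0 p1.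
by move=> a b e d c p p0 p1 H1 H2; nra.
Qed.

Lemma perturb_Zset : Zset Om A f z'.
Proof.
have [ic _ aec] := Zset_conj zZ; have [K HK] := zM.
have zX' : X2 Om A z'.
  split; last by exists perturb_div; [exact: perturb_div_L2|exact: perturb_is_wdiv].
  - split; first exact: (measurable_fun_mx_in mOm).
    exists (K + (frob z0 + K)); apply: filterS HK => x H Ox; have {}H := H Ox.
    apply: le_trans (ler_frobD _ _) _; apply: lerD => //; rewrite frobZ.
    have /andP[p0 p1] := phi01 x.
    have H1 : frob (z0 - z x) <= frob z0 + K.
      by apply: le_trans (ler_frobD _ _) _; rewrite lerD2l frobN.
    by apply: le_trans H1; rewrite ger0_norm// ler_piMl ?frob_ge0.
  - have [_ Az _] := zX; apply: filterS Az => x H Ox.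
    by rewrite /perturb linearD/= linearZ/= linearB/= Az0 H.
split=> //.
pose Kx x := conj_val z x + (phi x * k0 x - phi x * conj_val z x).
have iK : la.-integrable Om (EFin \o Kx) by apply: rintD => //; apply: rintB => //; exact: iphi.
have mF : measurable_fun Om (fun x => fconjugate f x (z' x)).
  exact: (measurable_fconjugate oOm A_sym A_idem f_cont f_conv C0_gt0 f_gr).
have iKC : la.-integrable Om (EFin \o (fun x => `|Kx x| + C0)).
  by apply: rintD => //; [exact: rint_norm|apply: (@rint_bdd _ _ _ _ _ mOm _ `|C0|)].
apply/integrableP; split=> //.
apply: (@le_lt_trans _ _ (\int[la]_(x in Om) (`|Kx x| + C0)%:E)%E); last first.
  rewrite -RintegralE//; exact: ltry.
apply: ae_ge0_le_integral => //.
- exact: measurableT_comp.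
- by move=> x _; rewrite lee_fin addr_ge0// ltW.
- exact: (measurable_int _ iKC).
apply: filterS perturb_conj => x H Ox; have {}H := H Ox; have F := conj_le_fin H.
rewrite -(fineK F) lee_fin ler_norml; apply/andP; split.
  have := fconjugate_fin F 0; rewrite frob_ip0r; have := f0_le f_gr (Ocl Ox); have := normr_ge0 (Kx x); lra.
apply: (@le_trans _ _ (Kx x)); first by rewrite -lee_fin fineK//; apply/fconjugate_le.
by apply: le_trans (ler_norm _) _; rewrite lerDl ltW.
Qed.

Section paired.
Variable u : 'rV[R]_n.+1 -> 'rV[R]_m.
Hypotheses (uBV : BVA Om A u) (u2 : L2 la Om u).
Local Notation mu := (Agrad Om A u).
Local Notation V := (mx_variation mu).
Variables (s : 'rV[R]_n.+1 -> 'M[R]_(m, n.+1)) (th : 'rV[R]_n.+1 -> R) (C : R).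
Hypotheses (ms : forall i j, measurable_fun setT (fun x => s x i j))
  (s1 : forall x i j, `|s x i j| <= 1)
  (mus : forall i j E, measurable E -> mu i j E = (\int[V]_(x in E) (s x i j)%:E)%E)
  (mth : measurable_fun setT th) (thC : forall x, `|th x| <= C)
  (prP : is_pairing Om z u (pairing Om z u))
  (prP' : is_pairing Om z' u (pairing Om z' u))
  (thE : forall E, measurable E -> pairing Om z u E = (\int[V]_(x in E) th x)%:E).

Let ith E : measurable E -> V.-integrable E (EFin \o th).
Proof. by move=> mE; apply: rint_finite_measure mE; [exact: mth|exact: thC]. Qed.

Let is_ i j E : measurable E -> V.-integrable E (EFin \o (fun x => s x i j)).
Proof. by move=> mE; apply: rint_finite_measure mE; [exact: ms|exact: (fun x => s1 x i j)]. Qed.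

Let izs E : measurable E -> V.-integrable E (EFin \o (fun x => frob_ip z0 (s x))).
Proof.
by move=> mE; apply: rint_sum => // i _; apply: rint_sum => // j _; apply: rintZ => //; exact: is_.
Qed.

Let ibM (g h : 'rV[R]_n.+1 -> R) E : measurable E -> V.-integrable E (EFin \o g) -> test_function Om h ->
  V.-integrable E (EFin \o (fun x => h x * g x)).
Proof.
move=> mE ig thh; have [B _ HB] := test_function_bounded thh; have [sh _ _] := thh.
by apply: (@rint_bddM _ _ _ _ _ mE _ _ B) => //; exact: smooth_measurable.
Qed.

(** The density of the perturbed pairing is the same convex combination of [th] and [z0 : s], since
    [z0] is constant and pairs with A u by definition of A u, using [A z0 = z0]. It suffices to
    check this on test functions. *)
Lemma perturb_pairing : pairing Om z' u Om =
  (\int[V]_(x in Om) (th x - phi x * (th x - frob_ip z0 (s x))))%:E.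
Proof.
have VOm : (V Om < +oo)%E by rewrite -ge0_fin_numE// fin_num_measure.
have ig E : measurable E -> V.-integrable E (EFin \o (fun x => th x - phi x * (th x - frob_ip z0 (s x)))).
  by move=> mE; apply: rintB => //; [exact: ith|apply: ibM => //; apply: rintB => //; [exact: ith|exact: izs]].
rewrite (charge_eq_density oOm prP'.1 VOm (ig _ mOm)) ?setIid// => psi tpsi.
have [sp _ _] := tpsi.
have t1 := test_phiCM tpsi; have t2 := test_phiM tpsi.
have [C1 _ hC1] := test_function_bounded t1; have [s1' _ _] := t1.
have [C2 _ hC2] := test_function_bounded t2; have [s2' _ _] := t2.
pose P1 (x : 'rV[R]_n.+1) := (1 - phi x) * psi x * (\sum_i wdiv Om z x 0 i * u x 0 i) +
  \sum_i \sum_j pderive j (fun x => (1 - phi x) * psi x) x * z x i j * u x 0 i.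
pose P2 (x : 'rV[R]_n.+1) := \sum_i \sum_j z0 i j * (u x 0 i * pderive j (fun x => phi x * psi x) x).
have iu i := L1_entry oOm 0 i (L2_L1 oOm Omfin u2).
have iut g i : test_function Om g -> la.-integrable Om (EFin \o (fun x => u x 0 i * g x)).
  move=> tg; have [B _ HB] := test_function_bounded tg; have [sg _ _] := tg.
  apply: (@eq_rint _ _ _ _ _ mOm (fun x => g x * u x 0 i)) => [x _|]; first by rewrite mulrC.
  by apply: (@rint_bddM _ _ _ _ _ mOm _ _ B) => //; exact: smooth_measurable.
have iP1 : la.-integrable Om (EFin \o P1).
  apply: rintD => //.
    apply: (@rint_bddM _ _ _ _ _ mOm _ _ C1) => //; last exact: smooth_measurable.
    apply: (@eq_rint _ _ _ _ _ mOm (fun x => frob_ip (wdiv Om z x) (u x))); last exact: rint_L2_ip.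
    by move=> x _; rewrite frob_ip_row.
  apply: rint_sum => // i _; apply: rint_sum => // j _; have [K HK] := zM.
  have tj := test_function_pderive j t1.
  have ij := iut _ i tj.
  apply: (rint_ae_le mOm (g := fun x => K * `|u x 0 i * pderive j (fun x => (1 - phi x) * psi x) x|)).
  - apply: measurable_funM; last exact: (rint_measurable (iu i)).
    by apply: measurable_funM => //; apply: smooth_measurable; case: tj.
  - by apply: rintZ => //; exact: rint_norm.
  - apply: filterS HK => x H Ox.
    rewrite mulrAC mulrC normrM [X in _ * `|X|]mulrC ler_wpM2r//.
    by apply: le_trans (H Ox); exact: ler_entry_frob.
have iP2 : la.-integrable Om (EFin \o P2).
  apply: rint_sum => // i _; apply: rint_sum => // j _; apply: rintZ => //; apply: iut.
  exact: test_function_pderive.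
have zX' : X2 Om A z' by case: perturb_Zset.
have wE := wdiv_unique oOm Omfin zX' perturb_div_L2 perturb_is_wdiv.
have [w2' _] := wdiv_spec zX'.
rewrite (prP'.2 _ tpsi).
have -> : \int[la]_(x in Om) (psi x * (\sum_i wdiv Om z' x 0 i * u x 0 i) +
   \sum_i \sum_j pderive j psi x * z' x i j * u x 0 i) = \int[la]_(x in Om) (P1 x + P2 x).
  have mu_ i : measurable_fun Om (fun x => u x 0 i) by exact: (rint_measurable (iu i)).
  have mw' i : measurable_fun Om (fun x => wdiv Om z' x 0 i) by apply: measurable_entry; case: w2'.
  apply: ae_eq_Rintegral_in => //.
  - apply: measurable_funD.
      apply: measurable_funM; first exact: smooth_measurable.
      by apply: measurable_sum => i; exact: measurable_funM.
    apply: measurable_sum => i; apply: measurable_sum => j; apply: measurable_funM => //.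
    apply: measurable_funM => //; apply: smooth_measurable; exact: smooth_pderive.
  - by apply: (rint_measurable (mu := la)); exact: rintD.
  - apply: filterS wE => x H Ox; rewrite H// /P1 /P2 !mulr_sumr -!big_split/=; apply: eq_bigr => i _.
    rewrite /perturb_div !mxE mulrDl mulrDr -!addrA; congr (_ + _); first by ring.
    rewrite mulr_suml mulr_sumr -!big_split/=; apply: eq_bigr => j _.
    by rewrite pderiveMx// pderiveCMx// !mxE; ring.
rewrite RintegralD// opprD.
have -> : - (\int[la]_(x in Om) P1 x) = \int[V]_(x in Om) ((1 - phi x) * psi x * th x).
  rewrite -(prP.2 _ t1).
  rewrite (@charge_integral_density _ _ _ (pairing Om z u) V th _ C1)//.
  - rewrite (RintegralV oOm (Agrad_spec uBV) measurableT) ?setTI//; exact: ibM (ith measurableT) t1.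
  - exact: ith.
  - by move=> E mE; rewrite thE// RintegralE//; exact: ith.
  - exact: smooth_measurable.
have -> : - (\int[la]_(x in Om) P2 x) = \int[V]_(x in Om) (phi x * psi x * frob_ip z0 (s x)).
  pose B : 'M[R]_(m, n.+1) := \matrix_(i, j) - (\int[la]_(x in Om) (u x 0 i * pderive j (fun x => phi x * psi x) x)).
  transitivity (frob_ip z0 B).
    rewrite (Rintegral_sum mOm) => [|i _]; last first.
      by apply: rint_sum => // j _; apply: rintZ => //; apply: iut; exact: test_function_pderive.
    rewrite -sumrN; apply: eq_bigr => i _.
    rewrite (Rintegral_sum mOm) => [|j _]; last by apply: rintZ => //; apply: iut; exact: test_function_pderive.
    rewrite -sumrN; apply: eq_bigr => j _; rewrite RintegralZl// ?mxE ?mulrN//.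
    by apply: iut; exact: test_function_pderive.
  rewrite -Az0 A_sym -((Agrad_spec uBV).2 _ t2) Az0.
  transitivity (\int[V]_(x in Om) (\sum_i \sum_j z0 i j * (phi x * psi x * s x i j))).
    rewrite (Rintegral_sum mOm) => [|i _]; last first.
      by apply: rint_sum => // j _; apply: rintZ => //; exact: ibM (is_ i j mOm) t2.
    apply: eq_bigr => i _; rewrite (Rintegral_sum mOm) => [|j _]; last first.
      by apply: rintZ => //; exact: ibM (is_ i j mOm) t2.
    apply: eq_bigr => j _; rewrite RintegralZl//; last exact: ibM (is_ i j mOm) t2.
    rewrite mxE (@charge_integral_density _ _ _ (mu i j) V (fun x => s x i j) _ C2)//.
    - congr (_ * _); rewrite (RintegralV oOm (Agrad_spec uBV) measurableT) ?setTI//.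
      exact: ibM (is_ i j measurableT) t2.
    - exact: is_.
    - by move=> E mE; rewrite mus.
    - exact: smooth_measurable.
  apply: eq_Rintegral => x _; rewrite [in RHS]/frob_ip mulr_sumr; apply: eq_bigr => i _.
  by rewrite mulr_sumr; apply: eq_bigr => j _; ring.
rewrite -RintegralD//; [|exact: ibM (ith mOm) t1|exact: ibM (izs mOm) t2].
by apply: eq_Rintegral => x _; ring.
Qed.

Hypothesis zmax : (\int[la]_(x in Om) (- fconjugate f x (z' x)) + pairing Om z' u Om <=
  \int[la]_(x in Om) (- fconjugate f x (z x)) + pairing Om z u Om)%E.

Lemma perturb_maximal : 0 <= \int[la]_(x in U) ((k0 x - conj_val z x) * phi x) +
  \int[V]_(x in U) ((th x - frob_ip z0 (s x)) * phi x).
Proof.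
have [ic Ec _] := Zset_conj zZ; have [ic' Ec' _] := Zset_conj perturb_Zset.
have i1 : la.-integrable Om (EFin \o (fun x => phi x * k0 x - phi x * conj_val z x)).
  by apply: rintB => //; exact: iphi.
have i2 : V.-integrable Om (EFin \o (fun x => phi x * (th x - frob_ip z0 (s x)))).
  by apply: ibM => //; apply: rintB => //; [exact: ith|exact: izs].
have : \int[la]_(x in Om) conj_val z' x <=
    \int[la]_(x in Om) conj_val z x + \int[la]_(x in Om) (phi x * k0 x - phi x * conj_val z x).
  rewrite -RintegralD//; apply: ae_le_Rintegral => //; first exact: rintD.
  apply: filterS perturb_conj => x H Ox; have {}H := H Ox.
  by rewrite -lee_fin /conj_val fineK ?(conj_le_fin H)//; apply/fconjugate_le.
move: zmax; rewrite Ec Ec' perturb_pairing thE// -!EFinD lee_fin RintegralB//; last exact: ith.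
have supp (nu : {measure set 'rV[R]_n.+1 -> \bar R}) (g : 'rV[R]_n.+1 -> R) :
    (forall x, ~ U x -> g x = 0) -> \int[nu]_(x in Om) g x = \int[nu]_(x in U) g x.
  move=> g0; rewrite [LHS]Rintegral_mkcond [RHS]Rintegral_mkcond; apply: eq_Rintegral => x _.
  rewrite !patchE; case: (boolP (x \in U)) => [/set_mem Ux|]; first by rewrite mem_set//; exact: UO.
  by rewrite notin_setE => nU; rewrite g0//; case: ifP.
rewrite (supp V (fun x => phi x * _)); last by move=> x /phi_out ->; rewrite mul0r.
rewrite (supp la (fun x => phi x * k0 x - _)); last by move=> x /phi_out ->; rewrite !mul0r subrr.
have -> : \int[la]_(x in U) (phi x * k0 x - phi x * conj_val z x) =
    \int[la]_(x in U) ((k0 x - conj_val z x) * phi x) by apply: eq_Rintegral => x _; ring.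
have -> : \int[V]_(x in U) (phi x * (th x - frob_ip z0 (s x))) =
  \int[V]_(x in U) ((th x - frob_ip z0 (s x)) * phi x) by apply: eq_Rintegral => x _; rewrite mulrC.
move: (\int[V]_(x in U) _) (\int[V]_(x in Om) _) (\int[la]_(x in U) _) (\int[la]_(x in Om) _) (\int[la]_(x in Om) _).
by move=> p q a b c; lra.
Qed.

End paired.

End localization.

(** * Pointwise optimality of a maximizer *)

Variable u : 'rV[R]_n.+1 -> 'rV[R]_m.
Hypotheses (uBV : BVA Om A u) (u2 : L2 la Om u).
Local Notation mu := (Agrad Om A u).
Local Notation V := (mx_variation mu).
Local Notation a := (ac_density la mu).
Variable z : 'rV[R]_n.+1 -> 'M[R]_(m, n.+1).
Hypotheses (zZ : Zset Om A f z) (zmax : forall z', Zset Om A f z' ->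
  (\int[la]_(x in Om) (- fconjugate f x (z' x)) + pairing Om z' u Om <=
   \int[la]_(x in Om) (- fconjugate f x (z x)) + pairing Om z u Om)%E).

Section local_comparison.
Variables (s : 'rV[R]_n.+1 -> 'M[R]_(m, n.+1)) (N : set 'rV[R]_n.+1)
  (th : 'rV[R]_n.+1 -> R) (C : R).
Hypotheses (ms : forall i j, measurable_fun setT (fun x => s x i j))
  (s1 : forall x i j, `|s x i j| <= 1)
  (mus : forall i j E, measurable E -> mu i j E = (\int[V]_(x in E) (s x i j)%:E)%E).
Hypotheses (mN : measurable N) (N0 : la N = 0%E)
  (ia : forall i j, la.-integrable setT (EFin \o (fun x => a x i j)))
  (muN : forall i j E, measurable E -> E `<=` ~` N ->
     mu i j E = (\int[la]_(x in E) (a x i j)%:E)%E).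
Hypotheses (mth : measurable_fun setT th) (thC : forall x, `|th x| <= C)
  (prP : is_pairing Om z u (pairing Om z u))
  (thE : forall E, measurable E -> pairing Om z u E = (\int[V]_(x in E) th x)%:E)
  (iza : la.-integrable Om (EFin \o (fun x => frob_ip (z x) (a x))))
  (thS : forall E, measurable E -> \int[V]_(x in E) th x =
     \int[la]_(x in E `&` Om) frob_ip (z x) (a x) + \int[V]_(x in E `&` N) th x).

(** Maximality gives an inequality between integrals with weight [phi], hence on all Borel subsets
    of [U]. Subsets off [N] turn it into one Lebesgue integral, subsets of [N] into one integral
    against [V], as [N] is Lebesgue null. *)
Lemma maximizer_local (U : set 'rV[R]_n.+1) (M : R) (z0 : 'M[R]_(m, n.+1)) :
  open U -> U `<=` Om -> A z0 = z0 -> 0 <= M -> (forall x, U x -> conj_le f x z0 M) ->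
  {ae la, forall x, U x -> frob_ip z0 (a x) - conj_val (fun=> z0) x <=
     frob_ip (z x) (a x) - conj_val z x} /\
  {ae V, forall x, U x -> N x -> frob_ip z0 (s x) <= th x}.
Proof.
move=> oU UO Az0 M0 UM.
have mU : measurable U by exact: open_measurable_mx.
have Ufin : (la U < +oo)%E by apply: le_lt_trans Omfin; rewrite le_measure ?inE.
have VU : (V U < +oo)%E by rewrite -ge0_fin_numE// fin_num_measure.
have [ic _ _] := Zset_conj zZ.
have icU : la.-integrable U (EFin \o conj_val z) by apply: (integrableS mOm).
have izaU : la.-integrable U (EFin \o (fun x => frob_ip (z x) (a x))) by apply: (integrableS mOm).
have ik0 : la.-integrable U (EFin \o conj_val (fun=> z0)).
  apply: (@rint_bdd _ _ _ _ _ mU _ (M + C0)) => //.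
    apply: (measurableT_comp (fine_measurable measurableT)); apply: (measurable_funS mOm) => //.
    by apply: (measurable_fconjugate oOm A_sym A_idem f_cont f_conv C0_gt0 f_gr) => i j; exact: measurable_cst.
  move=> x Ux; have H := UM x Ux; have F := conj_le_fin H.
  have kM : conj_val (fun=> z0) x <= M by rewrite -lee_fin /conj_val fineK//; apply/fconjugate_le.
  have := fconjugate_fin F 0; rewrite frob_ip0r add0r -[fine _]/(conj_val (fun=> z0) x).
  have := f0_le f_gr (Ocl (UO _ Ux)); have := ltW C0_gt0.
  move=> C00 f0; rewrite ler_norml lerNl => fk; apply/andP; split; last by rewrite (le_trans kM)// lerDl.
  by rewrite lerNl (le_trans fk)// (le_trans f0)// lerDr.
have ith E : measurable E -> V.-integrable E (EFin \o th).
  by move=> mE; apply: rint_finite_measure mE; [exact: mth|exact: thC].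
have is_ i j E : measurable E -> V.-integrable E (EFin \o (fun x => s x i j)).
  by move=> mE; apply: rint_finite_measure mE; [exact: ms|exact: (fun x => s1 x i j)].
have izs E : measurable E -> V.-integrable E (EFin \o (fun x => frob_ip z0 (s x))).
  by move=> mE; apply: rint_sum => // i _; apply: rint_sum => // j _; apply: rintZ => //; exact: is_.
have i1 := rintB mU ik0 icU.
have i2 E (mE : measurable E) := rintB mE (ith E mE) (izs E mE).
have sets : forall E, measurable E -> E `<=` U -> 0 <= \int[la]_(x in E) (conj_val (fun=> z0) x - conj_val z x) +
    \int[V]_(x in E) (th x - frob_ip z0 (s x)).
  apply: (fundamental_lemma oU Ufin VU i1 (i2 _ mU)) => phi tphi.
  have z'Z := perturb_Zset UO Az0 M0 UM tphi zZ.
  have [th' [C' [_ [prP' _] _ _ _]]] := pairing_value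
    uBV u2 ms s1 mus mN N0 ia muN z'Z.
  exact: (perturb_maximal UO Az0 M0 UM tphi zZ uBV u2 ms s1 mus
    mth thC prP prP' thE (zmax z'Z)).
have iaU i j E : measurable E -> la.-integrable E (EFin \o (fun x => a x i j)).
  by move=> mE; apply: (integrableS measurableT).
have iz0a E : measurable E -> la.-integrable E (EFin \o (fun x => frob_ip z0 (a x))).
  by move=> mE; apply: rint_sum => // i _; apply: rint_sum => // j _; apply: rintZ => //; exact: iaU.
split.
- have ig : la.-integrable U (EFin \o (fun x => (conj_val (fun=> z0) x - conj_val z x) +
      (frob_ip (z x) (a x) - frob_ip z0 (a x)))).
    by apply: rintD => //; apply: rintB => //; exact: iz0a.
  have : {ae la, forall x, U x -> 0 <= (conj_val (fun=> z0) x - conj_val z x) +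
      (frob_ip (z x) (a x) - frob_ip z0 (a x))}.
    apply: (nonneg_sets_ae mU ig) => E mE EU; pose E' := E `\` N.
    have mE' : measurable E' by exact: measurableD.
    have EO' : E' `<=` Om by move=> x [Ex _]; exact/UO/EU.
    have EU' : E' `<=` U by move=> x [Ex _]; exact: EU.
    have iE (h : 'rV[R]_n.+1 -> R) : la.-integrable U (EFin \o h) -> la.-integrable E' (EFin \o h).
      by move=> ih; apply: (integrableS mU).
    have := sets E' mE' EU'; rewrite (RintegralB mE' (ith _ mE') (izs _ mE')).
    rewrite thS// [X in _ + (_ + X - _)](_ : _ = 0); last first.
      rewrite (_ : E' `&` N = set0) ?Rintegral_set0//.
      by apply/seteqP; split=> // x [[]].
    rewrite addr0 (setIidl EO').
    have -> : \int[V]_(x in E') frob_ip z0 (s x) = \int[la]_(x in E') frob_ip z0 (a x).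
      rewrite /frob_ip !(Rintegral_sum mE'); first last.
      + by move=> i _; apply: rint_sum => // j _; apply: rintZ => //; exact: is_.
      + by move=> i _; apply: rint_sum => // j _; apply: rintZ => //; exact: iaU.
      apply: eq_bigr => i _; rewrite !(Rintegral_sum mE'); first last.
      + by move=> j _; apply: rintZ => //; exact: is_.
      + by move=> j _; apply: rintZ => //; exact: iaU.
      apply: eq_bigr => j _; rewrite !RintegralZl//; [|exact: iaU|exact: is_].
      by congr (_ * _); rewrite /Rintegral -mus// muN// => x [].
    have iB := iE _ (rintB mU izaU (iz0a _ mU)).
    rewrite -RintegralB//; [|exact: iE|exact: iz0a].
    rewrite -RintegralD//; last exact: iE.
    move=> H; apply: le_trans H _; rewrite le_eqVlt; apply/orP; left; apply/eqP.
    rewrite /Rintegral [in RHS](@negligible_integral _ _ _ la E N)//.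
    by apply: (integrableS mU).
  apply: filterS => x H Ux; have {}H := H Ux.
  rewrite -subr_ge0 (le_trans H)// le_eqVlt; apply/orP; left; apply/eqP; ring.
- have mUN : measurable (U `&` N) by exact: measurableI.
  have : {ae V, forall x, (U `&` N) x -> 0 <= th x - frob_ip z0 (s x)}.
    apply: (nonneg_sets_ae mUN (i2 _ mUN)) => E mE EUN.
    have := sets E mE (fun x Ex => (EUN x Ex).1).
    rewrite [X in X + _](_ : _ = 0) ?add0r// /Rintegral null_set_integral//.
      by apply: (@measurable_int _ _ _ la); apply: (integrableS mU) => // x /EUN[].
    by apply: (subset_measure0 mE mN) => // x /EUN[].
  by apply: filterS => x H Ux Nx; rewrite -subr_ge0; exact: H.
Qed.

(** The exceptional null set must not depend on the competitor. There are countably many rational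
    matrices and cubes; the bound [M] is absorbed into an existence hypothesis since the conclusion
    does not mention it. *)
Lemma maximizer_rational :
  {ae la, forall x (q : 'M[rat]_(m, n.+1)) (b : 'rV[rat]_n.+1) (r : rat) (M : R),
     let U := cube (@rat_mx R _ _ b) (ratr r) in let z0 := A (@rat_mx R _ _ q) in
     U `<=` Om -> 0 <= M -> (forall x', U x' -> conj_le f x' z0 M) -> U x ->
     frob_ip z0 (a x) - conj_val (fun=> z0) x <= frob_ip (z x) (a x) - conj_val z x} /\
  {ae V, forall x (q : 'M[rat]_(m, n.+1)) (b : 'rV[rat]_n.+1) (r : rat) (M : R),
     let U := cube (@rat_mx R _ _ b) (ratr r) in let z0 := A (@rat_mx R _ _ q) in
     U `<=` Om -> 0 <= M -> (forall x', U x' -> conj_le f x' z0 M) -> U x -> N x ->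
     frob_ip z0 (s x) <= th x}.
Proof.
have H (q : 'M[rat]_(m, n.+1)) (b : 'rV[rat]_n.+1) (r : rat) :
   let U := cube (@rat_mx R _ _ b) (ratr r) in let z0 := A (@rat_mx R _ _ q) in
   {ae la, forall x, (exists M, [/\ U `<=` Om, 0 <= M & (forall x', U x' -> conj_le f x' z0 M)]) -> U x ->
     frob_ip z0 (a x) - conj_val (fun=> z0) x <= frob_ip (z x) (a x) - conj_val z x} /\
   {ae V, forall x, (exists M, [/\ U `<=` Om, 0 <= M & (forall x', U x' -> conj_le f x' z0 M)]) -> U x -> N x ->
     frob_ip z0 (s x) <= th x}.
  move=> U z0; have [[M [UO M0 UM]]|nM] := pselect (exists M, [/\ U `<=` Om, 0 <= M &
      (forall x', U x' -> conj_le f x' z0 M)]); last by split; apply: aeW => x /nM.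
  have oU : open U by exact: open_cube.
  have [H1 H2] := maximizer_local oU UO (A_idem _) M0 UM.
  by split; [apply: filterS H1|apply: filterS H2] => x H _.
pose dec (k : nat) : 'M[rat]_(m, n.+1) * 'rV[rat]_n.+1 * rat := odflt (0, 0, 0) (unpickle k).
have decP qbr : dec (pickle qbr) = qbr by rewrite /dec pickleK.
have H1 := ae_foralln (fun k => (H (dec k).1.1 (dec k).1.2 (dec k).2).1).
have H2 := ae_foralln (fun k => (H (dec k).1.1 (dec k).1.2 (dec k).2).2).
split.
  apply: filterS H1 => x Hx q b r M U z0 UO M0 UM Ux.
  by have := Hx (pickle (q, b, r)); rewrite decP /=; apply => //; exists M.
apply: filterS H2 => x Hx q b r M U z0 UO M0 UM Ux Nx.
by have := Hx (pickle (q, b, r)); rewrite decP /=; apply => //; exists M.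
Qed.

Let slope_limit (X F Y : R) : (forall e, 0 < e -> e < 1 -> F - e * Y <= X) -> F <= X.
Proof.
move=> H; apply/ler_addgt0Pr => d d0; pose e := Num.min (1 / 2) (d / (`|Y| + 1)).
have Y1 : 0 < `|Y| + 1 by rewrite ltr_wpDl.
have e0 : 0 < e by rewrite lt_min !divr_gt0.
have e1 : e < 1 by rewrite gt_min; apply/orP; left; lra.
have eY : e * Y <= d.
  apply: le_trans (ler_norm _) _; rewrite normrM (gtr0_norm e0).
  have : e * (`|Y| + 1) <= d by rewrite -ler_pdivlMr// ge_min lexx orbT.
  by rewrite mulrDr mulr1; apply: le_trans; rewrite lerDl ltW.
by have := H e e0 e1; lra.
Qed.

Lemma maximizer_subdiff : {ae la, forall x, Om x -> subdiff setT (@frob_ip R m n.+1)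
  (fun y => (f x y)%:E) (a x) (z x)}.
Proof.
have [H _] := maximizer_rational; have [_ _ aec] := Zset_conj zZ.
apply: filterS (filterI aec H) => x [zc {}H] Ox; have {}zc := zc Ox.
have cx := Ocl Ox.
have [p [_ pc]] := subgradient_exists f_conv (a x) cx.
have main : f x (a x) <= frob_ip (z x) (a x) - conj_val z x.
  (* The term linear in [e] collects the error of the rational competitor against [p] and the factor
     [1 - e] in the bound on its conjugate. *)
  apply: (@slope_limit _ _ ((C0 + c0) * frob (a x) - (frob_ip p (a x) - f x (a x)))) => e e0 e1.
  have [q [b [r [Ux UO [M M0 UM] Hq qc]]]] := conj_le_rational oOm A_sym A_idem f_ge0 f_conv c0_gt0 C0_gt0 f_gr f_rec
    Ox pc e0 e1.
  have UO' : cube (rat_mx R b) (ratr r) `<=` Om.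
    by move=> y Uy; apply: UO => i j; exact/ltW/Uy.
  have := H q b r M UO' M0 UM Ux.
  have k0 : conj_val (fun=> A (rat_mx R q)) x <= (1 - e) * (frob_ip p (a x) - f x (a x)).
    by rewrite -lee_fin /conj_val fineK ?(conj_le_fin qc)//; apply/fconjugate_le.
  have := frob_cauchy_schwarz_norm (A (rat_mx R q) - p) (a x).
  rewrite frob_ipBl ler_norml => /andP[h1 _] h2.
  have h3 : frob (A (rat_mx R q) - p) * frob (a x) <= e * (C0 + c0) * frob (a x).
    by rewrite ler_wpM2r ?frob_ge0.
  apply: le_trans h2; move: k0 h1 h3.
  move: (conj_val _ _) (frob_ip p _) (frob_ip (A _) _) (f x _) (frob (a x)) (frob _ * _) => k P Q F D W.
  by move=> h1 h2 h3; nra.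
split=> // y _; rewrite -EFinB lee_fin frob_ipBr.
by have := zc y; lra.
Qed.

Lemma maximizer_singular : {ae V, forall x, N x -> Om x -> finfty Om f x (s x) <= th x}.
Proof.
have [_ H] := maximizer_rational; apply: filterS H => x H Nx Ox; have cx := Ocl Ox.
apply/ler_addgt0Pr => d d0.
have [p [c [pc pd]]] := finfty_sup f_conv C0_gt0 f_gr f_rec (s x) cx d0.
rewrite -lerBlDr; apply: le_trans pd _.
apply: (@slope_limit _ _ ((C0 + c0) * frob (s x))) => e e0 e1.
have [q [b [r [Ux UO [M M0 UM] Hq qc]]]] := conj_le_rational oOm A_sym A_idem f_ge0 f_conv c0_gt0 C0_gt0 f_gr f_rec
  Ox pc e0 e1.
have UO' : cube (rat_mx R b) (ratr r) `<=` Om.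
  by move=> y Uy; apply: UO => i j; exact/ltW/Uy.
apply: le_trans (H q b r M UO' M0 UM Ux Nx).
have := frob_cauchy_schwarz_norm (A (rat_mx R q) - p) (s x).
rewrite frob_ipBl ler_norml => /andP[h1 _].
have h3 : frob (A (rat_mx R q) - p) * frob (s x) <= e * (C0 + c0) * frob (s x).
  by rewrite ler_wpM2r ?frob_ge0.
move: h1 h3; move: (frob_ip p _) (frob_ip (A _) _) (frob _ * _) => P Q W; rewrite mulrA.
by move: (e * _ * _) => K h1 h2; lra.
Qed.

End local_comparison.

Theorem maximizer_optimality :
  {ae la, forall x, Om x -> subdiff setT (@frob_ip R m n.+1) (fun y => (f x y)%:E) (a x) (z x)} /\
  {ae mx_variation (singular_part la mu), forall x, Om x -> theta Om A z u x = (finfty Om f x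
      (polar_density (singular_part la mu) x))%:E}.
Proof.
have [s [ms s1 mus]] := variation_density mu.
have [N [mN N0 ia muN aeN]] := singular_set_exists ms s1 mus.
have [th [C [[mth thC] [prP thE] [iza thS] [thU thT] _]]] := pairing_value uBV u2 ms s1 mus mN N0 ia muN zZ.
split; first exact: (maximizer_subdiff ms s1 mus mN N0 ia muN mth thC prP thE iza thS).
apply/(aeN (fun x y => Om x -> theta Om A z u x = (finfty Om f x y)%:E)).
have thL := maximizer_singular ms s1 mus mN N0 ia muN mth thC prP thE iza thS.
apply: filterS (filterI thL (filterI thU thT)) => x [h1 [h2 h3]] Nx Ox.
by rewrite h3; congr EFin; apply/eqP; rewrite eq_le h2// h1.
Qed.

End duality.

Theorem proposition4p8
  (R : realType) (m n : nat) (Om : set 'rV[R]_n.+1)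
  (Om_bounded : bounded_set Om) (Om_open : open Om)
  (Om_lip : lipschitz_boundary Om)
  (A : {linear 'M[R]_(m, n.+1) -> 'M[R]_(m, n.+1)})
  (A_sym : forall y y', frob_ip (A y) y' = frob_ip y (A y'))
  (A_idem : forall y, A (A y) = A y)
  (f : 'rV[R]_n.+1 -> 'M[R]_(m, n.+1) -> R)
  (f_ge0 : forall (x : 'rV[R]_n.+1) (y : 'M[R]_(m, n.+1)), closure Om x -> 0 <= f x y)
  (f_cont : {within closure Om `*` [set: 'M[R]_(m, n.+1)],
    continuous (fun p : 'rV[R]_n.+1 * 'M[R]_(m, n.+1) => f p.1 p.2)})
  (f_convex : forall x : 'rV[R]_n.+1, closure Om x ->
    convex_function [set: convex_lmodType 'M[R]_(m, n.+1)] (f x))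
  (f_growth : exists c0 C0 : R, [/\ 0 < c0, 0 < C0 &
    forall (x : 'rV[R]_n.+1) (y : 'M[R]_(m, n.+1)), closure Om x ->
      c0 * frob (A y) <= f x y <= C0 * (1 + frob (A y))])
  (f_recession : forall (x : 'rV[R]_n.+1) (y : 'M[R]_(m, n.+1)), closure Om x ->
    cvg (recession_quotient f y @ recession_filter Om x))
  (u r : 'rV[R]_n.+1 -> 'rV[R]_m)
  (u_L2 : L2 (lebesgue_rV R n.+1) Om u) (r_L2 : L2 (lebesgue_rV R n.+1) Om r) :
  subdiff (L2 (lebesgue_rV R n.+1) Om) (L2_ip Om) (Fdual Om A f) u r
  <->
  BVA Om A u /\
  exists z : 'rV[R]_n.+1 -> 'M[R]_(m, n.+1),
  [/\ Zset Om A f z,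
      {ae lebesgue_rV R n.+1, forall x, Om x -> r x = - wdiv Om z x},
      exists2 w, is_normal_trace Om z w &
        {ae hausdorff_measure R n.+1 n, forall x, boundary Om x -> w x = 0},
      {ae lebesgue_rV R n.+1, forall x, Om x ->
        subdiff setT (@frob_ip R m n.+1) (fun y => (f x y)%:E)
          (ac_density (lebesgue_rV R n.+1) (Agrad Om A u) x) (z x)} &
      {ae mx_variation (singular_part (lebesgue_rV R n.+1) (Agrad Om A u)),
        forall x, Om x -> theta Om A z u x = (finfty Om f x
          (polar_density (singular_part (lebesgue_rV R n.+1) (Agrad Om A u)) x))%:E}].
Proof.
have [c0 [C0 [c0_gt0 C0_gt0 f_gr]]] := f_growth.
have f_conv (x : 'rV[R]_n.+1) : closure Om x -> forall (v w : 'M[R]_(m, n.+1)) (t : R), 0 < t -> t < 1 ->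
    f x (t *: v + (1 - t) *: w) <= t * f x v + (1 - t) * f x w.
  move=> cx v w t t0 t1.
  have := f_convex x cx (Itv01 (ltW t0) (ltW t1)) v w; rewrite !inE => /(_ I I).
  by [].
split=> [sub|[uBV [z [zZ rz tr0 zs zt]]]].
  have [uBV [z [zZ rz tr zmax]]] := subdiff_maximizer Om_open Om_bounded Om_lip A_sym A_idem
    f_ge0 f_cont f_conv C0_gt0 f_gr f_recession u_L2 r_L2 sub.
  have [zs zt] := maximizer_optimality Om_open Om_bounded Om_lip A_sym A_idem
    f_ge0 f_cont f_conv c0_gt0 C0_gt0 f_gr f_recession uBV u_L2 zZ zmax.
  (* The normal trace of the constructed field is exhibited by the zero function. *)
  by split=> //; exists z; split=> //; exists (fun=> 0) => //; exact: aeW.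
exact: (optimality_sufficient Om_open Om_bounded Om_lip A_sym A_idem f_ge0 f_conv C0_gt0 f_gr f_recession
  u_L2 r_L2 uBV zZ rz tr0 zs zt).
Qed.
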